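(* Let $\Gamma=\Gamma_1*\Gamma_2$ be the free product of $\Gamma_1=\mathbb{Z}^3$ and $\Gamma_2=\mathbb{Z}^d$, with $d\in\{5,6\}$. For $i=1,2$, let $\mu_i$ be a finitely supported, admissible, symmetric and aperiodic probability measure on $\Gamma_i$. For $\alpha\in[0,1]$, let $\mu_\alpha=\alpha\mu_1+(1-\alpha)\mu_2$. Let $\alpha_*\in(0,1)$ be such that the random walk on $\Gamma$ driven by $\mu_{\alpha_*}$ is divergent and not spectrally positive recurrent (such an $\alpha_*$ exists). Let $R$ be the inverse of the spectral radius of $\mu_{\alpha_*}$. Then there is a constant $C>0$ such that, as $n\to\infty$: - if $d=5$, $\ \mu_{\alpha_*}^{*n}(e)\sim C R^{-n}n^{-5/3}$; - if $d=6$, $\ \mu_{\alpha_*}^{*n}(e)\sim C R^{-n}n^{-3/2}(\log n)^{-1/2}$.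
   Context: A probability measure $\mu$ on a group $\Gamma$ is symmetric if $\mu(x)=\mu(x^{-1})$ for all $x$, admissible if for every $x\in\Gamma$ there is $n$ with $\mu^{*n}(x)>0$ (where $\mu^{*n}$ is the $n$th convolution power), and aperiodic if there is $n_0$ with $\mu^{*n}(e)>0$ for all $n\ge n_0$. The measures $\mu_1,\mu_2$ are viewed as measures on $\Gamma$ via the inclusions $\Gamma_i\subset\Gamma$. Here $a_n\sim b_n$ means $a_n/b_n\to1$. The spectral radius of $\mu$ is $\limsup_n \mu^{*n}(e)^{1/n}$. The Green function is $G(x,y|r)=\sum_{n\ge 0}\mu^{*n}(x^{-1}y)r^n$, with radius of convergence $R$ equal to the inverse of the spectral radius; $G(r)=G(e,e|r)$. The random walk driven by $\mu$ is divergent if $G'(R)=\sum_{n\ge1} n\mu^{*n}(e)R^{n-1}=+\infty$. For $\Gamma=\Gamma_1*\Gamma_2$ and $i=1,2$, set $$I_i^{(2)}(r)=\sum_{x_1,x_2\in\Gamma_i}G(e,x_1|r)G(x_1,x_2|r)G(x_2,e|r),\qquad J^{(2)}(r)=I_1^{(2)}(r)+I_2^{(2)}(r).$$ The random walk is spectrally positive recurrent if it is divergent and $J^{(2)}(R)<\infty$. *)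

(* Defs.v *)
From HB Require Import structures.
From mathcomp Require Import all_boot all_order all_algebra.
From mathcomp Require Import all_classical all_reals all_analysis.

Set Implicit Arguments.
Unset Strict Implicit.
Unset Printing Implicit Defensive.

Import Order.TTheory GRing.Theory Num.Theory.
Import numFieldNormedType.Exports.

Local Open Scope classical_set_scope.
Local Open Scope ring_scope.

(* The free product G1 * G2 of two groups, as the set of reduced words: the
   letters are nontrivial elements of G1 or G2 and two consecutive letters
   never come from the same factor.  Words are multiplied by concatenation
   followed by reduction, and the empty word is the unit. *)
Section FreeProduct.
Variables G1 G2 : groupType.

Local Notation letter := (G1 + G2)%type.
Local Notation word := (seq (G1 + G2)%type).

Definition same_side (a b : letter) : bool :=
  match a, b with
  | inl _, inl _ | inr _, inr _ => true
  | _, _ => false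
  end.

Definition trivial_letter (a : letter) : bool :=
  match a with inl x => x == 1%g | inr y => y == 1%g end.

(* Only meaningful when both letters come from the same factor. *)
Definition letter_mul (a b : letter) : letter :=
  match a, b with
  | inl x, inl y => inl (x * y)%g
  | inr x, inr y => inr (x * y)%g
  | _, _ => a
  end.

Definition letter_inv (a : letter) : letter :=
  match a with inl x => inl x^-1%g | inr y => inr y^-1%g end.

Fixpoint reduced (w : word) : bool :=
  match w with
  | [::] => true
  | a :: t => [&& ~~ trivial_letter a,
                  (if t is b :: _ then ~~ same_side a b else true) & reduced t]
  end.

(* The reduced word representing a * w, for w reduced. *)
Definition push (a : letter) (w : word) : word :=
  if trivial_letter a then w else
  match w with
  | [::] => [:: a]
  | b :: t => if same_side a b then
                let c := letter_mul a b in
                if trivial_letter c then t else c :: t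
              else a :: w
  end.

Definition word_mul (u v : word) : word := foldr push v u.

Definition word_inv (w : word) : word := rev (map letter_inv w).

Lemma same_sideC a b : same_side a b = same_side b a.
Proof. by case: a b => a [] b. Qed.

Lemma same_side_trans a b c : same_side a b -> same_side b c = same_side a c.
Proof. by case: a b c => a [] b [] c. Qed.

Lemma letter_mul_side a b c : same_side a b ->
  same_side (letter_mul a b) c = same_side b c.
Proof. by case: a b c => a [] b [] c. Qed.

Lemma letter_inv_side a b : same_side (letter_inv a) b = same_side a b.
Proof. by case: a b => a [] b. Qed.

Lemma letter_mulA a b c : same_side a b -> same_side b c ->
  letter_mul a (letter_mul b c) = letter_mul (letter_mul a b) c.
Proof. by case: a b c => a [] b [] c //= _ _; rewrite mulgA. Qed.

Lemma letter_mul_trivl a b : same_side a b -> trivial_letter a ->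
  letter_mul a b = b.
Proof. by case: a b => a [] b //= _ /eqP ->; rewrite mul1g. Qed.

Lemma letter_mul_trivr a b : same_side a b -> trivial_letter b ->
  letter_mul a b = a.
Proof. by case: a b => a [] b //= _ /eqP ->; rewrite mulg1. Qed.

Lemma letter_invK : involutive letter_inv.
Proof. by case=> a /=; rewrite invgK. Qed.

Lemma trivial_letterV a : trivial_letter (letter_inv a) = trivial_letter a.
Proof.
by case: a => a /=; exact: invg_eq1.
Qed.

Lemma letter_mulV a : trivial_letter (letter_mul (letter_inv a) a).
Proof. by case: a => a /=; rewrite mulVg. Qed.

Lemma reduced_push a w : reduced w -> reduced (push a w).
Proof.
rewrite /push; case: ifPn => // a1; case: w => [|b t] /=; first by rewrite a1.
case/and3P=> b1 bt rt; case: ifPn => [sab|nab]; last first.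
  by rewrite /= a1 nab b1 bt rt.
case: ifPn => //= c1; rewrite c1 rt andbT /=.
by case: t bt {rt} => // c t; rewrite letter_mul_side.
Qed.

Lemma reduced_mul u v : reduced v -> reduced (word_mul u v).
Proof. by move=> rv; elim: u => //= a u; apply: reduced_push. Qed.

Lemma push_trivial a w : trivial_letter a -> push a w = w.
Proof. by rewrite /push => ->. Qed.

Lemma push_cons a w : reduced (a :: w) -> push a w = a :: w.
Proof.
by case/and3P => a1; rewrite /push (negPf a1); case: w => // b t /negPf ->.
Qed.

(* Each factor acts on reduced words by left multiplication. *)
Lemma push_mul a b w : reduced w -> same_side a b ->
  push (letter_mul a b) w = push a (push b w).
Proof.
move=> rw sab; have [b1|b1] := boolP (trivial_letter b).
  by rewrite letter_mul_trivr// (push_trivial _ b1).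
have [a1|a1] := boolP (trivial_letter a).
  by rewrite letter_mul_trivl// (push_trivial _ a1).
case: w rw => [|c t] /= rw.
  rewrite /push (negPf a1) (negPf b1) sab /=.
  by case: ifP.
case/and3P: rw => c1 ct rt.
have sm x : same_side (letter_mul a b) x = same_side b x.
  exact: letter_mul_side.
have -> : push b (c :: t) = if same_side b c then
    if trivial_letter (letter_mul b c) then t else letter_mul b c :: t
    else b :: c :: t by rewrite /push (negPf b1).
rewrite {1}/push sm.
have [sbc|nbc] := boolP (same_side b c); last first.
  by rewrite /push (negPf a1) sab.
have sac : same_side a c by rewrite -(same_side_trans c sab).
have sabc : same_side a (letter_mul b c).
  by rewrite same_sideC letter_mul_side// same_sideC.
rewrite -letter_mulA//.
have [ab1|ab1] := boolP (trivial_letter (letter_mul a b)).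
  have Ec : letter_mul a (letter_mul b c) = c.
    by rewrite letter_mulA// letter_mul_trivl// sm.
  case: ifPn => [bc1|bc1].
    rewrite -Ec letter_mul_trivr//.
    rewrite push_cons //= a1 rt andbT /=.
    by case: t ct {rt} => // x t; rewrite -(same_side_trans x sac).
  by rewrite /push (negPf a1) sabc Ec (negPf c1).
have [bc1|bc1] := boolP (trivial_letter (letter_mul b c)).
  rewrite letter_mul_trivr// (negPf a1).
  rewrite push_cons //= a1 rt andbT /=.
  by case: t ct {rt} => // x t; rewrite (same_side_trans x sac).
by rewrite /push (negPf a1) sabc.
Qed.

Lemma word_mul_push a v w : reduced v -> reduced w ->
  word_mul (push a v) w = push a (word_mul v w).
Proof.
move=> rv rw; have [a1|a1] := boolP (trivial_letter a).
  by rewrite !(push_trivial _ a1).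
rewrite {1}/push (negPf a1); case: v rv => //= b t /and3P[_ _ rt].
case: ifPn => // sab; rewrite -push_mul//; last exact: reduced_mul.
by case: ifPn => // ab1; rewrite push_trivial.
Qed.

Lemma word_mulA u v w : reduced v -> reduced w ->
  word_mul u (word_mul v w) = word_mul (word_mul u v) w.
Proof.
move=> rv rw; elim: u => //= a u ->.
by rewrite word_mul_push//; exact: reduced_mul.
Qed.

Lemma word_mul1 w : reduced w -> word_mul w [::] = w.
Proof.
elim: w => //= a w IH raw; have /and3P[_ _ rw] := raw.
by rewrite IH// push_cons.
Qed.

Lemma word_mulV w : reduced w -> word_mul (word_inv w) w = [::].
Proof.
elim: w => //= a w IH /and3P[a1 _ rw].
rewrite /word_inv /= rev_cons /word_mul foldr_rcons.
rewrite {2}/push trivial_letterV (negPf a1) letter_inv_side.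
by rewrite (_ : same_side a a) ?letter_mulV; [exact: IH | case: (a)].
Qed.

Lemma word_invK : involutive word_inv.
Proof.
by move=> w; rewrite /word_inv map_rev revK -map_comp map_id_in// => x _ /=;
  rewrite letter_invK.
Qed.

Lemma reduced_rcons u b a : reduced (rcons u b) -> ~~ same_side b a ->
  ~~ trivial_letter a -> reduced (rcons (rcons u b) a).
Proof.
move=> + ba a1; elim: u => /= [|c u IH]; first by rewrite ba a1 !andbT.
case/and3P=> c1 cu rub; rewrite c1 IH// andbT /=.
by case: u cu {IH rub}.
Qed.

Lemma reduced_inv w : reduced w -> reduced (word_inv w).
Proof.
elim: w => //= a w IH /and3P[a1 aw /IH]; rewrite /word_inv /= rev_cons.
case: w aw {IH} => [_ _|b w nab]; first by rewrite /= trivial_letterV a1.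
rewrite /= rev_cons => rw; apply: reduced_rcons => //.
  by rewrite letter_inv_side same_sideC letter_inv_side.
by rewrite trivial_letterV.
Qed.

Record free_product :=
  FreeProduct { fp_word :> word ; fp_reduced : reduced fp_word }.

HB.instance Definition _ := [isSub for fp_word].
HB.instance Definition _ := [Choice of free_product by <:].

Definition fp_one : free_product := FreeProduct (isT : reduced [::]).

Definition fp_mul (u v : free_product) : free_product :=
  FreeProduct (reduced_mul u (fp_reduced v)).

Definition fp_inv (u : free_product) : free_product :=
  FreeProduct (reduced_inv (fp_reduced u)).

Fact fp_mulA : associative fp_mul.
Proof. by move=> u v w; apply: val_inj; apply: word_mulA; exact: fp_reduced. Qed.

Fact fp_mul1g : left_id fp_one fp_mul.
Proof. by move=> u; apply: val_inj. Qed.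

Fact fp_mulg1 : right_id fp_one fp_mul.
Proof. by move=> u; apply: val_inj; apply: word_mul1; exact: fp_reduced. Qed.

Fact fp_mulVg : left_inverse fp_one fp_inv fp_mul.
Proof. by move=> u; apply: val_inj; apply: word_mulV; exact: fp_reduced. Qed.

Fact fp_mulgV : right_inverse fp_one fp_inv fp_mul.
Proof.
move=> u; apply: val_inj; rewrite /= -{1}(word_invK u).
by apply: word_mulV; apply: reduced_inv; exact: fp_reduced.
Qed.

HB.instance Definition _ := isGroup.Build free_product
  fp_mulA fp_mul1g fp_mulg1 fp_mulVg fp_mulgV.

Definition fp_letter (a : letter) : free_product :=
  FreeProduct (reduced_push a (fp_reduced fp_one)).

Definition fp_inl (x : G1) : free_product := fp_letter (inl x).
Definition fp_inr (y : G2) : free_product := fp_letter (inr y).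

Lemma fp_letterM a b : same_side a b ->
  fp_letter (letter_mul a b) = (fp_letter a * fp_letter b)%g.
Proof.
move=> sab; apply: val_inj; rewrite /= push_mul//.
by rewrite word_mul_push// reduced_push.
Qed.

Fact fp_inl_morphism : monoid.monoid_morphism fp_inl.
Proof.
split=> [|x y]; last exact: (@fp_letterM (inl x) (inl y)).
by apply: val_inj; rewrite /= /push /= eqxx.
Qed.

Fact fp_inr_morphism : monoid.monoid_morphism fp_inr.
Proof.
split=> [|x y]; last exact: (@fp_letterM (inr x) (inr y)).
by apply: val_inj; rewrite /= /push /= eqxx.
Qed.

HB.instance Definition _ := isUMagmaMorphism.Build G1 free_product
  fp_inl fp_inl_morphism.
HB.instance Definition _ := isUMagmaMorphism.Build G2 free_product
  fp_inr fp_inr_morphism.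

Lemma free_product_universal (H : groupType) (f1 : G1 -> H) (f2 : G2 -> H) :
  monoid.monoid_morphism f1 -> monoid.monoid_morphism f2 ->
  exists! f : free_product -> H,
    [/\ monoid.monoid_morphism f, f \o fp_inl = f1 & f \o fp_inr = f2].
Proof.
move=> [f11 f1M] [f21 f2M].
pose g a := match a with inl x => f1 x | inr y => f2 y end.
pose F (w : word) := foldr (fun a h => g a * h)%g 1%g w.
have g1 a : trivial_letter a -> g a = 1%g by case: a => x /= /eqP ->.
have gM a b : same_side a b -> g (letter_mul a b) = (g a * g b)%g.
  by case: a b => a [] b //= _; rewrite ?f1M ?f2M.
have Fpush a w : F (push a w) = (g a * F w)%g.
  rewrite /push; case: ifPn => [/g1 ->|a1]; first by rewrite mul1g.
  case: w => //= b t; case: ifPn => // /gM ab.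
  by case: ifPn => [/g1 ab1|_] /=; rewrite mulgA -ab// ab1 mul1g.
have FM u v : F (word_mul u v) = (F u * F v)%g.
  by elim: u => [|a u IH] /=; rewrite ?mul1g// Fpush IH mulgA.
exists (fun u => F (fp_word u)); split; first split.
- by split=> // u v; exact: FM.
- by apply/funext => x /=; rewrite Fpush mulg1.
- by apply/funext => x /=; rewrite Fpush mulg1.
move=> f [[f_1 fM] fl fr]; apply/funext => -[w rw] /=.
have fg a : f (fp_letter a) = g a.
  by case: a => x; [rewrite -[LHS]/((f \o fp_inl) x) fl
                   | rewrite -[LHS]/((f \o fp_inr) x) fr].
elim: w rw => [|a t IH] rw /=.
  by rewrite -f_1; congr f; apply: val_inj.
have /and3P[_ _ rt] := rw; rewrite (IH rt) -fg -fM; congr f.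
apply: val_inj; rewrite /= word_mul_push//= push_cons//.
Qed.

End FreeProduct.

(* The additive group Z^d, in multiplicative notation. *)
Definition Zpow (d : nat) : groupType := Algebra.to_multiplicative 'rV[int]_d.

Section RandomWalk.
Variables (R : realType) (G : groupType).
Implicit Types (mu f g : G -> R) (x y : G).

Definition is_probability mu : Prop :=
  (forall x, 0 <= mu x) /\ (\esum_(x in [set: G]) (mu x)%:E = 1)%E.

Definition finitely_supported mu : Prop := finite_set [set x | mu x != 0].

Definition symmetric_measure mu : Prop := forall x, mu x = mu x^-1%g.

Definition unit_mass : G -> R := fun x => (x == 1%g)%:R.

(* [esum] is the sum of a family of nonnegative terms; all convolutions below
   are between (sub)probability measures, so that the sum is in [0, 1]. *)
Definition convolution f g : G -> R :=
  fun x => fine (\esum_(y in [set: G]) (f y * g (y^-1 * x)%g)%:E).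

Fixpoint convolution_pow mu (n : nat) : G -> R :=
  if n is m.+1 then convolution (convolution_pow mu m) mu else unit_mass.

Definition admissible mu : Prop :=
  forall x, exists n, 0 < convolution_pow mu n x.

Definition aperiodic mu : Prop :=
  exists n0, forall n, (n0 <= n)%N -> 0 < convolution_pow mu n 1%g.

Definition spectral_radius mu : R :=
  limn_sup (fun n => convolution_pow mu n 1%g `^ n%:R^-1).

Definition inv_spectral_radius mu : R := (spectral_radius mu)^-1.

Definition green mu x y (r : R) : \bar R :=
  (\sum_(0 <= n <oo) (convolution_pow mu n (x^-1 * y)%g * r ^+ n)%:E)%E.

(* G'(r) *)
Definition green_derivative mu (r : R) : \bar R :=
  (\sum_(1 <= n <oo) (n%:R * convolution_pow mu n 1%g * r ^+ n.-1)%:E)%E.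

Definition divergent mu : Prop :=
  green_derivative mu (inv_spectral_radius mu) = +oo%E.

End RandomWalk.

Section FreeProductWalk.
Variables (R : realType) (G1 G2 : groupType).
Local Notation Gamma := (free_product G1 G2).

(* The measure mu on H, viewed as a measure on G via i : H -> G. *)
Definition push_measure (H G : groupType) (i : H -> G) (mu : H -> R) : G -> R :=
  fun x => fine (\esum_(h in [set h | i h = x]) (mu h)%:E).

Definition mixture (mu1 : G1 -> R) (mu2 : G2 -> R) (alpha : R) : Gamma -> R :=
  fun x => alpha * push_measure (@fp_inl G1 G2) mu1 x
           + (1 - alpha) * push_measure (@fp_inr G1 G2) mu2 x.

(* The sum I_i^(2), for the factor embedded by i. *)
Definition green_triangle (H : groupType) (i : H -> Gamma) (mu : Gamma -> R)
    (r : R) : \bar R :=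
  (\esum_(x in [set: H * H])
     (green mu 1%g (i x.1) r * green mu (i x.1) (i x.2) r
      * green mu (i x.2) 1%g r))%E.

Definition J2 (mu : Gamma -> R) (r : R) : \bar R :=
  (green_triangle (@fp_inl G1 G2) mu r + green_triangle (@fp_inr G1 G2) mu r)%E.

Definition spectrally_positive_recurrent (mu : Gamma -> R) : Prop :=
  divergent mu /\ (J2 mu (inv_spectral_radius mu) < +oo)%E.

End FreeProductWalk.

(* u_n ~ v_n; finitely many vanishing v_n are harmless. *)
Definition asymptotically_equal (R : realType) (u v : nat -> R) : Prop :=
  (fun n => u n / v n) @ \oo --> (1 : R).

(* Main.v *)
(** Let [p] be the return probabilities and [u] the first-return probabilities of
    a walk, [G] and [U] their generating functions, [V s = (1 - U s) / s], which
    is [1 / (s G(s))], and [W s = - s^2 V'(s)].  For the free product with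
    weights [a] and [b = 1 - a], let [s1] and [s2] solve
    [a V1(s1) = b V2(s2) = X].  The product, over the letters of a reduced word,
    of the hitting generating functions of the factors at [s1] and [s2] solves
    the resolvent equation at [z(X) = a / s1 + b / s2 - X], and therefore
    [G(1 / z(X)) = z(X) / X] wherever [z] increases.  Moreover
    [z'(X) = psi(X) = 1 / W1(s1) + 1 / W2(s2) - 1].

    By the local limit theorem [W1] is unbounded on [Z^3], whereas on [Z^5] and
    [Z^6] the value [W2(1)] is finite but [W2] has infinite derivative at [1].
    Hence the curve cannot stop at [s1 = 1] before [psi] becomes negative, and the
    walk is divergent without being spectrally positive recurrent exactly when
    the curve stops at a point [X0] with [s2 = 1] and [psi(X0) = 0]; then
    [R = 1 / z(X0)].  There [X - X0] is of order [e = 1 - s2] while [z(X) - z(X0)]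
    is of the order of the Taylor remainder of [G2] at [1], that is [e^(3/2)] for
    [d = 5] and [e^2 log (1 / e)] for [d = 6].  Inverting,
    [G(R) - G(R e^-t)] is equivalent to a constant times [t^(2/3)], respectively
    [(t / log (1 / t))^(1/2)].

    The coefficients [p n * R^n] are almost decreasing: symmetry makes the even
    ones log-convex and aperiodicity controls the odd ones.  A Tauberian theorem
    of Karamata type then gives their asymptotics. *)

Require Import Defs.
From mathcomp Require Import all_boot all_order all_algebra.
From mathcomp Require Import all_classical all_reals all_analysis.
From mathcomp Require Import ring lra zify.

Set Implicit Arguments.
Unset Strict Implicit.
Unset Printing Implicit Defensive.

Import Order.TTheory GRing.Theory Num.Theory.
Import numFieldNormedType.Exports.

Local Open Scope classical_set_scope.
Local Open Scope ring_scope.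

(** * Convolution powers and first returns *)

(** The Green function of the product is reached only at real arguments, through its values on the
    curve. Its singularity at [R] must therefore be exploited by real Tauberian arguments, which
    need some regularity of the coefficients. Two inequalities supply it: log-convexity at even
    times, from Cauchy-Schwarz, and, for an odd [k] with [p k 1 > 0], an almost log-convex
    inequality along steps of length [k], which carries information from even to odd times.

    Only the existence of a constant is claimed, so limits need not be identified: the local limit
    theorem compares time [n] with time [m^2 n] on finite Fourier grids and concludes by a Cauchy
    argument, and so does the Tauberian theorem.

    A positive slope at the end of the curve contradicts divergence for the following reason. [G']
    is then finite at [1 / z(X0)]; if [G] converged beyond that radius, [G''] would be finite there
    too and the chord slopes of [z] would be Lipschitz, against the infinite derivative of [W2] at
    [1]. *)

Lemma cauchy_schwarz_seq (R : realFieldType) (I : Type) (r : seq I)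
    (a b : I -> R) :
  (\sum_(i <- r) a i * b i) ^+ 2 <=
  (\sum_(i <- r) a i ^+ 2) * (\sum_(i <- r) b i ^+ 2).
Proof.
set A := \sum_(i <- r) a i ^+ 2; set B := \sum_(i <- r) b i ^+ 2.
set C := \sum_(i <- r) a i * b i.
have A0 : 0 <= A by apply: sumr_ge0 => i _; exact: sqr_ge0.
have B0 : 0 <= B by apply: sumr_ge0 => i _; exact: sqr_ge0.
have E x y : \sum_(i <- r) (x * a i + y * b i) ^+ 2 =
    x ^+ 2 * A + 2 * x * y * C + y ^+ 2 * B.
  rewrite /A /B /C !mulr_sumr -!big_split /=; apply: eq_bigr => i _; ring.
have P x y : 0 <= x ^+ 2 * A + 2 * x * y * C + y ^+ 2 * B.
  by rewrite -E; apply: sumr_ge0 => i _; exact: sqr_ge0.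
have [A1|A1] := eqVneq A 0.
  have [->|C0] := eqVneq C 0; first by rewrite expr0n mulr_ge0.
  have := P (- (B + 1) / C) 1; rewrite A1.
  have -> : (- (B + 1) / C) ^+ 2 * 0 + 2 * (- (B + 1) / C) * 1 * C + 1 ^+ 2 * B =
    - B - 2 by field.
  by move=> H; exfalso; lra.
have Ap : 0 < A by rewrite lt_neqAle eq_sym A1.
have := P (- C) A.
have -> : (- C) ^+ 2 * A + 2 * - C * A * C + A ^+ 2 * B = A * (A * B - C ^+ 2).
  by ring.
by rewrite pmulr_rge0// subr_ge0.
Qed.

Lemma big_supp_eq (R : zmodType) (I : eqType) (r1 r2 : seq I) (f : I -> R) :
  uniq r1 -> uniq r2 -> (forall i, f i != 0 -> i \in r1) ->
  (forall i, f i != 0 -> i \in r2) ->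
  \sum_(i <- r1) f i = \sum_(i <- r2) f i.
Proof.
move=> u1 u2 s1 s2.
have E r : \sum_(i <- r) f i = \sum_(i <- r | f i != 0) f i.
  rewrite (bigID (fun i => f i == 0))/= big1 ?add0r// => i.
  by move/eqP.
rewrite E [RHS]E -big_filter -[RHS]big_filter; apply: perm_big.
apply: uniq_perm; rewrite ?filter_uniq// => i; rewrite !mem_filter.
by case: eqVneq => //= fi; rewrite s1// s2.
Qed.

Lemma fine_esum_seq (R : realType) (T : choiceType) (a : T -> R) (r : seq T) :
  uniq r -> (forall x, 0 <= a x) -> (forall x, a x != 0 -> x \in r) ->
  fine (\esum_(x in [set: T]) (a x)%:E) = \sum_(x <- r) a x.
Proof.
move=> ur a0 ar.
have -> : (\esum_(x in [set: T]) (a x)%:E = \esum_(x in [set` r]) (a x)%:E)%E.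
  rewrite [RHS]esum_mkcond; apply: eq_esum => i _.
  case: ifPn => // /negP ir; have [->//|/ar] := eqVneq (a i) 0.
  by move=> ir'; case: ir; rewrite inE.
rewrite esum_fset//; last by move=> i _; rewrite lee_fin.
by rewrite -fsbig_seq// sumEFin.
Qed.

(** * Binomial mixtures are nearly log-convex *)

Section Difference.
Variable R : realType.

(* [d i n] stands for the i-th iterate of [P_n |-> P_(n+1) - c P_n]. *)
Lemma difference_expansion (c : R) (d : nat -> nat -> R) :
  (forall i n, d i n.+1 = d i.+1 n + c * d i n) ->
  forall n i, d i n = \sum_(l < n.+1) 'C(n, l)%:R * c ^+ (n - l) * d (i + l)%N 0%N.
Proof.
move=> dS; elim=> [|n IH] i; first by rewrite big_ord1 /= addn0 expr0 !mul1r.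
rewrite dS !IH mulr_sumr.
rewrite [RHS]big_ord_recl /= bin0 subn0 addn0.
rewrite [X in _ + X]big_ord_recl /= bin0 subn0 addn0 addrCA.
rewrite exprS !mul1r !mulrA; congr (_ + _).
under [RHS]eq_bigr => l _.
  rewrite /bump /= add1n binS natrD !mulrDl subSS addnS.
  over.
rewrite big_split /= [RHS]addrC; congr (_ + _).
rewrite [RHS]big_ord_recr /= bin_small// !mul0r addr0.
apply: eq_bigr => l _; rewrite /bump /= add1n addnS.
have ln : (l < n)%N by [].
by rewrite !mulrA [c * _]mulrC -!mulrA [c * _]mulrA -exprS subnSK.
Qed.

(** With [n = m + 1] and [W l] the terms of the binomial expansion of [d 0 n], Cauchy-Schwarz is
    applied to [W l = sqrt (W l * (n - l + 1)) * sqrt (W l / (n - l + 1))]. The identities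
    [(n - l) C(n, l) = n C(n - 1, l)] and [C(n, l) / (n - l + 1) = C(n + 1, l) / (n + 1)] express
    the two resulting sums by neighbouring values of [d 0]. *)
Lemma difference_ratio (c : R) (d : nat -> nat -> R) : 0 < c ->
  (forall i n, d i n.+1 = d i.+1 n + c * d i n) -> (forall i, 0 <= d i 0%N) ->
  forall n, n.+2%:R * d 0%N n.+1 ^+ 2 <=
    d 0%N n.+2 * (n.+1%:R * d 0%N n + d 0%N n.+1 / c).
Proof.
move=> c0 dS d0 m; set n := m.+1.
pose W l := 'C(n, l)%:R * c ^+ (n - l) * d l 0%N.
have W0 l : 0 <= W l by rewrite !mulr_ge0// exprn_ge0// ltW.
have E k : d 0%N k = \sum_(l < k.+1) 'C(k, l)%:R * c ^+ (k - l) * d l 0%N.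
  by rewrite (difference_expansion dS).
have S1 : \sum_(l < n.+1) W l = d 0%N n by rewrite E.
have S2 : \sum_(l < n.+1) W l * (n - l)%:R = n%:R * c * d 0%N m.
  rewrite big_ord_recr /= subnn mulr0 addr0 E mulr_sumr.
  apply: eq_bigr => l _; rewrite /W.
  have lm : (l <= m)%N by rewrite -ltnS.
  have -> : (n - l)%N = (m - l).+1 by rewrite subSn.
  rewrite exprS.
  have := mul_bin_left n l; have := mul_bin_diag n l; rewrite /= => e1 e2.
  have -> : 'C(n, l)%:R * (c * c ^+ (m - l)) * d l 0%N * (m - l).+1%:R =
     ((m - l).+1 * 'C(n, l))%:R * (c * c ^+ (m - l)) * d l 0%N :> R.
    by rewrite natrM; ring.
  have -> : ((m - l).+1 * 'C(n, l))%N = (n * 'C(m, l))%N.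
    by rewrite -subSn// -e2 -e1.
  by rewrite natrM; ring.
(* Only an inequality: the expansion of [d 0 n.+1] has one more term, of index [n.+1], which is
   dropped. *)
have S3 : \sum_(l < n.+1) W l / (n - l).+1%:R <= d 0%N n.+1 / (c * n.+1%:R).
  rewrite E mulr_suml [leRHS]big_ord_recr /=.
  rewrite -[leLHS]addr0 lerD//; last first.
    by rewrite !mulr_ge0// ?invr_ge0 ?mulr_ge0 ?exprn_ge0// ltW.
  apply: ler_sum => l _; rewrite /W.
  have lm : (l <= n)%N by rewrite -ltnS.
  have -> : (n.+1 - l)%N = (n - l).+1 by rewrite subSn.
  rewrite exprS le_eqVlt; apply/orP; left; apply/eqP.
  have e2 := mul_bin_left n.+1 l; have e1 := mul_bin_diag n.+1 l.
  rewrite /= in e1 e2.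
  have e : ((n - l).+1 * 'C(n.+1, l))%N = (n.+1 * 'C(n, l))%N.
    by rewrite -subSn// -e2 -e1.
  have /(congr1 (fun k => k%:R : R)) := e; rewrite !natrM => e'.
  have h1 : (n - l).+1%:R != 0 :> R by rewrite pnatr_eq0.
  have h2 : n.+1%:R != 0 :> R by rewrite pnatr_eq0.
  have h3 : c != 0 by rewrite gt_eqF.
  have -> : 'C(n, l)%:R = (n - l).+1%:R * 'C(n.+1, l)%:R / n.+1%:R :> R.
    by rewrite e' mulrC mulKf.
  clear -h1 h2 h3; move: (n - l).+1%:R h1 => A h1.
  by move: (n.+1%:R : R) h2 => B h2; field; rewrite h1 h2 h3.
have CS := cauchy_schwarz_seq (index_enum 'I_n.+1)
   (fun l => Num.sqrt (W l * (n - l).+1%:R)) (fun l => Num.sqrt (W l / (n - l).+1%:R)).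
have Es l : Num.sqrt (W l * (n - l).+1%:R) * Num.sqrt (W l / (n - l).+1%:R) = W l.
  rewrite -sqrtrM; last by rewrite mulr_ge0.
  have -> : W l * (n - l).+1%:R * (W l / (n - l).+1%:R) = W l ^+ 2.
    by rewrite mulrACA divff ?pnatr_eq0// mulr1 -expr2.
  by rewrite sqrtr_sqr ger0_norm.
have := CS.
under eq_bigr do rewrite Es.
rewrite S1.
have E2 l : Num.sqrt (W l * (n - l).+1%:R) ^+ 2 = W l * (n - l)%:R + W l.
  by rewrite sqr_sqrtr; [rewrite -natr1 mulrDr mulr1 | rewrite mulr_ge0].
have E3 l : Num.sqrt (W l / (n - l).+1%:R) ^+ 2 = W l / (n - l).+1%:R.
  by rewrite sqr_sqrtr// mulr_ge0.
under [X in _ <= X * _ -> _]eq_bigr do rewrite E2.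
under [X in _ <= _ * X -> _]eq_bigr do rewrite E3.
rewrite big_split /= S1 S2 => H.
have dn0 k : 0 <= d 0%N k.
  by rewrite E; apply: sumr_ge0 => l _; rewrite !mulr_ge0// exprn_ge0// ltW.
have : d 0%N n ^+ 2 <= (n%:R * c * d 0%N m + d 0%N n) * (d 0%N n.+1 / (c * n.+1%:R)).
  apply: (le_trans H); rewrite ler_wpM2l// addr_ge0// !mulr_ge0// ltW//.
rewrite mulrA ler_pdivlMr ?mulr_gt0//.
move=> H2; rewrite -(ler_pM2r c0).
have -> : d 0%N m.+2 * (m.+1%:R * d 0%N m + d 0%N m.+1 / c) * c =
  (n%:R * c * d 0%N m + d 0%N n) * d 0%N n.+1 by rewrite /n; field; rewrite gt_eqF.
by apply: le_trans H2; rewrite le_eqVlt; apply/orP; left; apply/eqP; rewrite /n; ring.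
Qed.

End Difference.

Section Walk.
Variables (R : realType) (G : groupType) (mu : G -> R) (S : seq G).
Hypotheses (mu_ge0 : forall x, 0 <= mu x) (uS : uniq S).
Hypothesis suppS : forall x, mu x != 0 -> x \in S.

Local Notation p := (convolution_pow mu).

Definition step (f : G -> R) (x : G) : R := \sum_(s <- S) mu s * f (s^-1 * x)%g.

Lemma convolutionE (f : G -> R) x : (forall y, 0 <= f y) ->
  convolution f mu x = \sum_(s <- S) f (x * s^-1)%g * mu s.
Proof.
move=> f0; rewrite /convolution.
rewrite (@fine_esum_seq _ _ _ [seq (x * s^-1)%g | s <- S]).
- rewrite big_map; apply: eq_bigr => s _.
  by rewrite invgM invgK -mulgA mulVg mulg1.
- by rewrite map_inj_uniq// => s t /mulgI /invg_inj.
- by move=> y; rewrite mulr_ge0.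
- move=> y; rewrite mulf_eq0 negb_or => /andP[_ /suppS yS].
  by apply/mapP; exists (y^-1 * x)%g => //; rewrite invgM invgK mulgA mulgV mul1g.
Qed.

Lemma convpow_ge0 n x : 0 <= p n x.
Proof.
elim: n x => [|n IH] x /=; first by rewrite /unit_mass ler0n.
by rewrite convolutionE//; apply: sumr_ge0 => s _; rewrite mulr_ge0.
Qed.

Lemma convpowSr n x : p n.+1 x = \sum_(s <- S) p n (x * s^-1)%g * mu s.
Proof. by rewrite /= convolutionE//; exact: convpow_ge0. Qed.

Lemma convpowSl n x : p n.+1 x = step (p n) x.
Proof.
elim: n x => [|n IH] x.
  rewrite convpowSr /step; apply: eq_bigr => s _ /=; rewrite /unit_mass mulrC.
  congr (_ * (_ : bool)%:R); apply/eqP/eqP => [/(congr1 (fun y => y * s)%g)|/(congr1 (fun y => s * y)%g)].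
    by rewrite -mulgA mulVg mulg1 mul1g => ->; rewrite mulVg.
  by rewrite mulgA mulgV mul1g mulg1 => ->; rewrite mulgV.
rewrite convpowSr; under eq_bigr do rewrite IH /step mulr_suml.
rewrite exchange_big /step /=; apply: eq_bigr => s _.
rewrite convolutionE//; last exact: convpow_ge0.
by rewrite mulr_sumr; apply: eq_bigr => t _; rewrite !mulrA mulgA.
Qed.

Lemma convpow1 x : p 1 x = mu x.
Proof.
rewrite convpowSl /step /=; have [xS|xS] := boolP (x \in S).
  rewrite (bigD1_seq x)//= /unit_mass mulVg eqxx mulr1 big1 ?addr0// => s sx.
  case: eqP => [/(congr1 (fun y => s * y)%g)|]; last by rewrite mulr0.
  by rewrite mulgA mulgV mul1g mulg1 => xs; rewrite xs eqxx in sx.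
rewrite big_seq big1 => [|s sS]; first by apply/esym/eqP; apply: contraNT xS => /suppS.
rewrite /unit_mass; case: eqP => [/(congr1 (fun y => s * y)%g)|]; last by rewrite mulr0.
by rewrite mulgA mulgV mul1g mulg1 => xs; rewrite -xs in sS; rewrite sS in xS.
Qed.

Lemma eq_step f g : f =1 g -> step f =1 step g.
Proof. by move=> fg x; apply: eq_bigr => s _; rewrite fg. Qed.

Lemma step_ge0 f : (forall x, 0 <= f x) -> forall x, 0 <= step f x.
Proof. by move=> f0 x; apply: sumr_ge0 => s _; rewrite mulr_ge0. Qed.

Lemma step_le f g : (forall x, f x <= g x) -> forall x, step f x <= step g x.
Proof. by move=> fg x; apply: ler_sum => s _; rewrite ler_wpM2l. Qed.

Lemma step_lin a b f g x :
  step (fun y => a * f y + b * g y) x = a * step f x + b * step g x.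
Proof.
rewrite /step !mulr_sumr -big_split /=; apply: eq_bigr => s _; ring.
Qed.

Lemma iter_step_lin n a b f g x :
  iter n step (fun y => a * f y + b * g y) x =
  a * iter n step f x + b * iter n step g x.
Proof.
elim: n x => //= n IH x.
by rewrite (eq_step IH) step_lin.
Qed.

Lemma eq_iter_step n f g : f =1 g -> iter n step f =1 iter n step g.
Proof. by move=> fg; elim: n => //= n IH; exact: eq_step. Qed.

Lemma iter_step_le n f g : (forall x, f x <= g x) ->
  forall x, iter n step f x <= iter n step g x.
Proof. by move=> fg; elim: n => //= n IH x; exact: step_le. Qed.

Lemma iter_step_ge0 n f : (forall x, 0 <= f x) -> forall x, 0 <= iter n step f x.
Proof. by move=> f0; elim: n => //= n IH x; exact: step_ge0. Qed.

Lemma convpow_add m n x : p (m + n) x = iter m step (p n) x.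
Proof.
by elim: m x => //= m IH x; rewrite -[LHS]/(p (m + n).+1 x) convpowSl; exact: eq_step.
Qed.

Fixpoint walk_support (n : nat) : seq G :=
  if n is m.+1 then undup [seq (s * y)%g | s <- S, y <- walk_support m]
  else [:: 1%g].

Lemma uniq_walk_support n : uniq (walk_support n).
Proof. by case: n => // n; exact: undup_uniq. Qed.

Lemma walk_supportP n x : p n x != 0 -> x \in walk_support n.
Proof.
elim: n x => [|n IH] x /=.
  by rewrite /unit_mass mem_seq1; case: (x == _) => //=; rewrite eqxx.
rewrite -[convolution _ _ _]/(p n.+1 x) convpowSl => pn.
rewrite mem_undup; have /hasP[s sS ps] : has (fun s => p n (s^-1 * x)%g != 0) S.
  apply: contraNT pn => /hasPn ps; rewrite /step big_seq big1// => s sS.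
  by have /negPn/eqP -> := ps s sS; rewrite mulr0.
apply/allpairsP; exists (s, s^-1 * x)%g => /=; split => //; first exact: IH.
by rewrite mulgA mulgV mul1g.
Qed.

Lemma iter_stepE n g x :
  iter n step g x = \sum_(y <- walk_support n) p n y * g (y^-1 * x)%g.
Proof.
elim: n g x => [|n IH] g x.
  by rewrite /= big_seq1 /unit_mass eqxx mul1r invg1 mul1g.
rewrite -[LHS]/(step (iter n step g) x) (eq_step (IH g)).
under [RHS]eq_bigr do rewrite convpowSl /step mulr_suml.
rewrite exchange_big /step /= big_seq [RHS]big_seq; apply: eq_bigr => s sS.
rewrite mulr_sumr.
transitivity (\sum_(y <- [seq (s^-1 * z)%g | z <- undup [seq (s * y)%g | s <- S, y <- walk_support n]])
   mu s * (p n y * g (y^-1 * (s^-1 * x))%g)).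
  apply: big_supp_eq.
  - exact: uniq_walk_support.
  - by rewrite map_inj_uniq ?undup_uniq// => a b /mulgI.
  - by move=> y; rewrite !mulf_eq0 !negb_or => /and3P[_ /walk_supportP].
  - move=> y; rewrite !mulf_eq0 !negb_or => /and3P[_ /walk_supportP yn _].
    apply/mapP; exists (s * y)%g; last by rewrite mulgA mulVg mul1g.
    by rewrite mem_undup; apply/allpairsP; exists (s, y).
rewrite big_map; apply: eq_bigr => z _.
by rewrite invgM invgK -mulgA [(s * _)%g]mulgA mulgV mul1g mulrA.
Qed.

Lemma chapman_kolmogorov m n x :
  p (m + n) x = \sum_(y <- walk_support m) p m y * p n (y^-1 * x)%g.
Proof. by rewrite convpow_add iter_stepE. Qed.

Lemma convpow_mul_le m n x y : p m x * p n y <= p (m + n) (x * y)%g.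
Proof.
have [->|px] := eqVneq (p m x) 0; first by rewrite mul0r convpow_ge0.
rewrite chapman_kolmogorov (bigD1_seq x)//=; last 2 first.
- exact: walk_supportP.
- exact: uniq_walk_support.
rewrite mulgA mulVg mul1g lerDl; apply: sumr_ge0 => z _.
by rewrite mulr_ge0// convpow_ge0.
Qed.

Section Probability.
Hypothesis mu1 : \sum_(s <- S) mu s = 1.

Lemma sum_convpow n : \sum_(y <- walk_support n) p n y = 1.
Proof.
have := iter_stepE n (fun=> 1) 1%g.
under eq_bigr do rewrite mulr1.
move=> <-; have : iter n step (fun=> 1) =1 fun=> 1.
  elim: n => //= n IH x; rewrite (eq_step IH) /step -[RHS]mu1.
  by apply: eq_bigr => s _; rewrite mulr1.
exact.
Qed.

Lemma convpow_le1 n x : p n x <= 1.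
Proof.
have [->|pn] := eqVneq (p n x) 0; first exact: ler01.
rewrite -(sum_convpow n) (bigD1_seq x)//=; last 2 first.
- exact: walk_supportP.
- exact: uniq_walk_support.
by rewrite lerDl; apply: sumr_ge0 => y _; exact: convpow_ge0.
Qed.

End Probability.

Section Symmetric.
Hypothesis mu_sym : symmetric_measure mu.

Lemma convpow_inv n x : p n x^-1%g = p n x.
Proof.
elim: n x => [|n IH] x.
  by rewrite /= /unit_mass -[1%g in LHS]invg1 (inj_eq (@invg_inj _)).
rewrite convpowSl convpowSr /step.
transitivity (\sum_(s <- [seq s^-1%g | s <- S]) mu s * p n (x * s^-1)%g).
  rewrite big_map; apply: eq_bigr => s _.
  by rewrite -mu_sym -IH invgM invgK.
rewrite [RHS](eq_bigr (fun s => mu s * p n (x * s^-1)%g)); last first.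
  by move=> s _; rewrite mulrC.
apply: big_supp_eq => //.
- by rewrite map_inj_uniq// => a b /invg_inj.
- move=> s; rewrite mulf_eq0 negb_or mu_sym => /andP[/suppS sS _].
  by apply/mapP; exists s^-1%g => //; rewrite invgK.
- by move=> s; rewrite mulf_eq0 negb_or => /andP[/suppS sS _].
Qed.

(** By symmetry [p (k + l) 1] is the inner product of [p k] and [p l], so this is Cauchy-Schwarz; it
    makes the return probabilities at even times log-convex. *)
Lemma convpow_sqr_le m n : p (m + n) 1%g ^+ 2 <= p (m + m) 1%g * p (n + n) 1%g.
Proof.
have E k l : p (k + l) 1%g = \sum_(y <- walk_support k) p k y * p l y.
  by rewrite chapman_kolmogorov; apply: eq_bigr => y _; rewrite mulg1 convpow_inv.
(* One finite set that carries both [p m] and [p n], so that all three inner products are sums over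
   the same list. *)
pose X := undup (walk_support m ++ walk_support n).
have EX k l : (k == m) || (k == n) -> p (k + l) 1%g = \sum_(y <- X) p k y * p l y.
  move=> kmn; rewrite E; apply: big_supp_eq.
  - exact: uniq_walk_support.
  - exact: undup_uniq.
  - by move=> y; rewrite mulf_eq0 negb_or => /andP[/walk_supportP].
  - move=> y; rewrite mulf_eq0 negb_or => /andP[/walk_supportP yk _].
    by rewrite mem_undup mem_cat; case/orP: kmn => /eqP <-; rewrite yk ?orbT.
rewrite !EX ?eqxx ?orbT//.
have := cauchy_schwarz_seq X (p m) (p n).
by under [X in _ <= X * _ -> _]eq_bigr do rewrite expr2;
  under [X in _ <= _ * X -> _]eq_bigr do rewrite expr2.
Qed.

(* Since [mu^k >= p k 1%g * unit_mass], every application of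
   [f |-> mu^k * f - p k 1%g * f] to a nonnegative function is nonnegative:
   [n |-> p (j + k * n) 1%g] is a binomial mixture with nonnegative weights. *)
Lemma convpow_ratio k j n : 0 < p k 1%g ->
  n.+2%:R * p (j + k * n.+1) 1%g ^+ 2 <=
  p (j + k * n.+2) 1%g *
    (n.+1%:R * p (j + k * n) 1%g + p (j + k * n.+1) 1%g / p k 1%g).
Proof.
set c := p k 1%g => c0.
pose D f (x : G) := 1 * iter k step f x + (- c) * f x.
pose F i := iter i D (p j).
pose d i m := iter (k * m) step (F i) 1%g.
have F0 i x : 0 <= F i x.
  elim: i x => [|i IH] x; first exact: convpow_ge0.
  rewrite /F /= -/(F i) /D mul1r mulNr subr_ge0 iter_stepE.
  have kk : 1%g \in walk_support k by apply: walk_supportP; rewrite gt_eqF.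
  rewrite (bigD1_seq 1%g)//=; last exact: uniq_walk_support.
  rewrite invg1 mul1g lerDl; apply: sumr_ge0 => y _.
  by rewrite mulr_ge0// convpow_ge0.
have dS i m : d i m.+1 = d i.+1 m + c * d i m.
  rewrite /d /F /= -/(F i) /D iter_step_lin mul1r mulNr addrNK.
  by rewrite mulnSr iterD.
have d0 i : 0 <= d i 0%N by rewrite /d muln0 /=; exact: F0.
have E m : d 0%N m = p (j + k * m) 1%g.
  by rewrite addnC convpow_add.
by have := difference_ratio c0 dS d0 n; rewrite !E.
Qed.

End Symmetric.

(* [taboo n x] is the probability that the walk is at [x] at time [n + 1] and
   does not visit the identity at times [1, ..., n]. *)
Fixpoint taboo (n : nat) : G -> R :=
  if n is m.+1 then step (fun x => (x != 1%g)%:R * taboo m x) else mu.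

Lemma taboo_ge0 n x : 0 <= taboo n x.
Proof.
elim: n x => //= n IH x; apply: step_ge0 => y; exact: mulr_ge0.
Qed.

(** Decomposition by the time [k + 1] of the first return to the identity. The last term collects
    the paths without a return up to time [n + 1]; at the identity itself it has to vanish, since
    the sum already contains the return at time [n + 1]. *)
Lemma taboo_decomposition n x :
  p n.+1 x = \sum_(k < n.+1) taboo k 1%g * p (n - k)%N x + (x != 1%g)%:R * taboo n x.
Proof.
elim: n x => [|n IH] x.
  rewrite big_ord1 subnn convpow1 /= /unit_mass.
  by case: eqVneq => [->|_]; rewrite ?mulr1 ?mulr0 ?mul0r ?mul1r ?addr0 ?add0r.
have key : step (p n.+1) x =
    \sum_(k < n.+1) taboo k 1%g * p (n.+1 - k)%N x + taboo n.+1 x.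
  rewrite (eq_step IH) /step.
  under eq_bigr do rewrite mulrDr mulr_sumr.
  rewrite big_split /= exchange_big /=; congr (_ + _).
  apply: eq_bigr => k _; have kn : (k <= n)%N by rewrite -ltnS.
  rewrite (_ : (n.+1 - k)%N = (n - k).+1) ?subSn// convpowSl /step mulr_sumr.
  by apply: eq_bigr => s _; rewrite mulrCA.
rewrite convpowSl key [in RHS]big_ord_recr /= subnn -addrA; congr (_ + _).
rewrite -[convolution_pow _ _ _]/((x == 1%g)%:R).
by case: eqVneq => [->|_]; rewrite ?mulr1 ?mulr0 ?mul0r ?mul1r ?addr0 ?add0r.
Qed.

Lemma renewal_equation n :
  p n.+1 1%g = \sum_(k < n.+1) taboo k 1%g * p (n - k)%N 1%g.
Proof. by rewrite taboo_decomposition eqxx mul0r addr0. Qed.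

End Walk.

(** * Elementary real bounds and grid sums *)

Section RealBounds.
Variable R : realType.
Implicit Types x y a b r : R.

(** The Taylor inequalities for sine and cosine follow from one another by this lemma: each
    difference has the preceding one as its derivative. *)
Lemma ge0_of_derive (f df : R -> R) : (forall x, is_derive x 1 f (df x)) ->
  f 0 = 0 -> (forall x, 0 <= x -> 0 <= df x) -> forall x, 0 <= x -> 0 <= f x.
Proof.
move=> fd f0 df0 x; rewrite le_eqVlt => /orP[/eqP <-|x0]; first by rewrite f0.
have cf : {within `[0, x], continuous f}.
  apply: derivable_within_continuous => y _.
  exact: (@ex_derive _ _ _ _ _ _ _ (fd y)).
have [c /andP[c0 _]] := MVT x0 (fun y _ => fd y) cf.
by rewrite f0 !subr0 => ->; rewrite mulr_ge0 ?df0// ltW.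
Qed.

Lemma sin_lex x : 0 <= x -> sin x <= x.
Proof.
move=> x0; rewrite -subr_ge0.
apply: (@ge0_of_derive (fun x => x - sin x) (fun x => 1 - cos x)) => //.
- by rewrite sin0 subr0.
Qed.

Lemma cos_ge1Bsqr x : 1 - x ^+ 2 / 2 <= cos x.
Proof.
wlog x0 : x / 0 <= x.
  by move=> h; have [/h//|/ltW x0] := leP 0 x; rewrite -sqrrN -cosN h// oppr_ge0.
rewrite -subr_ge0.
apply: (@ge0_of_derive (fun x => cos x - (1 - x ^+ 2 / 2)) (fun x => x - sin x)) => //.
- move=> y; apply: is_derive_eq; rewrite /GRing.scale /=; lra.
- by rewrite cos0 expr0n mul0r subr0 subrr.
- by move=> y y0; rewrite subr_ge0 sin_lex.
Qed.

Lemma sin_gexBcub x : 0 <= x -> x - x ^+ 3 / 6 <= sin x.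
Proof.
move=> x0; rewrite -subr_ge0.
apply: (@ge0_of_derive (fun x => sin x - (x - x ^+ 3 / 6)) (fun x => cos x - (1 - x ^+ 2 / 2))) => //.
- move=> y; apply: is_derive_eq; rewrite /GRing.scale /=; lra.
- by rewrite sin0 expr0n mul0r subr0 subrr.
- by move=> y _; rewrite subr_ge0 cos_ge1Bsqr.
Qed.

Lemma cos_le_quartic x : cos x <= 1 - x ^+ 2 / 2 + x ^+ 4 / 24.
Proof.
wlog x0 : x / 0 <= x.
  move=> h; have [/h//|/ltW x0] := leP 0 x.
  by have := h (- x); rewrite cosN !sqrrN oppr_ge0 x0 (_ : (- x) ^+ 4 = x ^+ 4); [apply | ring].
rewrite -subr_ge0.
apply: (@ge0_of_derive (fun x => 1 - x ^+ 2 / 2 + x ^+ 4 / 24 - cos x)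
  (fun x => sin x - (x - x ^+ 3 / 6))) => //.
- move=> y; apply: is_derive_eq; rewrite /GRing.scale /=; lra.
- by rewrite cos0 !expr0n !mul0r subr0 addr0 subrr.
- by move=> y y0; rewrite subr_ge0 sin_gexBcub.
Qed.

Lemma pi_le4 : pi <= 4 :> R.
Proof. have := pihalf_lt2 R; rewrite ltr_pdivrMr//; lra. Qed.

(** In terms of half angles, [1 - cos c = 2 sin (c / 2) ^ 2], and the square of the sum formula for
    the sine is at most twice the sum of the squares. This approximate subadditivity lets [1 - cos]
    be propagated along a path. *)
Lemma oneB_cosD a b : 1 - cos (a + b) <= 2 * (1 - cos a) + 2 * (1 - cos b).
Proof.
have E (c : R) : 1 - cos c = 2 * sin (c / 2) ^+ 2.
  by rewrite {1}(_ : c = (c / 2) *+ 2) ?cos_mulr2n ?cos2sin2; lra.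
have D : (a + b) / 2 = a / 2 + b / 2 by rewrite mulrDl.
rewrite !E D sinD.
have h1 := cos2Dsin2 (a / 2); have h2 := cos2Dsin2 (b / 2).
set sa := sin (a / 2) in h1 *; set ca := cos (a / 2) in h1 *.
set sb := sin (b / 2) in h2 *; set cb := cos (b / 2) in h2 *.
have -> : 2 * (2 * sa ^+ 2) + 2 * (2 * sb ^+ 2) =
  2 * (2 * (sa ^+ 2 * (cb ^+ 2 + sb ^+ 2))) + 2 * (2 * (sb ^+ 2 * (ca ^+ 2 + sa ^+ 2))).
  by rewrite h1 h2 !mulr1.
have := sqr_ge0 (sa * cb - ca * sb); have := sqr_ge0 (sa * sb).
rewrite !exprMn; nra.
Qed.

(** Doubling an angle of size at most [pi / 2] at least doubles [1 - cos]. Two halvings bring [x] to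
    [x / 4], of size at most [1], where the quartic Taylor bound gives [1 - cos y >= 11 y^2 / 24];
    the resulting constant [4 * 11 / 24 / 16] exceeds [1 / 9]. *)
Lemma oneB_cos_ge x : `|x| <= pi -> x ^+ 2 / 9 <= 1 - cos x.
Proof.
move=> xpi; have pi4 := pi_le4; have pi0 := pi_ge0 R.
have half y : `|y| <= pi / 2 -> 2 * (1 - cos y) <= 1 - cos (y *+ 2).
  rewrite ler_norml => /cos_ge0_pihalf c0; rewrite cos_mulr2n.
  have := cos_le1 y; nra.
have x2 : `|x / 2| <= pi / 2 by rewrite normrM (@ger0_norm _ 2^-1)//; lra.
have x4 : `|x / 4| <= pi / 2 by rewrite normrM (@ger0_norm _ 4^-1)//; lra.
have := half _ x2; have := half _ x4.
rewrite (_ : x / 4 *+ 2 = x / 2); last by lra.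
rewrite (_ : x / 2 *+ 2 = x); last by lra.
have := cos_le_quartic (x / 4).
have xx : `|x / 4| <= 1 by rewrite normrM (@ger0_norm _ 4^-1)//; lra.
have y2 : (x / 4) ^+ 2 <= 1 by rewrite -real_normK ?num_real// expr_le1.
have -> : x ^+ 2 / 9 = (x / 4) ^+ 2 * (16 / 9) by field.
have -> : (x / 4) ^+ 4 = (x / 4) ^+ 2 * (x / 4) ^+ 2 by ring.
have := sqr_ge0 (x / 4).
move: ((x / 4) ^+ 2) y2 => y; nra.
Qed.

Lemma norm_exprB_le x y r n : `|x| <= r -> `|y| <= r ->
  `|x ^+ n.+1 - y ^+ n.+1| <= n.+1%:R * `|x - y| * r ^+ n.
Proof.
move=> xr yr; rewrite subrXX normrM mulrAC mulrC ler_wpM2r//.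
apply: (le_trans (ler_norm_sum _ _ _)).
have r0 : 0 <= r by exact: le_trans xr.
rewrite -[n.+1 in leRHS](card_ord n.+1) -sumr_const mulr_suml; apply: ler_sum => i _.
rewrite normrM !normrX /= mul1r.
have -> : r ^+ n = r ^+ (n - i) * r ^+ i by rewrite -exprD subnK// -ltnS.
by rewrite ler_pM ?exprn_ge0// lerXn2r ?nnegrE.
Qed.

Lemma bernoulli_ge x n : 0 <= x <= 1 -> 1 - n%:R * x <= (1 - x) ^+ n.
Proof.
move=> /andP[x0 x1]; elim: n => [|n IH]; first by rewrite mul0r subr0 expr0.
rewrite exprS; have : (1 - x) * (1 - n%:R * x) <= (1 - x) * (1 - x) ^+ n.
  by rewrite ler_wpM2l// subr_ge0.
apply: le_trans; rewrite -natr1; have : 0 <= n%:R :> R by [].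
nra.
Qed.

Lemma bernoulli_gep x n : 0 <= x -> 1 + n%:R * x <= (1 + x) ^+ n.
Proof.
move=> x0; elim: n => [|n IH]; first by rewrite mul0r addr0 expr0.
rewrite exprS; have : (1 + x) * (1 + n%:R * x) <= (1 + x) * (1 + x) ^+ n.
  by rewrite ler_wpM2l// addr_ge0.
apply: le_trans; rewrite -natr1; have : 0 <= n%:R :> R by [].
nra.
Qed.

(** From [(1 - x)^n (1 + n x) <= (1 - x^2)^n <= 1] and [1 / (1 + y) <= 1 - y + y^2]. *)
Lemma bernoulli_le x n : 0 <= x <= 1 ->
  (1 - x) ^+ n <= 1 - n%:R * x + (n%:R * x) ^+ 2.
Proof.
move=> /andP[x0 x1].
have h : (1 - x) ^+ n * (1 + n%:R * x) <= 1.
  apply: (@le_trans _ _ ((1 - x) ^+ n * (1 + x) ^+ n)).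
    by rewrite ler_wpM2l ?exprn_ge0 ?subr_ge0// bernoulli_gep.
  by rewrite -exprMn exprn_ile1//; nra.
have y0 : 0 <= n%:R * x by rewrite mulr_ge0.
have z0 : 0 <= (1 - x) ^+ n by rewrite exprn_ge0// subr_ge0.
move: (n%:R * x) ((1 - x) ^+ n) h y0 z0 => y z h y0 z0.
rewrite -(@ler_pM2r _ (1 + y)); last by lra.
apply: (le_trans h); nra.
Qed.

Lemma expR_sqr_le x : 0 <= x -> x ^+ 2 * expR (- x) <= 2.
Proof.
move=> x0; rewrite expRN ler_pdivrMr ?expR_gt0//.
have := expR_ge1Dxn 1 x0; rewrite (_ : 2`! = 2%N)//; lra.
Qed.

Lemma expR_lin_le x : 0 <= x -> x * expR (- x) <= 1.
Proof.
move=> x0; rewrite expRN ler_pdivrMr ?expR_gt0// mul1r.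
by have := expR_ge1Dx x; lra.
Qed.

End RealBounds.

Section GridSums.
Variables (R : realType) (d : nat).

(** The offset [o] is the index of the angle [0]. With mesh [2 pi / N] and [o = N./2] the grid lies
    in [[-pi, pi]], where the Gaussian bound on the characteristic function holds; the orthogonality
    relations hold for every offset. *)
Definition grid_angle (N : nat) (h : R) (o : nat) (k : {ffun 'I_d -> 'I_N}) :
  'I_d -> R := fun j => h * ((k j)%:R - o%:R).

Definition sqr_norm (t : 'I_d -> R) : R := \sum_j t j ^+ 2.

Lemma sqr_norm_ge0 t : 0 <= sqr_norm t.
Proof. by apply: sumr_ge0 => j _; exact: sqr_ge0. Qed.

Lemma sum_grid_prod (N : nat) (f : nat -> R) :
  \sum_(k : {ffun 'I_d -> 'I_N}) \prod_(j < d) f (k j) = (\sum_(i < N) f i) ^+ d.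
Proof.
rewrite -[RHS]/(_ ^+ d) -[d in RHS]card_ord -prodr_const.
by rewrite (bigA_distr_bigA (fun (j : 'I_d) (i : 'I_N) => f i)).
Qed.

Lemma sum_geometric_le (q : R) N : 0 <= q < 1 -> \sum_(i < N) q ^+ i <= (1 - q)^-1.
Proof.
move=> /andP[q0 q1]; rewrite -[leRHS]mul1r ler_pdivlMr ?subr_gt0//.
rewrite mulrC -opprB mulNr -subrX1 opprB lerBlDr lerDl exprn_ge0//.
Qed.

(** Since [- x^2 <= 1 - |x|], the sum is dominated by [e] times two geometric series of ratio
    [q = exp (- b h)], one on each side of [o], and [1 / (1 - q) <= 1 + 1 / (b h)]. *)
Lemma gauss_sum1 (N o : nat) (h b : R) : 0 < h -> 0 < b ->
  \sum_(i < N) expR (- (b ^+ 2 * (h * (i%:R - o%:R)) ^+ 2)) <=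
  2 * expR 1 * (1 + (b * h)^-1).
Proof.
move=> h0 b0; set q := expR (- (b * h)).
have bh : 0 < b * h by rewrite mulr_gt0.
have q01 : 0 <= q < 1 by rewrite expR_ge0 expR_lt1 oppr_lt0.
have q1 : 0 < 1 - q by rewrite subr_gt0; case/andP: q01.
have invq : (1 - q)^-1 <= 1 + (b * h)^-1.
  rewrite -[leLHS]mul1r ler_pdivrMr//.
  have : q <= (1 + b * h)^-1.
    by rewrite /q expRN lef_pV2 ?posrE ?expR_gt0 ?expR_ge1Dx// addr_gt0.
  move=> qle; apply: (@le_trans _ _ ((1 + (b * h)^-1) * (1 - (1 + b * h)^-1))).
    rewrite le_eqVlt; apply/orP; left; apply/eqP.
    by field; rewrite ?gt_eqF// addr_gt0.
  by rewrite ler_wpM2l ?lerB// addr_ge0// invr_ge0 ltW.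
have term (i : nat) : expR (- (b ^+ 2 * (h * (i%:R - o%:R)) ^+ 2)) <=
    expR 1 * ((o <= i)%:R * q ^+ (i - o) + (i <= o)%:R * q ^+ (o - i)).
  apply: (@le_trans _ _ (expR (1 - b * h * `|i%:R - o%:R|))).
    rewrite ler_expR; set x := b * h * _.
    have -> : b ^+ 2 * (h * (i%:R - o%:R)) ^+ 2 = x ^+ 2.
      by rewrite /x !exprMn real_normK ?num_real//; ring.
    have := sqr_ge0 (x - 1); have := sqr_ge0 x; nra.
  rewrite expRD ler_wpM2l ?expR_ge0//.
  have q0 (j : nat) c : 0 <= c%:R * q ^+ j by rewrite mulr_ge0// exprn_ge0// expR_ge0.
  have [io|/ltnW io] := leqP i o.
    rewrite distrC ger0_norm ?subr_ge0 ?ler_nat// -natrB//.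
    have -> : expR (- (b * h * (o - i)%:R)) = q ^+ (o - i) by rewrite -expRM_natr mulNr.
    by rewrite mul1r lerDr q0.
  rewrite ger0_norm ?subr_ge0 ?ler_nat// -natrB//.
  have -> : expR (- (b * h * (i - o)%:R)) = q ^+ (i - o) by rewrite -expRM_natr mulNr.
  by rewrite io mul1r lerDl q0.
apply: (le_trans (ler_sum _ (fun (i : 'I_N) _ => term i))).
rewrite -mulr_sumr big_split /= [2 * _]mulrC -mulrA ler_wpM2l ?expR_ge0//.
have S m : \sum_(i < m) q ^+ i <= 1 + (b * h)^-1.
  exact: le_trans (sum_geometric_le _ q01) invq.
have S1 : \sum_(i < N) (o <= i)%:R * q ^+ (i - o) <= 1 + (b * h)^-1.
  apply: le_trans (S (N - o)%N); elim: N => [|n IH]; first by rewrite !big_ord0.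
  rewrite big_ord_recr /=; have [on|no] := leqP o n.
    by rewrite subSn// big_ord_recr /= mul1r lerD2r.
  rewrite mul0r addr0; apply: (le_trans IH).
  have /eqP -> : (n - o == 0)%N by rewrite subn_eq0 ltnW.
  by rewrite big_ord0; apply: sumr_ge0 => i _; rewrite exprn_ge0// expR_ge0.
have S2 : \sum_(i < N) (i <= o)%:R * q ^+ (o - i) <= 1 + (b * h)^-1.
  apply: le_trans (S o.+1); rewrite [leRHS](reindex_inj rev_ord_inj)/=.
  apply: (@le_trans _ _ (\sum_(i < o.+1 + N) (i <= o)%:R * q ^+ (o - i))).
    rewrite addnC big_split_ord /= lerDl; apply: sumr_ge0 => i _.
    by rewrite mulr_ge0// exprn_ge0// expR_ge0.
  rewrite big_split_ord /= [X in _ + X]big1 ?addr0; last first.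
    by move=> i _; rewrite leqNgt ltn_addr// mul0r.
  apply: ler_sum => i _; rewrite subSS.
  by rewrite -ltnS ltn_ord mul1r.
lra.
Qed.

Lemma gauss_sum (N o : nat) (h b : R) : 0 < h -> 0 < b ->
  \sum_(k : {ffun 'I_d -> 'I_N}) expR (- (b ^+ 2 * sqr_norm (grid_angle h o k))) <=
  (2 * expR 1 * (1 + (b * h)^-1)) ^+ d.
Proof.
move=> h0 b0.
have E (k : {ffun 'I_d -> 'I_N}) : expR (- (b ^+ 2 * sqr_norm (grid_angle h o k))) =
    \prod_(j < d) expR (- (b ^+ 2 * (h * ((k j)%:R - o%:R)) ^+ 2)).
  by rewrite /sqr_norm mulr_sumr -sumrN expR_sum.
under eq_bigr do rewrite E.
rewrite (sum_grid_prod N (fun i => expR (- (b ^+ 2 * (h * (i%:R - o%:R)) ^+ 2)))).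
rewrite lerXn2r ?nnegrE ?gauss_sum1//.
  by apply: sumr_ge0 => i _; rewrite expR_ge0.
by rewrite !mulr_ge0 ?expR_ge0// addr_ge0// invr_ge0 mulr_ge0 ?ltW.
Qed.

End GridSums.

(** * The local limit theorem on the integer lattice *)

Section TrigSums.
Variables (R : realType) (d : nat).
Implicit Types (x y : 'rV[int]_d) (t : 'I_d -> R).

Lemma cosD_int (a : R) (z : int) : cos (a + z%:~R * (pi *+ 2)) = cos a.
Proof.
have P (n : nat) (b : R) : cos (b + n%:R * (pi *+ 2)) = cos b.
  by rewrite mulr_natl (periodicn (@cosD2pi R)).
case: z => n; first exact: P.
by rewrite NegzE mulrNz mulNr -(P n.+1) subrK.
Qed.

Lemma sinD_int (a : R) (z : int) : sin (a + z%:~R * (pi *+ 2)) = sin a.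
Proof.
have P (n : nat) (b : R) : sin (b + n%:R * (pi *+ 2)) = sin b.
  by rewrite mulr_natl (periodicn (@sinD2pi R)).
case: z => n; first exact: P.
by rewrite NegzE mulrNz mulNr -(P n.+1) subrK.
Qed.

Definition dot x t : R := \sum_j (x 0 j)%:~R * t j.

Lemma dotB x y t : dot (x - y) t = dot x t - dot y t.
Proof.
rewrite /dot -sumrB; apply: eq_bigr => j _.
by rewrite !mxE intrB mulrBl.
Qed.

Lemma dot0 t : dot 0 t = 0.
Proof. by rewrite /dot big1// => j _; rewrite mxE mul0r. Qed.

Lemma dotZ x c t : dot x (fun j => c * t j) = c * dot x t.
Proof. by rewrite /dot mulr_sumr; apply: eq_bigr => j _; ring. Qed.

(** A cyclic shift of the index along a coordinate with [x_j] nonzero permutes the grid and rotates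
    every phase by [b = h x_j]. The vector of the cosine sum and the sine sum is thus fixed by the
    rotation of angle [b], and it vanishes because [|x_j| < N] forces [cos b < 1]. *)
Lemma grid_orthogonality (N o : nat) x : (0 < N)%N ->
  x != 0 -> (forall j, `|x 0%R j| < N)%N ->
  \sum_(k : {ffun 'I_d -> 'I_N}) cos (dot x (grid_angle (pi *+ 2 / N%:R) o k)) = 0.
Proof.
move=> N0 x0 xN; set h := pi *+ 2 / N%:R.
have [j xj] : exists j, x 0 j != 0.
  apply/existsP; apply: contraNT x0; rewrite negb_exists => /forallP x0.
  by apply/eqP/rowP => j; rewrite mxE; apply/eqP; have := x0 j; rewrite negbK.
have NR : N%:R != 0 :> R by rewrite pnatr_eq0 -lt0n.
pose a (k : {ffun 'I_d -> 'I_N}) := dot x (grid_angle h o k).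
pose s (k : {ffun 'I_d -> 'I_N}) : {ffun 'I_d -> 'I_N} :=
  [ffun i => if i == j then ordS (k i) else k i].
have s_bij : bijective s.
  exists (fun k : {ffun 'I_d -> 'I_N} =>
    [ffun i => if i == j then ord_pred (k i) else k i] : {ffun 'I_d -> 'I_N}).
    by move=> k; apply/ffunP => i; rewrite !ffunE; case: eqP => // _; rewrite ordSK.
  by move=> k; apply/ffunP => i; rewrite !ffunE; case: eqP => // _; rewrite ord_predK.
(* The multiple of [2 pi] is nonzero only when the shifted index wraps around from [N - 1] to
   [0]. *)
have as_ k : exists z : int, a (s k) = a k + h * (x 0 j)%:~R + z%:~R * (pi *+ 2).
  have -> : a (s k) = a k + (x 0 j)%:~R * h * ((s k j)%:R - (k j)%:R).
    rewrite /a /dot (bigD1 j)//= [in RHS](bigD1 j)//= addrAC /grid_angle; congr (_ + _); last first.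
      by apply: eq_bigr => i /negPf ij; rewrite ffunE ij.
    by ring.
  rewrite /s ffunE eqxx /=; have [kN|] := ltnP (k j).+1 N.
    by exists 0; rewrite modn_small// -natr1; ring.
  move=> kN; have kE : (k j).+1 = N by apply/eqP; rewrite eqn_leq kN andbT.
  exists (- x 0 j); rewrite kE modnn.
  have -> : (k j)%:R = N%:R - 1 :> R by rewrite -[in RHS]kE -natr1 addrK.
  by rewrite /h intrN; field.
have sh_cos : \sum_k cos (a k) = \sum_k cos (a k + h * (x 0 j)%:~R).
  rewrite (reindex s)/=; last exact: onW_bij.
  by apply: eq_bigr => k _; have [z ->] := as_ k; rewrite cosD_int.
have sh_sin : \sum_k sin (a k) = \sum_k sin (a k + h * (x 0 j)%:~R).
  rewrite (reindex s)/=; last exact: onW_bij.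
  by apply: eq_bigr => k _; have [z ->] := as_ k; rewrite sinD_int.
set b := h * _ in sh_cos sh_sin.
rewrite -/(\sum_k cos (a k)).
move: sh_cos sh_sin.
under [X in _ = X -> _]eq_bigr do rewrite cosD.
under [X in _ -> _ = X -> _]eq_bigr do rewrite sinD.
rewrite big_split /= sumrN -!mulr_suml big_split /= -!mulr_suml.
set C := \sum_k cos _; set T := \sum_k sin _ => e1 e2.
have cb : cos b < 1.
  have -> : b = (b / 2) *+ 2 by lra.
  rewrite cos_mulr2n cos2sin2.
  suff : 0 < sin (b / 2) ^+ 2 by lra.
  rewrite exprn_even_gt0//=.
  suff : sin `|b / 2| != 0.
    by case: (ger0P (b / 2)) => // _; rewrite sinN oppr_eq0.
  rewrite gt_eqF// sin_gt0_pi//.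
  have -> : `|b / 2| = pi * ((absz (x 0 j))%:R / N%:R).
    rewrite /b /h !normrM !normfV (@ger0_norm _ (pi *+ 2)); last by have := pi_ge0 R; lra.
    rewrite [`|N%:R|]ger0_norm// [`|2|]ger0_norm//.
    by rewrite -intr_norm -natr_absz; field.
  have xj0 : 0 < (absz (x 0 j))%:R :> R by rewrite ltr0n absz_gt0.
  have N0R : 0 < N%:R :> R by rewrite ltr0n.
  apply/andP; split; first by apply: mulr_gt0; [exact: pi_gt0 | exact: divr_gt0].
  rewrite gtr_pMr; last exact: pi_gt0.
  by rewrite ltr_pdivrMr// mul1r ltr_nat.
(* Adding the two rotation equations, multiplied by [C] and by [T], cancels the terms in [sin b]. *)
have : (1 - cos b) * (C ^+ 2 + T ^+ 2) = 0.
  have e1' : (1 - cos b) * C = - T * sin b by rewrite mulrBl mul1r {1}e1; ring.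
  have e2' : (1 - cos b) * T = C * sin b by rewrite mulrBl mul1r {1}e2; ring.
  by rewrite mulrDr !expr2 !mulrA e1' e2'; ring.
move/eqP; rewrite mulf_eq0 subr_eq0 gt_eqF//= paddr_eq0 ?sqr_ge0//.
by move=> /andP[]; rewrite sqrf_eq0 => /eqP.
Qed.

End TrigSums.

Lemma absz_subadd (a b : int) : (`|(a - b)%R| <= `|a| + `|b|)%N.
Proof. by rewrite -lez_nat PoszD !abszE ler_normB. Qed.

(** Arithmetic of a window of length [B'] placed around the middle of a range of length [B]: it
    fits, its points are within [B' / 2] of the middle, and the others are at least that far. *)
Lemma half_window_le (B B' : nat) : (B' <= B)%N -> (B./2 - B'./2 + B' <= B)%N.
Proof.
have := odd_double_half B; have := odd_double_half B'.
move: (odd B : nat) (leq_b1 (odd B)) (odd B' : nat) (leq_b1 (odd B')).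
move: (B./2) (B'./2); lia.
Qed.

Lemma half_window_dist (R : realDomainType) (B B' k : nat) : (B' <= B)%N ->
  (B./2 - B'./2 <= k < B./2 - B'./2 + B')%N ->
  2 * `|k%:R - (B./2)%:R| <= B'%:R :> R.
Proof.
move=> BB /andP[k1 k2]; have oo := half_leq BB.
have := odd_double_half B'; move: (odd B' : nat) (leq_b1 (odd B')) => b b1 E.
rewrite -[2]/(2%:R) -(@ger0_norm R 2%:R)// -normrM ler_norml mulrBr -!natrM.
apply/andP; split.
  rewrite -subr_ge0 opprK addrAC -natrD subr_ge0 ler_nat; lia.
rewrite lerBlDr -natrD ler_nat; lia.
Qed.

Lemma half_window_far (R : realDomainType) (B B' k : nat) : (B' <= B)%N ->
  ~~ (B./2 - B'./2 <= k < B./2 - B'./2 + B')%N ->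
  B'%:R <= 2 * `|k%:R - (B./2)%:R| :> R.
Proof.
move=> BB bj; have oo := half_leq BB.
have := odd_double_half B'; move: (odd B' : nat) (leq_b1 (odd B')) => b b1 E.
rewrite -[2]/(2%:R) -(@ger0_norm R 2%:R)// -normrM ler_normr mulrBr -!natrM.
move: bj; rewrite negb_and -!ltnNge ltnS => /orP[bj|bj]; apply/orP; [right|left].
  rewrite opprB lerBrDr -natrD ler_nat; lia.
rewrite lerBrDr -natrD ler_nat; lia.
Qed.

Lemma even_part_bounds (X a b M M' : nat) : ((X + a + b).+1 < M)%N ->
  (M' <= M <= M'.+1)%N -> [/\ (X <= M')%N, (a <= M')%N & (b <= M')%N].
Proof. by move=> h /andP[_ h']; split; lia. Qed.

Section LatticeWalk.
Variables (R : realType) (d : nat) (mu : 'rV[int]_d -> R) (S : seq 'rV[int]_d).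
Hypotheses (mu_ge0 : forall x, 0 <= mu x) (uS : uniq S).
Hypothesis suppS : forall x, mu x != 0 -> x \in S.
Hypothesis mu1 : \sum_(s <- S) mu s = 1.
Hypothesis mu_sym : forall x, mu (- x) = mu x.
Variable p : nat -> 'rV[int]_d -> R.
Hypothesis p_0 : forall x, p 0 x = (x == 0)%:R.
Hypothesis p_S : forall n x, p n.+1 x = \sum_(s <- S) mu s * p n (x - s).
Implicit Types (x y : 'rV[int]_d) (t : 'I_d -> R).

(** The characteristic function of a symmetric measure is real, so cosines suffice; [sum_sin]
    records that the imaginary part vanishes. *)
Definition charfun t : R := \sum_(s <- S) mu s * cos (dot s t).
Local Notation phi := charfun.

Lemma sum_sin t : \sum_(s <- S) mu s * sin (dot s t) = 0.
Proof.
have E : \sum_(s <- S) mu s * sin (dot s t) = \sum_(s <- [seq - s | s <- S]) mu s * sin (dot s t).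
  apply: big_supp_eq => //.
  - by rewrite map_inj_uniq//; exact: oppr_inj.
  - by move=> s; rewrite mulf_eq0 negb_or => /andP[/suppS].
  - move=> s; rewrite mulf_eq0 negb_or -mu_sym => /andP[/suppS sS _].
    by apply/mapP; exists (- s) => //; rewrite opprK.
have : \sum_(s <- S) mu s * sin (dot s t) = - \sum_(s <- S) mu s * sin (dot s t).
  rewrite {1}E big_map -sumrN; apply: eq_bigr => s _.
  by rewrite mu_sym -[- s]add0r dotB dot0 add0r sinN mulrN.
lra.
Qed.

Lemma sum_cosB x t : \sum_(s <- S) mu s * cos (dot (x - s) t) = phi t * cos (dot x t).
Proof.
transitivity (phi t * cos (dot x t) + (\sum_(s <- S) mu s * sin (dot s t)) * sin (dot x t)).
  rewrite /phi !mulr_suml -big_split /=; apply: eq_bigr => s _.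
  by rewrite dotB cosB; ring.
by rewrite sum_sin mul0r addr0.
Qed.

(** Exact inversion on a finite torus: the bound [|x_j| + n L < N] prevents the walk of range [L]
    from wrapping around within [n] steps, so the torus is indistinguishable from the lattice. *)
Lemma fourier_inversion (L N o : nat) : (0 < N)%N ->
  (forall s j, s \in S -> `|s 0%R j| <= L)%N ->
  forall n x, (forall j, `|x 0%R j| + n * L < N)%N ->
  N%:R ^+ d * p n x = \sum_(k : {ffun 'I_d -> 'I_N})
    phi (grid_angle (pi *+ 2 / N%:R) o k) ^+ n *
    cos (dot x (grid_angle (pi *+ 2 / N%:R) o k)).
Proof.
move=> N0 SL; elim=> [|n IH] x xN.
  under eq_bigr do rewrite expr0 mul1r.
  rewrite p_0; have [->|x0] := eqVneq x 0.
    under eq_bigr do rewrite dot0 cos0.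
    by rewrite mulr1 sumr_const card_ffun !card_ord natrX.
  by rewrite mulr0 grid_orthogonality// => j; have := xN j; rewrite mul0n addn0.
rewrite p_S mulr_sumr.
transitivity (\sum_(s <- S) \sum_(k : {ffun 'I_d -> 'I_N})
  mu s * (phi (grid_angle (pi *+ 2 / N%:R) o k) ^+ n *
    cos (dot (x - s) (grid_angle (pi *+ 2 / N%:R) o k)))).
  rewrite big_seq [RHS]big_seq; apply: eq_bigr => s sS.
  rewrite mulrCA IH ?mulr_sumr// => j; have := SL s j sS; have := xN j.
  rewrite !mxE mulSn => h1 h2.
  have := absz_subadd (x 0 j) (s 0 j); move: h1 h2.
  move: (absz (x 0 j)) (absz (s 0 j)) (absz (x 0 j - s 0 j)%R) => a b c; lia.
rewrite exchange_big /=; apply: eq_bigr => k _.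
rewrite exprSr -mulrA -sum_cosB mulr_sumr; apply: eq_bigr => s _; ring.
Qed.

(** Induction along a path of positive probability from [0] to [x], adding one step at a time with
    [oneB_cosD]. The extra phase [w] per step is [0] when [1 - phi] is to be bounded below and [pi]
    when [1 + phi] is. *)
Lemma cos_path_bound n x : 0 < p n x -> exists2 K : R, 0 <= K & forall w t,
  1 - cos (n%:R * w + dot x t) <= K * \sum_(s <- S) mu s * (1 - cos (w + dot s t)).
Proof.
have pge m y : 0 <= p m y.
  elim: m y => [|m IH] y; first by rewrite p_0.
  by rewrite p_S; apply: sumr_ge0 => s _; rewrite mulr_ge0.
elim: n x => [|n IH] x.
  rewrite p_0; have [-> _|] := eqVneq x 0; last by rewrite ltxx.
  by exists 0 => // w t; rewrite !mul0r dot0 addr0 cos0 subrr.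
rewrite p_S => pn.
have [s sS] : exists2 s, s \in S & 0 < mu s * p n (x - s).
  apply/hasP; apply: contraTT pn => /hasPn ps; rewrite -leNgt big_seq.
  by apply: sumr_le0 => s sS; have := ps s sS; rewrite -leNgt.
move=> mp; have ms : 0 < mu s.
  rewrite lt_neqAle mu_ge0 andbT eq_sym; apply: contraTneq mp => ->.
  by rewrite mul0r ltxx.
have [K K0 KP] := IH (x - s) ltac:(by rewrite pmulr_rgt0 in mp).
exists (2 * K + 2 / mu s); first by rewrite addr_ge0// mulr_ge0// invr_ge0 ltW.
move=> w t; rewrite -natr1.
have -> : (n%:R + 1) * w + dot x t = (n%:R * w + dot (x - s) t) + (w + dot s t).
  by rewrite dotB; ring.
apply: (le_trans (oneB_cosD _ _)); rewrite [leRHS]mulrDl lerD//.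
  by rewrite -mulrA ler_wpM2l.
rewrite -mulrA ler_wpM2l// ler_pdivlMl//.
rewrite (bigD1_seq s)//= lerDl; apply: sumr_ge0 => y _.
by rewrite mulr_ge0// subr_ge0 cos_le1.
Qed.

Lemma oneB_charfun t : 1 - phi t = \sum_(s <- S) mu s * (1 - cos (dot s t)).
Proof.
rewrite -{1}mu1 /phi -sumrB; apply: eq_bigr => s _; ring.
Qed.

Lemma oneD_charfun t : 1 + phi t = \sum_(s <- S) mu s * (1 - cos (pi + dot s t)).
Proof.
rewrite -{1}mu1 /phi -big_split /=; apply: eq_bigr => s _.
by rewrite addrC addrC [pi + _]addrC cosDpi; ring.
Qed.

Lemma norm_charfun_le1 t : `|phi t| <= 1.
Proof.
rewrite ler_norml; apply/andP; split.
  have : 0 <= 1 + phi t; last lra.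
  rewrite oneD_charfun; apply: sumr_ge0 => s _.
  by rewrite mulr_ge0// subr_ge0 cos_le1.
rewrite -subr_ge0 oneB_charfun; apply: sumr_ge0 => s _.
by rewrite mulr_ge0// subr_ge0 cos_le1.
Qed.

Hypothesis adm : forall x, exists n, 0 < p n x.
Hypothesis aper : exists n0, forall n, (n0 <= n)%N -> 0 < p n 0.

(** Admissibility reaches each basis vector, so [1 - phi t] dominates every [1 - cos (t j)], hence
    [|t|^2]. Aperiodicity keeps [1 + phi] away from [0], which is enough on the bounded box. Both
    [1 - phi] and [1 + phi] are thus at least a multiple of [|t|^2]. *)
Lemma norm_charfun_gauss : exists2 K : R, 0 < K & forall t,
  (forall j, `|t j| <= pi) -> `|phi t| <= expR (- (K * sqr_norm t)).
Proof.
have [Kf Kp] : {Kf : 'I_d -> R & forall j, 0 <= Kf j /\ forall t, 1 - cos (t j) <= Kf j * (1 - phi t)}.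
  apply: (@choice _ _ (fun j K => 0 <= K /\ forall t, 1 - cos (t j) <= K * (1 - phi t))) => j.
  have [n /cos_path_bound[K K0 KP]] := adm (delta_mx 0 j).
  exists K; split => // t; have := KP 0 t.
  rewrite mulr0 add0r oneB_charfun.
  under eq_bigr do rewrite add0r.
  rewrite (_ : dot _ t = t j)//.
  rewrite /dot (bigD1 j)//= mxE !eqxx mul1r big1 ?addr0// => i /negPf ij.
  by rewrite mxE ij andbF mul0r.
have [K2 K20 K2P] : exists2 K2 : R, 0 < K2 & forall t, 2 <= K2 * (1 + phi t).
  (* An odd return time: with the phase [w = pi] the left side of the path bound is then
     [1 - cos (n pi) = 2]. *)
  have [n0 /(_ n0.*2.+1)] := aper; rewrite -addnn leqW ?leq_addr// addnn => /(_ isT).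
  move=> /cos_path_bound[K K0 KP]; have KP' t : 2 <= K * (1 + phi t).
    have e : cos (n0.*2.+1%:R * pi) = -1 :> R.
      rewrite mulr_natl -[X in cos X]add0r (alternatingn (@cosDpi R)) cos0 mulr1.
      by rewrite -signr_odd /= odd_double expr1.
    by have := KP pi t; rewrite dot0 addr0 oneD_charfun e opprK.
  exists K => //; rewrite lt_neqAle K0 andbT eq_sym; apply/eqP => K00.
  by have := KP' (fun=> 0); rewrite K00 mul0r; lra.
pose K := 1 + \sum_j Kf j.
have K0 : 0 < K by rewrite ltr_pwDl// sumr_ge0// => j _; case: (Kp j).
have KP j t : 1 - cos (t j) <= K * (1 - phi t).
  apply: le_trans (proj2 (Kp j) t) _; rewrite ler_wpM2r//.
    by have := norm_charfun_le1 t; rewrite ler_norml; lra.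
  rewrite /K (bigD1 j)//= addrCA lerDl addr_ge0// sumr_ge0// => i _.
  by case: (Kp i).
pose d1 : R := d%:R + 1.
have d10 : 0 < d1 by rewrite /d1 ltr_pwDr.
exists (Num.min (9 * K * d1)^-1 (K2 * 8 * d1)^-1).
  by rewrite lt_min !invr_gt0 !mulr_gt0.
move=> t tpi; have T0 := sqr_norm_ge0 t.
have T1 : sqr_norm t <= d%:R * (9 * K * (1 - phi t)).
  rewrite -[d in leRHS]card_ord mulr_natl -sumr_const; apply: ler_sum => j _.
  have := oneB_cos_ge (tpi j); have := KP j t; lra.
have T2 : sqr_norm t <= 16 * d1.
  have -> : 16 * d1 = d%:R * 16 + 16 by rewrite /d1; ring.
  rewrite -[leLHS]addr0 lerD//.
  rewrite -[d in leRHS]card_ord mulr_natl -sumr_const; apply: ler_sum => j _.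
  rewrite -real_normK ?num_real// (_ : 16 = 4 ^+ 2 :> R); last by ring.
  by rewrite lerXn2r ?nnegrE// (le_trans (tpi j))// pi_le4.
apply: le_trans (expR_ge1Dx _).
have n1 := norm_charfun_le1 t.
have B1 : (9 * K * d1)^-1 * sqr_norm t <= 1 - phi t.
  rewrite ler_pdivrMl ?mulr_gt0//; apply: (le_trans T1).
  rewrite mulrA ler_wpM2r//; first by move: n1; rewrite ler_norml; lra.
  by rewrite /d1; lra.
have B2 : (K2 * 8 * d1)^-1 * sqr_norm t <= 1 + phi t.
  rewrite ler_pdivrMl ?mulr_gt0//; apply: (le_trans T2).
  have := K2P t; rewrite -(@ler_pM2r _ (8 * d1)) ?mulr_gt0//; lra.
set m := Num.min _ _.
have m1 : m * sqr_norm t <= 1 - phi t.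
  by apply: le_trans B1; rewrite ler_wpM2r// ge_min lexx.
have m2 : m * sqr_norm t <= 1 + phi t.
  by apply: le_trans B2; rewrite ler_wpM2r// ge_min lexx orbT.
by rewrite ler_norml; apply/andP; split; lra.
Qed.

Definition quad_form t : R := (\sum_(s <- S) mu s * dot s t ^+ 2) / 2.

Lemma quad_formZ c t : quad_form (fun j => c * t j) = c ^+ 2 * quad_form t.
Proof.
rewrite /quad_form mulrA mulr_sumr; congr (_ / _); apply: eq_bigr => s _.
by rewrite dotZ; ring.
Qed.

Lemma sqr_normZ c t : sqr_norm (fun j => c * t j) = c ^+ 2 * sqr_norm t.
Proof. by rewrite /sqr_norm mulr_sumr; apply: eq_bigr => j _; rewrite exprMn. Qed.

Lemma charfun_taylor : exists2 A : R, 1 <= A & forall t,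
  [/\ 0 <= quad_form t <= A * sqr_norm t, 0 <= 1 - phi t <= A * sqr_norm t &
   `|phi t - (1 - quad_form t)| <= A * sqr_norm t ^+ 2].
Proof.
pose L := \sum_(s <- S) \sum_j ((s 0 j)%:~R : R) ^+ 2.
have L0 : 0 <= L by apply: sumr_ge0 => s _; apply: sumr_ge0 => j _; exact: sqr_ge0.
exists (1 + L + L ^+ 2); first by rewrite -addrA lerDl addr_ge0// sqr_ge0.
move=> t; have T0 := sqr_norm_ge0 t.
have dL s : s \in S -> dot s t ^+ 2 <= L * sqr_norm t.
  move=> sS; apply: (le_trans (cauchy_schwarz_seq _ _ _)).
  rewrite ler_wpM2r// /L (bigD1_seq s)//= lerDl.
  by apply: sumr_ge0 => x _; apply: sumr_ge0 => j _; exact: sqr_ge0.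
have avg (f : 'rV[int]_d -> R) B : (forall s, s \in S -> f s <= B) -> \sum_(s <- S) mu s * f s <= B.
  move=> fB; rewrite -[leRHS]mul1r -mu1 mulr_suml big_seq [leRHS]big_seq.
  by apply: ler_sum => s sS; rewrite ler_wpM2l// fB.
have Q1 : quad_form t <= L * sqr_norm t.
  have := avg _ _ dL; rewrite /quad_form; have : 0 <= L * sqr_norm t by rewrite mulr_ge0.
  lra.
have Q0 : 0 <= quad_form t.
  rewrite mulr_ge0// sumr_ge0// => s _; rewrite mulr_ge0// sqr_ge0//.
have lo : 0 <= phi t - (1 - quad_form t).
  have -> : phi t - (1 - quad_form t) =
      \sum_(s <- S) mu s * (cos (dot s t) - (1 - dot s t ^+ 2 / 2)).
    rewrite -{1}mu1 /phi /quad_form mulr_suml opprB -sumrB -big_split /=.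
    by apply: eq_bigr => s _; field.
  apply: sumr_ge0 => s _; rewrite mulr_ge0// subr_ge0.
  exact: cos_ge1Bsqr.
have hi : phi t - (1 - quad_form t) <= L ^+ 2 * sqr_norm t ^+ 2.
  have -> : phi t - (1 - quad_form t) =
      \sum_(s <- S) mu s * (cos (dot s t) - (1 - dot s t ^+ 2 / 2)).
    rewrite -{1}mu1 /phi /quad_form mulr_suml opprB -sumrB -big_split /=.
    by apply: eq_bigr => s _; field.
  apply: avg => s sS; have := cos_le_quartic (dot s t).
  have : (dot s t ^+ 2) ^+ 2 <= (L * sqr_norm t) ^+ 2.
    by rewrite lerXn2r ?nnegrE ?sqr_ge0 ?mulr_ge0// dL.
  rewrite [(L * _) ^+ 2]exprMn; have -> : dot s t ^+ 4 = (dot s t ^+ 2) ^+ 2 by ring.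
  have := sqr_ge0 (dot s t ^+ 2).
  move: (dot s t ^+ 2) (L ^+ 2 * sqr_norm t ^+ 2) (cos _) => a b c; lra.
have LT : 0 <= L * sqr_norm t by rewrite mulr_ge0.
have LT2 : 0 <= L ^+ 2 * sqr_norm t by rewrite mulr_ge0 ?sqr_ge0.
have n1 := norm_charfun_le1 t; rewrite ler_norml in n1.
have E1 : (1 + L + L ^+ 2) * sqr_norm t = sqr_norm t + L * sqr_norm t + L ^+ 2 * sqr_norm t by ring.
split.
- rewrite Q0 E1; lra.
- rewrite E1; lra.
rewrite ger0_norm//; apply: (le_trans hi); rewrite ler_wpM2r ?sqr_ge0//.
lra.
Qed.

(** Both quantities equal [1 - quad_form t] up to [O(|t|^4)], because [m ^ 2] steps at angle [t / m]
    preserve the quadratic form. This is the comparison between time [m ^ 2 n] and time [n]. *)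
Lemma charfun_scaling : exists2 K : R, 0 <= K & forall t m, (0 < m)%N ->
  `|phi t - phi (fun j => m%:R^-1 * t j) ^+ (m ^ 2)| <= K * sqr_norm t ^+ 2.
Proof.
have [A A1 AP] := charfun_taylor.
exists (2 * A + 2 * A ^+ 2); first by rewrite addr_ge0 ?mulr_ge0 ?sqr_ge0//; lra.
move=> t m m0; set T := sqr_norm t; have T0 : 0 <= T := sqr_norm_ge0 t.
have [v01 _ v1] := AP t; have [_ _] := AP (fun j => m%:R^-1 * t j).
rewrite quad_formZ sqr_normZ -/T in v01 v1 *.
set v := quad_form t in v01 v1 *; set w := _ ^+ 2 * v => w1.
have n1 := norm_charfun_le1 t; set f := phi t in v1 n1 *.
have n2 := norm_charfun_le1 (fun j => m%:R^-1 * t j).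
set g := phi _ in w1 n2 *.
(* For large [t] both terms have absolute value at most [1], and the term [2 * A ^ 2 * T ^ 2]
   already exceeds [2]. *)
have [AT|AT] := leP (A * T) 1; last first.
  have gn : `|g ^+ (m ^ 2)| <= 1 by rewrite normrX exprn_ile1.
  apply: (@le_trans _ _ 2).
    apply: (le_trans (ler_normB _ _)); lra.
  have : 1 <= (A * T) ^+ 2 by rewrite exprn_ege1// ltW.
  rewrite exprMn; have : 0 <= A * T ^+ 2 by rewrite mulr_ge0 ?sqr_ge0//; lra.
  rewrite mulrDl; lra.
have m0R : 0 < m%:R :> R by rewrite ltr0n.
have m1R : 1 <= m%:R :> R by rewrite ler1n.
have mi : 0 <= (m%:R^-1 : R) ^+ 2 <= 1.
  have i0 : 0 <= m%:R^-1 :> R by rewrite invr_ge0 ltW.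
  have i1 : m%:R^-1 <= 1 :> R by rewrite invf_le1.
  by rewrite sqr_ge0 exprn_ile1.
have M0 : (0 < m ^ 2)%N by rewrite expn_gt0 m0.
have mE : (m ^ 2)%:R * w = v by rewrite /w natrX; field; rewrite gt_eqF.
have w01 : 0 <= w <= 1 by rewrite /w; nra.
have h1 : `|g ^+ (m ^ 2) - (1 - w) ^+ (m ^ 2)| <= A * T ^+ 2.
  rewrite -(prednK M0).
  have w1' : `|1 - w| <= 1 by rewrite ler_norml; lra.
  apply: (le_trans (norm_exprB_le _ n2 w1')).
  rewrite expr1n mulr1 (prednK M0).
  apply: (@le_trans _ _ ((m ^ 2)%:R * (A * (m%:R^-1 ^+ 2 * T) ^+ 2))).
    by rewrite ler_wpM2l.
  have -> : (m ^ 2)%:R * (A * (m%:R^-1 ^+ 2 * T) ^+ 2) = m%:R^-1 ^+ 2 * (A * T ^+ 2) :> R.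
    by rewrite natrX; field; rewrite gt_eqF.
  by rewrite ler_piMl ?mulr_ge0 ?sqr_ge0//; lra.
have h2 : `|(1 - w) ^+ (m ^ 2) - (1 - v)| <= A ^+ 2 * T ^+ 2.
  have l1 := bernoulli_ge (m ^ 2) w01; have l2 := bernoulli_le (m ^ 2) w01.
  rewrite mE in l1 l2; rewrite ger0_norm; last by lra.
  have : v ^+ 2 <= (A * T) ^+ 2.
    have /andP[v0 vAT] := v01; have AT0 := le_trans v0 vAT.
    by rewrite lerXn2r ?nnegrE.
  rewrite [(A * T) ^+ 2]exprMn; lra.
have -> : f - g ^+ (m ^ 2) = (f - (1 - v)) - (g ^+ (m ^ 2) - (1 - w) ^+ (m ^ 2))
   - ((1 - w) ^+ (m ^ 2) - (1 - v)) by ring.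
apply: (le_trans (ler_normB _ _)); apply: (@le_trans _ _ (A * T ^+ 2 + A * T ^+ 2 + A ^+ 2 * T ^+ 2)).
  apply: lerD => //; apply: (le_trans (ler_normB _ _)); exact: lerD.
have : 0 <= A ^+ 2 * T ^+ 2 by rewrite mulr_ge0 ?sqr_ge0.
rewrite mulrDl; lra.
Qed.

Lemma grid_average (L N o n : nat) : (0 < N)%N ->
  (forall s j, s \in S -> `|s 0%R j| <= L)%N -> (n * L < N)%N ->
  p n 0 = (N%:R^-1) ^+ d *
    \sum_(k : {ffun 'I_d -> 'I_N}) phi (grid_angle (pi *+ 2 / N%:R) o k) ^+ n.
Proof.
move=> N0 SL nL; have NR : N%:R != 0 :> R by rewrite pnatr_eq0 -lt0n.
rewrite exprVn; apply: (mulfI (expf_neq0 d NR)); rewrite mulrA divff ?mul1r ?expf_neq0//.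
rewrite (@fourier_inversion L N o)//; last by move=> j; rewrite mxE absz0 add0n.
by apply: eq_bigr => k _; rewrite dot0 cos0 mulr1.
Qed.

(** Grids of equal mesh are nested: shifting the indices by [o - o'] matches the angle [0] of
    both. *)
Lemma sub_box_sum (B B' o o' : nat) (h : R) (F : ('I_d -> R) -> R) : (0 < B')%N ->
  (o' <= o)%N -> (o - o' + B' <= B)%N ->
  \sum_(k : {ffun 'I_d -> 'I_B'}) F (grid_angle h o' k) =
  \sum_(k : {ffun 'I_d -> 'I_B} | [forall j, (o - o' <= k j < o - o' + B')%N])
    F (grid_angle h o k).
Proof.
move=> B'0 oo oB; set e := (o - o')%N in oB *.
have lt_e (i : 'I_B') : (e + i < B)%N by apply: leq_trans oB; rewrite ltn_add2l.
pose emb (k : {ffun 'I_d -> 'I_B'}) : {ffun 'I_d -> 'I_B} := [ffun j => Ordinal (lt_e (k j))].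
pose ret (k : {ffun 'I_d -> 'I_B}) : {ffun 'I_d -> 'I_B'} :=
  [ffun j => insubd (Ordinal B'0) (k j - e)%N].
rewrite [RHS](reindex_onto emb ret)/=; last first.
  move=> k /forallP kb; apply/ffunP => j; apply: val_inj; rewrite !ffunE /=.
  have /andP[k1 k2] := kb j.
  by rewrite val_insubd ltn_subLR// k2 subnKC.
apply: eq_big => [k|k _].
  apply/esym/andP; split.
    by apply/forallP => j; rewrite ffunE /= leq_addr ltn_add2l ltn_ord.
  apply/eqP/ffunP => j; apply: val_inj; rewrite /ret /emb !ffunE val_insubd /=.
  by rewrite addKn ltn_ord.
congr F; apply/funext => j; rewrite /grid_angle ffunE /=; congr (_ * _).
by rewrite natrD /e natrB//; ring.
Qed.

Lemma grid_angle_le_pi (N : nat) (k : {ffun 'I_d -> 'I_N}) j :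
  `|grid_angle (pi *+ 2 / N%:R : R) N./2 k j| <= pi.
Proof.
rewrite /grid_angle; have N0 : (0 < N)%N by apply: leq_ltn_trans (ltn_ord (k j)).
have NR : 0 < N%:R :> R by rewrite ltr0n.
have := pi_gt0 R => pi0.
rewrite normrM ger0_norm; last by rewrite divr_ge0 ?ltW//; lra.
rewrite mulrAC ler_pdivrMr//.
have : 2 * `|(k j)%:R - (N./2)%:R| <= N%:R :> R.
  by apply: half_window_dist => //; rewrite subnn leq0n /= add0n.
by rewrite -(ler_pM2l pi0); lra.
Qed.

(** The Gaussian rate [q] is divided by [4] so that the spare decay absorbs powers of
    [y = k n |t|^2]; each power absorbed trades a factor [|t|^2] for [1 / n]. The bounds serve, in
    order, for size, for a unit time step, for the scaling by [m] inside the smaller box, and for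
    the angles outside it. *)
Lemma charfun_power_bounds : exists k C : R, [/\ 0 < k, 0 <= C &
  [/\ forall n t, (forall j, `|t j| <= pi) ->
       `|phi t ^+ n| <= expR (- (k * n%:R * sqr_norm t)),
     forall n t, (0 < n)%N -> (forall j, `|t j| <= pi) ->
       `|phi t ^+ n - phi t ^+ n.+1| <= C / n%:R * expR (- (k * n%:R * sqr_norm t)),
     forall n m t, (1 < n)%N -> (0 < m)%N -> (forall j, `|t j| <= pi) ->
       `|phi (fun j => m%:R^-1 * t j) ^+ (m ^ 2 * n) - phi t ^+ n| <=
         C / n%:R * expR (- (k * n%:R * sqr_norm t)) &
     forall n m t, (0 < n)%N -> (0 < m)%N -> (forall j, `|m%:R^-1 * t j| <= pi) ->
       1 <= sqr_norm t ->
       `|phi (fun j => m%:R^-1 * t j) ^+ (m ^ 2 * n)| <=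
         C / n%:R * expR (- (k * n%:R * sqr_norm t)) ]].
Proof.
have [q q0 qP] := norm_charfun_gauss; have [A A1 AP] := charfun_taylor.
have [K K0 KP] := charfun_scaling.
pose C := 4 / q + 4 * A / q + 32 * K / q ^+ 2.
have C1 : 0 <= 4 / q by rewrite divr_ge0// ltW.
have C2 : 0 <= 4 * A / q by rewrite divr_ge0 ?mulr_ge0 ?ltW//; lra.
have C3 : 0 <= 32 * K / q ^+ 2 by apply: divr_ge0; [exact: mulr_ge0 | exact: sqr_ge0].
have C0 : 0 <= C by rewrite !addr_ge0.
have qe t m : expR (- (q * sqr_norm t)) ^+ m = expR (- (4 * (q / 4 * m%:R * sqr_norm t))).
  by rewrite -expRM_natr; congr expR; field.
have mscale m t : (0 < m)%N -> (forall j, `|m%:R^-1 * t j| <= pi) ->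
    `|phi (fun j => m%:R^-1 * t j) ^+ (m ^ 2)| <= expR (- (q * sqr_norm t)).
  move=> m0 tm; rewrite normrX.
  apply: (@le_trans _ _ (expR (- (q * sqr_norm (fun j => m%:R^-1 * t j))) ^+ (m ^ 2))).
    by rewrite lerXn2r ?nnegrE ?expR_ge0// qP.
  rewrite -expRM_natr sqr_normZ le_eqVlt; apply/orP; left; apply/eqP; congr expR.
  by rewrite natrX; field; rewrite pnatr_eq0 -lt0n.
have y_ge0 n t : 0 <= q / 4 * n%:R * sqr_norm t.
  by rewrite !mulr_ge0 ?sqr_norm_ge0// ltW.
exists (q / 4), C; split=> //; first by rewrite divr_gt0.
have small n t : (forall j, `|t j| <= pi) ->
    `|phi t ^+ n| <= expR (- (4 * (q / 4 * n%:R * sqr_norm t))).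
  by move=> tpi; rewrite normrX -qe lerXn2r ?nnegrE ?expR_ge0// qP.
split.
- move=> n t tpi; apply: (le_trans (small n t tpi)); rewrite ler_expR.
  have := y_ge0 n t; lra.
- move=> n t n0 tpi; have nR : 0 < n%:R :> R by rewrite ltr0n.
  have -> : phi t ^+ n - phi t ^+ n.+1 = phi t ^+ n * (1 - phi t) by rewrite exprSr; ring.
  have [_ /andP[a1 a2] _] := AP t.
  rewrite normrM (ger0_norm a1).
  apply: (@le_trans _ _ (expR (- (4 * (q / 4 * n%:R * sqr_norm t))) * (A * sqr_norm t))).
    by rewrite ler_pM// small.
  set y := q / 4 * n%:R * sqr_norm t; have y0 : 0 <= y := y_ge0 n t.
  have -> : A * sqr_norm t = 4 * A / q / n%:R * y by rewrite /y; field; rewrite !gt_eqF.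
  have e1 := expR_lin_le y0.
  have e2 : expR (- (4 * y)) <= expR (- y) * expR (- y).
    by rewrite -expRD ler_expR; lra.
  apply: (@le_trans _ _ (4 * A / q / n%:R * (y * expR (- y)) * expR (- y))).
    have c0 : 0 <= 4 * A / q / n%:R by rewrite divr_ge0// ltW.
    move: (4 * A / q / n%:R) (expR (- y)) (expR _) c0 e2 => c E E4 c0 e2.
    suff : 0 <= c * y * (E * E - E4) by lra.
    by apply: mulr_ge0; [exact: mulr_ge0 | rewrite subr_ge0].
  apply: (@le_trans _ _ (4 * A / q / n%:R * 1 * expR (- y))).
    by rewrite ler_wpM2r ?expR_ge0// ler_wpM2l// divr_ge0// ltW.
  rewrite mulr1 ler_wpM2r ?expR_ge0// ler_wpM2r ?invr_ge0 ?(ltW nR)//.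
  by rewrite /C; lra.
- move=> [|n] m t // n1 m0 tpi; have nR : 0 < n.+1%:R :> R by rewrite ltr0n.
  rewrite exprM; set x := phi _ ^+ (m ^ 2); set z := phi t.
  have xr : `|x| <= expR (- (q * sqr_norm t)).
    apply: mscale => // j; apply: le_trans (tpi j).
    rewrite normrM ger0_norm ?invr_ge0// ler_piMl//.
    by rewrite invf_le1 ?ltr0n// ler1n.
  have zr : `|z| <= expR (- (q * sqr_norm t)) by exact: qP.
  apply: (le_trans (norm_exprB_le n xr zr)).
  rewrite distrC; have xz := KP t m m0; rewrite -/x -/z in xz.
  set y := q / 4 * n.+1%:R * sqr_norm t; have y0 : 0 <= y := y_ge0 n.+1 t.
  have T2 : sqr_norm t ^+ 2 = 16 / q ^+ 2 / n.+1%:R ^+ 2 * y ^+ 2.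
    by rewrite /y; field; rewrite ?gt_eqF.
  have e0 : expR (- (q * sqr_norm t)) ^+ n <= expR (- y) * expR (- y).
    rewrite qe -expRD ler_expR /y -[n.+1%:R]natr1.
    have n1R : 1 <= n%:R :> R by rewrite ler1n -ltnS.
    have := sqr_norm_ge0 t => T0.
    suff : 0 <= q * sqr_norm t * (n%:R - 1) by lra.
    by apply: mulr_ge0; [apply: mulr_ge0 => //; exact: ltW | rewrite subr_ge0].
  apply: (@le_trans _ _ (n.+1%:R * (K * (16 / q ^+ 2 / n.+1%:R ^+ 2 * y ^+ 2)) * (expR (- y) * expR (- y)))).
    rewrite ler_pM ?mulr_ge0 ?exprn_ge0 ?expR_ge0// ler_wpM2l//.
    by rewrite -T2.
  have -> : n.+1%:R * (K * (16 / q ^+ 2 / n.+1%:R ^+ 2 * y ^+ 2)) * (expR (- y) * expR (- y)) =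
     (16 * K / q ^+ 2 / n.+1%:R) * (y ^+ 2 * expR (- y)) * expR (- y).
    by move: (expR _) => E; field; rewrite ?gt_eqF.
  rewrite ler_wpM2r ?expR_ge0//.
  apply: (@le_trans _ _ (16 * K / q ^+ 2 / n.+1%:R * 2)).
    apply: ler_wpM2l; last exact: expR_sqr_le.
    apply: divr_ge0 => //; apply: divr_ge0; first exact: mulr_ge0.
    exact: sqr_ge0.
  rewrite mulrAC ler_wpM2r ?invr_ge0 ?(ltW nR)//; rewrite /C; lra.
move=> n m t n0 m0 tpi T1; have nR : 0 < n%:R :> R by rewrite ltr0n.
rewrite exprM normrX.
apply: (@le_trans _ _ (expR (- (q * sqr_norm t)) ^+ n)).
  by rewrite lerXn2r ?nnegrE ?expR_ge0// mscale.
rewrite qe; set y := q / 4 * n%:R * sqr_norm t; have y0 : 0 <= y := y_ge0 n t.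
have yq : q / 4 * n%:R <= y by rewrite ler_peMr// mulr_ge0// divr_ge0// ltW.
have q4 : 0 < q / 4 * n%:R by rewrite !mulr_gt0// invr_gt0.
have e2 : expR (- (4 * y)) <= expR (- y) * expR (- y).
  by rewrite -expRD ler_expR; lra.
apply: (le_trans e2); rewrite ler_wpM2r ?expR_ge0//.
apply: (@le_trans _ _ (y^-1)).
  rewrite -[leRHS]mul1r ler_pdivlMr; last exact: lt_le_trans yq.
  by rewrite mulrC expR_lin_le.
apply: (@le_trans _ _ ((q / 4 * n%:R)^-1)).
  by rewrite lef_pV2 ?posrE// (lt_le_trans q4).
have -> : (q / 4 * n%:R)^-1 = 4 / q / n%:R by field; rewrite !gt_eqF.
rewrite ler_wpM2r ?invr_ge0 ?(ltW nR)//; rewrite /C; lra.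
Qed.

(** A Riemann sum of a Gaussian. The condition on [N] makes the mesh finer than the width: with
    [b^2 = k n] one has [b <= b^2 + 1 <= N]. *)
Lemma grid_gauss (k : R) : 0 < k -> exists2 C : R, 0 <= C & forall n N B o,
  (0 < n)%N -> (0 < N)%N -> k * n%:R + 1 <= N%:R ->
  (N%:R^-1) ^+ d * (\sum_(i : {ffun 'I_d -> 'I_B})
     expR (- (k * n%:R * sqr_norm (grid_angle (pi *+ 2 / N%:R) o i)))) <=
  C / (Num.sqrt n%:R) ^+ d.
Proof.
move=> k0; have sk : 0 < Num.sqrt k by rewrite sqrtr_gt0.
exists ((4 * expR 1 / Num.sqrt k) ^+ d).
  by rewrite exprn_ge0// divr_ge0 ?mulr_ge0 ?expR_ge0// ltW.
move=> n N B o n0 N0 kN; have nR : 0 < n%:R :> R by rewrite ltr0n.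
have NR : 0 < N%:R :> R by rewrite ltr0n.
have sn : 0 < Num.sqrt n%:R :> R by rewrite sqrtr_gt0.
pose b := Num.sqrt k * Num.sqrt n%:R.
have b0 : 0 < b by rewrite mulr_gt0.
have bE : b ^+ 2 = k * n%:R by rewrite exprMn !sqr_sqrtr// ltW.
have bN : b <= N%:R by apply: le_trans kN; rewrite -bE; have := sqr_ge0 (b - 1); nra.
rewrite -bE; have h0 : 0 < pi *+ 2 / N%:R :> R by rewrite divr_gt0//; have := pi_gt0 R; lra.
apply: (@le_trans _ _ (N%:R^-1 ^+ d * (2 * expR 1 * (1 + (b * (pi *+ 2 / N%:R))^-1)) ^+ d)).
  apply: ler_wpM2l; first by rewrite exprn_ge0 ?invr_ge0 ?ltW.
  exact: (@gauss_sum R d B o _ b h0 b0).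
rewrite -exprMn -exprVn -exprMn.
have pi0 := pi_gt0 R; have pi2 := pi_ge2 R.
have e1 : (b * (pi *+ 2 / N%:R))^-1 = N%:R * (b^-1 * (pi *+ 2)^-1).
  by field; rewrite ?gt_eqF//; lra.
have E0 : 0 <= expR 1 :> R := expR_ge0 1.
rewrite lerXn2r ?nnegrE.
- by [].
- apply: mulr_ge0; first by rewrite invr_ge0 ltW.
  apply: mulr_ge0; first exact: mulr_ge0.
  by apply: addr_ge0 => //; rewrite invr_ge0; apply: mulr_ge0; exact: ltW.
- by apply: divr_ge0; [apply: divr_ge0; [exact: mulr_ge0 | exact: ltW] | exact: ltW].
rewrite e1; have -> : N%:R^-1 * (2 * expR 1 * (1 + N%:R * (b^-1 * (pi *+ 2)^-1))) =
  2 * expR 1 * (N%:R^-1 + b^-1 * (pi *+ 2)^-1).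
  by move: (expR 1) => E; field; rewrite ?gt_eqF//; lra.
have -> : 4 * expR 1 / Num.sqrt k / Num.sqrt n%:R = 2 * expR 1 * (b^-1 + b^-1).
  by rewrite /b; move: (expR 1) => E; field; rewrite !gt_eqF.
rewrite ler_wpM2l ?mulr_ge0// lerD//; first by rewrite lef_pV2 ?posrE.
rewrite ler_piMr ?invr_ge0 ?(ltW b0)// invf_le1; lra.
Qed.

Let E n : R := Num.sqrt n%:R ^+ d * p n 0.

Lemma support_bound : exists L, forall s j, s \in S -> (absz (s 0%R j) <= L)%N.
Proof.
exists (\sum_(s <- S) \sum_(j < d) absz (s 0%R j))%N => s j sS.
rewrite (big_rem s)//= (bigD1 j)//= -addnA; exact: leq_addr.
Qed.

(** At even times every term of the Fourier sum is nonnegative, so it is enough to keep the angles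
    of size at most a multiple of [1 / sqrt n], on which the power of [phi] is at least [1 / 2]. *)
Lemma lattice_return_lower : exists2 c : R, 0 < c & forall n, (0 < n)%N -> c <= E n.*2.
Proof.
have [A A1 AP] := charfun_taylor; have [L SL] := support_bound.
pose al : R := A * (d%:R + 1).
have al0 : 0 < al by apply: mulr_gt0; [lra | rewrite ltr_pwDr].
exists (2^-1 * ((8 * al)^-1) ^+ d).
  by rewrite mulr_gt0// exprn_gt0// invr_gt0 mulr_gt0.
move=> n n0; set n' := n.*2; have n'0 : (0 < n')%N by rewrite double_gt0.
pose N := (n' * L).+1; have N0 : (0 < N)%N by []; have nN : (n' * L < N)%N by [].
have nR : 0 < n'%:R :> R by rewrite ltr0n.
have NR : 0 < N%:R :> R by rewrite ltr0n.
have sn : 0 < Num.sqrt n'%:R ^+ d :> R by rewrite exprn_gt0// sqrtr_gt0.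
have Ni : 0 <= (N%:R^-1) ^+ d :> R by rewrite exprn_ge0// invr_ge0.
(* Coordinates at most [1 / a] give [1 - phi <= 1 / (2 n')], and Bernoulli's inequality then gives
   [phi ^ n' >= 1 / 2]. *)
pose a := al * Num.sqrt n'%:R.
have a0 : 0 < a by rewrite mulr_gt0// sqrtr_gt0.
rewrite /E (@grid_average L N 0)//.
set h : R := pi *+ 2 / N%:R.
have h0 : 0 < h by rewrite divr_gt0//; have := pi_gt0 R; lra.
pose f (i : nat) : R := (h * i%:R <= a^-1)%R%:R.
have term (i : {ffun 'I_d -> 'I_N}) : 2^-1 * \prod_(j < d) f (i j) <= phi (grid_angle h 0 i) ^+ n'.
  have [fi|] := boolP [forall j, h * (i j)%:R <= a^-1]; last first.
    rewrite negb_forall => /existsP[j fj]; rewrite (bigD1 j)//= /f (negPf fj) mul0r mulr0.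
    by rewrite exprn_even_ge0// odd_double.
  rewrite big1 ?mulr1; last by move=> j _; rewrite /f (forallP fi j).
  have [_ /andP[_ p1] _] := AP (grid_angle h 0 i).
  have T1 : sqr_norm (grid_angle h 0 i) <= d%:R * (a^-1) ^+ 2.
    rewrite -[d in leRHS]card_ord mulr_natl -sumr_const; apply: ler_sum => j _.
    have hj : 0 <= h * (i j)%:R by apply: mulr_ge0 => //; exact: ltW.
    have ai : 0 <= a^-1 by rewrite invr_ge0 ltW.
    rewrite /grid_angle subr0 lerXn2r ?nnegrE//.
    exact: (forallP fi j).
  have aE : (a^-1) ^+ 2 = (al ^+ 2)^-1 / n'%:R.
    by rewrite exprVn /a exprMn sqr_sqrtr ?ler0n// invfM.
  have T2 : A * sqr_norm (grid_angle h 0 i) <= (2 * n'%:R)^-1.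
    apply: (@le_trans _ _ (A * (d%:R * (a^-1) ^+ 2))).
      by rewrite ler_wpM2l//; lra.
    have e1 : A * (d%:R * a^-1 ^+ 2) = A * d%:R / al ^+ 2 / n'%:R by rewrite aE; ring.
    rewrite e1 [(2 * _)^-1]invfM; apply: ler_wpM2r; first by rewrite invr_ge0.
    rewrite ler_pdivrMr ?exprn_gt0// /al.
    have d0 : 0 <= d%:R :> R by [].
    have h1 : 0 <= A * (d%:R + 1) ^+ 2 - 2 * d%:R by nra.
    have A0 : 0 <= A by lra.
    have := mulr_ge0 A0 h1; lra.
  have n'1 : 0 <= (2 * n'%:R : R)^-1 <= 1.
    rewrite invr_ge0 mulr_ge0//= invf_le1 ?mulr_gt0//.
    have : 1 <= n'%:R :> R by rewrite ler1n.
    lra.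
  have := bernoulli_ge n' n'1.
  have -> : 1 - n'%:R * (2 * n'%:R)^-1 = 2^-1 :> R by field; rewrite gt_eqF.
  move=> /le_trans; apply; case/andP: n'1 => n'2 n'3.
  rewrite lerXn2r ?nnegrE//; lra.
apply: (@le_trans _ _ (Num.sqrt n'%:R ^+ d * ((N%:R^-1) ^+ d *
   \sum_(i : {ffun 'I_d -> 'I_N}) 2^-1 * \prod_(j < d) f (i j)))); last first.
  apply: ler_wpM2l; first exact: ltW.
  by apply: ler_wpM2l => //; apply: ler_sum => i _; exact: term.
rewrite -mulr_sumr (sum_grid_prod d N f).
(* At least [N / (8 a)] indices [i] satisfy [2 pi i / N <= 1 / a], since [pi / 4 <= 1]. *)
have cnt : N%:R / (8 * a) <= \sum_(i < N) f i.
  set x := N%:R / (8 * a); set M := Num.truncn x.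
  have x0 : 0 <= x by apply: divr_ge0 => //; apply: mulr_ge0 => //; exact: ltW.
  have /andP[M1 M2] := truncn_itv x0; rewrite -/M in M1 M2.
  have a1 : 1 <= a.
    rewrite mulr_ege1//; first by rewrite /al; have : 0 <= d%:R :> R by []; nra.
    have n1R : 1 <= n'%:R :> R by rewrite ler1n.
    by have := ler_wsqrtr n1R; rewrite sqrtr1.
  have MN : (M.+1 <= N)%N.
    rewrite -(ltr_nat R); apply: (le_lt_trans M1).
    have a8 : 0 < 8 * a by apply: mulr_gt0.
    have a81 : 0 < 8 * a - 1 by lra.
    by rewrite /x ltr_pdivrMr//; have := mulr_gt0 NR a81; lra.
  apply: (le_trans (ltW M2)); rewrite -(subnKC MN) big_split_ord /=.
  apply: (@le_trans _ _ (\sum_(i < M.+1) (1 : R))); first by rewrite sumr_const card_ord.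
  rewrite -[leLHS]addr0 lerD//; last by apply: sumr_ge0 => i _; exact: ler0n.
  apply: ler_sum => i _; rewrite /f.
  suff -> : h * i%:R <= a^-1 by [].
  have iM : i%:R <= x by apply: le_trans M1; rewrite ler_nat -ltnS.
  apply: (@le_trans _ _ (h * x)); first by rewrite ler_wpM2l// ltW.
  have -> : h * x = pi / 4 * a^-1 by rewrite /h /x; field; rewrite !gt_eqF.
  rewrite ler_piMl ?invr_ge0 ?(ltW a0)//; have := pi_le4 R; lra.
apply: (@le_trans _ _ (Num.sqrt n'%:R ^+ d * ((N%:R^-1) ^+ d * (2^-1 * (N%:R / (8 * a)) ^+ d)))).
  rewrite le_eqVlt; apply/orP; left; apply/eqP.
  rewrite [RHS](_ : _ = 2^-1 * (Num.sqrt n'%:R * (N%:R^-1 * (N%:R / (8 * a)))) ^+ d).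
    congr (_ * _ ^+ d); rewrite /a; field.
    by rewrite !gt_eqF// sqrtr_gt0.
  by rewrite !exprMn; ring.
apply: ler_wpM2l; first exact: ltW.
apply: ler_wpM2l => //; apply: ler_wpM2l => //.
rewrite lerXn2r ?nnegrE//.
- by apply: divr_ge0 => //; apply: mulr_ge0 => //; exact: ltW.
- by apply: sumr_ge0 => i _; exact: ler0n.
Qed.

(** What remains of Fourier analysis for the limit theorem: boundedness, slow variation under a unit
    step and under multiplication of time by a square, a lower bound at even times, and monotonicity
    along even times, where [phi ^ 2 <= 1]. *)
Lemma lattice_return_estimates : exists C c : R, [/\ 0 <= C, 0 < c &
  [/\ forall n, (0 < n)%N -> E n <= C,
      forall n, (0 < n)%N -> Num.sqrt n%:R ^+ d * `|p n 0 - p n.+1 0| <= C / n%:R,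
      forall n m, (1 < n)%N -> (0 < m)%N -> `|E (m ^ 2 * n) - E n| <= C / n%:R,
      forall n, (0 < n)%N -> c <= E n.*2 &
      forall n, p n.+1.*2 0 <= p n.*2 0]].
Proof.
have [k [C1 [k0 C10 [B1 B2 B3 B4]]]] := charfun_power_bounds.
have [CG CG0 G] := grid_gauss k0.
have [c c0 cP] := lattice_return_lower; have [L SL] := support_bound.
have grid n : exists N, [/\ (0 < N)%N, (n * L < N)%N & k * n%:R + 1 <= N%:R].
  exists (n * L + (Num.bound (k * n%:R + 1)).+1)%N; split.
  - by rewrite addnS.
  - by rewrite addnS ltnS leq_addr.
  have h : 0 <= k * n%:R + 1 by rewrite addr_ge0// mulr_ge0// ltW.
  rewrite (le_trans (ltW (archi_boundP h)))// ler_nat; lia.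
have sn n : (0 < n)%N -> 0 < Num.sqrt n%:R ^+ d :> R.
  by move=> n0; rewrite exprn_gt0// sqrtr_gt0 ltr0n.
have Ni N : 0 <= (N%:R^-1) ^+ d :> R by rewrite exprn_ge0// invr_ge0.
pose C := CG + CG * C1.
have C2 : 0 <= CG * C1 by rewrite mulr_ge0.
have C0 : 0 <= C by rewrite addr_ge0.
exists C, c; split => //.
split.
- move=> n n0; have [N [N0 nN kN]] := grid n.
  rewrite /E (@grid_average L N (N./2))// mulrC -ler_pdivlMr ?sn//.
  apply: (@le_trans _ _ (CG / Num.sqrt n%:R ^+ d)); last first.
    by rewrite ler_wpM2r ?invr_ge0 ?(ltW (sn _ n0))// /C; lra.
  apply: le_trans (G n N N (N./2) n0 N0 kN); apply: ler_wpM2l => //.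
  apply: ler_sum => i _; apply: le_trans (ler_norm _) _; apply: B1 => j.
  exact: grid_angle_le_pi.
- move=> n n0; have [N [N0 nN kN]] := grid n.+1.
  have nN' : (n * L < N)%N by apply: leq_ltn_trans nN; rewrite leq_mul2r leqnSn orbT.
  have kN' : k * n%:R + 1 <= N%:R.
    by apply: le_trans kN; rewrite -natr1 mulrDr mulr1; lra.
  rewrite !(@grid_average L N (N./2))// -mulrBr -sumrB normrM (ger0_norm (Ni _)).
  rewrite mulrC -ler_pdivlMr ?sn//.
  apply: (@le_trans _ _ (C1 / n%:R * (CG / Num.sqrt n%:R ^+ d))).
    apply: le_trans (ler_wpM2l _ (G n N N (N./2) n0 N0 kN')); last by rewrite divr_ge0.
    rewrite mulrCA; apply: ler_wpM2l => //; rewrite mulr_sumr.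
    apply: (le_trans (ler_norm_sum _ _ _)); apply: ler_sum => i _; apply: B2 => // j.
    exact: grid_angle_le_pi.
  have -> : C1 / n%:R * (CG / Num.sqrt n%:R ^+ d) = (CG * C1) / n%:R / Num.sqrt n%:R ^+ d by ring.
  rewrite ler_wpM2r ?invr_ge0 ?(ltW (sn _ n0))// ler_wpM2r ?invr_ge0//.
  by rewrite /C; lra.
- move=> n m n1 m0; have n0 : (0 < n)%N by apply: ltnW.
  have [N [N0 nN kN]] := grid n.
  (* As [B = m B'], the grid of [B] points consists of the angles [t / m] with [t] on a grid with
     the mesh of [B']. The walk at time [m ^ 2 n] therefore lives on the larger box and the walk at
     time [n] on the sub-box, with the same normalization. *)
  set B := (m ^ 2 * N)%N; set B' := (m * N)%N.
  have B0 : (0 < B)%N by rewrite muln_gt0 expn_gt0 m0.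
  have B'0 : (0 < B')%N by rewrite muln_gt0 m0.
  have mNB : (N <= B')%N by rewrite leq_pmull.
  have nB : (m ^ 2 * n * L < B)%N by rewrite -mulnA ltn_pmul2l// expn_gt0 m0.
  have nB' : (n * L < B')%N by apply: leq_trans mNB.
  have kB' : k * n%:R + 1 <= B'%:R by rewrite (le_trans kN)// ler_nat.
  have BB' : B = (m * B')%N by rewrite /B /B' mulnA.
  set o := B./2; set o' := B'./2.
  have leBB : (B' <= B)%N by rewrite BB' leq_pmull.
  have oo : (o' <= o)%N by rewrite half_leq.
  have oB : (o - o' + B' <= B)%N by exact: half_window_le.
  have mR : m%:R != 0 :> R by rewrite pnatr_eq0 -lt0n.
  have B'R : B'%:R != 0 :> R by rewrite pnatr_eq0 -lt0n.
  have BR : B%:R = m%:R * B'%:R :> R by rewrite BB' natrM.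
  set h : R := pi *+ 2 / B'%:R.
  pose t (i : {ffun 'I_d -> 'I_B}) := grid_angle h o i.
  have tE i : grid_angle (pi *+ 2 / B%:R) o i = (fun j => m%:R^-1 * t i j).
    apply/funext => j; rewrite /t /grid_angle /h BR; field.
    by rewrite mR B'R.
  have -> : E (m ^ 2 * n) = Num.sqrt n%:R ^+ d * ((B'%:R^-1) ^+ d *
      \sum_(i : {ffun 'I_d -> 'I_B}) phi (fun j => m%:R^-1 * t i j) ^+ (m ^ 2 * n)).
    rewrite /E (@grid_average L B o)//.
    under eq_bigr do rewrite tE.
    rewrite natrM sqrtrM ?natrX ?sqr_ge0// sqrtr_sqr ger0_norm// exprMn.
    rewrite BR invfM exprMn !mulrA; congr (_ * _ * _).
    by rewrite [m%:R^-1 ^+ d]exprVn mulrAC divff ?expf_neq0// mul1r.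
  pose box (i : {ffun 'I_d -> 'I_B}) := [forall j, (o - o' <= i j < o - o' + B')%N].
  have -> : E n = Num.sqrt n%:R ^+ d * ((B'%:R^-1) ^+ d *
      \sum_(i : {ffun 'I_d -> 'I_B} | box i) phi (t i) ^+ n).
    rewrite /E (@grid_average L B' o')//.
    by rewrite (@sub_box_sum B B' o o' h (fun t => phi t ^+ n)).
  rewrite -!mulrBr !normrM (ger0_norm (Ni _)) (ger0_norm (ltW (sn _ n0))).
  rewrite mulrC -ler_pdivlMr ?sn//.
  apply: (@le_trans _ _ (C1 / n%:R * (CG / Num.sqrt n%:R ^+ d))); last first.
    have -> : C1 / n%:R * (CG / Num.sqrt n%:R ^+ d) = (CG * C1) / n%:R / Num.sqrt n%:R ^+ d by ring.
    rewrite ler_wpM2r ?invr_ge0 ?(ltW (sn _ n0))// ler_wpM2r ?invr_ge0//.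
    by rewrite /C; lra.
  apply: le_trans (ler_wpM2l _ (G n B' B o n0 B'0 kB')); last by rewrite divr_ge0.
  rewrite mulrCA; apply: ler_wpM2l => //; rewrite mulr_sumr.
  rewrite (bigID box)/= addrAC -sumrB [leRHS](bigID box)/=.
  apply: (le_trans (ler_normD _ _)); apply: lerD; apply: (le_trans (ler_norm_sum _ _ _)).
    apply: ler_sum => i /forallP bi; apply: B3 => // j; have := bi j.
    have pi0 := pi_gt0 R; have B'p : 0 < B'%:R :> R by rewrite ltr0n.
    move=> /andP[i1 i2]; rewrite /t /grid_angle /h normrM ger0_norm; last first.
      by rewrite divr_ge0//; lra.
    rewrite mulrAC ler_pdivrMr//.
    have : 2 * `|(i j)%:R - o%:R| <= B'%:R :> R.
      by apply: half_window_dist; rewrite ?i1.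
    by rewrite -(ler_pM2l pi0); lra.
  apply: ler_sum => i bi; apply: B4 => //.
    by move=> j; rewrite -[_ * _](congr1 (fun f => f j) (tE i)); exact: grid_angle_le_pi.
  (* Outside the sub-box some coordinate of [t] has absolute value at least [pi], so [|t|^2 >= 1]
     and the fourth bound applies. *)
  have [j bj] : exists j, ~~ (o - o' <= i j < o - o' + B')%N.
    by apply/existsP; move: bi; rewrite negb_forall.
  rewrite /sqr_norm (bigD1 j)//= -[leLHS]addr0 lerD//; last first.
    by apply: sumr_ge0 => ? _; exact: sqr_ge0.
  rewrite -real_normK ?num_real// exprn_ege1//.
  rewrite /t /grid_angle /h normrM ger0_norm; last first.
    by rewrite divr_ge0//; have := pi_gt0 R; lra.
  have B'p : 0 < B'%:R :> R by rewrite ltr0n.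
  rewrite mulrAC ler_pdivlMr// mul1r.
  have : B'%:R <= 2 * `|(i j)%:R - o%:R| :> R by exact: half_window_far.
  move=> /le_trans; apply; apply: ler_wpM2r => //.
  by have := pi_ge2 R; lra.
- exact: cP.
move=> n; have [N [N0 nN kN]] := grid n.+1.*2.
have nN' : (n.*2 * L < N)%N.
  by apply: leq_ltn_trans nN; rewrite leq_mul2r doubleS -addn2 leq_addr orbT.
rewrite !(@grid_average L N 0)//; apply: ler_wpM2l => //; apply: ler_sum => i _.
have -> : n.+1.*2 = (n.*2 + 2)%N by rewrite doubleS addn2.
rewrite exprD ler_piMr ?exprn_even_ge0 ?odd_double//.
by rewrite -real_normK ?num_real// exprn_ile1// norm_charfun_le1.
Qed.

Lemma lattice_return_ge0 n : 0 <= p n 0.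
Proof.
elim: n (0 : 'rV[int]_d) => [|n IH] x; first by rewrite p_0.
by rewrite p_S; apply: sumr_ge0 => s _; rewrite mulr_ge0.
Qed.

(** The sequence is shown to be Cauchy: a late time is trapped between [m ^ 2 n] and [(m + 1) ^ 2 n]
    for a fixed even [n], where the values are close to [E n]. The lower bound along even times
    makes the limit positive. *)
Theorem lattice_local_limit : exists2 c : R, 0 < c & E n @[n --> \oo] --> c.
Proof.
have [C [c [C0 c0 [Ha Hb Hc Hd He]]]] := lattice_return_estimates.
have p0 := lattice_return_ge0.
have dR : 0 <= d%:R :> R by [].
have mono a b : (a <= b)%N -> ~~ odd a -> ~~ odd b -> p b 0 <= p a 0.
  move=> ab /even_halfK <- /even_halfK <-.
  have : (a./2 <= b./2)%N by apply: half_leq.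
  move: a./2 b./2 => a' b' /subnK <-; elim: (b' - a')%N => // k IH.
  by rewrite addSn; apply: le_trans (He _) IH.
have sq0 n : 0 <= Num.sqrt n%:R :> R by exact: sqrtr_ge0.
have E0 n : 0 <= E n by rewrite /E mulr_ge0 ?exprn_ge0.
have ratio m : 1 - d%:R / m.+1%:R <= (m%:R / m.+1%:R) ^+ d :> R.
  have -> : m%:R / m.+1%:R = 1 - m.+1%:R^-1 :> R.
    by rewrite -[X in X / _](addrK 1) natr1 mulrBl divff ?mul1r// pnatr_eq0.
  apply: bernoulli_ge; rewrite invr_ge0 ler0n /= invf_le1 ?ltr0n// ler1n//.
have ratio1 m : (m%:R / m.+1%:R) ^+ d <= 1 :> R.
  by rewrite exprn_ile1 ?divr_ge0// ler_pdivrMr ?ltr0n// mul1r ler_nat.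
(* Along even times [p] decreases, and over the interval [sqrt] changes by a factor at most
   [(m + 1) / m], which costs [d / (m + 1)] after the power [d]. *)
have even_close n m M : (1 < n)%N -> (0 < m)%N -> ~~ odd n -> ~~ odd M ->
    (m ^ 2 * n <= M)%N -> (M <= m.+1 ^ 2 * n)%N ->
    `|E M - E n| <= C / n%:R + C * (d%:R / m.+1%:R).
  move=> n1 m0 on oM lo hi.
  have om : ~~ odd (m ^ 2 * n) by rewrite oddM (negPf on) andbF.
  have om1 : ~~ odd (m.+1 ^ 2 * n) by rewrite oddM (negPf on) andbF.
  have n0 : (0 < n)%N by apply: ltnW.
  have M0 : (0 < M)%N by apply: leq_trans lo; rewrite muln_gt0 expn_gt0 m0.
  have sqE k : Num.sqrt (k ^ 2 * n)%:R = k%:R * Num.sqrt n%:R :> R.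
    by rewrite natrM sqrtrM ?natrX ?sqr_ge0// sqrtr_sqr ger0_norm.
  have s1 : Num.sqrt M%:R <= m.+1%:R * Num.sqrt n%:R :> R.
    by rewrite -sqE ler_wsqrtr// ler_nat.
  have s2 : m%:R * Num.sqrt n%:R <= Num.sqrt M%:R :> R.
    by rewrite -sqE ler_wsqrtr// ler_nat.
  have rat : m%:R * Num.sqrt n%:R = m%:R / m.+1%:R * (m.+1%:R * Num.sqrt n%:R) :> R.
    by rewrite mulrA divfK ?pnatr_eq0.
  have h1 : E M - C * (d%:R / m.+1%:R) <= E (m ^ 2 * n).
    apply: (@le_trans _ _ ((m%:R / m.+1%:R) ^+ d * E M)).
      have := ler_wpM2r (E0 M) (ratio m); have := Ha M M0.
      have : 0 <= d%:R / m.+1%:R :> R by rewrite divr_ge0.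
      move: (d%:R / m.+1%:R) (_ ^+ d) (E M) => u v w; nra.
    have Em : E (m ^ 2 * n) = (m%:R / m.+1%:R) ^+ d *
        ((m.+1%:R * Num.sqrt n%:R) ^+ d * p (m ^ 2 * n) 0).
      by rewrite /E sqE rat exprMn mulrA.
    rewrite Em; apply: ler_wpM2l; first by rewrite exprn_ge0// divr_ge0.
    by rewrite /E ler_pM ?exprn_ge0// ?lerXn2r ?nnegrE ?mulr_ge0// mono.
  have h2 : E (m.+1 ^ 2 * n) - C * (d%:R / m.+1%:R) <= E M.
    apply: (@le_trans _ _ ((m%:R / m.+1%:R) ^+ d * E (m.+1 ^ 2 * n))).
      have E1 : E (m.+1 ^ 2 * n) <= C by apply: Ha; rewrite muln_gt0 expn_gt0.
      have := ler_wpM2r (E0 (m.+1 ^ 2 * n)%N) (ratio m).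
      have : 0 <= d%:R / m.+1%:R :> R by rewrite divr_ge0.
      move: (d%:R / m.+1%:R) (_ ^+ d) (E _) E1 => u v w; nra.
    have -> : (m%:R / m.+1%:R) ^+ d * E (m.+1 ^ 2 * n) =
        (m%:R * Num.sqrt n%:R) ^+ d * p (m.+1 ^ 2 * n) 0.
      by rewrite /E sqE mulrA -exprMn -rat.
    by rewrite /E ler_pM ?exprn_ge0 ?mulr_ge0// ?lerXn2r ?nnegrE ?mulr_ge0// mono.
  have h3 := Hc n m n1 m0; have h4 := Hc n m.+1 n1 (ltn0Sn m).
  move: h1 h2 h3 h4; rewrite !ler_norml.
  move: (E M) (E n) (E (m.+1 ^ 2 * n)) (E (m ^ 2 * n)) (C / n%:R) (C * _) => x1 x2 x3 x4 x5 x6.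
  by move=> h1 h2 /andP[h3 h3'] /andP[h4 h4']; apply/andP; split; lra.
have odd_close M : (0 < M)%N -> `|E M.+1 - E M| <= C / M%:R + C * (d%:R / M.+1%:R).
  move=> M0; have MR : 0 < M%:R :> R by rewrite ltr0n.
  pose r : R := (Num.sqrt M%:R / Num.sqrt M.+1%:R) ^+ d.
  have sM : 0 < Num.sqrt M.+1%:R :> R by rewrite sqrtr_gt0 ltr0n.
  have sMM : Num.sqrt M%:R <= Num.sqrt M.+1%:R :> R by rewrite ler_wsqrtr// ler_nat.
  have r1 : 1 - d%:R / M.+1%:R <= r.
    apply: (le_trans (ratio M)).
    rewrite /r lerXn2r ?nnegrE ?divr_ge0//.
    rewrite ler_pdivrMr ?ltr0n// mulrAC ler_pdivlMr//.
    rewrite -{1}(sqr_sqrtr (ler0n R M)) -[X in _ <= _ * X](sqr_sqrtr (ler0n R M.+1)).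
    rewrite !expr2 -mulrA; apply: ler_wpM2l => //.
    by rewrite mulrC; apply: ler_wpM2l => //; exact: ltW.
  have r2 : r <= 1.
    by rewrite exprn_ile1 ?divr_ge0// ler_pdivrMr// mul1r.
  have rE : r * E M.+1 = Num.sqrt M%:R ^+ d * p M.+1 0.
    by rewrite /r /E mulrA -exprMn divfK ?gt_eqF.
  have h1 : `|r * E M.+1 - E M| <= C / M%:R.
    rewrite rE /E -mulrBr normrM ger0_norm ?exprn_ge0// distrC; exact: Hb.
  have h2 := Ha M.+1 (ltn0Sn M); have h3 := E0 M.+1.
  have h4 : 0 <= d%:R / M.+1%:R :> R by rewrite divr_ge0.
  have h5 : `|E M.+1 - r * E M.+1| <= C * (d%:R / M.+1%:R).
    have -> : E M.+1 - r * E M.+1 = (1 - r) * E M.+1 by ring.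
    rewrite normrM (ger0_norm h3) ger0_norm ?subr_ge0// mulrC.
    by apply: ler_pM => //; [rewrite subr_ge0 | rewrite lerBlDl -lerBlDr].
  have -> : E M.+1 - E M = (E M.+1 - r * E M.+1) + (r * E M.+1 - E M) by ring.
  by apply: (le_trans (ler_normD _ _)); rewrite addrC lerD.
have arch (K e : R) : 0 <= K -> 0 < e -> exists n0, forall n, (n0 <= n)%N -> (0 < n)%N -> K / n%:R <= e.
  move=> K0 e0; exists (Num.bound (K / e)) => n nn n0.
  have nR : 0 < n%:R :> R by rewrite ltr0n.
  rewrite ler_pdivrMr// mulrC -ler_pdivrMr//.
  have Ke : 0 <= K / e by rewrite divr_ge0// ltW.
  by apply: (le_trans (ltW (archi_boundP Ke))); rewrite ler_nat.
have key (e : R) : 0 < e -> exists n M0, forall M, (M0 <= M)%N -> `|E M - E n| < e.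
  move=> e0; have e5 : 0 < e / 5 by rewrite divr_gt0.
  have Cd : 0 <= C * d%:R by rewrite mulr_ge0.
  have [a aP] := arch C _ C0 e5; have [b bP] := arch (C * d%:R) _ Cd e5.
  pose n := a.+1.*2; exists n, ((b.+1 ^ 2 * n) + a + b).+2 => M MM.
  have n1 : (1 < n)%N by rewrite /n doubleS.
  have n0 : (0 < n)%N by apply: ltnW.
  pose M' := (M./2).*2.
  have MM' : (M' <= M <= M'.+1)%N.
    rewrite /M'; have := odd_double_half M; have := leq_b1 (odd M).
    by move: (odd M : nat) (M./2) => o q; lia.
  have [bM' aM' bM''] := even_part_bounds MM MM'.
  (* The largest [m] with [m ^ 2 n <= M']; the threshold on [M] makes it exceed [b], so that the
     error [C d / (m + 1)] is small. *)
  have ex : exists m, (m ^ 2 * n <= M')%N by exists b.+1.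
  have ub m : (m ^ 2 * n <= M')%N -> (m <= M')%N.
    apply: leq_trans; rewrite -[leqLHS]muln1 leq_mul//.
    by rewrite -mulnn; case: m => // m; rewrite leq_pmull.
  have [m mP mmax] := ex_maxnP ex ub.
  have mb : (b.+1 <= m)%N by apply: mmax.
  have m0 : (0 < m)%N by apply: leq_trans mb.
  have hi : (M' <= m.+1 ^ 2 * n)%N.
    by rewrite leqNgt; apply/negP => /ltnW /mmax; rewrite ltnn.
  have h1 := @even_close n m M' n1 m0; rewrite /n /M' !odd_double -/n -/M' in h1.
  have {}h1 := h1 isT isT mP hi.
  have h2 : C / n%:R <= e / 5 by apply: aP => //; rewrite /n -addnn ltnW// ltn_addr.
  have h3 : C * (d%:R / m.+1%:R) <= e / 5 by rewrite mulrA; apply: bP => //; rewrite ltnW// ltnW.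
  have h4 : `|E M - E M'| <= e / 5 + e / 5.
    case/andP: MM'; rewrite leq_eqVlt => /orP[/eqP <- _|M1 M2].
      by rewrite subrr normr0; lra.
    have -> : M = M'.+1 by apply/eqP; rewrite eqn_leq M2 M1.
    have M'0 : (0 < M')%N by apply: leq_trans bM'; rewrite muln_gt0 expn_gt0.
    apply: (le_trans (odd_close M' M'0)); apply: lerD.
      exact: aP.
    by rewrite mulrA; apply: bP => //; exact: leqW.
  have -> : E M - E n = (E M - E M') + (E M' - E n) by ring.
  apply: (le_lt_trans (ler_normD _ _)).
  by apply: (le_lt_trans (lerD h4 (le_trans h1 (lerD h2 h3)))); lra.
have /cauchy_cvgP cE : cauchy (E n @[n --> \oo]).
  apply: cauchy_exP => e e0; have [n [M0 MP]] := key e e0.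
  exists (E n), M0 => // M /= M0M; rewrite /ball /= distrC; exact: MP.
exists (lim (E n @[n --> \oo])); last exact: cE.
have cc : c / 2 < c by lra.
apply: (@lt_le_trans _ _ (c / 2)); first by rewrite divr_gt0.
rewrite leNgt; apply/negP => lc.
have e0 : 0 < c / 2 - lim (E n @[n --> \oo]) by rewrite subr_gt0.
have /cvgrPdist_lt /(_ _ e0) [M0 _ MP] := cE.
have := MP M0.+1.*2; rewrite /= => /(_ _)/wrap[|].
  by rewrite -addnn; lia.
have := Hd M0.+1 (ltn0Sn _); rewrite ltr_norml; lra.
Qed.

End LatticeWalk.

(** * Nonnegative series *)

Section SeriesTools.
Variable R : realType.
Implicit Types u v b : R^nat.

Definition ssum u : R := limn (series u).

Lemma series_cvg_bounded u (B : R) : (forall n, 0 <= u n) ->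
  (forall n, series u n <= B) -> cvgn (series u) /\ ssum u <= B.
Proof.
move=> u0 uB.
have nd : nondecreasing_seq (series u) by apply: nondecreasing_series => n _ _.
have c : cvgn (series u).
  by apply: nondecreasing_is_cvgn => //; exists B => _ [n _ <-].
by split=> //; apply: limr_le => //; exact: nearW.
Qed.

Lemma series_le_ssum u n : (forall n, 0 <= u n) -> cvgn (series u) ->
  series u n <= ssum u.
Proof.
by move=> u0 c; apply: nondecreasing_cvgn_le => //; apply: nondecreasing_series.
Qed.

Lemma ssum_ge0 u : (forall n, 0 <= u n) -> cvgn (series u) -> 0 <= ssum u.
Proof.
by move=> u0 c; have := series_le_ssum 0 u0 c; rewrite /series /= big_geq.
Qed.

Lemma term_le_ssum u n : (forall n, 0 <= u n) -> cvgn (series u) -> u n <= ssum u.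
Proof.
move=> u0 c; apply: le_trans (series_le_ssum n.+1 u0 c).
by rewrite seriesSr lerDr; apply: sumr_ge0.
Qed.

Lemma ssumD u v : cvgn (series u) -> cvgn (series v) ->
  cvgn (series (fun n => u n + v n)) /\ ssum (fun n => u n + v n) = ssum u + ssum v.
Proof.
by move=> cu cv; split; [exact: (is_cvg_seriesD cu cv) | exact: (lim_seriesD cu cv)].
Qed.

Lemma ssumB u v : cvgn (series u) -> cvgn (series v) ->
  cvgn (series (fun n => u n - v n)) /\ ssum (fun n => u n - v n) = ssum u - ssum v.
Proof.
by move=> cu cv; split; [exact: (is_cvg_seriesB cu cv) | exact: (lim_seriesB cu cv)].
Qed.

Lemma ssumZ (c : R) u : cvgn (series u) ->
  cvgn (series (fun n => c * u n)) /\ ssum (fun n => c * u n) = c * ssum u.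
Proof.
move=> cu; have E : series (fun n => c * u n) = (fun n => c * series u n).
  by apply/funext => n; rewrite /series /= mulr_sumr.
have h : (fun n => c * series u n) @ \oo --> c * ssum u.
  by apply: cvgM; [exact: cvg_cst | exact: cu].
by rewrite /ssum E; split; [apply/cvg_ex; exists (c * ssum u) | exact: cvg_lim].
Qed.

Lemma ssum_le u v : cvgn (series u) -> cvgn (series v) -> (forall n, u n <= v n) ->
  ssum u <= ssum v.
Proof. exact: lim_series_le. Qed.

Lemma ssum_eq u v : u =1 v -> ssum u = ssum v.
Proof. by move=> /funext ->. Qed.

Lemma cvg_series_dominated u b : (forall n, `|u n| <= b n) -> cvgn (series b) ->
  cvgn (series u).
Proof.
move=> ub cb; apply: normed_cvg.
apply: (@series_le_cvg R (fun n => `|u n|) b) => // n.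
exact: le_trans (ub n).
Qed.

Lemma ssum_tail u b n : (forall n, `|u n| <= b n) -> cvgn (series b) ->
  `|ssum u - series u n| <= ssum b - series b n.
Proof.
move=> ub cb; have cu := cvg_series_dominated ub cb.
have b0 k : 0 <= b k by exact: le_trans (ub k).
have c1 : (fun m => `|series u m - series u n|) @ \oo --> `|ssum u - series u n|.
  by apply: cvg_norm; apply: cvgB => //; exact: cvg_cst.
rewrite -(cvg_lim _ c1)//; apply: limr_le; first by apply/cvg_ex; exists `|ssum u - series u n|.
exists n => // m /= nm.
rewrite sub_series_geq//; apply: (le_trans (ler_norm_sum _ _ _)).
apply: (@le_trans _ _ (series b m - series b n)).
  by rewrite sub_series_geq//; apply: ler_sum => k _.
by rewrite lerB// series_le_ssum.
Qed.

(* Tannery's theorem. *)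
Lemma tannery (T : Type) (F : set_system T) {FF : ProperFilter F}
    (a : T -> R^nat) (b g : R^nat) : cvgn (series b) ->
  (\forall t \near F, forall n, `|a t n| <= b n) ->
  (forall n, a t n @[t --> F] --> g n) ->
  [/\ \forall t \near F, cvgn (series (a t)), cvgn (series g) &
   ssum (a t) @[t --> F] --> ssum g].
Proof.
move=> cb ab ag.
have gb n : `|g n| <= b n.
  have c : `|a t n| @[t --> F] --> `|g n| by apply: cvg_norm; exact: ag.
  rewrite -(cvg_lim _ c)//; apply: limr_le; first by apply/cvg_ex; exists `|g n|.
  by apply: filterS ab => t /(_ n).
have cg := cvg_series_dominated gb cb.
split => //; first by near=> t; apply: (cvg_series_dominated _ cb); near: t.
apply/cvgrPdist_lt => e e0.
have e4 : 0 < e / 4 by rewrite divr_gt0.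
have /cvgrPdist_lt /(_ _ e4) [N _ NP] := cb.
have tailb : ssum b - series b N < e / 4.
  by apply: le_lt_trans (NP N (leqnn N)); exact: ler_norm.
have cN : series (a t) N @[t --> F] --> series g N.
  elim: {NP tailb} N => [|N IH].
    by rewrite (_ : (fun t => _) = (fun=> 0)) ?/series/= ?big_geq//;
      [exact: cvg_cst | apply/funext => t; rewrite /= big_geq].
  rewrite seriesSr (_ : (fun t => _) = (fun t => series (a t) N + a t N)).
    exact: cvgD.
  by apply/funext => t; rewrite seriesSr.
near=> t.
have t1 : `|ssum (a t) - series (a t) N| <= ssum b - series b N.
  by apply: ssum_tail => //; near: t.
have t2 := ssum_tail N gb cb.
have t3 : `|series g N - series (a t) N| < e / 4.
  by near: t; move/cvgrPdist_lt : cN; apply.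
have -> : ssum g - ssum (a t) = (ssum g - series g N) + (series g N - series (a t) N)
   - (ssum (a t) - series (a t) N) by ring.
apply: (le_lt_trans (ler_normB _ _)).
apply: (@le_lt_trans _ _ (`|ssum g - series g N| + `|series g N - series (a t) N| +
  `|ssum (a t) - series (a t) N|)); first by rewrite lerD2r ler_normD.
lra.
Unshelve. all: by end_near.
Qed.

Lemma cvgn_geometric (q : R) : 0 <= q < 1 -> cvgn (series (fun n => q ^+ n)).
Proof.
move=> /andP[q0 q1].
have h : `|q| < 1 by rewrite ger0_norm.
have := @is_cvg_geometric_series R 1 q h.
rewrite (_ : geometric 1 q = (fun n => q ^+ n))//.
by apply/funext => n; rewrite /geometric /= mul1r.
Qed.

(** For [q <= 1] each of the [n] terms of the geometric sum [1 + q + ... + q^(n-1)] is at least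
    [q^n]. *)
Lemma poly_expr_le (q : R) (n : nat) : 0 <= q <= 1 -> n%:R * q ^+ n * (1 - q) <= 1.
Proof.
move=> /andP[q0 q1].
have h : n%:R * q ^+ n <= \sum_(i < n) q ^+ i.
  rewrite mulr_natl -[n in X in _ *+ X]card_ord -sumr_const.
  apply: ler_sum => -[j jn] _ /=; rewrite -{1}(subnKC (ltnW jn)) exprD.
  by rewrite ler_piMr ?exprn_ge0// exprn_ile1.
apply: (@le_trans _ _ ((\sum_(i < n) q ^+ i) * (1 - q))).
  by rewrite ler_wpM2r// subr_ge0.
by rewrite mulrC -opprB mulNr -subrX1 opprB lerBlDr lerDl exprn_ge0.
Qed.

(* Each factor [n] is absorbed by [sqrt(s)^n]. *)
Lemma cvgn_nat_geometric (k : nat) (s : R) : 0 <= s < 1 ->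
  cvgn (series (fun n => n%:R ^+ k * s ^+ n)).
Proof.
elim: k s => [|k IH] s s01.
  rewrite (_ : (fun n => _) = (fun n => s ^+ n)); first exact: cvgn_geometric.
  by apply/funext => n; rewrite expr0 mul1r.
have /andP[s0 s1] := s01; set q := Num.sqrt s.
have q0 : 0 <= q by exact: sqrtr_ge0.
have sE : s = q * q by rewrite -expr2 sqr_sqrtr.
have q1 : q < 1 by rewrite -sqrtr1 ltr_sqrt.
have q01 : 0 <= q < 1 by rewrite q0.
apply: (@series_le_cvg R _ (fun n => (1 - q)^-1 * (n%:R ^+ k * q ^+ n))).
- by move=> n; rewrite mulr_ge0 ?exprn_ge0.
- by move=> n; rewrite !mulr_ge0 ?exprn_ge0// invr_ge0 subr_ge0 ltW.
- move=> n; rewrite sE exprMn exprSr.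
  have := @poly_expr_le q n; rewrite q0 (ltW q1) => /(_ isT) h.
  rewrite mulrC ler_pdivlMl ?subr_gt0//.
  have -> : (1 - q) * (q ^+ n * q ^+ n * (n%:R ^+ k * n%:R)) =
     (n%:R * q ^+ n * (1 - q)) * (n%:R ^+ k * q ^+ n) by ring.
  by rewrite ler_piMl// mulr_ge0 ?exprn_ge0.
- by have [] := ssumZ ((1 - q)^-1) (IH q q01).
Qed.

Lemma cvgn_series_power u (B s : R) (k : nat) : (forall n, 0 <= u n <= B) -> 0 <= s < 1 ->
  cvgn (series (fun n => n%:R ^+ k * u n * s ^+ n)).
Proof.
move=> uB s01; have /andP[s0 s1] := s01.
apply: (@series_le_cvg R _ (fun n => B * (n%:R ^+ k * s ^+ n))).
- by move=> n; have /andP[u0 _] := uB n; rewrite !mulr_ge0 ?exprn_ge0.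
- move=> n; have /andP[u0 uB'] := uB n.
  by rewrite !mulr_ge0 ?exprn_ge0// (le_trans u0).
- move=> n; have /andP[u0 uB'] := uB n.
  have -> : n%:R ^+ k * u n * s ^+ n = u n * (n%:R ^+ k * s ^+ n) by ring.
  by rewrite ler_wpM2r// mulr_ge0 ?exprn_ge0.
- by have [] := ssumZ B (@cvgn_nat_geometric k s s01).
Qed.

End SeriesTools.

(** * Transient renewal sequences *)

Section RealTools.
Variable R : realType.

Lemma ivt_pointwise (f : R -> R) (a b c : R) : a <= b ->
  (forall x, a <= x <= b -> {for x, continuous f}) ->
  (f a <= c <= f b) \/ (f b <= c <= f a) -> exists2 x, a <= x <= b & f x = c.
Proof.
move=> ab fc fab.
have [x xab fx] : exists2 x, x \in `[a, b] & f x = c.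
  apply: IVT => //.
    apply: continuous_in_subspaceT => x; rewrite inE /= in_itv /= => xab.
    exact: fc.
  case: fab => /andP[h1 h2]; first by rewrite ge_min h1 le_max h2 orbT.
  by rewrite ge_min h1 orbT le_max h2.
by exists x => //; move: xab; rewrite in_itv.
Qed.

Lemma lipschitz_continuous_at (f : R -> R) (k x : R) :
  (forall y, `|f x - f y| <= k * `|x - y|) -> {for x, continuous f}.
Proof.
move=> fk; apply/cvgrPdist_lt => e e0.
have k1 : 0 < `|k| + 1 by rewrite ltr_wpDl.
near=> y; apply: (le_lt_trans (fk y)).
apply: (@le_lt_trans _ _ ((`|k| + 1) * `|x - y|)).
  by rewrite ler_wpM2r// (le_trans (ler_norm k))// lerDl.
rewrite mulrC -ltr_pdivlMr//; near: y.
by apply: cvgr_dist_lt => //; rewrite divr_gt0.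
Unshelve. all: by end_near.
Qed.

Lemma clamp_itv (b s : R) : 0 <= b -> 0 <= Num.max 0 (Num.min s b) <= b.
Proof. by move=> b0; rewrite le_max lexx /= ge_max b0 ge_min lexx orbT. Qed.

Lemma clamp_id (b s : R) : 0 <= s <= b -> Num.max 0 (Num.min s b) = s.
Proof. by move=> /andP[s0 sb]; rewrite min_l// max_r. Qed.

(* Clamping the argument makes the sum of a power series continuous on the
   whole line, which avoids subspace topologies. *)
Lemma power_series_continuous (c : R^nat) (b : R) : 0 <= b -> (forall n, 0 <= c n) ->
  cvgn (series (fun n => c n * b ^+ n.+1)) ->
  continuous (fun s : R => ssum (fun n => c n * Num.max 0 (Num.min s b) ^+ n.+1)).
Proof.
move=> b0 c0 cc x.
pose a (s : R) n := c n * Num.max 0 (Num.min s b) ^+ n.+1.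
suff [h1 h2] : (forall s n, `|a s n| <= c n * b ^+ n.+1) /\
    (forall n, a s n @[s --> x] --> a x n).
  have h1' : \forall s \near nbhs (x : R), forall n, `|a s n| <= c n * b ^+ n.+1.
    by apply: nearW => s; exact: h1.
  by have [_ _ h] := tannery cc h1' h2; exact: h.
split=> [s n|n]; rewrite /a.
- have /andP[m0 mb] := clamp_itv s b0.
  rewrite ger0_norm; last by apply: mulr_ge0 => //; exact: exprn_ge0.
  by apply: ler_wpM2l => //; apply: lerXn2r => //; rewrite nnegrE.
- apply: cvgM; first exact: cvg_cst.
  apply: (@continuous_cvg _ _ _ _ _ _ (fun y : R => y ^+ n.+1)).
    exact: exprn_continuous.
  apply: (@continuous_cvg _ _ _ _ _ _ (fun y : R => Num.max 0 (Num.min y b))).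
    apply: continuous_max; first exact: cvg_cst.
    by apply: continuous_min; [exact: cvg_id | exact: cvg_cst].
  exact: cvg_id.
Qed.

Lemma ssum_lt (f g : R^nat) k : cvgn (series f) -> cvgn (series g) ->
  (forall n, f n <= g n) -> f k < g k -> ssum f < ssum g.
Proof.
move=> cf cg fg fgk; have [c e] := ssumB cg cf.
rewrite -subr_gt0 -e; apply: (@lt_le_trans _ _ (g k - f k)); first by rewrite subr_gt0.
by apply: (@term_le_ssum _ (fun n => g n - f n)) => // n; rewrite subr_ge0.
Qed.

Lemma cvgn_series_expr (c : R^nat) s : (forall n, 0 <= c n) -> cvgn (series c) ->
  0 <= s <= 1 -> cvgn (series (fun n => c n * s ^+ n)) /\
  cvgn (series (fun n => c n * s ^+ n.+1)).
Proof.
move=> c0 cc /andP[s0 s1].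
have h m : (forall n, c n * s ^+ m n <= c n) by
  move=> n; rewrite ler_piMr// exprn_ile1.
split; first by apply: (series_le_cvg _ c0 (h id) cc) => n; rewrite mulr_ge0 ?exprn_ge0.
by apply: (series_le_cvg _ c0 (h succn) cc) => n; rewrite mulr_ge0 ?exprn_ge0.
Qed.

(** The partial sum of the product is a sum over [k] of [c k] times the partial sum of [a] of length
    [N - k]; Tannery's theorem with the bound [c k * ssum a] passes to the limit. *)
Lemma cauchy_product (c a : R^nat) : (forall n, 0 <= c n) -> (forall n, 0 <= a n) ->
  cvgn (series c) -> cvgn (series a) ->
  series (fun n => \sum_(k < n.+1) c k * a (n - k)%N) @ \oo --> ssum c * ssum a.
Proof.
move=> c0 a0 cc ca.
have E N : series (fun n => \sum_(k < n.+1) c k * a (n - k)%N) N =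
    \sum_(k < N) c k * series a (N - k)%N.
  elim: N => [|N IH]; first by rewrite /series /= big_geq// big_ord0.
  rewrite seriesSr IH [in RHS]big_ord_recr /= subSnn seriesSr {3}/series /= big_geq//.
  rewrite add0r big_ord_recr /= subnn addrA; congr (_ + _).
  rewrite -big_split /=; apply: eq_bigr => i _.
  by rewrite subSn ?(ltnW (ltn_ord i))// seriesSr mulrDr.
pose f (N : nat) (k : nat) : R := (k < N)%:R * (c k * series a (N - k)%N).
have a0' m : 0 <= series a m by rewrite /series /=; apply: sumr_ge0.
have cf : cvgn (series (fun k => c k * ssum a)).
  rewrite (_ : (fun k => _) = (fun k => ssum a * c k)).
    by have [] := ssumZ (ssum a) cc.
  by apply/funext => k; rewrite mulrC.
suff [h1 h2] : (forall N k, `|f N k| <= c k * ssum a) /\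
    (forall k, f N k @[N --> \oo] --> c k * ssum a).
  have h1' : \forall N \near \oo, forall k, `|f N k| <= c k * ssum a by apply: nearW.
  have [_ _ h] := tannery cf h1' h2.
  move: h; rewrite (_ : ssum (fun k => _) = ssum c * ssum a); last first.
    have [_ e] := ssumZ (ssum a) cc; rewrite [RHS]mulrC -e.
    by apply: ssum_eq => k; rewrite mulrC.
  apply: cvg_trans; apply: near_eq_cvg; apply: nearW => N /=.
  rewrite E; apply: cvg_lim => //; apply: cvg_near_cst; exists N => // M /= NM.
  rewrite /series /= (big_cat_nat _ NM)//= [X in _ + X](_ : _ = 0) ?addr0; last first.
    by rewrite big_nat big1// => i /andP[Ni _]; rewrite /f ltnNge Ni mul0r.
  rewrite big_mkord; apply: eq_bigr => i _.
  by rewrite /f ltn_ord mul1r.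
split=> [N k|k].
- rewrite /f ger0_norm; last by rewrite !mulr_ge0.
  have cl : c k * series a (N - k)%N <= c k * ssum a.
    by apply: ler_wpM2l => //; exact: series_le_ssum.
  case: (k < N)%N; rewrite ?mul1r// mul0r mulr_ge0//.
  exact: ssum_ge0.
- rewrite -(cvg_shiftn k); apply: cvg_trans (_ : (fun N => c k * series a N) @ \oo --> _).
    apply: near_eq_cvg; exists 1%N => // N /= N1.
    by rewrite /f -{2}[k]add0n ltn_add2r N1 mul1r addnK.
  by apply: cvgM; [exact: cvg_cst | exact: ca].
Qed.

(** Bernoulli's inequality. It transfers bounds on power series near [s = 1] to a fixed partial sum
    of coefficients. *)
Lemma exprn_near1 (N : nat) (e : R) : 0 < e ->
  exists2 s0 : R, 0 < s0 < 1 & forall s, s0 <= s <= 1 -> 1 - e <= s ^+ N.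
Proof.
move=> e0; pose t : R := Num.min (1 / 2) (e / N.+1%:R).
have t0 : 0 < t by rewrite lt_min; apply/andP; split; [lra | rewrite divr_gt0].
have tl : t <= 1 / 2 by rewrite ge_min lexx.
exists (1 - t); first by apply/andP; split; lra.
move=> s /andP[ts s1].
have s0 : 0 <= s by lra.
have h : 1 - N%:R * (1 - s) <= s ^+ N.
  elim: (N) => [|n IH]; first by rewrite mul0r expr0 subr0.
  rewrite exprS -natr1.
  have n0 : (0 : R) <= n%:R by exact: ler0n.
  apply: (@le_trans _ _ (s * (1 - n%:R * (1 - s)))); last by rewrite ler_wpM2l.
  rewrite -subr_ge0 (_ : _ - _ = n%:R * (1 - s) ^+ 2); last by ring.
  by apply: mulr_ge0 => //; exact: sqr_ge0.
apply: le_trans h; rewrite lerB//.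
have h2 : t <= e / N.+1%:R by rewrite ge_min lexx orbT.
have h3 : N%:R * (1 - s) <= N.+1%:R * (e / N.+1%:R).
  by apply: ler_pM; rewrite ?subr_ge0 ?ler_nat//; apply: le_trans h2; lra.
by rewrite [leRHS]mulrC divfK// in h3.
Qed.

End RealTools.

Section Renewal.
Variable R : realType.
Variables p u : R^nat.

(** The indices of [u] are shifted: [u k] is the probability of a first return at time [k + 1]. The
    summability of [p] is transience, and the last field, a possible first return after more than
    one step, makes [slope] strictly increasing. *)
Record transient_renewal : Prop := TransientRenewal {
  tr_p0 : p 0%N = 1 ;
  tr_renewal : forall n, p n.+1 = \sum_(k < n.+1) u k * p (n - k)%N ;
  tr_p : forall n, 0 <= p n <= 1 ;
  tr_u : forall n, 0 <= u n ;
  tr_cvg : cvgn (series p) ;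
  tr_pos : exists2 k, (0 < k)%N & 0 < u k }.

Hypothesis tr : transient_renewal.

Definition gen_p (s : R) : R := ssum (fun n => p n * s ^+ n).
Definition gen_u (s : R) : R := ssum (fun n => u n * s ^+ n.+1).
(* [gap = 1 / (s * gen_p s)], [slope s = - s ^ 2 * gap' s], and [secant s t] is
   the difference quotient of [gap], times [- s * t]. *)
Definition gap (s : R) : R := (1 - gen_u s) / s.
Definition slope (s : R) : R := 1 + ssum (fun n => n%:R * u n * s ^+ n.+1).

Local Notation V := gap.
Local Notation W := slope.

Let p_ge0 n : 0 <= p n. Proof. by have /andP[] := tr_p tr n. Qed.
Let u_ge0 := tr_u tr.

Lemma renewal_le n : u n <= p n.+1.
Proof.
rewrite (tr_renewal tr) big_ord_recr /= subnn (tr_p0 tr) mulr1 lerDr.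
by apply: sumr_ge0 => i _; exact: mulr_ge0.
Qed.

Lemma cvgn_u : cvgn (series u).
Proof.
have h : cvgn (series (fun n => p n.+1)).
  apply: (@series_cvg_bounded _ _ (ssum p) _ _).1 => // n.
  apply: le_trans (series_le_ssum n.+1 p_ge0 (tr_cvg tr)).
  by rewrite /series /= big_nat_recl// lerDr.
exact: (series_le_cvg u_ge0 (fun n => p_ge0 n.+1) renewal_le h).
Qed.

Lemma cvgn_gen_p s : 0 <= s <= 1 -> cvgn (series (fun n => p n * s ^+ n)).
Proof. by move=> s01; have [] := cvgn_series_expr p_ge0 (tr_cvg tr) s01. Qed.

Lemma cvgn_gen_u s : 0 <= s <= 1 -> cvgn (series (fun n => u n * s ^+ n.+1)).
Proof. by move=> s01; have [] := cvgn_series_expr u_ge0 cvgn_u s01. Qed.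

Lemma gen_p_ge1 s : 0 <= s <= 1 -> 1 <= gen_p s.
Proof.
move=> s01; have /andP[s0 _] := s01.
rewrite (_ : 1 = p 0%N * s ^+ 0); last by rewrite (tr_p0 tr) expr0 mulr1.
apply: (@term_le_ssum _ (fun n => p n * s ^+ n)); last exact: cvgn_gen_p.
by move=> n; rewrite mulr_ge0 ?exprn_ge0.
Qed.

Lemma gen_p_gt0 s : 0 <= s <= 1 -> 0 < gen_p s.
Proof. by move=> s01; apply: lt_le_trans (gen_p_ge1 s01). Qed.

Lemma gen_pu s : 0 <= s <= 1 -> gen_p s * (1 - gen_u s) = 1.
Proof.
move=> s01; have /andP[s0 _] := s01.
have cu := cvgn_gen_u s01; have cp := cvgn_gen_p s01.
have h := cauchy_product (fun n => mulr_ge0 (u_ge0 n) (exprn_ge0 n.+1 s0))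
  (fun n => mulr_ge0 (p_ge0 n) (exprn_ge0 n s0)) cu cp.
have E : (fun N => series (fun n => p n * s ^+ n) N.+1) =
   (fun N => 1 + series (fun n => \sum_(k < n.+1) u k * s ^+ k.+1 * (p (n - k)%N * s ^+ (n - k))) N).
  apply/funext => N; rewrite /series /= big_nat_recl// (tr_p0 tr) expr0 mulr1.
  congr (_ + _); apply: eq_big_nat => n _; rewrite (tr_renewal tr) mulr_suml.
  apply: eq_bigr => -[k /= kn] _; rewrite (_ : n.+1 = k.+1 + (n - k))%N; last by lia.
  by rewrite exprD; ring.
have h1 : (fun N => series (fun n => p n * s ^+ n) N.+1) @ \oo --> 1 + gen_u s * gen_p s.
  by rewrite E; apply: cvgD; [exact: cvg_cst | exact: h].
have h2 : (fun N => series (fun n => p n * s ^+ n) N.+1) @ \oo --> gen_p s.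
  by move: cp; rewrite -(cvg_shiftS).
have := cvg_unique _ h1 h2; move=> /(_ (@norm_hausdorff _ _)) e.
by rewrite mulrBr mulr1 -{1}e; ring.
Qed.

Lemma gapE s : 0 < s <= 1 -> V s = (s * gen_p s)^-1.
Proof.
move=> /andP[s0 s1]; have s01 : 0 <= s <= 1 by rewrite ltW.
have g := gen_p_gt0 s01; have e := gen_pu s01.
rewrite /gap invfM mulrC; congr (_ * _).
by apply: (mulfI (lt0r_neq0 g)); rewrite e divff// gt_eqF.
Qed.

Lemma gap_gt0 s : 0 < s <= 1 -> 0 < V s.
Proof.
move=> s01; rewrite gapE// invr_gt0; have /andP[s0 s1] := s01.
by rewrite mulr_gt0// gen_p_gt0// ltW.
Qed.

Definition secant (s t : R) : R :=
  1 + ssum (fun n => u n * \sum_(i < n) t ^+ (n - i) * s ^+ i.+1).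

Lemma secant_sum_bounds (s t : R) n : 0 <= s <= t ->
  n%:R * s ^+ n.+1 <= \sum_(i < n) t ^+ (n - i) * s ^+ i.+1 <= n%:R * t ^+ n.+1.
Proof.
move=> /andP[s0 st]; have t0 := le_trans s0 st.
have E (c : R) : n%:R * c = \sum_(i < n) c by rewrite sumr_const card_ord mulr_natl.
have D (x : R) (i : 'I_n) : x ^+ n.+1 = x ^+ (n - i) * x ^+ i.+1.
  by rewrite -exprD; congr (_ ^+ _); have := ltn_ord i; lia.
rewrite !E; apply/andP; split; apply: ler_sum => i _; rewrite (D _ i).
  by apply: ler_wpM2r; [exact: exprn_ge0 | apply: lerXn2r; rewrite ?nnegrE].
by apply: ler_wpM2l; [exact: exprn_ge0 | apply: lerXn2r; rewrite ?nnegrE].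
Qed.

Section Secant.
Variables s t : R.
Hypotheses (s0 : 0 < s) (st : s < t) (t1 : t <= 1).
Hypothesis ct : cvgn (series (fun n => n%:R * u n * t ^+ n.+1)).

Let t0 : 0 < t. Proof. exact: lt_trans st. Qed.
Let st0 : 0 <= s <= t. Proof. by rewrite !ltW. Qed.

Lemma slope_cvg_le : cvgn (series (fun n => n%:R * u n * s ^+ n.+1)).
Proof.
apply: series_le_cvg ct => n; rewrite ?mulr_ge0 ?exprn_ge0 ?(ltW s0) ?(ltW t0)//.
apply: ler_wpM2l; first exact: mulr_ge0.
by apply: lerXn2r; rewrite ?nnegrE ltW.
Qed.

Lemma cvgn_secant : cvgn (series (fun n => u n * \sum_(i < n) t ^+ (n - i) * s ^+ i.+1)).
Proof.
apply: series_le_cvg ct => n; have /andP[b1 b2] := secant_sum_bounds n st0.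
- apply: mulr_ge0 => //; apply: le_trans b1.
  by rewrite mulr_ge0 ?exprn_ge0// ltW.
- by rewrite !mulr_ge0 ?exprn_ge0// ltW.
- by rewrite mulrAC [leRHS]mulrC; apply: ler_wpM2l.
Qed.

(** Writing [gap s] as [1 / s] minus the series of [u n * s ^ n] separates the pole; the rest is the
    factorization of [t ^ n - s ^ n] term by term. *)
Lemma gap_secant : V s - V t = (s^-1 - t^-1) * secant s t.
Proof.
have s01 : 0 <= s <= 1 by rewrite (ltW s0) (le_trans (ltW st)).
have t01 : 0 <= t <= 1 by rewrite (ltW t0).
have E x : 0 < x -> 0 <= x <= 1 ->
    cvgn (series (fun n => u n * x ^+ n)) /\ V x = x^-1 - ssum (fun n => u n * x ^+ n).
  move=> x0 x01; split; first by have [] := cvgn_series_expr u_ge0 cvgn_u x01.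
  have [_ e] := ssumZ (x^-1) (cvgn_gen_u x01).
  rewrite /gap mulrDl mul1r mulNr [gen_u _ / _]mulrC -e; congr (_ - _).
  by apply: ssum_eq => n; rewrite exprS mulrCA mulKf// gt_eqF.
have [cs ->] := E _ s0 s01; have [ct' ->] := E _ t0 t01.
have [_ e1] := ssumB ct' cs.
have -> : s^-1 - ssum (fun n => u n * s ^+ n) - (t^-1 - ssum (fun n => u n * t ^+ n)) =
  (s^-1 - t^-1) + ssum (fun n => u n * t ^+ n - u n * s ^+ n) by rewrite e1; ring.
rewrite /secant mulrDr mulr1; congr (_ + _).
have [_ <-] := ssumZ (s^-1 - t^-1) cvgn_secant.
apply: ssum_eq => n; rewrite -mulrBr mulrCA; congr (_ * _).
rewrite subrXX mulr_sumr mulr_sumr; apply: eq_bigr => -[i /= i_n] _.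
rewrite (_ : (n - i = (n.-1 - i).+1)%N); last by lia.
by rewrite !exprS /=; field; rewrite !gt_eqF.
Qed.

(** The secant is a difference quotient in the variable [1 / s], in which [slope] is the derivative
    of [gap]. Strictness on the right comes from the index [k > 0] with [u k > 0]. *)
Lemma secant_bounds : W s <= secant s t < W t.
Proof.
rewrite /slope /secant lerD2l ltrD2l; apply/andP; split.
  apply: ssum_le; [exact: slope_cvg_le | exact: cvgn_secant |] => n.
  have /andP[b1 _] := secant_sum_bounds n st0.
  by rewrite mulrAC [leLHS]mulrC; apply: ler_wpM2l.
have [k k0 uk] := tr_pos tr.
apply: (@ssum_lt _ _ _ k); [exact: cvgn_secant | exact: ct | |].
  move=> n; have /andP[_ b2] := secant_sum_bounds n st0.
  by rewrite mulrAC [leRHS]mulrC; apply: ler_wpM2l.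
rewrite mulrAC [ltRHS]mulrC ltr_pM2l//.
have -> : k%:R * t ^+ k.+1 = \sum_(i < k) t ^+ k.+1.
  by rewrite sumr_const card_ord mulr_natl.
apply: ltr_sum.
  by apply/hasP; exists (Ordinal k0) => //; rewrite mem_index_enum.
move=> -[i /= ik] _.
rewrite (_ : k.+1 = (k - i) + i.+1)%N; last by lia.
rewrite exprD ltr_pM2l; last exact: exprn_gt0.
by rewrite ltrXn2r// ltW.
Qed.

Lemma secant_ge1 : 1 <= secant s t.
Proof.
rewrite lerDl; apply: ssum_ge0; last exact: cvgn_secant.
move=> n; apply: mulr_ge0 => //; apply: sumr_ge0 => i _.
by apply: mulr_ge0; apply: exprn_ge0; exact: ltW.
Qed.

End Secant.

Lemma slope_cvg s : 0 <= s < 1 -> cvgn (series (fun n => n%:R * u n * s ^+ n.+1)).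
Proof.
move=> s01; have /andP[s0 s1] := s01.
have uB n : 0 <= u n <= 1.
  by rewrite u_ge0 (le_trans (renewal_le n))//; have /andP[] := tr_p tr n.+1.
have := @cvgn_series_power R u 1 s 1 uB s01 => h.
have [h2 _] := ssumZ s h.
rewrite (_ : (fun n => _) = (fun n => s * (n%:R ^+ 1 * u n * s ^+ n)))//.
by apply/funext => n; rewrite exprS expr1; ring.
Qed.

Lemma slope_ge1 s : 0 <= s -> cvgn (series (fun n => n%:R * u n * s ^+ n.+1)) ->
  1 <= W s.
Proof.
move=> s0 c; rewrite lerDl; apply: ssum_ge0 => // n.
by rewrite !mulr_ge0 ?exprn_ge0.
Qed.

(** The series of [u n * s ^ n] is nondecreasing in [s]. Besides strict monotonicity of [gap] this
    gives a Lipschitz bound for its inverse, in the variable [1 / s]. *)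
Lemma gap_decr s t : 0 < s -> s < t -> t <= 1 -> s^-1 - t^-1 <= V s - V t.
Proof.
move=> s0 st t1; have t0 := lt_trans s0 st.
have s01 : 0 <= s <= 1 by rewrite (ltW s0) (le_trans (ltW st)).
have t01 : 0 <= t <= 1 by rewrite (ltW t0).
rewrite /gap !mulrBl !mul1r.
suff : gen_u s / s <= gen_u t / t by lra.
rewrite /gen_u ![_ / _]mulrC.
have [c1 <-] := ssumZ (s^-1) (cvgn_gen_u s01).
have [c2 <-] := ssumZ (t^-1) (cvgn_gen_u t01).
apply: ssum_le => // n.
have E x : 0 < x -> x^-1 * (u n * x ^+ n.+1) = u n * x ^+ n.
  by move=> x0; rewrite exprS mulrCA mulKf// gt_eqF.
rewrite !E//; by apply: ler_wpM2l => //; apply: lerXn2r; rewrite ?nnegrE ?ltW.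
Qed.

Lemma gap_ge s : 0 < s <= 1 -> s^-1 - 1 <= V s.
Proof.
move=> /andP[s0]; rewrite le_eqVlt => /predU1P[->|s1].
  by rewrite invr1 subrr ltW// gap_gt0// lexx ltr01.
have := gap_decr s0 s1 (lexx _); rewrite invr1.
have : 0 < V 1 by rewrite gap_gt0// lexx ltr01.
lra.
Qed.

Lemma gap_inj s t : 0 < s <= 1 -> 0 < t <= 1 -> V s = V t -> s = t.
Proof.
move=> /andP[s0 s1] /andP[t0 t1] e; have [st|st|//] := ltgtP s t.
- have := gap_decr s0 st t1; rewrite e subrr subr_le0 lef_pV2// => h.
  by rewrite ltNge h in st.
- have := gap_decr t0 st s1; rewrite e subrr subr_le0 lef_pV2// => h.
  by rewrite ltNge h in st.
Qed.

Lemma gap_surj (x : R) : V 1 <= x -> exists2 s, 0 < s <= 1 & V s = x.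
Proof.
move=> x1; have V1 : 0 < V 1 by rewrite gap_gt0// lexx ltr01.
(* The ends of the intermediate value argument: [gap a >= 1 / a - 1 = x] by [gap_ge], and
   [gap 1 <= x]. *)
pose a := (x + 1)^-1.
have x0 : 0 < x by exact: lt_le_trans x1.
have a0 : 0 < a by rewrite invr_gt0; lra.
have a1 : a <= 1 by rewrite invf_le1; lra.
have cu : cvgn (series (fun n => u n * 1 ^+ n.+1)) by apply: cvgn_gen_u; rewrite ler01 lexx.
pose U' (s : R) := ssum (fun n => u n * Num.max 0 (Num.min s 1) ^+ n.+1).
have U'c : continuous U' := power_series_continuous ler01 u_ge0 cu.
have U'E s : 0 <= s <= 1 -> U' s = gen_u s by move=> s01; rewrite /U' clamp_id.
have [s sa sx] : exists2 s, a <= s <= 1 & (1 - U' s) / s = x.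
  apply: (@ivt_pointwise R (fun s => (1 - U' s) / s)) => //.
    move=> s /andP[as_ _]; apply: cvgM.
      by apply: cvgB; [exact: cvg_cst | exact: U'c].
    by apply: cvgV; [rewrite gt_eqF// (lt_le_trans a0) | exact: cvg_id].
  right; rewrite !U'E ?ler01 ?lexx// ?(ltW a0)//.
  rewrite -[(1 - gen_u 1) / 1]/(V 1) x1 -[(1 - gen_u a) / a]/(V a) /=.
  have := @gap_ge a; rewrite a0 a1 => /(_ isT).
  by rewrite /a invrK addrK.
have /andP[as_ s1] := sa; have s0 := lt_le_trans a0 as_.
by exists s; [rewrite s0 | rewrite -sx U'E// ltW].
Qed.

End Renewal.

Section RenewalInverse.
Variables (R : realType) (p u : R^nat).
Hypothesis tr : transient_renewal p u.

Local Notation V := (gap u).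
Local Notation W := (slope u).
Local Notation Gp := (gen_p p).

Let p_ge0 n : 0 <= p n. Proof. by have /andP[] := tr_p tr n. Qed.
Let u_ge0 := tr_u tr.
Let nu_ge0 n : 0 <= n%:R * u n. Proof. by rewrite mulr_ge0. Qed.

(** Inverse of the decreasing function [gap] on [(0, 1]]; below [gap 1] there is no solution and the
    default value [1] is returned. *)
Definition gap_inv (x : R) : R := xget 1 [set s : R | (0 < s <= 1) && (V s == x)].

Lemma gap_invP x : V 1 <= x -> 0 < gap_inv x <= 1 /\ V (gap_inv x) = x.
Proof.
move=> x1; have [s s01 sx] := gap_surj tr x1.
have h : exists t, [set s : R | (0 < s <= 1) && (V s == x)] t.
  by exists s; rewrite /= s01 sx eqxx.
by have /andP[? /eqP ?] := xgetPex 1 h.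
Qed.

Lemma gap_invK s : 0 < s <= 1 -> gap_inv (V s) = s.
Proof.
move=> s01; have [i1 i2] : 0 < gap_inv (V s) <= 1 /\ V (gap_inv (V s)) = V s.
  have h : exists t, [set t : R | (0 < t <= 1) && (V t == V s)] t.
    by exists s; rewrite /= s01 eqxx.
  by have /andP[? /eqP ?] := xgetPex 1 h.
exact: (gap_inj tr).
Qed.

Lemma gap_inv_decr x y : V 1 <= x -> x < y ->
  gap_inv y < gap_inv x /\ (gap_inv y)^-1 - (gap_inv x)^-1 <= y - x.
Proof.
move=> x1 xy; have [/andP[sx0 sx1] Ex] := gap_invP x1.
have [/andP[sy0 sy1] Ey] := gap_invP (le_trans x1 (ltW xy)).
have lt_ : gap_inv y < gap_inv x.
  rewrite ltNge le_eqVlt; apply/negP => /predU1P[e|h].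
    by move: xy; rewrite -Ex -Ey e ltxx.
  have := gap_decr tr sx0 h sy1; rewrite Ex Ey.
  have : 0 < (gap_inv x)^-1 - (gap_inv y)^-1 by rewrite subr_gt0 ltf_pV2.
  lra.
by split=> //; have := gap_decr tr sy0 lt_ sx1; rewrite Ex Ey.
Qed.

(** The reciprocal of [gap_inv] is Lipschitz with constant [1] by [gap_inv_decr]; the maximum with
    [x0] extends the function to the whole line. *)
Lemma gap_inv_continuous x0 : V 1 <= x0 ->
  continuous (fun x => gap_inv (Num.max x0 x)).
Proof.
move=> h0 x; have pos y : 0 < gap_inv (Num.max x0 y).
  have h1 : V 1 <= Num.max x0 y by rewrite le_max h0.
  by have [/andP[]] := gap_invP h1.
have key a b : a <= b -> `|(gap_inv (Num.max x0 a))^-1 - (gap_inv (Num.max x0 b))^-1| <= b - a.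
  move=> ab; have hm : Num.max x0 a <= Num.max x0 b by rewrite ge_max !le_max lexx ab orbT.
  move: hm; rewrite le_eqVlt => /predU1P[->|hm].
    by rewrite subrr normr0 subr_ge0.
  have h1 : V 1 <= Num.max x0 a by rewrite le_max h0.
  have [h2 h3] := gap_inv_decr h1 hm.
  rewrite distrC ger0_norm; last by rewrite subr_ge0 ltW// ltf_pV2 ?posrE.
  apply: (le_trans h3); move: hm; case: (leP x0 a); case: (leP x0 b) => //; lra.
have lc : {for x, continuous (fun x => (gap_inv (Num.max x0 x))^-1)}.
  apply: (@lipschitz_continuous_at R _ 1) => y; rewrite mul1r.
  have [xy|xy] := leP x y; first by rewrite [`|x - y|]distrC [leRHS]ger0_norm ?subr_ge0// key.
  rewrite distrC [leRHS]ger0_norm; last by rewrite subr_ge0 ltW.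
  by apply: key; exact: ltW.
have -> : (fun x => gap_inv (Num.max x0 x)) = (fun x => (gap_inv (Num.max x0 x))^-1^-1).
  by apply/funext => y; rewrite invrK.
by apply: cvgV; [rewrite invr_neq0// gt_eqF | exact: lc].
Qed.

Local Notation clamp b s := (Num.max 0 (Num.min s b)).

Definition slope_clamped (b s : R) : R := 1 + ssum (fun n => n%:R * u n * clamp b s ^+ n.+1).

Lemma slope_clamped_continuous b : 0 <= b ->
  cvgn (series (fun n => n%:R * u n * b ^+ n.+1)) -> continuous (slope_clamped b).
Proof.
move=> b0 c x; apply: cvgD; first exact: cvg_cst.
exact: (power_series_continuous b0 nu_ge0 c).
Qed.

Lemma slope_clampedE b s : 0 <= s <= b -> slope_clamped b s = W s.
Proof. by move=> h; rewrite /slope_clamped clamp_id. Qed.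

Lemma slope_gt1 s : 0 < s -> cvgn (series (fun n => n%:R * u n * s ^+ n.+1)) -> 1 < W s.
Proof.
move=> s0 c; have [k k0 uk] := tr_pos tr.
rewrite ltrDl; apply: (@lt_le_trans _ _ (k%:R * u k * s ^+ k.+1)).
  by rewrite !mulr_gt0 ?exprn_gt0// ltr0n.
apply: (@term_le_ssum _ (fun n => n%:R * u n * s ^+ n.+1)) => // n.
by rewrite !mulr_ge0 ?exprn_ge0// ltW.
Qed.

Lemma slope_le s t : 0 <= s <= t -> cvgn (series (fun n => n%:R * u n * t ^+ n.+1)) ->
  cvgn (series (fun n => n%:R * u n * s ^+ n.+1)) /\ W s <= W t.
Proof.
move=> /andP[s0 st] c; have t0 := le_trans s0 st.
have le_ n : n%:R * u n * s ^+ n.+1 <= n%:R * u n * t ^+ n.+1.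
  by apply: ler_wpM2l => //; apply: lerXn2r; rewrite ?nnegrE.
have cs : cvgn (series (fun n => n%:R * u n * s ^+ n.+1)).
  by apply: (series_le_cvg _ _ le_ c) => n; rewrite !mulr_ge0 ?exprn_ge0.
by split=> //; rewrite lerD2l; exact: ssum_le.
Qed.

Lemma slope_small b s : 0 < s <= b -> cvgn (series (fun n => n%:R * u n * b ^+ n.+1)) ->
  W s - 1 <= s / b * (W b - 1).
Proof.
move=> /andP[s0 sb] c; have b0 := lt_le_trans s0 sb.
have sb0 : 0 <= s <= b by rewrite ltW.
have [c1 _] := slope_le sb0 c.
rewrite /slope ![1 + _]addrC !addrK.
have [c2 <-] := ssumZ (s / b) c; apply: ssum_le => // n.
rewrite [leRHS]mulrCA; apply: ler_wpM2l => //.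
rewrite !exprS mulrA divfK ?gt_eqF//; apply: ler_wpM2l; first exact: ltW.
by apply: lerXn2r; rewrite ?nnegrE// ltW.
Qed.

Lemma gen_p_secant s : 0 < s -> s < 1 ->
  cvgn (series (fun n => n%:R * u n * 1 ^+ n.+1)) ->
  Gp 1 - s * Gp s = (1 - s) * secant u s 1 * (Gp s * Gp 1).
Proof.
move=> s0 s1 c1; have e := gap_secant tr s0 s1 (lexx _) c1.
have s1' : 0 < s <= 1 by rewrite s0 ltW.
have gs : 0 < Gp s by rewrite (gen_p_gt0 tr)// !ltW.
have g1 : 0 < Gp 1 by rewrite (gen_p_gt0 tr)// ler01 lexx.
rewrite !(gapE tr) ?ltr01 ?lexx// mul1r invr1 in e.
have : s * Gp s * Gp 1 * ((s * Gp s)^-1 - (Gp 1)^-1) =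
   s * Gp s * Gp 1 * ((s^-1 - 1) * secant u s 1) by rewrite e.
rewrite (_ : s * Gp s * Gp 1 * ((s * Gp s)^-1 - (Gp 1)^-1) = Gp 1 - s * Gp s); last first.
  by field; rewrite !gt_eqF.
by move=> ->; field; rewrite gt_eqF.
Qed.

(** A bound on the slope passes to [s = 1] on each partial sum, so the first-return time has a
    finite mean. Then [gen_p 1 - s * gen_p s] is [O(1 - s)], and each partial sum of [n p n] is
    bounded by letting [s] come close to [1]. *)
Lemma slope_unbounded (K : R) : ~ cvgn (series (fun n => n%:R * p n)) ->
  exists2 s, 0 < s < 1 & K <= W s.
Proof.
move=> np; apply: contrapT => /forall2NP nK; apply: np.
have WK s : 0 < s < 1 -> W s <= K.
  by move=> s01; have [//|/negP] := nK s; rewrite -ltNge => /ltW.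
have cu : cvgn (series (fun n => n%:R * u n)).
  apply: (@series_cvg_bounded _ _ (2 * K) nu_ge0 _).1 => N.
  have half : (0 : R) < 1 / 2 by lra.
  have [s /andP[s0 s1] sN] := exprn_near1 N half.
  have s01 : 0 <= s < 1 by rewrite ltW.
  have c := slope_cvg tr s01.
  have nn n : 0 <= n%:R * u n * s ^+ n.+1 by rewrite !mulr_ge0 ?exprn_ge0// ltW.
  have h := series_le_ssum N nn c.
  have hK := WK s; rewrite s0 s1 /slope in hK; have := hK isT => {}hK.
  have sN1 := sN s; rewrite lexx ltW// in sN1; have {}sN1 := sN1 isT.
  apply: (@le_trans _ _ (2 * series (fun n => n%:R * u n * s ^+ n.+1) N)); last lra.
  rewrite /series /= mulr_sumr; apply: ler_sum_nat => n /andP[_ nN].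
  have : s ^+ N <= s ^+ n.+1 by apply: ler_wiXn2l => //; exact: ltW.
  by have := nu_ge0 n; nra.
have c1 : cvgn (series (fun n => n%:R * u n * 1 ^+ n.+1)).
  by rewrite (_ : (fun n => _) = (fun n => n%:R * u n))//; apply/funext => n; rewrite expr1n mulr1.
have g1 : 0 < Gp 1 by rewrite (gen_p_gt0 tr)// ler01 lexx.
have np0 n : 0 <= n%:R * p n by rewrite mulr_ge0.
apply: (@series_cvg_bounded _ _ (4 * W 1 * Gp 1 ^+ 2) np0 _).1 => N.
have half : (0 : R) < 1 / 2 by lra.
have [s0 /andP[s00 s01] sN] := exprn_near1 N half.
(* For this [s] all powers up to [N] are at least [1 / 2], so [1 - s ^ n >= (1 - s) n / 2] for
   [n < N]. *)
pose s := Num.max s0 (1 / 2).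
have s_lt1 : s < 1 by rewrite gt_max s01; lra.
have s_gt0 : 0 < s by rewrite lt_max s00.
have s_half : 1 / 2 <= s by rewrite le_max lexx orbT.
have sP : 1 / 2 <= s ^+ N.
  have := sN s; rewrite (ltW s_lt1) andbT le_max lexx => /(_ isT); lra.
have /andP[_ sec] := secant_bounds tr s_gt0 s_lt1 (lexx _) c1.
have s1' : 0 < s <= 1 by rewrite s_gt0 ltW.
have s1'' : 0 <= s <= 1 by rewrite ltW// ltW.
have gs : 0 < Gp s by rewrite (gen_p_gt0 tr).
have gs1 : Gp s <= Gp 1.
  apply: ssum_le; try by apply: (cvgn_gen_p tr); rewrite ?ler01 ?lexx.
  move=> n; rewrite expr1n ler_wpM2l// exprn_ile1//; exact: ltW.
have e2 := gen_p_secant s_gt0 s_lt1 c1.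
have l1 : series (fun n => p n * (1 - s ^+ n)) N <= Gp 1 - Gp s.
  have cg1 : cvgn (series (fun n => p n * 1 ^+ n)).
    by apply: (cvgn_gen_p tr); rewrite ler01 lexx.
  have [c2 <-] := ssumB cg1 (cvgn_gen_p tr s1'').
  rewrite (_ : (fun n => p n * 1 ^+ n - p n * s ^+ n) = (fun n => p n * (1 - s ^+ n))) in c2 *.
    apply: series_le_ssum => // n; rewrite mulr_ge0// subr_ge0 exprn_ile1// ltW//.
  by apply/funext => n; rewrite expr1n mulrBr.
have l2 : (1 - s) * (1 / 2) * series (fun n => n%:R * p n) N <=
    series (fun n => p n * (1 - s ^+ n)) N.
  rewrite /series /= mulr_sumr; apply: ler_sum_nat => n /andP[_ nN].
  have -> : 1 - s ^+ n = 1 ^+ n - s ^+ n by rewrite expr1n.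
  rewrite subrXX.
  have : n%:R * (1 / 2) <= \sum_(i < n) (1 : R) ^+ (n.-1 - i) * s ^+ i.
    rewrite mulr_natl -[n in X in X <= _]card_ord -sumr_const; apply: ler_sum => -[i /= i_n] _.
    rewrite expr1n [leRHS]mul1r; apply: (le_trans sP).
    apply: ler_wiXn2l; [exact: ltW | exact: ltW|].
    by apply: ltnW; exact: ltn_trans nN.
  move=> h; have : 0 <= (1 - s) * p n by rewrite mulr_ge0// subr_ge0 ltW.
  by move=> h2; have := ler_wpM2l h2 h; lra.
have l3 : Gp 1 - Gp s <= (1 - s) * (W 1 * Gp 1 ^+ 2).
  apply: (@le_trans _ _ (Gp 1 - s * Gp s)); first by rewrite lerB// ler_piMl// ltW.
  rewrite e2 -mulrA; apply: ler_wpM2l; first by rewrite subr_ge0 ltW.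
  have sec1 := secant_ge1 tr s_gt0 s_lt1 c1.
  apply: ler_pM; [lra | by apply: mulr_ge0; exact: ltW | exact: ltW |].
  by rewrite expr2 ler_pM2r.
have l4 := le_trans l2 (le_trans l1 l3).
rewrite -mulrA in l4; have : 0 < 1 - s by rewrite subr_gt0.
by move=> h; rewrite ler_pM2l// in l4; have : 0 <= W 1 * Gp 1 ^+ 2; [|lra];
  rewrite mulr_ge0 ?sqr_ge0//; have := @slope_ge1 R p u tr 1 ler01 c1; lra.
Qed.

Section FiniteMean.
Hypothesis cm : cvgn (series (fun n => n%:R * p n)).

Definition mean : R := ssum (fun n => n%:R * p n).
(* The first-order Taylor remainder of [gen_p] at [1]. *)
Definition excess (s : R) : R := ssum (fun n => p n * (n%:R * (1 - s) - 1 + s ^+ n)).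

Lemma slope_cvg1 : cvgn (series (fun n => n%:R * u n * 1 ^+ n.+1)).
Proof.
rewrite (_ : (fun n => _) = (fun n => n%:R * u n)); last first.
  by apply/funext => n; rewrite expr1n mulr1.
have h : cvgn (series (fun n => n.+1%:R * p n.+1)).
  apply: (@series_cvg_bounded _ _ mean _ _).1 => [n|n]; first by rewrite mulr_ge0.
  have nn k : 0 <= k%:R * p k by rewrite mulr_ge0.
  apply: le_trans (series_le_ssum n.+1 nn cm).
  by rewrite /series /= big_nat_recl// mul0r add0r.
apply: (series_le_cvg nu_ge0 _ _ h) => n; first by rewrite mulr_ge0.
by apply: ler_pM; rewrite ?ler_nat//; exact: (renewal_le tr).
Qed.

Lemma excess_term n (s : R) : 0 <= s <= 1 ->
  0 <= n%:R * (1 - s) - 1 + s ^+ n <= n%:R * (1 - s).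
Proof.
move=> /andP[s0 s1]; apply/andP; split; last first.
  have : s ^+ n <= 1 by apply: exprn_ile1.
  by move: (s ^+ n) => x; lra.
have : 1 - n%:R * (1 - s) <= s ^+ n; last by move: (s ^+ n) => x; lra.
elim: n => [|n IH]; first by rewrite mul0r expr0 subr0.
rewrite exprS -natr1; have n0 : (0 : R) <= n%:R by exact: ler0n.
apply: (@le_trans _ _ (s * (1 - n%:R * (1 - s)))); last by rewrite ler_wpM2l.
rewrite -subr_ge0 (_ : _ - _ = n%:R * (1 - s) ^+ 2); last by ring.
by apply: mulr_ge0 => //; exact: sqr_ge0.
Qed.

Lemma cvgn_excess s : 0 <= s <= 1 ->
  cvgn (series (fun n => p n * (n%:R * (1 - s) - 1 + s ^+ n))).
Proof.
move=> s01; have [c _] := ssumZ (1 - s) cm.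
apply: (series_le_cvg _ _ _ c) => n; have /andP[h1 h2] := excess_term n s01.
- by rewrite mulr_ge0.
- by have /andP[_ s1] := s01; rewrite mulr_ge0 ?subr_ge0 ?mulr_ge0.
- rewrite [leRHS](_ : _ = p n * (n%:R * (1 - s))); last by ring.
  exact: ler_wpM2l.
Qed.

Lemma gen_p_excess s : 0 <= s <= 1 -> Gp 1 - Gp s = (1 - s) * mean - excess s.
Proof.
move=> s01; have cg1 : cvgn (series (fun n => p n * 1 ^+ n)).
  by apply: (cvgn_gen_p tr); rewrite ler01 lexx.
have [c1 e1] := ssumZ (1 - s) cm; have ce := cvgn_excess s01.
have [_ e2] := ssumB c1 ce; have [_ e3] := ssumB cg1 (cvgn_gen_p tr s01).
rewrite /mean -e1 /excess -e2 -e3; apply: ssum_eq => n; rewrite expr1n; ring.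
Qed.

Lemma secantE s : 0 < s < 1 ->
  secant u s 1 = (mean + Gp s - excess s / (1 - s)) / (Gp s * Gp 1).
Proof.
move=> /andP[s0 s1]; have s01 : 0 <= s <= 1 by rewrite ltW// ltW.
have gs : 0 < Gp s by rewrite (gen_p_gt0 tr).
have g1 : 0 < Gp 1 by rewrite (gen_p_gt0 tr)// ler01 lexx.
have e2 := gen_p_secant s0 s1 slope_cvg1.
have e3 := gen_p_excess s01.
have e4 : (1 - s) * secant u s 1 * (Gp s * Gp 1) = (1 - s) * mean - excess s + (1 - s) * Gp s.
  by rewrite -e2 -e3; ring.
have d0 : 0 < 1 - s by rewrite subr_gt0.
apply: (mulIf (lt0r_neq0 (mulr_gt0 gs g1))); rewrite divfK ?gt_eqF ?mulr_gt0//.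
apply: (mulfI (lt0r_neq0 d0)); rewrite mulrA e4; field.
by rewrite gt_eqF.
Qed.

End FiniteMean.
End RenewalInverse.

(** * The curve of a free product *)

(* The generating function of a free product is studied along a curve
   parametrized by [X]: the arguments [s1], [s2] at which the two factors are
   evaluated satisfy [a V1(s1) = b V2(s2) = X], and the Green function of the
   product is then taken at [1 / zz X]. *)
Section Curve.
Variables (R : realType) (p1 u1 p2 u2 : R^nat) (a b : R).
Hypotheses (tr1 : transient_renewal p1 u1) (tr2 : transient_renewal p2 u2).
Hypotheses (a0 : 0 < a) (b0 : 0 < b).

Local Notation V1 := (gap u1).
Local Notation V2 := (gap u2).
Local Notation W1 := (slope u1).
Local Notation W2 := (slope u2).

Definition arg1 (X : R) : R := gap_inv u1 (X / a).
Definition arg2 (X : R) : R := gap_inv u2 (X / b).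
Definition zz (X : R) : R := a / arg1 X + b / arg2 X - X.
(* [psi] is the derivative of [zz], [chord] below its difference quotient. *)
Definition psi (X : R) : R := (W1 (arg1 X))^-1 + (W2 (arg2 X))^-1 - 1.
Definition admissible_arg (X : R) : Prop := a * V1 1 <= X /\ b * V2 1 <= X.
Definition finite_slopes (X : R) : Prop :=
  cvgn (series (fun n => n%:R * u1 n * arg1 X ^+ n.+1)) /\
  cvgn (series (fun n => n%:R * u2 n * arg2 X ^+ n.+1)).

Local Notation G1 X := (gen_p p1 (arg1 X)).
Local Notation G2 X := (gen_p p2 (arg2 X)).

Lemma admissible_arg_le X Y : admissible_arg X -> X <= Y -> admissible_arg Y.
Proof. by move=> [h1 h2] XY; split; apply: le_trans XY. Qed.

Lemma zz_args X : zz X = a / arg1 X + b / arg2 X - X.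
Proof. by []. Qed.

Lemma psi_slopes X : psi X = (W1 (arg1 X))^-1 + (W2 (arg2 X))^-1 - 1.
Proof. by []. Qed.

Lemma arg1K s : 0 < s <= 1 -> arg1 (a * V1 s) = s.
Proof. by move=> s01; rewrite /arg1 mulrAC divff ?gt_eqF// mul1r (gap_invK tr1). Qed.

Lemma arg2K s : 0 < s <= 1 -> arg2 (b * V2 s) = s.
Proof. by move=> s01; rewrite /arg2 mulrAC divff ?gt_eqF// mul1r (gap_invK tr2). Qed.

Section Argument.
Variable X : R.
Hypothesis aX : admissible_arg X.

Lemma argP : [/\ 0 < arg1 X <= 1, 0 < arg2 X <= 1, a * V1 (arg1 X) = X & b * V2 (arg2 X) = X].
Proof.
have [h1 h2] := aX.
have h1' : V1 1 <= X / a by rewrite ler_pdivlMr// mulrC.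
have h2' : V2 1 <= X / b by rewrite ler_pdivlMr// mulrC.
have [i1 e1] := gap_invP tr1 h1'; have [i2 e2] := gap_invP tr2 h2'.
by split; rewrite // ?/arg1 ?/arg2 ?e1 ?e2 mulrC divfK// gt_eqF.
Qed.

Lemma arg_pos : 0 < X.
Proof. by have [i1 _ <- _] := argP; rewrite mulr_gt0// (gap_gt0 tr1). Qed.

Lemma zzE : zz X = X * (G1 X + G2 X - 1).
Proof.
have [i1 i2 e1 e2] := argP.
have /andP[p10 p11] := i1; have /andP[p20 p21] := i2.
have g1 : 0 < G1 X by rewrite (gen_p_gt0 tr1)// ltW.
have g2 : 0 < G2 X by rewrite (gen_p_gt0 tr2)// ltW.
have F (c s g x : R) : 0 < s -> 0 < g -> c * (s * g)^-1 = x -> c / s = x * g.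
  by move=> s0 g0 <-; field; rewrite !gt_eqF.
rewrite (gapE tr1)// in e1; rewrite (gapE tr2)// in e2.
by rewrite /zz (F _ _ _ _ p10 g1 e1) (F _ _ _ _ p20 g2 e2); ring.
Qed.

Lemma zz_ge : X <= zz X.
Proof.
have [/andP[p10 p11] /andP[p20 p21] _ _] := argP.
rewrite zzE ler_peMr ?(ltW arg_pos)//.
have : 1 <= G1 X by rewrite (gen_p_ge1 tr1)// ltW.
have : 1 <= G2 X by rewrite (gen_p_ge1 tr2)// ltW.
lra.
Qed.

Lemma zz_gt0 : 0 < zz X. Proof. exact: lt_le_trans arg_pos zz_ge. Qed.

End Argument.

Definition chord (X0 X : R) : R :=
  (secant u1 (arg1 X) (arg1 X0))^-1 + (secant u2 (arg2 X) (arg2 X0))^-1 - 1.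

Section Chord.
Variables X0 X : R.
Hypotheses (aX0 : admissible_arg X0) (fX0 : finite_slopes X0) (X0X : X0 < X).

Let aX : admissible_arg X. Proof. exact: admissible_arg_le (ltW X0X). Qed.

Lemma arg_decr : arg1 X < arg1 X0 /\ arg2 X < arg2 X0.
Proof.
have [h1 h2] := aX0.
by split; [have [] := @gap_inv_decr _ _ _ tr1 (X0 / a) (X / a) |
  have [] := @gap_inv_decr _ _ _ tr2 (X0 / b) (X / b)];
  rewrite ?ltr_pM2r ?invr_gt0// ler_pdivlMr// mulrC.
Qed.

Lemma finite_slopes_right : finite_slopes X.
Proof.
have [l1 l2] := arg_decr; have [c1 c2] := fX0.
have [/andP[p10 _] /andP[p20 _] _ _] := argP aX.
split.
- by have [] := @slope_le _ _ _ tr1 (arg1 X) (arg1 X0) _ c1; rewrite ?(ltW p10) ?(ltW l1).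
- by have [] := @slope_le _ _ _ tr2 (arg2 X) (arg2 X0) _ c2; rewrite ?(ltW p20) ?(ltW l2).
Qed.

(** Along the curve [X - X0] is [a] times the increment of [V1], hence [a] times the increment of
    [1 / s1] times a secant. Each of the terms [a / s1] and [b / s2] thus grows by [X - X0] divided
    by its secant. *)
Lemma zz_chord : zz X - zz X0 = (X - X0) * chord X0 X.
Proof.
have [l1 l2] := arg_decr; have [c1 c2] := fX0.
have [/andP[p10 _] /andP[p20 _] e1 e2] := argP aX.
have [/andP[_ q11] /andP[_ q21] f1 f2] := argP aX0.
have d1 := gap_secant tr1 p10 l1 q11 c1.
have d2 := gap_secant tr2 p20 l2 q21 c2.
have w1 := secant_ge1 tr1 p10 l1 c1.
have w2 := secant_ge1 tr2 p20 l2 c2.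
rewrite /chord; move: (secant u1 _ _) (secant u2 _ _) d1 d2 w1 w2 => w1 w2 d1 d2 w1_ge w2_ge.
have k1 : a / arg1 X - a / arg1 X0 = (X - X0) / w1.
  apply: (mulIf (_ : w1 != 0)); first by rewrite gt_eqF//; lra.
  rewrite divfK; last by rewrite gt_eqF//; lra.
  have -> : X - X0 = a * (V1 (arg1 X) - V1 (arg1 X0)) by rewrite mulrBr e1 f1.
  by rewrite d1; ring.
have k2 : b / arg2 X - b / arg2 X0 = (X - X0) / w2.
  apply: (mulIf (_ : w2 != 0)); first by rewrite gt_eqF//; lra.
  rewrite divfK; last by rewrite gt_eqF//; lra.
  have -> : X - X0 = b * (V2 (arg2 X) - V2 (arg2 X0)) by rewrite mulrBr e2 f2.
  by rewrite d2; ring.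
rewrite mulrBr mulrDr -k1 -k2 /zz; ring.
Qed.

Lemma chord_bounds : psi X0 < chord X0 X <= psi X /\ chord X0 X <= 1.
Proof.
have [l1 l2] := arg_decr; have [c1 c2] := fX0.
have [/andP[p10 _] /andP[p20 _] _ _] := argP aX.
have [/andP[q10 q11] /andP[q20 q21] _ _] := argP aX0.
have /andP[b1 b1'] := secant_bounds tr1 p10 l1 q11 c1.
have /andP[b2 b2'] := secant_bounds tr2 p20 l2 q21 c2.
have w1 := secant_ge1 tr1 p10 l1 c1.
have w2 := secant_ge1 tr2 p20 l2 c2.
have [d1 d2] := finite_slopes_right.
have v1 := slope_ge1 tr1 (ltW p10) d1.
have v2 := slope_ge1 tr2 (ltW p20) d2.
have P (x : R) : 1 <= x -> x \is Num.pos by rewrite posrE; lra.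
have i1 : (W1 (arg1 X0))^-1 < (secant u1 (arg1 X) (arg1 X0))^-1.
  by rewrite ltf_pV2 ?P// (le_trans w1)// ltW.
have i2 : (W2 (arg2 X0))^-1 < (secant u2 (arg2 X) (arg2 X0))^-1.
  by rewrite ltf_pV2 ?P// (le_trans w2)// ltW.
have j1 : (secant u1 (arg1 X) (arg1 X0))^-1 <= (W1 (arg1 X))^-1 by rewrite lef_pV2 ?P.
have j2 : (secant u2 (arg2 X) (arg2 X0))^-1 <= (W2 (arg2 X))^-1 by rewrite lef_pV2 ?P.
have k1 : (secant u1 (arg1 X) (arg1 X0))^-1 <= 1 by rewrite invf_le1// (lt_le_trans _ w1).
have k2 : (secant u2 (arg2 X) (arg2 X0))^-1 <= 1 by rewrite invf_le1// (lt_le_trans _ w2).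
rewrite /psi /chord.
split; last by rewrite lerBlDr lerD.
by apply/andP; split; [rewrite ltrD2r ltrD | rewrite lerD2r lerD].
Qed.

End Chord.

Section Continuity.
Variable X0 : R.
Hypotheses (aX0 : admissible_arg X0) (fX0 : finite_slopes X0).

Definition psi_clamped (X : R) : R :=
  (slope_clamped u1 (arg1 X0) (arg1 (Num.max X0 X)))^-1 +
  (slope_clamped u2 (arg2 X0) (arg2 (Num.max X0 X)))^-1 - 1.

Lemma arg_continuous : continuous (fun X => arg1 (Num.max X0 X)) /\
  continuous (fun X => arg2 (Num.max X0 X)).
Proof.
have [h1 h2] := aX0.
have E (c X : R) : 0 < c -> Num.max X0 X / c = Num.max (X0 / c) (X / c).
  by move=> c0; rewrite maxr_pMl// invr_ge0 ltW.
split=> X.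
- rewrite /arg1 (_ : (fun X => _) = (fun X => gap_inv u1 (Num.max (X0 / a) (X / a)))); last first.
    by apply/funext => Y; rewrite E.
  apply: (@continuous_cvg _ _ _ _ _ _ (fun Y => gap_inv u1 (Num.max (X0 / a) Y))).
    by apply: (gap_inv_continuous tr1); rewrite ler_pdivlMr// mulrC.
  by apply: cvgM; [exact: cvg_id | exact: cvg_cst].
- rewrite /arg2 (_ : (fun X => _) = (fun X => gap_inv u2 (Num.max (X0 / b) (X / b)))); last first.
    by apply/funext => Y; rewrite E.
  apply: (@continuous_cvg _ _ _ _ _ _ (fun Y => gap_inv u2 (Num.max (X0 / b) Y))).
    by apply: (gap_inv_continuous tr2); rewrite ler_pdivlMr// mulrC.
  by apply: cvgM; [exact: cvg_id | exact: cvg_cst].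
Qed.

Lemma arg_le X : X0 <= X -> 0 <= arg1 X <= arg1 X0 /\ 0 <= arg2 X <= arg2 X0.
Proof.
move=> h; have [/andP[p10 _] /andP[p20 _] _ _] := argP (admissible_arg_le aX0 h).
move: h; rewrite le_eqVlt => /predU1P[<-|h].
  by have [/andP[q10 _] /andP[q20 _] _ _] := argP aX0; rewrite !lexx !ltW.
have [l1 l2] := arg_decr aX0 h.
by rewrite !ltW.
Qed.

Lemma psi_clampedE X : X0 <= X -> psi_clamped X = psi X.
Proof.
move=> h; have [l1 l2] := arg_le h.
by rewrite /psi_clamped max_r// !slope_clampedE.
Qed.

Lemma psi_clamped_continuous : continuous psi_clamped.
Proof.
move=> X; have [c1 c2] := arg_continuous; have [f1 f2] := fX0.
have [l1 l2] := arg_le (lexx X0).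
have mX : X0 <= Num.max X0 X by rewrite le_max lexx.
have [m1 m2] := arg_le mX.
have aM := admissible_arg_le aX0 mX.
have [/andP[p10 _] /andP[p20 _] _ _] := argP aM.
have [g1 _] := slope_le tr1 m1 f1; have [g2 _] := slope_le tr2 m2 f2.
have w1 := slope_ge1 tr1 (ltW p10) g1.
have w2 := slope_ge1 tr2 (ltW p20) g2.
have /andP[q1 _] := l1; have /andP[q2 _] := l2.
apply: cvgB; last exact: cvg_cst.
apply: cvgD.
- apply: cvgV; first by rewrite slope_clampedE// gt_eqF// (lt_le_trans _ w1).
  apply: (@continuous_cvg _ _ _ _ _ _ (slope_clamped u1 (arg1 X0))).
    exact: (slope_clamped_continuous tr1 q1 f1).
  exact: c1.
- apply: cvgV; first by rewrite slope_clampedE// gt_eqF// (lt_le_trans _ w2).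
  apply: (@continuous_cvg _ _ _ _ _ _ (slope_clamped u2 (arg2 X0))).
    exact: (slope_clamped_continuous tr2 q2 f2).
  exact: c2.
Qed.

Lemma right_cvg (f g : R -> R) : (forall X, X0 <= X -> f X = g X) ->
  continuous f -> g X @[X --> X0^'+] --> g X0.
Proof.
move=> fg cf; rewrite -fg//.
have h : f X @[X --> X0^'+] --> f X0.
  by apply: cvg_trans (cf X0); apply: cvg_app; exact: cvg_within.
apply: cvg_trans h; apply: near_eq_cvg; near=> X.
by rewrite fg// ltW//; near: X; exact: nbhs_right_gt.
Unshelve. all: by end_near.
Qed.

Lemma psi_right_cvg : psi X @[X --> X0^'+] --> psi X0.
Proof. exact: right_cvg psi_clampedE psi_clamped_continuous. Qed.

Lemma zz_clamped_continuous : continuous (fun X => zz (Num.max X0 X)).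
Proof.
move=> X; have [c1 c2] := arg_continuous.
have mX : X0 <= Num.max X0 X by rewrite le_max lexx.
have [/andP[p10 _] /andP[p20 _] _ _] := argP (admissible_arg_le aX0 mX).
apply: cvgB; last by apply: continuous_max; [exact: cvg_cst | exact: cvg_id].
apply: cvgD; apply: cvgM; try exact: cvg_cst.
- by apply: cvgV; [rewrite gt_eqF | exact: c1].
- by apply: cvgV; [rewrite gt_eqF | exact: c2].
Qed.

Lemma zz_right_cvg : zz X @[X --> X0^'+] --> zz X0.
Proof.
by apply: right_cvg zz_clamped_continuous => X h; rewrite max_r.
Qed.

Lemma chord_right_cvg : chord X0 X @[X --> X0^'+] --> psi X0.
Proof.
apply: (@squeeze_cvgr _ _ _ _ (fun=> psi X0) psi); last 2 first.
- exact: cvg_cst.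
- exact: psi_right_cvg.
near=> X; have h : X0 < X by near: X; exact: nbhs_right_gt.
by have [/andP[h1 ->] _] := chord_bounds aX0 fX0 h; rewrite ltW.
Unshelve. all: by end_near.
Qed.

(** For large [X] both arguments are small, because [gap s <= 1 / s]; both slopes are then at most
    [5 / 4], and [4 / 5 + 4 / 5 > 1]. *)
Lemma psi_large : exists2 X, X0 < X & 0 < psi X.
Proof.
have [f1 f2] := fX0.
have [/andP[q10 q11] /andP[q20 q21] _ _] := argP aX0.
pose A := Num.max (W1 (arg1 X0) / arg1 X0) (W2 (arg2 X0) / arg2 X0).
(* This makes [4 A] times each argument at most [1]; as the slope minus [1] is at most linear by
   [slope_small], it is then at most [1 / 4]. *)
pose X := Num.max (X0 + 1) (Num.max (a * (4 * A)) (b * (4 * A))).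
have h : X0 < X by rewrite lt_max ltrDl ltr01.
have aX := admissible_arg_le aX0 (ltW h).
have [f1' f2'] := finite_slopes_right aX0 fX0 h.
exists X => //; have [/andP[p10 p11] /andP[p20 p21] e1 e2] := argP aX.
have [l1 l2] := arg_decr aX0 h.
have A1 : W1 (arg1 X0) / arg1 X0 <= A by rewrite le_max lexx.
have A2 : W2 (arg2 X0) / arg2 X0 <= A by rewrite le_max lexx orbT.
have w1 := slope_ge1 tr1 (ltW q10) f1; have w2 := slope_ge1 tr2 (ltW q20) f2.
have v1 := slope_ge1 tr1 (ltW p10) f1'; have v2 := slope_ge1 tr2 (ltW p20) f2'.
have A0 : 0 < A by apply: lt_le_trans A1; rewrite divr_gt0//; lra.
have XA1 : a * (4 * A) <= X by rewrite !le_max lexx !orbT.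
have XA2 : b * (4 * A) <= X by rewrite !le_max lexx !orbT.
have k1 : arg1 X * (4 * A) <= 1.
  rewrite -{1}e1 ler_pM2l// (gapE tr1) ?p10// in XA1.
  have g1 : 1 <= G1 X by rewrite (gen_p_ge1 tr1)// ltW.
  rewrite mulrC -ler_pdivlMr// div1r; apply: (le_trans XA1).
  by rewrite lef_pV2 ?posrE ?mulr_gt0 ?ler_peMr//; [exact: ltW | lra].
have k2 : arg2 X * (4 * A) <= 1.
  rewrite -{1}e2 ler_pM2l// (gapE tr2) ?p20// in XA2.
  have g2 : 1 <= G2 X by rewrite (gen_p_ge1 tr2)// ltW.
  rewrite mulrC -ler_pdivlMr// div1r; apply: (le_trans XA2).
  by rewrite lef_pV2 ?posrE ?mulr_gt0 ?ler_peMr//; [exact: ltW | lra].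
have s1 : W1 (arg1 X) - 1 <= 1 / 4.
  have := @slope_small _ _ _ tr1 (arg1 X0) (arg1 X); rewrite p10 ltW// => /(_ isT f1) H.
  apply: (le_trans H); have := ler_wpM2l (ltW p10) A1.
  rewrite mulrBr mulr1; have : 0 <= arg1 X / arg1 X0 by rewrite divr_ge0// ltW.
  have -> : arg1 X / arg1 X0 * W1 (arg1 X0) = arg1 X * (W1 (arg1 X0) / arg1 X0) by ring.
  lra.
have s2 : W2 (arg2 X) - 1 <= 1 / 4.
  have := @slope_small _ _ _ tr2 (arg2 X0) (arg2 X); rewrite p20 ltW// => /(_ isT f2) H.
  apply: (le_trans H); have := ler_wpM2l (ltW p20) A2.
  rewrite mulrBr mulr1; have : 0 <= arg2 X / arg2 X0 by rewrite divr_ge0// ltW.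
  have -> : arg2 X / arg2 X0 * W2 (arg2 X0) = arg2 X * (W2 (arg2 X0) / arg2 X0) by ring.
  lra.
have I (x : R) : 1 <= x -> x - 1 <= 1 / 4 -> 4 / 5 <= x^-1.
  move=> x1 x2; have x0 : 0 < x by lra.
  have t0 : 0 < x^-1 by rewrite invr_gt0.
  have e : x * x^-1 = 1 by rewrite divff// gt_eqF.
  move: (x^-1) t0 e => t t0 e; nra.
rewrite /psi; have := I _ v1 s1; have := I _ v2 s2; lra.
Qed.

Lemma psi_zero : psi X0 < 0 -> exists2 X, X0 < X & psi X = 0.
Proof.
move=> n0; have [X1 h1 h2] := psi_large.
have [X /andP[hX _] eX] : exists2 X, X0 <= X <= X1 & psi_clamped X = 0.
  apply: ivt_pointwise; first exact: ltW.
    by move=> X _; exact: psi_clamped_continuous.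
  by left; rewrite !psi_clampedE ?(ltW h1)// !ltW.
rewrite psi_clampedE// in eX; exists X => //.
by rewrite lt_neqAle hX andbT; apply: contraTneq n0 => ->; rewrite eX ltxx.
Qed.

End Continuity.
End Curve.

(** * Hitting generating functions *)

Lemma ssum_sum (R : realType) (I : Type) (r : seq I) (f : I -> R^nat) :
  (forall i, cvgn (series (f i))) ->
  cvgn (series (fun n => \sum_(i <- r) f i n)) /\
  ssum (fun n => \sum_(i <- r) f i n) = \sum_(i <- r) ssum (f i).
Proof.
move=> cf; elim: r => [|i r [IH1 IH2]].
  have E : series (fun n => \sum_(i <- [::]) f i n) = fun=> 0.
    by apply/funext => n; rewrite /series /=; apply: big1 => k _; rewrite big_nil.
  rewrite big_nil /ssum E; split; first exact: is_cvg_cst.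
  exact: lim_cst.
have E : (fun n => \sum_(j <- i :: r) f j n) = (fun n => f i n + \sum_(j <- r) f j n).
  by apply/funext => n; rewrite big_cons.
by rewrite E big_cons -IH2; exact: ssumD.
Qed.

Section FactorGreen.
Variables (R : realType) (H : groupType) (mu : H -> R) (S : seq H).
Hypotheses (mu_ge0 : forall x, 0 <= mu x) (uS : uniq S).
Hypothesis suppS : forall x, mu x != 0 -> x \in S.
Hypothesis mu1 : \sum_(s <- S) mu s = 1.

Local Notation p := (convolution_pow mu).
Local Notation p0 := (fun n => p n 1%g).
Local Notation u0 := (fun n => taboo mu S n 1%g).

(** If every first return took one step, [p n 1] would be the geometric sequence [u 0 ^ n], with
    ratio below [1] by summability, and all its moments would be finite. *)
Lemma walk_transient_renewal k : cvgn (series p0) ->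
  ~ cvgn (series (fun n => n%:R ^+ k * p0 n)) -> transient_renewal p0 u0.
Proof.
move=> cp nk; have pE := renewal_equation mu_ge0 uS suppS.
have p01 : p 0 1%g = 1 by rewrite /= /unit_mass eqxx.
have p_bnd n : 0 <= p n 1%g <= 1.
  by rewrite (convpow_ge0 mu_ge0 uS suppS) (convpow_le1 mu_ge0 uS suppS mu1).
have u_ge0 n : 0 <= taboo mu S n 1%g by apply: taboo_ge0.
split=> //; apply: contrapT => nu; apply: nk.
have u_eq0 j : (0 < j)%N -> taboo mu S j 1%g = 0.
  move=> j0; apply/eqP; rewrite eq_le u_ge0 andbT leNgt; apply/negP => uj.
  by apply: nu; exists j.
have pX n : p n 1%g = taboo mu S 0 1%g ^+ n.
  elim: n => [|n IH]; first by rewrite p01 expr0.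
  rewrite pE big_ord_recl subn0 IH big1 ?addr0 ?exprS// => i _.
  by rewrite u_eq0// mul0r.
set q := taboo mu S 0 1%g in pX.
have q0 : 0 <= q by exact: u_ge0.
have q1 : q < 1.
  rewrite ltNge; apply/negP => q1.
  have h : p0 @ \oo --> (0 : R) by exact: cvg_series_cvg_0.
  have : p0 @ \oo --> (1 : R).
    apply: (@squeeze_cvgr _ _ _ _ (fun=> 1) (fun=> 1)); try exact: cvg_cst.
    apply: nearW => n; have /andP[_ ->] := p_bnd n; rewrite andbT pX.
    by rewrite exprn_ege1.
  move=> h1; have /eqP : (0 : R) = 1 by apply: cvg_unique h h1.
  by rewrite eq_sym oner_eq0.
rewrite (_ : (fun n => _) = (fun n => n%:R ^+ k * q ^+ n)).
  by apply: cvgn_nat_geometric; rewrite q0.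
by apply/funext => n; rewrite pX.
Qed.

Hypothesis adm : admissible mu.
Hypothesis tr : transient_renewal p0 u0.

Local Notation G := (gen_p p0).
Local Notation U := (gen_u u0).
Local Notation V := (gap u0).

Definition walk_green (s : R) (x : H) : R := ssum (fun n => p n x * s ^+ n).
(** The series counts the visits to [x] before a return to the identity, by last exit. By
    [walk_green_hit] it is the quotient of Green functions [G(1, x) / G(1, 1)], which on a group is
    also the generating function of the first passage to [x]. The value [1] at the identity makes it
    a multiplicative weight on reduced words. *)
Definition hit (s : R) (x : H) : R :=
  if x == 1%g then 1 else ssum (fun n => taboo mu S n x * s ^+ n.+1).

Let p_ge0 n x : 0 <= p n x. Proof. exact: (convpow_ge0 mu_ge0 uS suppS). Qed.
Let t_ge0 n x : 0 <= taboo mu S n x. Proof. exact: (taboo_ge0 S mu_ge0). Qed.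

(** Every visit to [x] is continued to the identity by a fixed path of positive probability, which
    bounds the sum by that of the return probabilities. *)
Lemma cvgn_convpow x : cvgn (series (fun n => p n x)).
Proof.
have [k pk] := adm x^-1%g.
apply: (@series_cvg_bounded _ _ (ssum p0 / p k x^-1%g) _ _).1 => // N.
rewrite ler_pdivlMr// /series /= mulr_suml.
have p00 n : 0 <= p0 n by exact: p_ge0.
apply: le_trans (series_le_ssum (N + k) p00 (tr_cvg tr)).
rewrite /series /=; apply: (@le_trans _ _ (\sum_(0 <= n < N) p (n + k)%N 1%g)).
  by apply: ler_sum => n _; rewrite -(mulgV x); exact: (convpow_mul_le mu_ge0 uS suppS).
rewrite [leRHS](big_cat_nat (n := k))//= ?leq_addl//.
rewrite -[X in \sum_(X <= i < N + k) _]add0n big_addn addnK lerDr.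
exact: sumr_ge0.
Qed.

Lemma cvgn_walk_green s x : 0 <= s <= 1 -> cvgn (series (fun n => p n x * s ^+ n)).
Proof. by move=> s01; have [] := cvgn_series_expr (p_ge0^~ x) (@cvgn_convpow x) s01. Qed.

Lemma taboo_le n x : x != 1%g -> taboo mu S n x <= p n.+1 x.
Proof.
move=> x1; rewrite (taboo_decomposition mu_ge0 uS suppS) x1 mul1r lerDr.
by apply: sumr_ge0 => k _; rewrite mulr_ge0.
Qed.

Lemma cvgn_taboo s x : x != 1%g -> 0 <= s <= 1 ->
  cvgn (series (fun n => taboo mu S n x * s ^+ n.+1)).
Proof.
move=> x1 s01; have h : cvgn (series (fun n => taboo mu S n x)).
  apply: (@series_le_cvg _ _ (fun n => p n.+1 x)) => // [n|]; first exact: taboo_le.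
  apply: (@series_cvg_bounded _ _ (ssum (fun n => p n x)) _ _).1 => // N.
  apply: le_trans (series_le_ssum N.+1 (p_ge0^~ x) (@cvgn_convpow x)).
  by rewrite /series /= [leRHS]big_nat_recl// lerDr.
by have [] := cvgn_series_expr (t_ge0^~ x) h s01.
Qed.

(* A walk from [1] to [x] is a loop followed by an excursion to [x] that does
   not return to [1]. *)
Lemma walk_green_hit s x : 0 <= s <= 1 -> walk_green s x = hit s x * G s.
Proof.
move=> s01; rewrite /hit; case: ifPn => [/eqP ->|x1]; first by rewrite mul1r.
have /andP[s0 _] := s01.
have cg := @cvgn_walk_green s x s01; have cu := cvgn_gen_u tr s01.
have ct := cvgn_taboo x1 s01.
have h := cauchy_product (fun n => mulr_ge0 (t_ge0 n 1%g) (exprn_ge0 n.+1 s0))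
  (fun n => mulr_ge0 (p_ge0 n x) (exprn_ge0 n s0)) cu cg.
have E : (fun N => series (fun n => p n x * s ^+ n) N.+1) =
   (fun N => series (fun n => \sum_(k < n.+1) taboo mu S k 1%g * s ^+ k.+1 *
      (p (n - k)%N x * s ^+ (n - k))) N + series (fun n => taboo mu S n x * s ^+ n.+1) N).
  apply/funext => N; rewrite /series /= big_nat_recl// -big_split /=.
  rewrite {1}/unit_mass (negPf x1) mul0r add0r; apply: eq_big_nat => n _.
  rewrite -[convolution _ _ _]/(p n.+1 x) (taboo_decomposition mu_ge0 uS suppS) x1 mul1r.
  rewrite mulrDl mulr_suml; congr (_ + _).
  apply: eq_bigr => -[k /= kn] _; rewrite (_ : n.+1 = k.+1 + (n - k))%N; last by lia.
  by rewrite exprD; ring.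
have h1 : (fun N => series (fun n => p n x * s ^+ n) N.+1) @ \oo -->
    U s * walk_green s x + ssum (fun n => taboo mu S n x * s ^+ n.+1).
  by rewrite E; apply: cvgD; [exact: h | exact: ct].
have h2 : (fun N => series (fun n => p n x * s ^+ n) N.+1) @ \oo --> walk_green s x.
  by move: cg; rewrite -(cvg_shiftS).
have := cvg_unique _ h1 h2; move=> /(_ (@norm_hausdorff _ _)) e.
have e1 := gen_pu tr s01.
rewrite -[LHS]mulr1 -e1 mulrA [walk_green s x * _]mulrC -mulrA mulrC; congr (_ * _).
by rewrite mulrBr mulr1 -{1}e; ring.
Qed.

Lemma hit1 s : hit s 1%g = 1. Proof. by rewrite /hit eqxx. Qed.

Lemma hit_ge0 s x : 0 <= s <= 1 -> 0 <= hit s x.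
Proof.
move=> s01; rewrite /hit; case: ifPn => // x1; apply: ssum_ge0; last exact: cvgn_taboo.
by move=> n; have /andP[s0 _] := s01; rewrite mulr_ge0 ?exprn_ge0.
Qed.

Lemma hit_le s t x : 0 <= s -> s <= t -> t <= 1 -> hit s x <= hit t x.
Proof.
move=> s0 st t1; rewrite /hit; case: ifPn => // x1.
have s01 : 0 <= s <= 1 by rewrite s0 (le_trans st).
have t01 : 0 <= t <= 1 by rewrite (le_trans s0 st).
apply: ssum_le; try exact: cvgn_taboo.
move=> n; apply: ler_wpM2l => //; apply: lerXn2r; rewrite ?nnegrE//.
exact: le_trans st.
Qed.

(** The resolvent equation of the factor divided by its Green function at the identity: the defect
    at the identity becomes [1 / (s * G s)], which is [gap s]. *)
Lemma step_hit s x : 0 < s <= 1 ->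
  step mu S (hit s) x = hit s x / s - (x == 1%g)%:R * V s.
Proof.
move=> s01; have /andP[s0 s1] := s01; have s01' : 0 <= s <= 1 by rewrite ltW.
have g := gen_p_gt0 tr s01'.
have hE y : hit s y = walk_green s y / G s by rewrite walk_green_hit// mulfK// gt_eqF.
have sg : s * step mu S (walk_green s) x = walk_green s x - (x == 1%g)%:R.
  have c y : cvgn (series (fun n => p n y * s ^+ n)) by exact: cvgn_walk_green.
  have [c1 e1] := @ssum_sum R H S (fun t n => mu t * (p n (t^-1 * x)%g * s ^+ n))
    (fun t => (ssumZ (mu t) (c (t^-1 * x)%g)).1).
  have e2 : step mu S (walk_green s) x = ssum (fun n => p n.+1 x * s ^+ n).
    rewrite /step /walk_green; under eq_bigr => t _ do rewrite -(ssumZ (mu t) (c _)).2.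
    rewrite -e1; apply: ssum_eq => n; rewrite (convpowSl mu_ge0 uS suppS) /step mulr_suml.
    by apply: eq_bigr => t _; rewrite mulrA.
  have c3 : cvgn (series (fun n => p n.+1 x * s ^+ n)).
    rewrite (_ : (fun n => _) = (fun n => \sum_(t <- S) mu t * (p n (t^-1 * x)%g * s ^+ n)))//.
    apply/funext => n; rewrite (convpowSl mu_ge0 uS suppS) /step mulr_suml.
    by apply: eq_bigr => t _; rewrite mulrA.
  have [_ e4] := ssumZ s c3; rewrite e2 -e4.
  have h1 : (fun N => series (fun n => p n x * s ^+ n) N.+1) @ \oo --> walk_green s x.
    by move: (c x); rewrite -(cvg_shiftS).
  have h2 : (fun N => series (fun n => p n x * s ^+ n) N.+1 - (x == 1%g)%:R) @ \oo -->
     walk_green s x - (x == 1%g)%:R by apply: cvgB => //; exact: cvg_cst.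
  apply: cvg_lim => //; move: h2; rewrite (_ : (fun N => _) = series (fun n => s * (p n.+1 x * s ^+ n)))//.
  apply/funext => N.
  rewrite /series /= big_nat_recl//= /unit_mass expr0 mulr1 addrC addKr.
  by apply: eq_bigr => n _; rewrite exprS; ring.
have -> : step mu S (hit s) x = step mu S (walk_green s) x / G s.
  by rewrite /step mulr_suml; apply: eq_bigr => t _; rewrite hE mulrA.
rewrite hE (gapE tr)//.
have -> : step mu S (walk_green s) x = (walk_green s x - (x == 1%g)%:R) / s.
  by rewrite -sg mulrC mulKf// gt_eqF.
by field; rewrite !gt_eqF.
Qed.

Lemma sum_convpow_le1 n (A : seq H) : uniq A -> \sum_(x <- A) p n x <= 1.
Proof.
move=> uA; rewrite -(sum_convpow mu_ge0 uS suppS mu1 n).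
rewrite (bigID (mem (walk_support S n))) /= [X in _ + X]big1 ?addr0; last first.
  move=> x xn; apply/eqP; apply: contraNT xn => pn.
  exact: (walk_supportP mu_ge0 uS suppS).
rewrite -big_filter; apply: (@le_trans _ _ (\sum_(x <- walk_support S n | x \in A) p n x)).
  rewrite -[leRHS]big_filter le_eqVlt; apply/orP; left; apply/eqP; apply: perm_big.
  apply: uniq_perm; rewrite ?filter_uniq// ?uniq_walk_support// => x.
  by rewrite !mem_filter andbC.
by rewrite big_mkcond /=; apply: ler_sum => x _; case: ifP.
Qed.

(** Summed over [A], the Green function is at most the geometric series of [s ^ n], as each [p n]
    has total mass [1], and [G s >= 1]. Strict inequality [s < 1] is what makes the triangle sums
    finite. *)
Lemma sum_hit_le s (A : seq H) : 0 <= s < 1 -> uniq A ->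
  \sum_(x <- A) hit s x <= (1 - s)^-1.
Proof.
move=> /andP[s0 s1] uA; have s01 : 0 <= s <= 1 by rewrite s0 ltW.
have g := gen_p_ge1 tr s01.
have g0 : 0 <= \sum_(x <- A) hit s x by apply: sumr_ge0 => x _; exact: hit_ge0.
apply: (@le_trans _ _ ((\sum_(x <- A) hit s x) * G s)); first by rewrite ler_peMr.
have [c e] := @ssum_sum R H A (fun x n => p n x * s ^+ n) (fun x => @cvgn_walk_green s x s01).
rewrite mulr_suml; under eq_bigr => x _ do rewrite -walk_green_hit//.
rewrite -e.
have n1 : `|s| < 1 by rewrite ger0_norm.
have E : (fun n : nat => s ^+ n) = geometric 1 s.
  by apply/funext => n; rewrite /geometric /= mul1r.
have cs' : cvgn (series (fun n : nat => s ^+ n)) by rewrite E; exact: is_cvg_geometric_series.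
have <- : ssum (fun n : nat => s ^+ n) = (1 - s)^-1.
  by rewrite /ssum E (cvg_lim _ (cvg_geometric_series n1))// mul1r.
apply: ssum_le => // n; rewrite -mulr_suml ler_piMl ?exprn_ge0//.
exact: sum_convpow_le1.
Qed.

Lemma hit_ge s x N : 0 <= s <= 1 ->
  series (fun n => p n x * s ^+ n) N <= hit s x * G s.
Proof.
move=> s01; rewrite -walk_green_hit//; apply: series_le_ssum; last exact: cvgn_walk_green.
by move=> n; have /andP[s0 _] := s01; rewrite mulr_ge0 ?exprn_ge0.
Qed.

End FactorGreen.

(** * The Green function of the free product *)

Section FreeProductWords.
Variables G1 G2 : groupType.
Local Notation Gamma := (free_product G1 G2).

Lemma fp_letter_mul (a : G1 + G2) (w : Gamma) :
  fp_word (fp_letter a * w)%g = push a (fp_word w).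
Proof. by rewrite /= word_mul_push//; exact: fp_reduced. Qed.

Lemma fp_inlV (x : G1) : (fp_inl G2 x)^-1%g = fp_inl G2 x^-1%g.
Proof.
have [f1 fM] := fp_inl_morphism G1 G2.
by apply: (mulgI (fp_inl G2 x)); rewrite mulgV -fM mulgV f1.
Qed.

Lemma fp_inrV (y : G2) : (fp_inr G1 y)^-1%g = fp_inr G1 y^-1%g.
Proof.
have [f1 fM] := fp_inr_morphism G1 G2.
by apply: (mulgI (fp_inr G1 y)); rewrite mulgV -fM mulgV f1.
Qed.

Lemma fp_inl_inj : injective (@fp_inl G1 G2).
Proof.
move=> x y /(congr1 (fun w : Gamma => fp_word w)) /=; rewrite /push /=.
by case: ifPn => [/eqP ->|_]; case: ifPn => [/eqP ->|_] // [].
Qed.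

Lemma fp_inr_inj : injective (@fp_inr G1 G2).
Proof.
move=> x y /(congr1 (fun w : Gamma => fp_word w)) /=; rewrite /push /=.
by case: ifPn => [/eqP ->|_]; case: ifPn => [/eqP ->|_] // [].
Qed.

End FreeProductWords.

Lemma push_measureE (R : realType) (H G : groupType) (i : H -> G) (mu : H -> R)
    (S : seq H) y : (forall x, 0 <= mu x) -> uniq S ->
  (forall x, mu x != 0 -> x \in S) ->
  push_measure i mu y = \sum_(x <- S) (i x == y)%:R * mu x.
Proof.
move=> mu0 uS suppS; rewrite /push_measure esum_mkcond.
rewrite -(@fine_esum_seq _ _ (fun x => (i x == y)%:R * mu x) S)//.
- congr fine; apply: eq_esum => x _; 
  case: ifPn => [|]; first by rewrite inE /= => ->; rewrite eqxx mul1r.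
  by rewrite notin_setE /= => /eqP/negPf ->; rewrite mul0r.
- by move=> x; rewrite mulr_ge0.
- by move=> x; rewrite mulf_eq0 negb_or => /andP[_ /suppS].
Qed.

Lemma push_measure_inj (R : realType) (H G : groupType) (i : H -> G) (mu : H -> R)
    (S : seq H) x : injective i -> (forall x, 0 <= mu x) -> uniq S ->
  (forall x, mu x != 0 -> x \in S) -> push_measure i mu (i x) = mu x.
Proof.
move=> inj_i mu0 uS suppS; rewrite (push_measureE _ _ mu0 uS suppS).
have [xS|xS] := boolP (x \in S).
  rewrite (bigD1_seq x)//= eqxx mul1r big1 ?addr0// => y yx.
  by rewrite (inj_eq inj_i) (negPf yx) mul0r.
have mx : mu x = 0 by apply/eqP; apply: contraNT xS; exact: suppS.
rewrite mx big1// => y _; rewrite (inj_eq inj_i).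
by case: eqP => [->|_]; rewrite ?mx ?mulr0// mul0r.
Qed.

Lemma push_measure_sym (R : realType) (H G : groupType) (i : H -> G) (mu : H -> R)
    (S : seq H) : injective i -> (forall x, (i x)^-1%g = i x^-1%g) ->
  (forall x, 0 <= mu x) -> uniq S ->
  (forall x, mu x != 0 -> x \in S) -> symmetric_measure mu ->
  symmetric_measure (push_measure i mu).
Proof.
move=> inj_i iV mu0 uS suppS sym_mu w.
have [[x xw]|nw] := pselect (exists x, i x = w).
  by rewrite -xw iV !(push_measure_inj _ inj_i mu0 uS suppS) -sym_mu.
rewrite !(push_measureE _ _ mu0 uS suppS) !big1// => x _.
- case: eqP => [e|_]; last by rewrite mul0r.
  by case: nw; exists x^-1%g; rewrite -iV e invgK.
- case: eqP => [e|_]; last by rewrite mul0r.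
  by case: nw; exists x.
Qed.

Section FreeProductGreen.
Variables (R : realType) (G1 G2 : groupType) (mu1 : G1 -> R) (mu2 : G2 -> R).
Variables (S1 : seq G1) (S2 : seq G2) (a : R).
Hypotheses (mu1_ge0 : forall x, 0 <= mu1 x) (mu2_ge0 : forall x, 0 <= mu2 x).
Hypotheses (uS1 : uniq S1) (uS2 : uniq S2).
Hypothesis suppS1 : forall x, mu1 x != 0 -> x \in S1.
Hypothesis suppS2 : forall x, mu2 x != 0 -> x \in S2.
Hypotheses (mu1_1 : \sum_(s <- S1) mu1 s = 1) (mu2_1 : \sum_(s <- S2) mu2 s = 1).
Hypothesis a01 : 0 < a < 1.

Local Notation Gamma := (free_product G1 G2).
Local Notation mu := (mixture mu1 mu2 a).
Local Notation b := (1 - a).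
Local Notation p := (convolution_pow mu).

Let a0 : 0 < a. Proof. by case/andP: a01. Qed.
Let b0 : 0 < b. Proof. by rewrite subr_gt0; case/andP: a01. Qed.

Definition mixture_support : seq Gamma :=
  undup (map (@fp_inl G1 G2) S1 ++ map (@fp_inr G1 G2) S2).
Local Notation S := mixture_support.

Lemma mixtureE w : mu w = a * \sum_(x <- S1) (fp_inl G2 x == w)%:R * mu1 x +
  b * \sum_(y <- S2) (fp_inr G1 y == w)%:R * mu2 y.
Proof.
by rewrite /mixture (push_measureE _ _ mu1_ge0 uS1 suppS1)
  (push_measureE _ _ mu2_ge0 uS2 suppS2).
Qed.

Lemma mixture_ge0 w : 0 <= mu w.
Proof.
rewrite mixtureE; apply: addr_ge0; apply: mulr_ge0; try exact: ltW.
all: by apply: sumr_ge0 => x _; rewrite mulr_ge0.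
Qed.

Lemma uniq_mixture_support : uniq S. Proof. exact: undup_uniq. Qed.

Lemma mixture_supportP w : mu w != 0 -> w \in S.
Proof.
rewrite mixtureE mem_undup mem_cat; apply: contraNT; rewrite negb_or => /andP[w1 w2].
rewrite !big1_seq ?mulr0 ?addr0//.
- move=> y /andP[_ yS]; case: eqP => [e|]; last by rewrite mul0r.
  by rewrite -e map_f in w2.
- move=> x /andP[_ xS]; case: eqP => [e|]; last by rewrite mul0r.
  by rewrite -e map_f in w1.
Qed.

Lemma step_mixture f w : step mu S f w =
  a * \sum_(x <- S1) mu1 x * f (fp_inl G2 x^-1%g * w)%g +
  b * \sum_(y <- S2) mu2 y * f (fp_inr G1 y^-1%g * w)%g.
Proof.
rewrite /step; under eq_bigr => s _ do rewrite mixtureE mulrDl.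
rewrite big_split /=; congr (_ + _).
- under eq_bigr => s _ do rewrite -mulrA mulr_suml.
  rewrite -mulr_sumr; congr (_ * _); rewrite exchange_big /=; apply: eq_big_seq => x xS.
  rewrite (bigD1_seq (fp_inl G2 x)) ?uniq_mixture_support//=; last first.
    by rewrite mem_undup mem_cat map_f.
  rewrite eqxx mul1r fp_inlV big1 ?addr0// => s sx.
  by rewrite eq_sym (negPf sx) !mul0r.
- under eq_bigr => s _ do rewrite -mulrA mulr_suml.
  rewrite -mulr_sumr; congr (_ * _); rewrite exchange_big /=; apply: eq_big_seq => x xS.
  rewrite (bigD1_seq (fp_inr G1 x)) ?uniq_mixture_support//=; last first.
    by rewrite mem_undup mem_cat map_f ?orbT.
  rewrite eqxx mul1r fp_inrV big1 ?addr0// => s sx.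
  by rewrite eq_sym (negPf sx) !mul0r.
Qed.

Lemma sum_mixture : \sum_(s <- S) mu s = 1.
Proof.
have := step_mixture (fun=> 1) 1%g; rewrite /step.
under eq_bigr do rewrite mulr1.
under [X in a * X]eq_bigr do rewrite mulr1.
under [X in b * X]eq_bigr do rewrite mulr1.
by rewrite mu1_1 mu2_1 => ->; rewrite !mulr1 addrC subrK.
Qed.

Lemma mixture_symmetric : symmetric_measure mu1 -> symmetric_measure mu2 ->
  symmetric_measure mu.
Proof.
move=> s1 s2 w; rewrite /mixture; congr (_ * _ + _ * _).
- exact: (push_measure_sym (@fp_inl_inj G1 G2) (@fp_inlV G1 G2) mu1_ge0 uS1 suppS1).
- exact: (push_measure_sym (@fp_inr_inj G1 G2) (@fp_inrV G1 G2) mu2_ge0 uS2 suppS2).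
Qed.

Local Notation q1 := (fun n => convolution_pow mu1 n 1%g).
Local Notation q2 := (fun n => convolution_pow mu2 n 1%g).
Local Notation u1 := (fun n => taboo mu1 S1 n 1%g).
Local Notation u2 := (fun n => taboo mu2 S2 n 1%g).

Hypotheses (adm1 : admissible mu1) (adm2 : admissible mu2).
Hypotheses (tr1 : transient_renewal q1 u1) (tr2 : transient_renewal q2 u2).

Local Notation arg1 := (arg1 u1 a).
Local Notation arg2 := (arg2 u2 b).
Local Notation zz := (zz u1 u2 a b).
Local Notation admissible_arg := (admissible_arg u1 u2 a b).

Definition word_weight (s1 s2 : R) (w : seq (G1 + G2)) : R :=
  \prod_(c <- w) match c with
    | inl x => hit mu1 S1 s1 x | inr y => hit mu2 S2 s2 y end.

Local Notation Phi X w := (word_weight (arg1 X) (arg2 X) (fp_word w)).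

Lemma word_weight_nil s1 s2 : word_weight s1 s2 [::] = 1.
Proof. by rewrite /word_weight big_nil. Qed.

Lemma word_weight_cons s1 s2 c w : word_weight s1 s2 (c :: w) =
  match c with inl x => hit mu1 S1 s1 x | inr y => hit mu2 S2 s2 y end *
  word_weight s1 s2 w.
Proof. by rewrite /word_weight big_cons. Qed.

(** Cancellation, merging and trivial letters all obey one formula because the weight of the
    identity is [1]. *)
Lemma word_weight_push s1 s2 c w : word_weight s1 s2 (push c w) =
  match c, w with
  | inl x, inl x' :: t => hit mu1 S1 s1 (x * x')%g * word_weight s1 s2 t
  | inr y, inr y' :: t => hit mu2 S2 s2 (y * y')%g * word_weight s1 s2 t
  | inl x, _ => hit mu1 S1 s1 x * word_weight s1 s2 w
  | inr y, _ => hit mu2 S2 s2 y * word_weight s1 s2 w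
  end.
Proof.
rewrite /push; case: c => x /=; case: ifPn => [/eqP ->|x1].
- by case: w => [|[x'|y'] t]; rewrite ?hit1 ?mul1r ?mul1g ?word_weight_cons.
- case: w => [|[x'|y'] t] /=; rewrite ?word_weight_cons//.
  by case: ifPn => [/eqP ->|_]; rewrite ?hit1 ?mul1r// word_weight_cons.
- by case: w => [|[x'|y'] t]; rewrite ?hit1 ?mul1r ?mul1g ?word_weight_cons.
- case: w => [|[x'|y'] t] /=; rewrite ?word_weight_cons//.
  by case: ifPn => [/eqP ->|_]; rewrite ?hit1 ?mul1r// word_weight_cons.
Qed.

Section Argument.
Variable X : R.
Hypothesis aX : admissible_arg X.

(* [Phi] is, up to a factor, the Green function at [1 / zz X]: the resolvent
   equation holds because the terms [gap] produced by the two factors are both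
   equal to [X] and cancel except at the empty word. *)
Lemma step_word_weight w :
  step mu S (fun w : Gamma => Phi X w) w = zz X * Phi X w - (w == 1%g)%:R * X.
Proof.
have [i1 i2 e1 e2] := argP tr1 tr2 a0 b0 aX.
have h1 := step_hit mu1_ge0 uS1 suppS1 adm1 tr1 _ i1.
have h2 := step_hit mu2_ge0 uS2 suppS2 adm2 tr2 _ i2.
rewrite step_mixture.
under [X in a * X]eq_bigr do rewrite fp_letter_mul word_weight_push.
under [X in b * X]eq_bigr do rewrite fp_letter_mul word_weight_push.
have -> : (w == 1%g) = (fp_word w == [::]) by [].
rewrite zz_args; case: w => -[|[x|y] t] rw /=.
- under [X in a * X]eq_bigr do rewrite word_weight_nil mulr1 -[_^-1%g]mulg1.
  under [X in b * X]eq_bigr do rewrite word_weight_nil mulr1 -[_^-1%g]mulg1.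
  rewrite -/(step mu1 S1 _ _) -/(step mu2 S2 _ _) h1 h2 !eqxx !hit1 word_weight_nil.
  by rewrite !mul1r !mulrBr e1 e2 mulr1; ring.
- have x1 : x != 1%g by case/andP: rw.
  under [X in a * X]eq_bigr do rewrite mulrA.
  under [X in b * X]eq_bigr do rewrite -[_^-1%g]mulg1 mulrA.
  rewrite -!mulr_suml -/(step mu1 S1 _ _) -/(step mu2 S2 _ _) h1 h2 eqxx (negPf x1) !hit1.
  rewrite word_weight_cons; clear h1 h2 i1 i2.
  move: (gap u1 (arg1 X)) (gap u2 (arg2 X)) (hit _ _ _ x) (word_weight _ _ t)
    (arg1 X)^-1 (arg2 X)^-1 e1 e2 => g1 g2 h Wt s1 s2 e1 e2.
  by rewrite -e2 /=; ring.
- have y1 : y != 1%g by case/andP: rw.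
  under [X in a * X]eq_bigr do rewrite -[_^-1%g]mulg1 mulrA.
  under [X in b * X]eq_bigr do rewrite mulrA.
  rewrite -!mulr_suml -/(step mu1 S1 _ _) -/(step mu2 S2 _ _) h1 h2 eqxx (negPf y1) !hit1.
  rewrite word_weight_cons; clear h1 h2 i1 i2.
  move: (gap u1 (arg1 X)) (gap u2 (arg2 X)) (hit _ _ _ y) (word_weight _ _ t)
    (arg1 X)^-1 (arg2 X)^-1 e1 e2 => g1 g2 h Wt s1 s2 e1 e2.
  by rewrite -e1 /=; ring.
Qed.

Let T := step mu S.

(** Iterating [T Phi = z Phi - X delta] produces the convolution powers one after another, with
    remainder [T^n Phi / z^n]. This holds everywhere on the curve, whether [z] increases or not. *)
Lemma green_partial_sum n w : series (fun k => p k w * (zz X)^-1 ^+ k) n =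
  zz X / X * (Phi X w - (zz X)^-1 ^+ n * iter n T (fun w => Phi X w) w).
Proof.
have z0 := zz_gt0 tr1 tr2 a0 b0 aX; have X0 := arg_pos tr1 tr2 a0 b0 aX.
elim: n => [|n IH]; first by rewrite /series /= big_geq// expr0 mul1r subrr mulr0.
rewrite seriesSr IH.
have -> : iter n.+1 T (fun w => Phi X w) w = zz X * iter n T (fun w => Phi X w) w - X * p n w.
  rewrite iterSr.
  have e : T (fun w => Phi X w) =1 (fun w => zz X * Phi X w + (- X) * p 0 w).
    by move=> v; rewrite /T step_word_weight /= /unit_mass; ring.
  rewrite (eq_iter_step _ _ _ e) iter_step_lin mulNr.
  by rewrite -(convpow_add mixture_ge0 uniq_mixture_support mixture_supportP) addn0.
rewrite exprS; field.
by rewrite !gt_eqF.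
Qed.

Lemma word_weight_ge0 w : 0 <= Phi X w.
Proof.
have [/andP[i1 i1'] /andP[i2 i2'] _ _] := argP tr1 tr2 a0 b0 aX.
rewrite /word_weight; apply: prodr_ge0 => -[x|y] _.
- by apply: (hit_ge0 mu1_ge0 uS1 suppS1 adm1 tr1); rewrite ltW.
- by apply: (hit_ge0 mu2_ge0 uS2 suppS2 adm2 tr2); rewrite ltW.
Qed.

Lemma green_le n w : series (fun k => p k w * (zz X)^-1 ^+ k) n <= zz X / X * Phi X w.
Proof.
have z0 := zz_gt0 tr1 tr2 a0 b0 aX; have X0 := arg_pos tr1 tr2 a0 b0 aX.
rewrite green_partial_sum ler_pM2l ?divr_gt0// gerBl mulr_ge0 ?exprn_ge0 ?invr_ge0 ?(ltW z0)//.
by apply: (iter_step_ge0 _ mixture_ge0) => v; exact: word_weight_ge0.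
Qed.

End Argument.

Lemma word_weight_le X Y w : admissible_arg X -> X < Y -> Phi Y w <= Phi X w.
Proof.
move=> aX XY; have aY := admissible_arg_le aX (ltW XY).
have [l1 l2] := arg_decr tr1 tr2 a0 b0 aX XY.
have [/andP[i1 i1'] /andP[i2 i2'] _ _] := argP tr1 tr2 a0 b0 aX.
have [/andP[j1 j1'] /andP[j2 j2'] _ _] := argP tr1 tr2 a0 b0 aY.
rewrite /word_weight; apply: ler_prod => -[x|y] _.
- rewrite (hit_ge0 mu1_ge0 uS1 suppS1 adm1 tr1) ?(ltW j1)//=.
  by apply: (hit_le mu1_ge0 uS1 suppS1 adm1 tr1) => //; exact: ltW.
- rewrite (hit_ge0 mu2_ge0 uS2 suppS2 adm2 tr2) ?(ltW j2)//=.
  by apply: (hit_le mu2_ge0 uS2 suppS2 adm2 tr2) => //; exact: ltW.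
Qed.

(** The remainder tends to [0]: [Phi Y <= Phi X], and [T^n Phi X <= z(X)^n Phi X] since the partial
    sums at [X] are nonnegative, so it is at most [Phi X] times [(z(X) / z(Y))^n]. Some [X < Y] with
    smaller [z] is what separates the true Green function from other solutions of the resolvent
    equation. *)
Lemma green_eq X Y w : admissible_arg X -> X < Y -> zz X < zz Y ->
  series (fun k => p k w * (zz Y)^-1 ^+ k) @ \oo --> zz Y / Y * Phi Y w.
Proof.
move=> aX XY zXY; have aY := admissible_arg_le aX (ltW XY).
have zX0 := zz_gt0 tr1 tr2 a0 b0 aX; have zY0 := zz_gt0 tr1 tr2 a0 b0 aY.
have X0 := arg_pos tr1 tr2 a0 b0 aX.
have -> : series (fun k => p k w * (zz Y)^-1 ^+ k) = (fun n => zz Y / Y *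
   (Phi Y w - (zz Y)^-1 ^+ n * iter n (step mu S) (fun w => Phi Y w) w)).
  by apply/funext => n; rewrite green_partial_sum.
rewrite (_ : zz Y / Y * Phi Y w = zz Y / Y * (Phi Y w - 0)); last by rewrite subr0.
apply: cvgM; first exact: cvg_cst.
apply: cvgB; first exact: cvg_cst.
apply: (@squeeze_cvgr _ _ _ _ (fun=> 0) (fun n => Phi X w * (zz X / zz Y) ^+ n)).
- apply: nearW => n.
  have it0 m : 0 <= iter m (step mu S) (fun w => Phi Y w) w.
    by apply: (iter_step_ge0 _ mixture_ge0) => v; exact: word_weight_ge0.
  rewrite mulr_ge0 ?exprn_ge0 ?invr_ge0 ?(ltW zY0)//=.
  rewrite expr_div_n mulrCA -exprVn mulrA mulrC ler_pM2r ?exprn_gt0 ?invr_gt0//.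
  apply: (@le_trans _ _ (iter n (step mu S) (fun w => Phi X w) w)).
    by apply: (iter_step_le _ mixture_ge0) => v; exact: word_weight_le.
  have := green_le aX n w; have := green_partial_sum aX n w.
  have s0 : 0 <= series (fun k => p k w * (zz X)^-1 ^+ k) n.
    rewrite /series /=; apply: sumr_ge0 => k _; rewrite mulr_ge0 ?exprn_ge0 ?invr_ge0 ?(ltW zX0)//.
    exact: (convpow_ge0 mixture_ge0 uniq_mixture_support mixture_supportP).
  move=> e _; rewrite e pmulr_rge0 ?divr_gt0// subr_ge0 exprVn mulrC ler_pdivrMr ?exprn_gt0// in s0.
  by rewrite mulrC.
- exact: cvg_cst.
- rewrite (_ : 0 = Phi X w * 0); last by rewrite mulr0.
  apply: cvgM; first exact: cvg_cst.
  apply: cvg_expr; rewrite ger0_norm ?divr_ge0 ?(ltW zX0) ?(ltW zY0)//.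
  by rewrite ltr_pdivrMr// mul1r.
Qed.

End FreeProductGreen.

(** * Spectral radius *)

Section SpectralRadius.
Variables (R : realType) (G : groupType) (mu : G -> R).
Local Notation p := (fun n => convolution_pow mu n 1%g).
Hypothesis p01 : forall n, 0 <= p n <= 1.

Local Notation root n := (p n `^ n%:R^-1).

Let p_ge0 n : 0 <= p n. Proof. by have /andP[] := p01 n. Qed.

Lemma root_le (c : R) n : (0 < n)%N -> 0 <= c -> (root n <= c) = (p n <= c ^+ n).
Proof.
move=> n0 c0; have nR : (n%:R : R) != 0 by rewrite pnatr_eq0 -lt0n.
have E (x : R) : 0 <= x -> x = (x ^+ n) `^ n%:R^-1.
  by move=> x0; rewrite -powR_mulrn// -powRrM divff// powRr1.
have F : root n ^+ n = p n.
  by rewrite -powR_mulrn ?powR_ge0// -powRrM mulVf// powRr1.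
apply/idP/idP => h.
- by rewrite -F; apply: lerXn2r => //; rewrite nnegrE ?powR_ge0.
- rewrite [leRHS]E//; apply: ge0_ler_powR => //; rewrite ?nnegrE ?exprn_ge0//.
Qed.

Lemma root_bounded : bounded_fun (fun n => root n).
Proof.
exists 1; split => // x x1 n _ /=; rewrite ger0_norm ?powR_ge0//.
(* At index [0] the exponent is the inverse of [0], that is [0], and the root is [1]. *)
apply: le_trans (ltW x1); case: n => [|n]; first by rewrite invr0 powRr0.
by rewrite root_le// expr1n; have /andP[] := p01 n.+1.
Qed.

Let ub_drop n : has_ubound (sdrop (fun n => root n) n).
Proof.
have [M [_ h]] := root_bounded.
exists (`|M| + 1) => _ [k _ <-]; apply: (le_trans (ler_norm _)); apply: h => //.
by rewrite (le_lt_trans (ler_norm _))// ltrDl.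
Qed.

Lemma spectral_radius_le (c : R) N : 0 <= c ->
  (forall n, (N <= n)%N -> p n <= c ^+ n) -> spectral_radius mu <= c.
Proof.
move=> c0 h; rewrite /spectral_radius limn_supE; last exact: root_bounded.
apply: (@le_trans _ _ (sups (fun n => root n) N.+1)).
  apply: ge_inf; last by exists N.+1.
  exact: bounded_fun_has_lbound_sups root_bounded.
apply: ge_sup; first by exists (root N.+1); exists N.+1 => /=.
move=> _ [k /= Nk <-]; rewrite root_le//; last exact: leq_trans Nk.
by apply: h; exact: ltnW.
Qed.

Lemma spectral_radius_lt (c : R) : 0 <= c -> spectral_radius mu < c ->
  exists N, forall n, (N <= n)%N -> p n <= c ^+ n.
Proof.
move=> c0; rewrite /spectral_radius limn_supE; last exact: root_bounded.
move=> /inf_lt -[|_ [N _ <-] hN]; first by exists (sups (fun n => root n) 0); exists 0%N.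
exists N.+1 => n Nn; rewrite -root_le//; last exact: leq_trans Nn.
apply: le_trans (ltW hN); apply: ub_le_sup; first exact: ub_drop.
by exists n => //=; exact: ltnW.
Qed.

Lemma spectral_radius_series (r : R) k : 0 < r -> spectral_radius mu < r^-1 ->
  cvgn (series (fun n => n%:R ^+ k * p n * r ^+ n)).
Proof.
(* The maximum with [r^-1 / 2] keeps [c] positive whatever the sign of the spectral radius; in both
   cases [c] stays strictly below [r^-1]. *)
move=> r0 h; pose c := Num.max (r^-1 / 2) ((spectral_radius mu + r^-1) / 2).
have ri : 0 < r^-1 by rewrite invr_gt0.
have c0 : 0 < c by rewrite lt_max; apply/orP; left; lra.
have c1 : spectral_radius mu < c by rewrite lt_max; apply/orP; right; lra.
have c2 : c < r^-1 by rewrite gt_max; apply/andP; split; lra.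
have [N hN] := spectral_radius_lt (ltW c0) c1.
have q1 : 0 <= c * r < 1.
  by rewrite mulr_ge0 ?(ltW c0) ?(ltW r0)//= -ltr_pdivlMr// div1r.
have t0 n : 0 <= n%:R ^+ k * p n * r ^+ n.
  by rewrite !mulr_ge0 ?exprn_ge0 ?ler0n ?(ltW r0).
have B n : n%:R ^+ k * p n * r ^+ n <=
   (n%:R ^+ k * (c * r) ^+ n) + (n < N)%:R * (n%:R ^+ k * p n * r ^+ n).
  have [nN|Nn] := ltnP n N.
    by rewrite mul1r lerDr mulr_ge0 ?exprn_ge0//; case/andP: q1.
  rewrite mul0r addr0 exprMn mulrA; apply: ler_wpM2r; first by rewrite exprn_ge0 ?(ltW r0).
  by apply: ler_wpM2l; [exact: exprn_ge0 | exact: hN].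
have c3 : cvgn (series (fun n => (n < N)%:R * (n%:R ^+ k * p n * r ^+ n))).
  apply: (@series_cvg_bounded _ _ (\sum_(0 <= n < N) n%:R ^+ k * p n * r ^+ n) _ _).1.
    by move=> n; rewrite mulr_ge0.
  move=> M; rewrite /series /=; have [MN|NM] := leqP M N.
    apply: (@le_trans _ _ (\sum_(0 <= n < M) n%:R ^+ k * p n * r ^+ n)).
      by apply: ler_sum => n _; case: (n < N)%N; rewrite ?mul1r ?mul0r.
    rewrite [leRHS](big_cat_nat (n := M))//= lerDl.
    by apply: sumr_ge0 => n _; exact: t0.
  rewrite (big_cat_nat (n := N) _ (ltnW NM))//= [X in _ + X](_ : _ = 0) ?addr0; last first.
    by rewrite big_nat big1// => n /andP[Nn _]; rewrite ltnNge Nn mul0r.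
  by apply: ler_sum => n _; case: (n < N)%N; rewrite ?mul1r ?mul0r.
have c4 := @cvgn_nat_geometric R k _ q1.
apply: (series_le_cvg t0 _ B (ssumD c4 c3).1) => n.
by rewrite addr_ge0// mulr_ge0 ?exprn_ge0//; case/andP: q1.
Qed.

(** Bounded terms put the radius of convergence at least at [r]; strictly inside the radius the
    differentiated series would converge, so its divergence puts the radius at most at [r]. *)
Lemma inv_spectral_radius_eq (r B : R) : 0 < r -> (forall n, p n * r ^+ n <= B) ->
  ~ cvgn (series (fun n => n%:R * p n * r ^+ n)) -> inv_spectral_radius mu = r.
Proof.
move=> r0 pB nc; rewrite /inv_spectral_radius.
have ri : 0 < r^-1 by rewrite invr_gt0.
suff -> : spectral_radius mu = r^-1 by rewrite invrK.
apply/eqP; rewrite eq_le !leNgt; apply/andP; split; apply/negP => h; last first.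
  by apply: nc; have := @spectral_radius_series r 1 r0 h; under eq_fun do rewrite expr1.
pose c := (spectral_radius mu + r^-1) / 2.
have c1 : r^-1 < c by rewrite /c; lra.
have c2 : c < spectral_radius mu by rewrite /c; lra.
have c0 : 0 < c by exact: lt_trans c1.
have q1 : `|(c * r)^-1| < 1.
  have cr0 : 0 < c * r by rewrite mulr_gt0.
  rewrite ger0_norm ?invr_ge0 ?(ltW cr0)// invf_lt1//.
  by rewrite -ltr_pdivrMr// div1r.
have h1 : (fun n => B * (c * r)^-1 ^+ n) @ \oo --> (B * 0 : R).
  by apply: cvgM; [exact: cvg_cst | exact: cvg_expr].
rewrite mulr0 in h1; have /cvgrPdist_lt /(_ 1 ltr01) [N _ NP] := h1.
suff : spectral_radius mu <= c by rewrite leNgt c2.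
apply: (@spectral_radius_le c N (ltW c0)) => n Nn.
have := NP n Nn; rewrite /= sub0r normrN => /(le_lt_trans (ler_norm _)).
rewrite exprVn ltr_pdivrMr; last by apply: exprn_gt0; exact: mulr_gt0.
rewrite mul1r exprMn => h2.
have := le_lt_trans (pB n) h2; rewrite ltr_pM2r ?exprn_gt0//.
exact: ltW.
Qed.

Lemma green_derivative_cvg (r : R) : 0 <= r ->
  green_derivative mu r = +oo%E <-> ~ cvgn (series (fun n => n%:R * p n * r ^+ n.-1)).
Proof.
move=> r0; pose f n := n%:R * p n * r ^+ n.-1.
have f0 n : 0 <= f n by rewrite !mulr_ge0 ?exprn_ge0.
have E n : (\sum_(1 <= i < n) (f i)%:E)%E = (series f n)%:E.
  rewrite sumEFin /series /=; case: n => [|n]; first by rewrite !big_geq.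
  by rewrite [in RHS]big_ltn// /f !mul0r add0r.
have F : green_derivative mu r = limn (EFin \o series f).
  by rewrite /green_derivative; congr (limn _); apply/funext => n; rewrite E.
have mono N : ((series f N)%:E <= green_derivative mu r)%E.
  rewrite -E; apply: (@nneseries_lim_ge R (fun n => (f n)%:E) xpredT 1%N N) => n _ _.
  by rewrite lee_fin.
split=> [oo c|nc].
- by move: oo; rewrite F EFin_lim.
- apply: contrapT => noo; apply: nc.
  have g0 : (0 <= green_derivative mu r)%E.
    by apply: le_trans (mono 0%N); rewrite lee_fin /series /= big_geq.
  case: (green_derivative mu r) mono noo g0 => [B mono _ _|//|//].
  by apply: (@series_cvg_bounded _ _ B f0 _).1 => n; rewrite -lee_fin.
Qed.

Lemma cvgn_derivative (r : R) : r != 0 ->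
  cvgn (series (fun n => n%:R * p n * r ^+ n.-1)) <->
  cvgn (series (fun n => n%:R * p n * r ^+ n)).
Proof.
move=> r0.
have E : (fun n => n%:R * p n * r ^+ n) = (fun n => r * (n%:R * p n * r ^+ n.-1)).
  by apply/funext => -[|n]; rewrite ?mul0r ?mulr0//= exprS; ring.
rewrite E; split=> c; first by have [] := ssumZ r c.
have [c' _] := ssumZ (r^-1) c.
rewrite (_ : (fun n => _) = (fun n => r^-1 * (r * (n%:R * p n * r ^+ n.-1))))//.
by apply/funext => n; rewrite mulKf.
Qed.

End SpectralRadius.

(** * First-order expansion of the generating functions at [s = 1] *)

Section SlopeAtOne.
Variables (R : realType) (p u : R^nat).
Hypothesis tr : transient_renewal p u.
Hypothesis cm : cvgn (series (fun n => n%:R * p n)).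

Let p_ge0 n : 0 <= p n. Proof. by have /andP[] := tr_p tr n. Qed.

Lemma near_left1 : \forall s \near (1 : R)^'-, 0 < s < 1.
Proof.
near=> s; apply/andP; split; near: s; last exact: nbhs_left_lt.
exact: nbhs_left_gt.
Unshelve. all: by end_near.
Qed.

(** After division the term of index [n] is [p n] times [n - (1 + s + ... + s^(n-1))], which is
    dominated by [n * p n] and tends to [0]: Tannery's theorem. *)
Lemma excess_div_cvg0 : excess p s / (1 - s) @[s --> (1 : R)^'-] --> (0 : R).
Proof.
pose f (s : R) n := p n * (n%:R - \sum_(i < n) s ^+ i).
have b1 : \forall s \near (1 : R)^'-, forall n, `|f s n| <= n%:R * p n.
  near=> s; have /andP[s0 s1] : 0 < s < 1 by near: s; exact: near_left1.
  move=> n; have h1 : 0 <= \sum_(i < n) s ^+ i <= n%:R.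
    rewrite sumr_ge0 ?(fun _ => exprn_ge0)//=; last by move=> i _; rewrite exprn_ge0 ?(ltW s0).
    have -> : n%:R = \sum_(i < n) (1 : R) by rewrite sumr_const card_ord.
    apply: ler_sum => i _.
    by rewrite exprn_ile1 ?(ltW s0) ?(ltW s1).
  case/andP: h1 => h1 h2.
  rewrite /f ger0_norm; last by rewrite mulr_ge0// subr_ge0.
  by rewrite mulrC; apply: ler_wpM2r => //; rewrite gerBl.
have b2 n : f s n @[s --> (1 : R)^'-] --> (0 : R).
  rewrite (_ : 0 = p n * (n%:R - \sum_(i < n) 1 ^+ i)); last first.
    by under eq_bigr do rewrite expr1n; rewrite sumr_const card_ord subrr mulr0.
  apply: cvgM; first exact: cvg_cst.
  apply: cvgB; first exact: cvg_cst.
  apply: cvg_at_left_filter.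
  elim: (n) => [|m IH].
    rewrite big_ord0; under eq_fun do rewrite big_ord0; exact: cvg_cst.
  rewrite big_ord_recr /=; under eq_fun do rewrite big_ord_recr /=.
  by apply: cvgD => //; exact: exprn_continuous.
have [_ _ h] := tannery cm b1 b2.
have -> : (0 : R) = ssum (fun _ : nat => 0 : R).
  rewrite /ssum (_ : series _ = fun=> 0) ?lim_cst//.
  by apply/funext => n; rewrite /series /= big1.
apply: cvg_trans h; apply: near_eq_cvg; near=> s.
have /andP[s0 s1] : 0 < s < 1 by near: s; exact: near_left1.
have d0 : 1 - s != 0 by rewrite subr_eq0 gt_eqF.
have c := cvgn_excess tr cm (_ : 0 <= s <= 1); rewrite !ltW// in c; have {}c := c isT.
rewrite /excess mulrC -(ssumZ ((1 - s)^-1) c).2; apply: ssum_eq => n.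
rewrite /f mulrCA; congr (_ * _).
apply: (mulfI d0); rewrite mulrA divff// mul1r mulrBr.
have -> : (1 - s) * (\sum_(i < n) s ^+ i) = 1 - s ^+ n.
  by apply: oppr_inj; rewrite opprB -mulNr opprB -subrX1.
by ring.
Unshelve. all: by end_near.
Qed.

Lemma gen_p_cvg1 : gen_p p s @[s --> (1 : R)^'-] --> gen_p p 1.
Proof.
have h : excess p s @[s --> (1 : R)^'-] --> (0 : R).
  have h1 : excess p s / (1 - s) * (1 - s) @[s --> (1 : R)^'-] --> (0 * 0 : R).
    apply: cvgM; first exact: excess_div_cvg0.
    rewrite -(subrr (1 : R)); apply: cvgB; first exact: cvg_cst.
    by apply: cvg_trans (@cvg_id _ _); exact: cvg_within.
  rewrite mul0r in h1; apply: cvg_trans h1; apply: near_eq_cvg; near=> s.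
  have /andP[s0 s1] : 0 < s < 1 by near: s; exact: near_left1.
  by rewrite divfK// subr_eq0 gt_eqF.
have h2 : gen_p p 1 - ((1 - s) * mean p - excess p s) @[s --> (1 : R)^'-] -->
    gen_p p 1 - (0 * mean p - 0).
  apply: cvgB; first exact: cvg_cst.
  apply: cvgB => //; apply: cvgM; last exact: cvg_cst.
  rewrite -(subrr (1 : R)); apply: cvgB; first exact: cvg_cst.
  by apply: cvg_trans (@cvg_id _ _); exact: cvg_within.
rewrite mul0r !subr0 in h2; apply: cvg_trans h2; apply: near_eq_cvg; near=> s.
have /andP[s0 s1] : 0 < s < 1 by near: s; exact: near_left1.
by rewrite -(gen_p_excess tr cm) ?subKr// !ltW.
Unshelve. all: by end_near.
Qed.

(** The secant ending at [1] has two expressions for its limit: it is squeezed between slopes, and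
    [secantE] computes it from [gen_p] and the excess. *)
Lemma slope1E : slope u 1 = (mean p + gen_p p 1) / gen_p p 1 ^+ 2.
Proof.
have g1 : 0 < gen_p p 1 by rewrite (gen_p_gt0 tr)// ler01 lexx.
have c1 := slope_cvg1 tr cm.
have h1 : secant u s 1 @[s --> (1 : R)^'-] --> (mean p + gen_p p 1) / gen_p p 1 ^+ 2.
  have h : (mean p + gen_p p s - excess p s / (1 - s)) / (gen_p p s * gen_p p 1)
      @[s --> (1 : R)^'-] --> (mean p + gen_p p 1 - 0) / (gen_p p 1 * gen_p p 1).
    apply: cvgM.
      apply: cvgB; last exact: excess_div_cvg0.
      by apply: cvgD; [exact: cvg_cst | exact: gen_p_cvg1].
    apply: cvgV; first by rewrite mulf_neq0// gt_eqF.
    by apply: cvgM; [exact: gen_p_cvg1 | exact: cvg_cst].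
  rewrite subr0 -expr2 in h; apply: cvg_trans h; apply: near_eq_cvg; near=> s.
  by rewrite -(secantE tr cm)//; near: s; exact: near_left1.
have h2 : secant u s 1 @[s --> (1 : R)^'-] --> slope u 1.
  apply: (@squeeze_cvgr _ _ _ _ (slope u) (fun=> slope u 1)); last 2 first.
  - have := slope_clamped_continuous tr ler01 c1 => /(_ 1).
    rewrite /continuous_at slope_clampedE ?ler01 ?lexx// => h.
    have h' : slope_clamped u 1 s @[s --> (1 : R)^'-] --> slope u 1.
      by apply: cvg_trans h; apply: cvg_app; exact: cvg_within.
    apply: cvg_trans h'; apply: near_eq_cvg; near=> s.
    have /andP[s0 s1] : 0 < s < 1 by near: s; exact: near_left1.
    by rewrite slope_clampedE// !ltW.
  - exact: cvg_cst.
  near=> s; have /andP[s0 s1] : 0 < s < 1 by near: s; exact: near_left1.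
  by have /andP[-> /ltW ->] := secant_bounds tr s0 s1 (lexx _) c1.
exact: cvg_unique h2 h1.
Unshelve. all: by end_near.
Qed.

Lemma slope1_secant s : 0 < s < 1 ->
  slope u 1 - secant u s 1 =
  (excess p s / (1 - s) - mean p * (gen_p p 1 - gen_p p s) / gen_p p 1) /
  (gen_p p s * gen_p p 1).
Proof.
move=> s01; have /andP[s0 s1] := s01.
have gs : 0 < gen_p p s by rewrite (gen_p_gt0 tr)// !ltW.
have g1 : 0 < gen_p p 1 by rewrite (gen_p_gt0 tr)// ler01 lexx.
have d0 : 0 < 1 - s by rewrite subr_gt0.
by rewrite slope1E (secantE tr cm)//; field; rewrite !gt_eqF.
Qed.

End SlopeAtOne.

(** * Difference quotients at a boundary point *)

(** Taylor bounds of orders one and two at [t], obtained by factoring differences of powers twice;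
    the factor [t] in the second avoids a power [n - 2]. *)
Lemma expr_diff_bounds (R : realType) (s t : R) n : 0 <= s -> s <= t ->
  t ^+ n - s ^+ n <= (t - s) * (n%:R * t ^+ n.-1) /\
  t * ((t - s) * (n%:R * t ^+ n.-1) - (t ^+ n - s ^+ n)) <=
    (t - s) ^+ 2 * (n%:R ^+ 2 * t ^+ n.-1).
Proof.
move=> s0 st; have t0 := le_trans s0 st; have d0 : 0 <= t - s by rewrite subr_ge0.
have E : (t - s) * (n%:R * t ^+ n.-1) = (t - s) * \sum_(i < n) t ^+ n.-1.
  by rewrite sumr_const card_ord mulr_natl.
rewrite E subrXX; split.
  apply: ler_wpM2l => //; apply: ler_sum => -[i /= i_n] _.
  rewrite [leRHS](_ : _ = t ^+ (n.-1 - i) * t ^+ i); last by rewrite -exprD; congr (_ ^+ _); lia.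
  by apply: ler_wpM2l; [exact: exprn_ge0 | apply: lerXn2r; rewrite ?nnegrE].
rewrite -mulrBr mulrCA expr2 -mulrA; apply: ler_wpM2l => //.
rewrite -sumrB mulr_sumr.
have -> : (t - s) * (n%:R ^+ 2 * t ^+ n.-1) = \sum_(i < n) ((t - s) * (n%:R * t ^+ n.-1)).
  by rewrite sumr_const card_ord -[RHS]mulr_natl; ring.
apply: ler_sum => -[i /= i_n] _.
rewrite [X in t * (X - _)](_ : _ = t ^+ (n.-1 - i) * t ^+ i); last by rewrite -exprD; congr (_ ^+ _); lia.
rewrite -mulrBr mulrCA subrXX.
apply: (@le_trans _ _ (t ^+ (n.-1 - i) * (t * ((t - s) * (i%:R * t ^+ i.-1))))).
  apply: ler_wpM2l; first exact: exprn_ge0.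
  apply: ler_wpM2l => //; apply: ler_wpM2l => //.
  have -> : i%:R * t ^+ i.-1 = \sum_(j < i) t ^+ i.-1 by rewrite sumr_const card_ord mulr_natl.
  apply: ler_sum => -[j /= ji] _.
  rewrite [leRHS](_ : _ = t ^+ (i.-1 - j) * t ^+ j); last by rewrite -exprD; congr (_ ^+ _); lia.
  by apply: ler_wpM2l; [exact: exprn_ge0 | apply: lerXn2r; rewrite ?nnegrE].
case: i i_n => [|i] i_n; first by rewrite mul0r !mulr0 !mulr_ge0 ?exprn_ge0.
rewrite [leLHS](_ : _ = (t - s) * (i.+1%:R * t ^+ n.-1)); last first.
  rewrite (_ : n.-1 = n.-1 - i.+1 + i.+1)%N; last by lia.
  by rewrite addnK exprD [t ^+ i.+1]exprS /=; ring.
apply: ler_wpM2l => //; apply: ler_wpM2r; first exact: exprn_ge0.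
by rewrite ler_nat ltnW.
Qed.

Lemma expr_diff_ge (R : realType) (s t : R) n : 0 <= s -> s <= t ->
  (t - s) * (n%:R * s ^+ n.-1) <= t ^+ n - s ^+ n.
Proof.
move=> s0 st; have t0 := le_trans s0 st; rewrite subrXX; apply: ler_wpM2l; first by rewrite subr_ge0.
have -> : n%:R * s ^+ n.-1 = \sum_(i < n) s ^+ n.-1 by rewrite sumr_const card_ord mulr_natl.
apply: ler_sum => -[i /= i_n] _.
rewrite [leLHS](_ : _ = s ^+ (n.-1 - i) * s ^+ i); last by rewrite -exprD; congr (_ ^+ _); lia.
by apply: ler_wpM2r; [exact: exprn_ge0 | apply: lerXn2r; rewrite ?nnegrE].
Qed.

Section DifferenceQuotient.
Variables (R : realType) (p1 u1 p2 u2 : R^nat) (a b : R) (p : R^nat).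
Hypotheses (tr1 : transient_renewal p1 u1) (tr2 : transient_renewal p2 u2).
Hypotheses (a0 : 0 < a) (b0 : 0 < b) (p_ge0 : forall n, 0 <= p n).

Local Notation zz := (zz u1 u2 a b).
Local Notation psi := (psi u1 u2 a b).
Local Notation chord := (chord u1 u2 a b).
Local Notation admissible_arg := (admissible_arg u1 u2 a b).
Local Notation finite_slopes := (finite_slopes u1 u2 a b).

(** The interface between the product walk and the analysis of its curve. The upper bound holds at
    every admissible point, the equality only at points preceded by a smaller value of [zz]. *)
Definition green_on_curve : Prop :=
  (forall X n, admissible_arg X -> series (fun k => p k * (zz X)^-1 ^+ k) n <= zz X / X) /\
  (forall X Y, admissible_arg X -> X < Y -> zz X < zz Y ->
     series (fun k => p k * (zz Y)^-1 ^+ k) @ \oo --> zz Y / Y).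
Hypothesis green : green_on_curve.

Variable X0 : R.
Hypotheses (aX0 : admissible_arg X0) (fX0 : finite_slopes X0) (psi0 : 0 <= psi X0).

Local Notation r0 := ((zz X0)^-1).
Local Notation gsum r := (ssum (fun n => p n * r ^+ n)).

Let X0_gt0 : 0 < X0. Proof. exact: (arg_pos tr1 tr2 a0 b0 aX0). Qed.
Let z0_gt0 : 0 < zz X0. Proof. exact: (zz_gt0 tr1 tr2 a0 b0 aX0). Qed.
Let r0_gt0 : 0 < r0. Proof. by rewrite invr_gt0. Qed.

Section Right.
Variable X : R.
Hypothesis hX : X0 < X.

Lemma chord_gt0 : 0 < chord X0 X.
Proof.
by have [/andP[h _] _] := chord_bounds tr1 tr2 a0 b0 aX0 fX0 hX; exact: le_lt_trans h.
Qed.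

Lemma zz_incr : zz X0 < zz X.
Proof.
rewrite -subr_gt0 (zz_chord tr1 tr2 a0 b0 aX0 fX0 hX); apply: mulr_gt0; first by rewrite subr_gt0.
exact: chord_gt0.
Qed.

Lemma rad_gt0 : 0 < (zz X)^-1.
Proof. by rewrite invr_gt0 (lt_trans z0_gt0 zz_incr). Qed.

Lemma rad_decr : (zz X)^-1 < r0.
Proof. by rewrite ltf_pV2 ?posrE// ?zz_incr// (lt_trans z0_gt0 zz_incr). Qed.

Lemma gsum_right : cvgn (series (fun n => p n * (zz X)^-1 ^+ n)) /\ gsum (zz X)^-1 = zz X / X.
Proof.
have h := green.2 _ _ aX0 hX zz_incr.
by split; [apply/cvg_ex; exists (zz X / X) | exact: cvg_lim].
Qed.

(** The difference quotient of the Green function between the radii [1 / zz X] and [1 / zz X0], in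
    closed form. As [X] decreases to [X0] it stays bounded when [psi X0 > 0] and blows up when
    [psi X0 = 0], through the inverse of the chord. *)
Definition quotient : R := zz X / X * (zz X0 / X0) * (zz X0 / chord X0 X - X0).

Lemma quotientE : zz X0 / X0 - zz X / X = (r0 - (zz X)^-1) * quotient.
Proof.
have e := zz_chord tr1 tr2 a0 b0 aX0 fX0 hX; have c := chord_gt0.
have zX := lt_trans z0_gt0 zz_incr; have Xp := lt_trans X0_gt0 hX.
have n1 : zz X != 0 by rewrite gt_eqF.
have n2 : zz X0 != 0 by rewrite gt_eqF.
have n3 : X != 0 by rewrite gt_eqF.
have n4 : X0 != 0 by rewrite gt_eqF.
have n5 : chord X0 X != 0 by rewrite gt_eqF.
rewrite /quotient.
have -> : r0 - (zz X)^-1 = (zz X - zz X0) / (zz X * zz X0) by field; rewrite n1 n2.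
have -> : zz X0 / X0 - zz X / X = (zz X0 * (X - X0) - (zz X - zz X0) * X0) / (X * X0).
  by field; rewrite n3 n4.
by rewrite e; field; rewrite n1 n2 n3 n4 n5.
Qed.

End Right.

(** At [X0] only the upper bound is given directly. The converse compares with the smaller radii
    [1 / zz X] for [X > X0] and uses that [zz X / X] is continuous from the right. *)
Lemma gsum_base : cvgn (series (fun n => p n * r0 ^+ n)) /\ gsum r0 = zz X0 / X0.
Proof.
have t0 n : 0 <= p n * r0 ^+ n by rewrite mulr_ge0// exprn_ge0// ltW.
have [c l] := series_cvg_bounded t0 (fun n => green.1 X0 n aX0).
split=> //; apply/eqP; rewrite eq_le l /=.
have h : zz X / X @[X --> X0^'+] --> zz X0 / X0.
  apply: cvgM; first exact: (zz_right_cvg tr1 tr2 a0 b0 aX0).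
  apply: cvgV; first by rewrite gt_eqF.
  exact: cvg_at_right_filter.
rewrite -(cvg_lim _ h)//; apply: limr_le; first by apply/cvg_ex; exists (zz X0 / X0).
near=> X.
have hX : X0 < X by near: X; exact: nbhs_right_gt.
have [cX <-] := gsum_right hX; apply: ssum_le => // n.
apply: ler_wpM2l => //; apply: lerXn2r; rewrite ?nnegrE ?(ltW r0_gt0) ?(ltW (rad_gt0 hX))//.
exact: ltW (rad_decr hX).
Unshelve. all: by end_near.
Qed.

Section PositiveSlope.
Hypothesis psi_gt0 : 0 < psi X0.

Let D0 := zz X0 / X0 * (zz X0 / X0) * (zz X0 / psi X0 - X0).

Lemma quotient_cvg : quotient X @[X --> X0^'+] --> D0.
Proof.
apply: cvgM.
  apply: cvgM; last exact: cvg_cst.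
  apply: cvgM; first exact: (zz_right_cvg tr1 tr2 a0 b0 aX0).
  by apply: cvgV; [rewrite gt_eqF | exact: cvg_at_right_filter].
apply: cvgB; last exact: cvg_cst.
apply: cvgM; first exact: cvg_cst.
apply: cvgV; first by rewrite gt_eqF.
exact: (chord_right_cvg tr1 tr2 a0 b0 aX0 fX0).
Qed.

(** Each partial sum of the derivative at the radius of [X] is at most the difference quotient; both
    sides have limits as [X] decreases to [X0]. *)
Lemma derivative_cvg : cvgn (series (fun n => n%:R * p n * r0 ^+ n.-1)).
Proof.
have t0 n : 0 <= n%:R * p n * r0 ^+ n.-1 by rewrite !mulr_ge0 ?exprn_ge0// ltW.
apply: (@series_cvg_bounded _ _ D0 t0 _).1 => N.
have hr : (zz X)^-1 @[X --> X0^'+] --> r0.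
  by apply: cvgV; [rewrite gt_eqF | exact: (zz_right_cvg tr1 tr2 a0 b0 aX0)].
have hl : series (fun n => n%:R * p n * (zz X)^-1 ^+ n.-1) N @[X --> X0^'+] -->
    series (fun n => n%:R * p n * r0 ^+ n.-1) N.
  elim: N => [|N IH].
    rewrite /series /= big_geq//; under eq_fun do rewrite big_geq//; exact: cvg_cst.
  rewrite seriesSr; under eq_fun do rewrite seriesSr.
  apply: cvgD => //; apply: cvgM; first exact: cvg_cst.
  exact: (cvg_comp _ _ hr (@exprn_continuous R N.-1 _)).
apply: ler_cvg_to hl quotient_cvg _; near=> X.
have hX : X0 < X by near: X; exact: nbhs_right_gt.
have rp := rad_gt0 hX; have rd := rad_decr hX.
have d0 : 0 < r0 - (zz X)^-1 by rewrite subr_gt0.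
rewrite -(ler_pM2l d0) -(quotientE hX).
have [c1 <-] := gsum_base; have [c2 <-] := gsum_right hX.
have [c3 <-] := ssumB c1 c2.
have m n : (r0 - (zz X)^-1) * (n%:R * p n * (zz X)^-1 ^+ n.-1) <= p n * r0 ^+ n - p n * (zz X)^-1 ^+ n.
  rewrite -mulrBr [n%:R * p n]mulrC -mulrA mulrCA.
  by apply: ler_wpM2l => //; apply: expr_diff_ge; exact: ltW.
apply: (@le_trans _ _ (series (fun n => p n * r0 ^+ n - p n * (zz X)^-1 ^+ n) N)).
  by rewrite /series /= mulr_sumr; apply: ler_sum_nat => n _; exact: m.
apply: series_le_ssum => // n; apply: le_trans (m n).
by rewrite !mulr_ge0 ?exprn_ge0// ltW.
Unshelve. all: by end_near.
Qed.

End PositiveSlope.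

Section FiniteDerivative.
Hypothesis cd : cvgn (series (fun n => n%:R * p n * r0 ^+ n.-1)).
Let L := ssum (fun n => n%:R * p n * r0 ^+ n.-1).

Lemma gsum_diff X : X0 < X ->
  cvgn (series (fun n => p n * (r0 ^+ n - (zz X)^-1 ^+ n))) /\
  zz X0 / X0 - zz X / X = ssum (fun n => p n * (r0 ^+ n - (zz X)^-1 ^+ n)).
Proof.
move=> hX; have [c0 <-] := gsum_base; have [c1 <-] := gsum_right hX.
have [c e] := ssumB c0 c1; rewrite -e; have -> : (fun n => p n * (r0 ^+ n - (zz X)^-1 ^+ n)) =
  (fun n => p n * r0 ^+ n - p n * (zz X)^-1 ^+ n) by apply/funext => n; rewrite mulrBr.
by [].
Qed.

Lemma quotient_le X : X0 < X -> 0 <= quotient X <= L.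
Proof.
move=> hX; have [c e] := gsum_diff hX; have rd := rad_decr hX; have rp := rad_gt0 hX.
have d0 : 0 < r0 - (zz X)^-1 by rewrite subr_gt0.
apply/andP; split.
  rewrite -(pmulr_rge0 _ d0) -(quotientE hX) e; apply: ssum_ge0 => // n; rewrite mulr_ge0// subr_ge0.
  by apply: lerXn2r; rewrite ?nnegrE ?(ltW rp) ?(ltW r0_gt0) ?(ltW rd).
rewrite -(ler_pM2l d0) -(quotientE hX) e.
have [c1 e1] := ssumZ (r0 - (zz X)^-1) cd; rewrite -e1; apply: ssum_le => // n.
have [h _] := expr_diff_bounds n (ltW rp) (ltW rd).
rewrite [leRHS](_ : _ = p n * ((r0 - (zz X)^-1) * (n%:R * r0 ^+ n.-1))); last by ring.
by apply: ler_wpM2l.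
Qed.

(** A finite derivative bounds the difference quotients, whereas [psi X0 = 0] would make the chord
    tend to [0] and the quotients unbounded. *)
Lemma psi0_gt0 : 0 < psi X0.
Proof.
rewrite lt_neqAle psi0 andbT eq_sym; apply/eqP => e.
have hc := chord_right_cvg tr1 tr2 a0 b0 aX0 fX0; rewrite e in hc.
have [L0 _] : 0 <= L /\ True.
  by split=> //; apply: ssum_ge0 => // n; rewrite !mulr_ge0 ?exprn_ge0// ltW.
(* Chosen so that [zz X0 / (X0 + 1) * (K - X0)], a lower bound for the quotient once the chord is
   below [zz X0 / K], equals [L] plus a positive number. *)
pose K := X0 + L * (X0 + 1) / zz X0 + 1.
have K0 : 0 < K by rewrite /K ltr_wpDl// addr_ge0 ?(ltW X0_gt0)// divr_ge0 ?mulr_ge0 ?(ltW z0_gt0)// addr_ge0// ltW.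
have /cvgrPdist_lt /(_ (zz X0 / K)) := hc; rewrite divr_gt0// => /(_ isT) hn.
near X0^'+ => X.
have hX : X0 < X by near: X; exact: nbhs_right_gt.
have hX1 : X < X0 + 1 by near: X; apply: nbhs_right_lt; rewrite ltrDl.
have cp := chord_gt0 hX.
have h : chord X0 X < zz X0 / K.
  have : `|0 - chord X0 X| < zz X0 / K by near: X.
  by rewrite sub0r normrN gtr0_norm.
have /andP[_ q] := quotient_le hX.
have K1 : K < zz X0 / chord X0 X by rewrite ltr_pdivlMr// mulrC -ltr_pdivlMr.
have zX := zz_incr hX; have Xp := lt_trans X0_gt0 hX.
have y1 : zz X0 / (X0 + 1) <= zz X / X.
  apply: ler_pM; rewrite ?(ltW z0_gt0) ?(ltW zX) ?invr_ge0 ?addr_ge0 ?(ltW X0_gt0)//.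
  by rewrite lef_pV2 ?posrE ?addr_gt0// ltW.
have y2 : 1 <= zz X0 / X0.
  by rewrite ler_pdivlMr// mul1r; exact: (zz_ge tr1 tr2 a0 b0 aX0).
have y3 : zz X0 / (X0 + 1) * (K - X0) <= L.
  apply: le_trans q; rewrite /quotient; apply: ler_pM.
  - by rewrite divr_ge0 ?(ltW z0_gt0)// addr_ge0// ltW.
  - have : 0 <= L * (X0 + 1) / zz X0.
      apply: divr_ge0; last exact: ltW.
      by apply: mulr_ge0 => //; apply: addr_ge0 => //; exact: ltW.
    by rewrite /K; move: (L * (X0 + 1) / zz X0) => y; lra.
  - by apply: (le_trans y1); rewrite ler_peMr// divr_ge0 ?(ltW (lt_trans z0_gt0 zX)) ?(ltW Xp).
  - by lra.
have : zz X0 / (X0 + 1) * (K - X0) = L + zz X0 / (X0 + 1).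
  by rewrite /K; field; rewrite !gt_eqF// addr_gt0.
have : 0 < zz X0 / (X0 + 1) by rewrite divr_gt0// addr_gt0.
lra.
Unshelve. all: by end_near.
Qed.

Hypothesis cd2 : cvgn (series (fun n => n%:R ^+ 2 * p n * r0 ^+ n.-1)).

(** With a finite second derivative the quotient differs from its limit by at most a multiple of the
    difference of radii, itself [O(X - X0)]. Solving [quotient] for the inverse of the chord
    transfers the rate to the chord. *)
Lemma chord_lipschitz : exists K, forall X, X0 < X ->
  chord X0 X - psi X0 <= K * (X - X0).
Proof.
pose M := ssum (fun n => n%:R ^+ 2 * p n * r0 ^+ n.-1).
have L0 : 0 <= L by apply: ssum_ge0 => // n; rewrite !mulr_ge0 ?exprn_ge0// ltW.
have M0 : 0 <= M by apply: ssum_ge0 => // n; rewrite !mulr_ge0 ?exprn_ge0// ltW.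
have lower X : X0 < X -> L - quotient X <= (r0 - (zz X)^-1) * (M / r0).
  move=> hX; have [c e] := gsum_diff hX; have rd := rad_decr hX; have rp := rad_gt0 hX.
  set d := r0 - (zz X)^-1; have d0 : 0 < d by rewrite subr_gt0.
  rewrite -(ler_pM2l d0) mulrBr -(quotientE hX) e mulrA -expr2.
  have [c1 e1] := ssumZ d cd; rewrite /L -e1.
  have [c2 e2] := ssumB c1 c; rewrite -e2 mulrA ler_pdivlMr// mulrC.
  have [c3 e3] := ssumZ r0 c2; rewrite -e3.
  have [c4 e4] := ssumZ (d ^+ 2) cd2; rewrite -e4; apply: ssum_le => // n.
  have [_ h] := expr_diff_bounds n (ltW rp) (ltW rd).
  have := ler_wpM2l (p_ge0 n) h; rewrite -/d.
  have -> : p n * (d ^+ 2 * (n%:R ^+ 2 * r0 ^+ n.-1)) = d ^+ 2 * (n%:R ^+ 2 * p n * r0 ^+ n.-1) by ring.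
  apply: le_trans; rewrite le_eqVlt; apply/orP; left; apply/eqP; ring.
pose D0 := zz X0 / X0 * (zz X0 / X0) * (zz X0 / psi X0 - X0).
have p0 := psi0_gt0.
have qD : quotient X @[X --> X0^'+] --> D0 by exact: quotient_cvg.
have D0L : D0 <= L.
  apply: (cvgr_to_le qD); near=> X; have hX : X0 < X by near: X; exact: nbhs_right_gt.
  by have /andP[] := quotient_le hX.
exists (M / r0 / (zz X0 ^+ 2) / ((zz X0 / X0) ^+ 2 * zz X0)) => X hX.
have zX := zz_incr hX; have Xp := lt_trans X0_gt0 hX; have cp := chord_gt0 hX.
have zXp := lt_trans z0_gt0 zX.
have /andP[q0 q1] := quotient_le hX.
have [/andP[cl _] c1] := chord_bounds tr1 tr2 a0 b0 aX0 fX0 hX.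
have e := zz_chord tr1 tr2 a0 b0 aX0 fX0 hX.
have fz : zz X / X <= zz X0 / X0.
  rewrite -subr_ge0 (quotientE hX) mulr_ge0// subr_ge0 ltW//; exact: rad_decr.
have h0 : 0 <= zz X0 / chord X0 X - X0.
  by move: q0; rewrite /quotient pmulr_rge0// mulr_gt0 ?divr_gt0.
have h1 : quotient X <= zz X0 / X0 * (zz X0 / X0) * (zz X0 / chord X0 X - X0).
  by apply: ler_wpM2r => //; apply: ler_wpM2r => //; rewrite divr_ge0 ?(ltW z0_gt0) ?(ltW X0_gt0).
have h2 : D0 - quotient X <= (r0 - (zz X)^-1) * (M / r0).
  by apply: le_trans (lower X hX); rewrite lerD2r.
have h3 : (zz X0 / X0) ^+ 2 * zz X0 * ((psi X0)^-1 - (chord X0 X)^-1) <= (r0 - (zz X)^-1) * (M / r0).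
  apply: le_trans h2; rewrite /D0.
  apply: (@le_trans _ _ (zz X0 / X0 * (zz X0 / X0) * (zz X0 / psi X0 - X0) -
    zz X0 / X0 * (zz X0 / X0) * (zz X0 / chord X0 X - X0))); last by rewrite lerD2l lerN2.
  rewrite le_eqVlt; apply/orP; left; apply/eqP; ring.
have h4 : chord X0 X - psi X0 <= (psi X0)^-1 - (chord X0 X)^-1.
  have -> : (psi X0)^-1 - (chord X0 X)^-1 = (chord X0 X - psi X0) / (chord X0 X * psi X0).
    by field; rewrite !gt_eqF.
  rewrite ler_peMr ?subr_ge0 ?(ltW cl)// invf_ge1 ?mulr_gt0//.
  by rewrite mulr_ile1 ?(ltW cp) ?(ltW p0)// (le_trans (ltW cl)).
have h5 : r0 - (zz X)^-1 <= (X - X0) / zz X0 ^+ 2.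
  have -> : r0 - (zz X)^-1 = (zz X - zz X0) / (zz X * zz X0) by field; rewrite !gt_eqF.
  rewrite e -mulrA; apply: ler_wpM2l; first by rewrite subr_ge0 ltW.
  rewrite -[leRHS]mul1r; apply: ler_pM; rewrite ?(ltW cp) ?invr_ge0 ?mulr_ge0 ?(ltW zXp) ?(ltW z0_gt0)//.
  by rewrite lef_pV2 ?posrE ?mulr_gt0 ?exprn_gt0// expr2 ler_pM2r// ltW.
have c0 : 0 < (zz X0 / X0) ^+ 2 * zz X0 by rewrite mulr_gt0// exprn_gt0// divr_gt0.
apply: (le_trans h4); rewrite mulrAC ler_pdivlMr// mulrC; apply: (le_trans h3).
have := ler_wpM2r (_ : 0 <= M / r0) h5; rewrite divr_ge0 ?(ltW r0_gt0)// => /(_ isT).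
move=> h6; apply: (le_trans h6); rewrite le_eqVlt; apply/orP; left; apply/eqP; ring.
Unshelve. all: by end_near.
Qed.

End FiniteDerivative.
End DifferenceQuotient.

(** * A Tauberian theorem *)

Lemma ssum_zero (R : realType) :
  cvgn (series (fun _ : nat => 0 : R)) /\ ssum (fun _ : nat => 0 : R) = 0.
Proof.
have h : series (fun _ : nat => 0 : R) @ \oo --> (0 : R).
  rewrite (_ : series _ = fun=> 0); first exact: cvg_cst.
  by apply/funext => n; rewrite /series /= big1.
by split; [apply/cvg_ex; exists 0 | exact: cvg_lim].
Qed.

Section PolynomialApproximation.
Variable R : realType.

(** Uniform approximation on [[0, 1]]. It is proved directly for the bumps below, where only an
    absolute value has to be approximated. *)
Definition poly_approximable (g : R -> R) : Prop :=
  forall e, 0 < e -> exists P : {poly R}, forall x, 0 <= x <= 1 -> `|g x - P.[x]| <= e.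

Lemma horner_bounded (P : {poly R}) : exists2 B, 0 < B & forall x, 0 <= x <= 1 -> `|P.[x]| <= B.
Proof.
exists (1 + \sum_(i < size P) `|P`_i|); first by rewrite ltr_wpDr// sumr_ge0.
move=> x /andP[x0 x1]; rewrite horner_coef; apply: (le_trans (ler_norm_sum _ _ _)).
apply: (@le_trans _ _ (\sum_(i < size P) `|P`_i|)); last by rewrite lerDr.
apply: ler_sum => i _; rewrite normrM ler_piMr// ger0_norm ?exprn_ge0//.
exact: exprn_ile1.
Qed.

Lemma poly_approximable_bounded g : poly_approximable g ->
  exists2 B, 0 < B & forall x, 0 <= x <= 1 -> `|g x| <= B.
Proof.
move=> ag; have [P hP] := ag 1 ltr01; have [B B0 hB] := horner_bounded P.
exists (1 + B); first by rewrite addr_gt0.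
move=> x x01; rewrite -[g x](subrK P.[x]); apply: (le_trans (ler_normD _ _)).
by rewrite lerD ?hP ?hB.
Qed.

Lemma poly_approximable_mulX g : poly_approximable g -> poly_approximable (fun x => x * g x).
Proof.
move=> ag e e0; have [P hP] := ag e e0; exists ('X * P) => x x01.
rewrite hornerM hornerX -mulrBr normrM; have /andP[x0 x1] := x01.
by rewrite (le_trans _ (hP x x01))// ler_piMl// ger0_norm.
Qed.

(* The iteration [Q := Q + (q^2 - Q^2) / 2] increases to [|q|], uniformly. *)
Fixpoint abs_iter (q : {poly R}) (k : nat) : {poly R} :=
  if k is k'.+1 then
    let Q := abs_iter q k' in Q + (2^-1)%:P * (q ^+ 2 - Q ^+ 2)
  else 0.

Lemma abs_iterP (q : {poly R}) k x : `|q.[x]| <= 1 ->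
  0 <= (abs_iter q k).[x] /\
  0 <= `|q.[x]| - (abs_iter q k).[x] <= `|q.[x]| * (1 - `|q.[x]| / 2) ^+ k.
Proof.
move=> q1; elim: k => [|k [IH0 IH]].
  by rewrite /= horner0 subr0 expr0 mulr1 lexx normr_ge0.
have -> : (abs_iter q k.+1).[x] =
    (abs_iter q k).[x] + 2^-1 * (`|q.[x]| ^+ 2 - (abs_iter q k).[x] ^+ 2).
  by rewrite /= !hornerE real_normK ?num_real.
move: IH0 IH; set Q := (abs_iter q k).[x]; set w := `|q.[x]|.
have w0 : 0 <= w by exact: normr_ge0.
move=> Q0 /andP[e0 e1]; have -> : w - (Q + 2^-1 * (w ^+ 2 - Q ^+ 2)) =
    (w - Q) * (1 - (w + Q) / 2) by field.
have w1 : w <= 1 by [].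
have f0 : 0 <= 1 - (w + Q) / 2 by lra.
split.
  apply: addr_ge0 => //; rewrite subr_sqr; apply: mulr_ge0 => //.
  by apply: mulr_ge0 => //; exact: addr_ge0.
apply/andP; split; first exact: mulr_ge0.
rewrite exprSr mulrA; apply: ler_pM => //.
by rewrite lerD2l lerN2 ler_pM2r// lerDl.
Qed.

(** [max 0 q = (q + |q|) / 2], with [|q|] replaced by [abs_iter q k]. Half the error
    [w (1 - w / 2)^k] is at most [1 / k], uniformly in [w], by [poly_expr_le]. *)
Lemma poly_approximable_bump (al be : R) : 0 <= al <= 1 -> 0 <= be <= 1 ->
  poly_approximable (fun x => Num.max 0 ((x - al) * (be - x))).
Proof.
move=> /andP[al0 al1] /andP[be0 be1] e e0.
have [q qE] : exists q : {poly R}, forall x, q.[x] = (x - al) * (be - x).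
  by exists (('X - al%:P) * (be%:P - 'X)) => x; rewrite !hornerE.
have [k hk] : exists k : nat, k%:R * e >= 1.
  exists (Num.bound (1 / e)); rewrite -ler_pdivrMr//.
  by apply: ltW; apply: archi_boundP; rewrite divr_ge0// ltW.
exists ((2^-1)%:P * (q + abs_iter q k)) => x x01; have /andP[x0 x1] := x01.
have q1 : `|q.[x]| <= 1.
  rewrite qE normrM mulr_ile1// ler_norml; apply/andP; split; lra.
have [_ /andP[h1 h2]] := abs_iterP k q1.
have -> : Num.max 0 ((x - al) * (be - x)) = 2^-1 * (q.[x] + `|q.[x]|).
  by rewrite qE; case: (lerP 0 ((x - al) * (be - x))) => h;
    [rewrite ger0_norm | rewrite ltr0_norm]; lra.
rewrite hornerM hornerC hornerD.
have -> : 2^-1 * (q.[x] + `|q.[x]|) - 2^-1 * (q.[x] + (abs_iter q k).[x]) =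
   2^-1 * (`|q.[x]| - (abs_iter q k).[x]) by ring.
rewrite ger0_norm; last by rewrite mulr_ge0.
set w := `|q.[x]| in q1 h1 h2 *.
have w0 : 0 <= w by exact: normr_ge0.
have h3 := @poly_expr_le R (1 - w / 2) k.
have h4 : 0 <= 1 - w / 2 <= 1 by apply/andP; split; lra.
have {}h3 := h3 h4.
have k0 : 0 < k%:R :> R by rewrite ltr0n lt0n; apply: contraTneq hk => ->; rewrite mul0r -ltNge.
rewrite -(ler_pM2l k0); apply: le_trans hk; apply: le_trans h3.
have {}h2 := ler_wpM2l (ltW k0) h2.
move: (_ ^+ k) h2 => y; move: (k%:R : R) (_ - _) => kk z h2.
have -> : 1 - (1 - w / 2) = w / 2 by ring.
by lra.
Qed.

End PolynomialApproximation.

Section Functional.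
Variables (R : realType) (T : Type) (F : set_system T).
Context {FF : ProperFilter F}.
Variables (w x : T -> R^nat) (m : R^nat).
Hypothesis good : \forall t \near F, [/\ forall n, 0 <= w t n,
  forall n, 0 <= x t n <= 1 & cvgn (series (w t))].
Hypothesis moment : forall k, ssum (fun n => w t n * x t n ^+ k) @[t --> F] --> m k.

Lemma cvgn_weighted (t : T) (g : R -> R) (B : R) :
  [/\ forall n, 0 <= w t n, forall n, 0 <= x t n <= 1 & cvgn (series (w t))] ->
  (forall y, 0 <= y <= 1 -> `|g y| <= B) ->
  cvgn (series (fun n => w t n * g (x t n))) /\
  `|ssum (fun n => w t n * g (x t n))| <= B * ssum (w t).
Proof.
move=> [w0 x01 cw] gB; have [cB eB] := ssumZ B cw.
have h n : `|w t n * g (x t n)| <= B * w t n.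
  by rewrite normrM ger0_norm// mulrC ler_wpM2r// gB.
have c := cvg_series_dominated h cB; split=> //.
have := ssum_tail 0 h cB; rewrite /series /= !big_geq// !subr0.
by rewrite -eB.
Qed.

Lemma functional_poly (P : {poly R}) :
  ssum (fun n => w t n * P.[x t n]) @[t --> F] --> \sum_(i < size P) P`_i * m i.
Proof.
have h : \sum_(i < size P) P`_i * ssum (fun n => w t n * x t n ^+ i) @[t --> F]
    --> \sum_(i < size P) P`_i * m i.
  elim: (size P) => [|k IH].
    by rewrite big_ord0; under eq_fun do rewrite big_ord0; exact: cvg_cst.
  rewrite big_ord_recr /=; under eq_fun do rewrite big_ord_recr /=.
  by apply: cvgD => //; apply: cvgM; [exact: cvg_cst | exact: moment].
apply: cvg_trans h; apply: near_eq_cvg; near=> t.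
have gt : [/\ forall n, 0 <= w t n, forall n, 0 <= x t n <= 1 & cvgn (series (w t))].
  by near: t; exact: good.
have c k : cvgn (series (fun n => w t n * x t n ^+ k)).
  have [] // := @cvgn_weighted t (fun y => y ^+ k) 1 gt.
  by move=> y /andP[y0 y1]; rewrite ger0_norm ?exprn_ge0// exprn_ile1.
suff H k : cvgn (series (fun n => w t n * \sum_(i < k) P`_i * x t n ^+ i)) /\
   ssum (fun n => w t n * \sum_(i < k) P`_i * x t n ^+ i) =
   \sum_(i < k) P`_i * ssum (fun n => w t n * x t n ^+ i).
  have [_ <-] := H (size P); apply: ssum_eq => n; by rewrite horner_coef.
elim: k => [|k [IH1 IH2]].
  rewrite big_ord0 (_ : (fun n => _) = (fun=> 0)); last first.
    by apply/funext => n; rewrite big_ord0 mulr0.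
  exact: ssum_zero.
have [c1 e1] := ssumZ (P`_k) (c k); have [c2 e2] := ssumD IH1 c1.
rewrite big_ord_recr /= -IH2 -e1 -e2.
rewrite (_ : (fun n => w t n * \sum_(i < k.+1) P`_i * x t n ^+ i) = (fun n =>
  w t n * \sum_(i < k) P`_i * x t n ^+ i + P`_k * (w t n * x t n ^+ k)))//.
by apply/funext => n; rewrite big_ord_recr /=; ring.
Unshelve. all: by end_near.
Qed.

(** Method of moments: convergent moments determine the limit on polynomials, and bounded total mass
    carries convergence over to uniform limits of polynomials. *)
Lemma functional_cvg (g : R -> R) : poly_approximable g ->
  exists l : R, ssum (fun n => w t n * g (x t n)) @[t --> F] --> l.
Proof.
move=> ag; have [B B0 gB] := poly_approximable_bounded ag.
suff : cvg (ssum (fun n => w t n * g (x t n)) @[t --> F]) by move/cvg_ex.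
apply: cauchy_cvg; apply: cauchy_exP => e e0.
have m0 : ssum (w t) @[t --> F] --> m 0%N.
  have := @moment 0%N; under eq_fun do under eq_fun do rewrite expr0 mulr1.
  by [].
pose M := `|m 0%N| + 1; have M0 : 0 < M by rewrite ltr_wpDl.
have [P hP] := ag (e / (4 * M)) (divr_gt0 e0 (mulr_gt0 (ltr0Sn R 3) M0)).
have hc := @functional_poly P.
exists (\sum_(i < size P) P`_i * m i); rewrite /ball /=; near=> t.
have gt : [/\ forall n, 0 <= w t n, forall n, 0 <= x t n <= 1 & cvgn (series (w t))].
  by near: t; exact: good.
have wM : ssum (w t) <= M.
  have : `|m 0%N - ssum (w t)| < 1 by near: t; move/cvgrPdist_lt : m0; apply.
  by have := ler_norm (m 0%N); rewrite ltr_norml /M; lra.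
have t1 : `|\sum_(i < size P) P`_i * m i - ssum (fun n => w t n * P.[x t n])| < e / 2.
  by near: t; move/cvgrPdist_lt : hc; apply; rewrite divr_gt0.
have [Bp _ hBp] := horner_bounded P.
have [c1 _] := @cvgn_weighted t (horner P) Bp gt hBp.
have [c2 _] := cvgn_weighted gt gB.
have hP' y : 0 <= y <= 1 -> `|P.[y] - g y| <= e / (4 * M) by rewrite distrC; exact: hP.
have [_ t2] := cvgn_weighted gt hP'.
have [_ e12] := ssumB c1 c2.
have t3 : `|ssum (fun n => w t n * P.[x t n]) - ssum (fun n => w t n * g (x t n))| <= e / 4.
  rewrite -e12; rewrite (_ : (fun n => _ - _) = (fun n => w t n * (P.[x t n] - g (x t n)))).
    apply: (le_trans t2); have W0 : 0 <= ssum (w t) by case: gt => w0 _ cw; exact: ssum_ge0.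
    rewrite (_ : e / 4 = e / (4 * M) * M); last by field; rewrite gt_eqF.
    by apply: ler_wpM2l => //; rewrite divr_ge0 ?mulr_ge0 ?(ltW e0) ?(ltW M0).
  by apply/funext => n; rewrite mulrBr.
rewrite /preimage /=.
set u := \sum_(i < size P) _ in t1 *; set v := ssum (fun n => w t n * P.[x t n]) in t1 t3 *.
set g' := ssum (fun n => w t n * g (x t n)) in t3 *.
rewrite (_ : u - g' = (u - v) + (v - g')); last by ring.
by apply: (le_lt_trans (ler_normD _ _)); lra.
Unshelve. all: by end_near.
Qed.

End Functional.

Lemma ssum_finite (R : realType) (f : R^nat) M : (forall n, (M <= n)%N -> f n = 0) ->
  cvgn (series f) /\ ssum f = series f M.
Proof.
move=> fM; have h : series f @ \oo --> series f M.
  apply: cvg_near_cst; exists M => // n /= Mn.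
  rewrite /series /= (big_cat_nat (n := M))//= [X in _ + X](_ : _ = 0) ?addr0//.
  by rewrite big_nat big1// => k /andP[Mk _]; exact: fM.
by split; [apply/cvg_ex; exists (series f M) | exact: cvg_lim].
Qed.

Lemma oneB_expRN_bounds (R : realType) (x : R) : 0 <= x ->
  x / (1 + x) <= 1 - expR (- x) <= x.
Proof.
move=> x0; apply/andP; split; last first.
  by have := expR_ge1Dx (- x); move: (expR (- x)) => y; lra.
rewrite expRN; have h := expR_ge1Dx x; have p : 0 < 1 + x by lra.
have : (expR x)^-1 <= (1 + x)^-1 by rewrite lef_pV2 ?posrE ?expR_gt0.
have -> : x / (1 + x) = 1 - (1 + x)^-1 by field; rewrite gt_eqF.
by move: (expR x)^-1 (1 + x)^-1 => y z; lra.
Qed.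

Lemma geometric_sum (R : realType) (s : R) : 0 <= s < 1 ->
  cvgn (series (fun n => s ^+ n)) /\ ssum (fun n => s ^+ n) = (1 - s)^-1.
Proof.
move=> /andP[s0 s1]; have n1 : `|s| < 1 by rewrite ger0_norm.
have E : (fun n : nat => s ^+ n) = geometric 1 s.
  by apply/funext => n; rewrite /geometric /= mul1r.
split; first by rewrite E; exact: is_cvg_geometric_series.
by rewrite /ssum E (cvg_lim _ (cvg_geometric_series n1))// mul1r.
Qed.

Lemma frac_ge_half (R : realType) (y : R) : 0 <= y ->
  (y <= 1 -> y <= 2 * (y / (1 + y))) /\ (1 <= y -> 1 <= 2 * (y / (1 + y))).
Proof.
move=> y0; have p : 0 < 1 + y by lra.
by split=> y1; rewrite mulrA ler_pdivlMr//; nra.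
Qed.

(** [A] solves [A ^ (1 - gm) = 1 / 8], which is possible because [gm < 1], so that [2 A] is a small
    fraction of [A ^ gm]; then [K] is taken large enough. *)
Lemma tauberian_constants (R : realType) (gm : R) : 0 < gm < 1 -> exists (A : R) (K : nat),
  [/\ 0 < A, (0 < K)%N, 2 * A = A `^ gm / 4 & 2 * K%:R^-1 `^ gm <= A `^ gm / 4].
Proof.
move=> /andP[g0 g1].
have [A [A0 Ag]] : exists A : R, 0 < A /\ A `^ (1 - gm) = 1 / 8.
  exists ((1 / 8) `^ ((1 - gm)^-1)); rewrite powR_gt0 ?divr_gt0//.
  by rewrite -powRrM mulVf ?powRr1 ?divr_ge0// gt_eqF// subr_gt0.
have A2 : 2 * A = A `^ gm / 4.
  have : A `^ (1 - gm) * A `^ gm = A.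
    rewrite -powRD; last by rewrite (gt_eqF A0) implybT.
    by rewrite subrK powRr1// ltW.
  rewrite Ag; move: (A `^ gm) (A) => z y; lra.
have Ap : 0 < A `^ gm by exact: powR_gt0.
have [B [B0 Bg]] : exists B : R, 0 < B /\ B `^ gm = 8 / A `^ gm.
  exists ((8 / A `^ gm) `^ (gm^-1)); rewrite powR_gt0 ?divr_gt0//.
  by rewrite -powRrM mulVf ?powRr1 ?divr_ge0 ?(ltW Ap)// gt_eqF.
have [K KB] : exists K : nat, B < K%:R.
  by exists (Num.bound B); apply: archi_boundP; exact: ltW.
have KR : (0 : R) < K%:R by exact: lt_trans B0 KB.
exists A, K; split=> //; first by rewrite -(ltr0n R).
have : B `^ gm <= K%:R `^ gm.
  by apply: ge0_ler_powR; rewrite ?nnegrE ?(ltW g0) ?(ltW B0) ?(ltW KB).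
have kp : 0 < K%:R `^ gm :> R by exact: powR_gt0.
have Ke : K%:R^-1 `^ gm = (K%:R `^ gm)^-1.
  have -> : K%:R^-1 = K%:R `^ (-1) :> R by rewrite powR_inv1// ltW.
  by rewrite -powRrM mulN1r powRN.
rewrite Bg Ke ler_pdivrMr// => h.
rewrite -(ler_pM2l kp) mulrCA divff ?gt_eqF// mulr1.
by move: (K%:R `^ gm : R) (A `^ gm) h => z y h; lra.
Qed.

(* Karamata's method with smooth bumps supported in [1 < n t < b] as test
   functions; quasi-monotonicity makes [a] almost constant on their support. *)
Section Tauberian.
Variables (R : realType) (a : R^nat) (gm : R).
Hypotheses (a_ge0 : forall n, 0 <= a n) (ca : cvgn (series a)).
Hypothesis (gm01 : 0 < gm < 1).

Local Notation q t := (expR (- t)).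
(** For [a n = p n * R ^ n] this is [G(R) - G(R e^-t)], the drop of the Green function below its
    radius of convergence. *)
Definition increment (t : R) : R := ssum (fun n => a n * (1 - q t ^+ n)).
Local Notation S := increment.

Hypothesis S_gt0 : forall t, 0 < t -> 0 < S t.
Hypothesis regular : forall l, 0 < l -> S (l * t) / S t @[t --> 0^'+] --> l `^ gm.
Hypothesis quasi_monotone : forall e, 0 < e ->
  exists N0, forall m n, (N0 <= m)%N -> (m <= n)%N -> a n <= (1 + e) * a m.

Let q01 (t : R) : 0 < t -> 0 < q t < 1.
Proof. by move=> t0; rewrite expR_gt0 /= expR_lt1 oppr_lt0. Qed.

Let qn01 (t : R) n : 0 <= t -> 0 <= q t ^+ n <= 1.
Proof.
move=> t0; rewrite exprn_ge0 ?expR_ge0//= exprn_ile1 ?expR_ge0// expR_le1 oppr_le0.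
by [].
Qed.

Lemma cvgn_increment t : 0 <= t -> cvgn (series (fun n => a n * (1 - q t ^+ n))).
Proof.
move=> t0; apply: (series_le_cvg _ a_ge0 _ ca) => n; have /andP[h1 h2] := qn01 n t0.
  by rewrite mulr_ge0// subr_ge0.
by rewrite ler_piMr// gerBl.
Qed.

Lemma q_mul k (t : R) : q (k%:R * t) = q t ^+ k.
Proof. by rewrite -mulrN expRM_natl. Qed.

Section Bump.
Variable b : R.
Hypothesis b1 : 1 < b.

Let g0 (x : R) : R := Num.max 0 ((x - q b) * (q 1 - x)).
Let L (t : R) : R := ssum (fun n => a n * (1 - q t ^+ n) / S t * (q t ^+ n * g0 (q t ^+ n))).
Let J (t : R) : R := ssum (fun n => t * (q t ^+ n * (1 - q t ^+ n)) * g0 (q t ^+ n)).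

Let q1b : 0 < q b < q 1.
Proof. by rewrite expR_gt0 ltr_expR ltrN2. Qed.
Let q11 : 0 < q (1 : R) < 1. Proof. exact: q01. Qed.

Let g0_approx : poly_approximable g0.
Proof.
have /andP[h1 h2] := q1b; have /andP[h3 h4] := q11.
apply: poly_approximable_bump; apply/andP; split; apply: ltW => //; exact: lt_trans h4.
Qed.

Let near_pos : \forall t \near (0 : R)^'+, 0 < t.
Proof. exact: nbhs_right_gt. Qed.

(** The weights [a n (1 - q^n) / S t] sit at the points [q^n]. Their [k]-th moment is
    [(S ((k + 1) t) - S (k t)) / S t], which converges by regular variation. *)
Lemma bump_cvg_S : exists l : R, L t @[t --> 0^'+] --> l.
Proof.
apply: (@functional_cvg R R ((0 : R)^'+) _ (fun t n => a n * (1 - q t ^+ n) / S t)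
  (fun t n => q t ^+ n) (fun k => k.+1%:R `^ gm - k%:R `^ gm) _ _ (fun x => x * g0 x)).
- near=> t; have t0 : 0 < t by near: t.
  split=> [n|n|]; first 1 last.
  - exact: qn01 (ltW t0).
  - have [c _] := ssumZ ((S t)^-1) (cvgn_increment (ltW t0)).
    by move: c; under eq_fun do rewrite mulrC.
  - have /andP[h1 h2] := qn01 n (ltW t0).
    by rewrite divr_ge0 ?(ltW (S_gt0 t0))// mulr_ge0// subr_ge0.
- move=> k.
  have hc : S (k.+1%:R * t) / S t - S (k%:R * t) / S t @[t --> 0^'+] -->
      k.+1%:R `^ gm - k%:R `^ gm.
    apply: cvgB; first by apply: regular; rewrite ltr0n.
    case: k => [|k]; last by apply: regular; rewrite ltr0n.
    have -> : (0%:R : R) `^ gm = 0 by rewrite powR0// gt_eqF//; case/andP: gm01.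
    rewrite (_ : (fun t => _) = fun=> 0); first exact: cvg_cst.
    apply/funext => t; rewrite mul0r /S (_ : ssum _ = 0) ?mul0r//.
    rewrite -[RHS](ssum_zero R).2; apply: ssum_eq => n.
    by rewrite oppr0 expR0 expr1n subrr mulr0.
  apply: cvg_trans hc; apply: near_eq_cvg; near=> t.
  have t0 : 0 < t by near: t.
  have kt0 : 0 <= k%:R * t by rewrite mulr_ge0 ?(ltW t0).
  have kt1 : 0 <= k.+1%:R * t by rewrite mulr_ge0 ?(ltW t0).
  have [c e] := ssumB (cvgn_increment kt1) (cvgn_increment kt0).
  have [c' e'] := ssumZ ((S t)^-1) c.
  rewrite -mulrBl /S -e mulrC -/(S t) -e'; apply: ssum_eq => n.
  rewrite !q_mul -!exprM ![(_ * n)%N]mulnC !exprM exprS; ring.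
- exact: poly_approximable_mulX.
Unshelve. all: by end_near.
Qed.

Lemma div_oneB_expRN_cvg (j : nat) :
  t / (1 - q t ^+ j.+1) @[t --> (0 : R)^'+] --> (j.+1%:R^-1 : R).
Proof.
apply: (@squeeze_cvgr _ _ _ _ (fun=> j.+1%:R^-1) (fun t => (1 + j.+1%:R * t) / j.+1%:R)).
- near=> t; have t0 : 0 < t by near: t.
  rewrite -q_mul; have y0 : 0 < j.+1%:R * t by rewrite mulr_gt0.
  have /andP[h1 h2] := oneB_expRN_bounds (ltW y0).
  have /andP[_ /= h3] := q01 y0.
  have p : 0 < 1 - q (j.+1%:R * t) by rewrite subr_gt0.
  have p1 : 0 < 1 + j.+1%:R * t by rewrite addr_gt0.
  apply/andP; split.
    by rewrite ler_pdivlMr// mulrC ler_pdivrMr// [leRHS]mulrC.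
  rewrite ler_pdivrMr// mulrAC ler_pdivlMr//.
  by rewrite ler_pdivrMr// in h1; rewrite mulrC [leRHS]mulrC.
- exact: cvg_cst.
- rewrite -[X in _ --> X]div1r; apply: cvgM; last exact: cvg_cst.
  rewrite -[X in _ --> X]addr0; apply: cvgD; first exact: cvg_cst.
  rewrite -[X in _ --> X](mulr0 (j.+1%:R)); apply: cvgM; first exact: cvg_cst.
  exact: cvg_at_right_filter.
Unshelve. all: by end_near.
Qed.

(** The same bump against the weights obtained when [a] is replaced by a constant; here the moments
    are differences of geometric sums. *)
Lemma bump_cvg_J : exists l : R, J t @[t --> 0^'+] --> l.
Proof.
apply: (@functional_cvg R R ((0 : R)^'+) _ (fun t n => t * (q t ^+ n * (1 - q t ^+ n)))
  (fun t n => q t ^+ n) (fun k => k.+1%:R^-1 - k.+2%:R^-1) _ _ g0 g0_approx).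
- near=> t; have t0 : 0 < t by near: t.
  have /andP[h3 h4] := q01 t0.
  split=> [n|n|]; first 1 last.
  - exact: qn01 (ltW t0).
  - apply: (@series_le_cvg _ _ (fun n => t * q t ^+ n)) => [n|n|n|].
    + have /andP[h1 h2] := qn01 n (ltW t0); apply: mulr_ge0; first exact: ltW.
      by rewrite mulr_ge0// subr_ge0.
    + by apply: mulr_ge0; [exact: ltW | case/andP: (qn01 n (ltW t0))].
    + have /andP[h1 h2] := qn01 n (ltW t0); rewrite ler_pM2l// ler_piMr// gerBl//.
    + have q01' : 0 <= q t < 1 by rewrite (ltW h3).
      have [c _] := geometric_sum q01'.
      by have [] := ssumZ t c.
  - have /andP[h1 h2] := qn01 n (ltW t0); apply: mulr_ge0; first exact: ltW.
    by rewrite mulr_ge0// subr_ge0.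
- move=> k.
  have hc : t / (1 - q t ^+ k.+1) - t / (1 - q t ^+ k.+2) @[t --> (0 : R)^'+] -->
      (k.+1%:R^-1 - k.+2%:R^-1 : R) by apply: cvgB; exact: div_oneB_expRN_cvg.
  apply: cvg_trans hc; apply: near_eq_cvg; near=> t.
  have t0 : 0 < t by near: t.
  have /andP[h3 h4] := q01 t0.
  have P j : 0 <= q t ^+ j.+1 < 1 by rewrite exprn_ge0 ?(ltW h3)//= exprn_ilt1 ?(ltW h3).
  have [c1 e1] := geometric_sum (P k); have [c2 e2] := geometric_sum (P k.+1).
  have [c3 e3] := ssumZ t c1; have [c4 e4] := ssumZ t c2; have [c5 e5] := ssumB c3 c4.
  rewrite -e1 -e2 -e3 -e4 -e5; apply: ssum_eq => n.
  rewrite -!exprM ![(_ * n)%N]mulnC !exprM !exprS; ring.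
Unshelve. all: by end_near.
Qed.

(** About [d / t] indices satisfy [1 + d <= n t <= 1 + 2 d], a range strictly inside the support of
    the bump, and there the summand is at least [c0 * t]. *)
Lemma bump_J_lower : exists2 c, 0 < c & \forall t \near (0 : R)^'+, c <= J t.
Proof.
pose d := (b - 1) / 3; have d0 : 0 < d by rewrite divr_gt0// subr_gt0.
pose y1 := q (1 + 2 * d); pose y2 := q (1 + d).
have y12 : y1 < y2 by rewrite ltr_expR ltrN2; lra.
have d3 : 3 * d = b - 1 by rewrite mulrC divfK.
have y1b : q b < y1 by rewrite ltr_expR ltrN2; lra.
have y21 : y2 < q 1 by rewrite ltr_expR ltrN2; lra.
have /andP[qb0 _] := q1b; have /andP[_ q1_1] := q11.
pose c0 := q b * (1 - q 1) * ((y1 - q b) * (q 1 - y2)).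
have c00 : 0 < c0 by rewrite !mulr_gt0// subr_gt0.
exists (d / 2 * c0); first by apply: mulr_gt0 => //; exact: divr_gt0.
near=> t; have t0 : 0 < t by near: t.
have td : t <= d / 2.
  by apply: ltW; near: t; apply: nbhs_right_lt; rewrite divr_gt0.
have good n : 1 + d <= n%:R * t <= 1 + 2 * d -> c0 <= q t ^+ n * (1 - q t ^+ n) * g0 (q t ^+ n).
  move=> /andP[n1 n2]; rewrite -q_mul.
  have z1 : y1 <= q (n%:R * t) by rewrite ler_expR lerN2.
  have z2 : q (n%:R * t) <= y2 by rewrite ler_expR lerN2.
  move: z1 z2; move: (q (n%:R * t)) => z z1 z2.
  have g1 : (y1 - q b) * (q 1 - y2) <= g0 z.
    apply: (@le_trans _ _ ((z - q b) * (q 1 - z))); last by rewrite le_max lexx orbT.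
    by apply: ler_pM; rewrite ?subr_ge0 ?(ltW y1b) ?(ltW y21)// lerB.
  have A1 : 0 <= q b * (1 - q 1) by rewrite mulr_ge0 ?(ltW qb0)// subr_ge0 ltW.
  have A2 : 0 <= (y1 - q b) * (q 1 - y2) by rewrite mulr_ge0// subr_ge0 ltW.
  rewrite /c0; apply: ler_pM => //.
  apply: ler_pM; rewrite ?(ltW qb0) ?subr_ge0 ?(ltW q1_1)//.
  - by apply: le_trans z1; exact: ltW.
  - by rewrite lerD2l lerN2 (le_trans z2)// ltW.
have nn n : 0 <= t * (q t ^+ n * (1 - q t ^+ n)) * g0 (q t ^+ n).
  have /andP[h1 h2] := qn01 n (ltW t0).
  apply: mulr_ge0; last by rewrite le_max lexx.
  by apply: mulr_ge0; [exact: ltW | rewrite mulr_ge0// subr_ge0].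
have cJ : cvgn (series (fun n => t * (q t ^+ n * (1 - q t ^+ n)) * g0 (q t ^+ n))).
  have [B B0 gB] := poly_approximable_bounded g0_approx.
  have /andP[h3 h4] := q01 t0.
  have q01' : 0 <= q t < 1 by rewrite (ltW h3).
  have [cq _] := geometric_sum q01'.
  have [cq2 _] := ssumZ (t * B) cq.
  apply: (series_le_cvg nn _ _ cq2) => n; have /andP[h1 h2] := qn01 n (ltW t0).
    by rewrite !mulr_ge0 ?(ltW t0) ?(ltW B0).
  rewrite -!mulrA; apply: ler_wpM2l; first exact: ltW.
  rewrite mulrCA; apply: (@le_trans _ _ (q t ^+ n * g0 (q t ^+ n))).
    rewrite mulrCA; apply: ler_wpM2l => //; rewrite ler_piMl ?gerBl//.
    by rewrite le_max lexx.
  rewrite [leRHS]mulrC; apply: ler_wpM2l => //.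
  by apply: le_trans (gB _ (qn01 n (ltW t0))); exact: ler_norm.
have [n0 /andP[n01 n02]] : exists n0 : nat, 1 + d < n0%:R * t <= 1 + d + t.
  have p : 0 <= (1 + d) / t by rewrite divr_ge0 ?(ltW t0)// addr_ge0 ?(ltW d0).
  exists (Num.truncn ((1 + d) / t)).+1; have /andP[u1 u2] := truncn_itv p.
  rewrite -ltr_pdivrMr// u2 /= -natr1 mulrDl mul1r lerD2r -ler_pdivlMr//.
have [m /andP[m1 m2]] : exists m : nat, d - t < m%:R * t <= d.
  have p : 0 <= d / t by rewrite divr_ge0 ?(ltW t0)// (ltW d0).
  exists (Num.truncn (d / t)); have /andP[u1 u2] := truncn_itv p.
  rewrite -ler_pdivlMr// u1 andbT ltrBlDr -[X in _ + X]mul1r -mulrDl -ltr_pdivrMr// natr1 //.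
apply: le_trans (series_le_ssum (n0 + m) nn cJ); rewrite /series /=.
rewrite (big_cat_nat (n := n0)) ?leq_addr//=.
apply: (@le_trans _ _ (\sum_(n0 <= n < n0 + m) t * c0)); last first.
  rewrite -[leLHS]add0r; apply: lerD; first exact: sumr_ge0.
  apply: ler_sum_nat => n /andP[nn0 nm]; rewrite -mulrA ler_pM2l//; apply: good.
  have f1 : n0%:R * t <= n%:R * t by rewrite ler_pM2r// ler_nat.
  have f2 : n%:R * t + t <= n0%:R * t + m%:R * t.
    rewrite -[X in _ + X <= _]mul1r -!mulrDl ler_pM2r// natr1 -natrD ler_nat//.
  by apply/andP; split; lra.
have -> : \sum_(n0 <= n < n0 + m) t * c0 = m%:R * t * c0.
  by rewrite sumr_const_nat addKn -[LHS]mulr_natl (mulrA m%:R).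
rewrite ler_pM2r//.
lra.
Unshelve. all: by end_near.
Qed.

Let g0_ge0 x : 0 <= g0 x. Proof. by rewrite le_max lexx. Qed.

Lemma bump_support t n : g0 (q t ^+ n) != 0 -> 1 < n%:R * t < b.
Proof.
rewrite -q_mul => gn.
have : 0 < (q (n%:R * t) - q b) * (q 1 - q (n%:R * t)).
  rewrite ltNge; apply: contraNN gn => le0; apply/eqP; exact: max_l.
have /andP[q0 qb] := q1b.
suff H z : 0 < (z - q b) * (q 1 - z) -> q b < z < q 1.
  by move=> /H; rewrite !ltr_expR !ltrN2 andbC.
have [h1|h1] := ltP z (q 1).
  by rewrite pmulr_lgt0 ?subr_gt0// => ->.
move=> h2; have h3 : 0 <= z - q b by rewrite subr_ge0 ltW// (lt_le_trans qb).
have h4 : q 1 - z <= 0 by rewrite subr_le0.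
by have := mulr_ge0_le0 h3 h4; rewrite leNgt h2.
Qed.

Let term_ge0 t n : 0 < t -> 0 <= a n * (1 - q t ^+ n) * (q t ^+ n * g0 (q t ^+ n)).
Proof.
move=> t0; have /andP[h1 h2] := qn01 n (ltW t0).
by rewrite !mulr_ge0// subr_ge0.
Qed.

Lemma bump_series t : 0 < t ->
  [/\ cvgn (series (fun n => a n * (1 - q t ^+ n) * (q t ^+ n * g0 (q t ^+ n)))),
    S t * L t = ssum (fun n => a n * (1 - q t ^+ n) * (q t ^+ n * g0 (q t ^+ n))),
    cvgn (series (fun n => q t ^+ n * (1 - q t ^+ n) * g0 (q t ^+ n))) &
    J t = t * ssum (fun n => q t ^+ n * (1 - q t ^+ n) * g0 (q t ^+ n))].
Proof.
move=> t0; have [B B0 gB] := poly_approximable_bounded g0_approx.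
have gB' n : g0 (q t ^+ n) <= B by apply: le_trans (gB _ (qn01 n (ltW t0))); exact: ler_norm.
have /andP[h3 h4] := q01 t0.
have c1 : cvgn (series (fun n => a n * (1 - q t ^+ n) * (q t ^+ n * g0 (q t ^+ n)))).
  have [cB _] := ssumZ B ca.
  apply: (series_le_cvg (fun n => term_ge0 n t0) _ _ cB) => n; first by rewrite mulr_ge0// ltW.
  have /andP[h1 h2] := qn01 n (ltW t0).
  rewrite [leRHS]mulrC -mulrA; apply: ler_wpM2l => //.
  rewrite -[leRHS]mul1r; apply: ler_pM; rewrite ?subr_ge0 ?gerBl ?mulr_ge0//.
  by rewrite -[leRHS]mul1r; apply: ler_pM.
have c2 : cvgn (series (fun n => q t ^+ n * (1 - q t ^+ n) * g0 (q t ^+ n))).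
  have q01' : 0 <= q t < 1 by rewrite (ltW h3).
  have [cq _] := geometric_sum q01'.
  have [cB _] := ssumZ B cq.
  apply: (series_le_cvg _ _ _ cB) => n; have /andP[h1 h2] := qn01 n (ltW t0).
  - by rewrite !mulr_ge0// subr_ge0.
  - by rewrite mulr_ge0// ltW.
  - rewrite [leRHS]mulrC -mulrA; apply: ler_wpM2l => //.
    by rewrite -[leRHS]mul1r; apply: ler_pM; rewrite ?subr_ge0 ?gerBl.
split=> //.
- have [c3 e3] := ssumZ ((S t)^-1) c1; rewrite /L.
  rewrite (_ : ssum _ = (S t)^-1 * ssum (fun n => a n * (1 - q t ^+ n) * (q t ^+ n * g0 (q t ^+ n)))).
    by rewrite mulrA divff ?mul1r// gt_eqF// S_gt0.
  by rewrite -e3; apply: ssum_eq => n; ring.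
- by have [_ <-] := ssumZ t c2; apply: ssum_eq => n; ring.
Qed.

Local Notation ratio N := (N%:R * a N / S N%:R^-1).

(** At [t = 1 / N] the bump sees only [N < n < b N], where [a n <= (1 + e) a N]. *)
Lemma bump_lower e N : 0 < e -> (0 < N)%N ->
  (forall n, (N <= n)%N -> a n <= (1 + e) * a N) ->
  L N%:R^-1 <= (1 + e) * ratio N * J N%:R^-1.
Proof.
move=> e0 N0 aN; have NR : (0 : R) < N%:R by rewrite ltr0n.
have t0 : (0 : R) < N%:R^-1 by rewrite invr_gt0.
have [c1 e1 c2 e2] := bump_series t0; have S0 := S_gt0 t0.
rewrite -(ler_pM2l S0) e1 e2.
have -> : S N%:R^-1 * ((1 + e) * ratio N * (N%:R^-1 * ssum (fun n => q N%:R^-1 ^+ n * (1 - q N%:R^-1 ^+ n) * g0 (q N%:R^-1 ^+ n)))) =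
  (1 + e) * a N * ssum (fun n => q N%:R^-1 ^+ n * (1 - q N%:R^-1 ^+ n) * g0 (q N%:R^-1 ^+ n)).
  by field; rewrite !gt_eqF.
have [c3 <-] := ssumZ ((1 + e) * a N) c2; apply: ssum_le => // n.
have [->|gn] := eqVneq (g0 (q N%:R^-1 ^+ n)) 0; first by rewrite !mulr0.
have /andP[n1 _] := bump_support gn.
have Nn : (N <= n)%N.
  by move: n1; rewrite ltr_pdivlMr// mul1r ltr_nat => /ltnW.
have /andP[h1 h2] := qn01 n (ltW t0).
rewrite -!mulrA [leRHS]mulrA [q _ ^+ n * ((1 - _) * _)]mulrCA; apply: ler_wpM2r; last exact: aN.
by rewrite !mulr_ge0// subr_ge0.
Qed.

(** At [t = b / N] the bump sees only [N / b < n < N], where [a N <= (1 + e) a n]. *)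
Lemma bump_upper e N0 N : 0 < e -> (0 < N)%N -> (N0%:R : R) <= N%:R / b ->
  (forall m n, (N0 <= m)%N -> (m <= n)%N -> a n <= (1 + e) * a m) ->
  ratio N * J (b / N%:R) <= (1 + e) * (b * (S (b / N%:R) / S N%:R^-1)) * L (b / N%:R).
Proof.
move=> e0 N1 NN0 aN; have NR : (0 : R) < N%:R by rewrite ltr0n.
have b0 : 0 < b by exact: lt_trans b1.
have t0 : 0 < b / N%:R by rewrite divr_gt0.
have t0' : (0 : R) < N%:R^-1 by rewrite invr_gt0.
have [c1 e1 c2 e2] := bump_series t0; have S0 := S_gt0 t0'.
rewrite -(ler_pM2l S0).
have -> : S N%:R^-1 * ((1 + e) * (b * (S (b / N%:R) / S N%:R^-1)) * L (b / N%:R)) =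
  b * ((1 + e) * (S (b / N%:R) * L (b / N%:R))) by field; rewrite gt_eqF.
rewrite e1 e2.
have -> : S N%:R^-1 * (ratio N * (b / N%:R * ssum (fun n => q (b / N%:R) ^+ n * (1 - q (b / N%:R) ^+ n) * g0 (q (b / N%:R) ^+ n)))) =
  b * (a N * ssum (fun n => q (b / N%:R) ^+ n * (1 - q (b / N%:R) ^+ n) * g0 (q (b / N%:R) ^+ n))).
  by field; rewrite !gt_eqF.
rewrite ler_pM2l//.
have [c3 <-] := ssumZ (a N) c2; have [c4 <-] := ssumZ (1 + e) c1.
apply: ssum_le => // n.
have [->|gn] := eqVneq (g0 (q (b / N%:R) ^+ n)) 0; first by rewrite !mulr0.
have /andP[n1 n2] := bump_support gn.
have nN : (n <= N)%N.
  by move: n2; rewrite mulrCA -[X in _ < X]mulr1 ltr_pM2l// ltr_pdivrMr// mul1r ltr_nat => /ltnW.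
have N0n : (N0 <= n)%N.
  rewrite -(ler_nat R) (le_trans NN0)// ler_pdivrMr//.
  by move: n1; rewrite mulrA ltr_pdivlMr// mul1r => /ltW.
have /andP[h1 h2] := qn01 n (ltW t0).
rewrite -!mulrA [leRHS]mulrA [q _ ^+ n * ((1 - _) * _)]mulrCA; apply: ler_wpM2r; last exact: aN.
by rewrite !mulr_ge0// subr_ge0.
Qed.

Lemma bump_functional : exists (L J : R -> R) (l I c : R),
  [/\ L t @[t --> 0^'+] --> l, J t @[t --> 0^'+] --> I, 0 < c,
      \forall t \near (0 : R)^'+, 0 <= L t /\ c <= J t &
  forall e N, 0 < e -> (0 < N)%N ->
    ((forall n, (N <= n)%N -> a n <= (1 + e) * a N) ->
      L N%:R^-1 <= (1 + e) * ratio N * J N%:R^-1) /\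
    (forall N0, (N0%:R : R) <= N%:R / b ->
      (forall m n, (N0 <= m)%N -> (m <= n)%N -> a n <= (1 + e) * a m) ->
      ratio N * J (b / N%:R) <= (1 + e) * (b * (S (b / N%:R) / S N%:R^-1)) * L (b / N%:R))].
Proof.
have [l hl] := bump_cvg_S; have [I hI] := bump_cvg_J; have [c c0 cJ] := bump_J_lower.
exists L, J, l, I, c; split=> //.
  near=> t; have t0 : 0 < t by near: t; exact: nbhs_right_gt.
  split; last by near: t.
  have [_ e1 _ _] := bump_series t0; have S0 := S_gt0 t0.
  rewrite -(pmulr_rge0 _ S0) e1.
  have [c1 _ _ _] := bump_series t0.
  by apply: ssum_ge0 => // n; exact: term_ge0.
move=> e N e0 N0; split=> [h1|M h1 h2]; first exact: bump_lower.
exact: (bump_upper e0 N0 h1 h2).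
Unshelve. all: by end_near.
Qed.

End Bump.

Lemma inv_nat_cvg (c : R) : 0 < c -> c / N%:R @[N --> \oo] --> (0 : R)^'+.
Proof.
move=> c0 P [e /= e0 eP].
exists (Num.bound (c / e)).+1 => // N /= hN.
have NR : (0 : R) < N%:R by rewrite ltr0n; exact: leq_trans hN.
have p : 0 <= c / e by rewrite divr_ge0 ?(ltW c0) ?(ltW e0).
apply: eP; last by rewrite divr_gt0.
rewrite /= sub0r normrN ger0_norm ?divr_ge0 ?(ltW c0) ?(ltW NR)//.
rewrite ltr_pdivrMr// mulrC -ltr_pdivrMr//.
by apply: lt_le_trans (archi_boundP p) _; rewrite ler_nat ltnW.
Qed.

Local Notation ratio N := (N%:R * a N / S N%:R^-1).

(** [k] is the limit of the quotient [L / J] of the two bump functionals. The upper estimate is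
    taken at [b / N], which costs a factor [b] and, by regular variation, [b ^ gm <= b]. *)
Lemma tauberian_sandwich b : 1 < b -> exists2 k, 0 <= k & forall e, 0 < e ->
  \forall N \near \oo, k - e <= ratio N <= b ^+ 2 * k + e.
Proof.
move=> b1; have b0 : 0 < b by exact: lt_trans b1.
have [L [J [l [I [c [hl hI c0 hLJ0 bnd]]]]]] := bump_functional b1.
have L0 : \forall t \near (0 : R)^'+, 0 <= L t by apply: filterS hLJ0 => t [].
have cJ : \forall t \near (0 : R)^'+, c <= J t by apply: filterS hLJ0 => t [].
have I0 : 0 < I by apply: lt_le_trans c0 _; apply: (cvgr_to_ge hI).
have hLJ : L t / J t @[t --> (0 : R)^'+] --> l / I.
  by apply: cvgM => //; apply: cvgV => //; rewrite gt_eqF.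
have L1 : L N%:R^-1 / J N%:R^-1 @[N --> \oo] --> l / I.
  have := inv_nat_cvg ltr01; under eq_fun do rewrite mul1r.
  by move=> h; exact: cvg_comp h hLJ.
have L2 : L (b / N%:R) / J (b / N%:R) @[N --> \oo] --> l / I.
  by have h := inv_nat_cvg b0; exact: cvg_comp h hLJ.
have J1 : \forall N \near \oo, c <= J N%:R^-1.
  have := inv_nat_cvg ltr01; under eq_fun do rewrite mul1r.
  by move=> h; exact: h _ cJ.
have J2 : \forall N \near \oo, c <= J (b / N%:R).
  by have h := inv_nat_cvg b0; exact: h _ cJ.
have S2 : S (b / N%:R) / S N%:R^-1 @[N --> \oo] --> b `^ gm.
  have := inv_nat_cvg ltr01; under eq_fun do rewrite mul1r.
  by move=> h; exact: (@cvg_comp _ _ _ (fun N : nat => N%:R^-1) (fun t => S (b * t) / S t) _ _ _ h (regular b0)).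
have bg : b `^ gm <= b.
  have /andP[g1 g2] := gm01.
  by rewrite -[leRHS]powRr1 ?(ltW b0)//; apply: ler_powR; exact: ltW.
have k0 : 0 <= l / I.
  apply: (cvgr_to_ge hLJ); near=> t; apply: divr_ge0; first by near: t.
  by apply: ltW; apply: lt_le_trans c0 _; near: t.
exists (l / I) => // e e0; set k := l / I in k0 L1 L2 *.
pose Y (N : nat) := b * (S (b / N%:R) / S N%:R^-1) * (L (b / N%:R) / J (b / N%:R)).
have hY : Y @ \oo --> b * b `^ gm * k.
  by apply: cvgM => //; apply: cvgM => //; exact: cvg_cst.
have y2 : b * b `^ gm * k <= b ^+ 2 * k by rewrite ler_wpM2r// expr2 ler_pM2l.
set y := b * b `^ gm * k in hY y2.
have y0 : 0 <= y by rewrite /y mulr_ge0// mulr_ge0 ?powR_ge0// ltW.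
pose d := Num.min 1 (e / (2 + y + k)).
have p0 : 0 < 2 + y + k by lra.
have d0 : 0 < d by rewrite lt_min ltr01 divr_gt0.
have d1 : d <= 1 by rewrite ge_min lexx.
have de : d * (2 + y + k) <= e by rewrite -ler_pdivlMr// ge_min lexx orbT.
have [N0 hN0] := quasi_monotone d0.
have kd : k - d < k by rewrite ltrBlDr ltrDl.
have yd : y < y + d by rewrite ltrDl.
have L1' := @cvgr_ge _ _ _ _ _ _ L1 _ kd; have Y' := @cvgr_le _ _ _ _ _ _ hY _ yd.
have J1' : \forall N \near \oo, 0 < J N%:R^-1 by apply: filterS J1 => N; exact: lt_le_trans.
have J2' : \forall N \near \oo, 0 < J (b / N%:R) by apply: filterS J2 => N; exact: lt_le_trans.
near=> N.
have N1 : (0 < N)%N by near: N; exists 1%N.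
have NN0 : (N0 <= N)%N by near: N; exists N0.
have NN0b : (N0%:R : R) <= N%:R / b.
  rewrite ler_pdivlMr//; near: N; exists (Num.bound (N0%:R * b)) => // n /= hn.
  apply: ltW; apply: lt_le_trans (archi_boundP _) _; first by rewrite mulr_ge0// ltW.
  by rewrite ler_nat.
have j1 : 0 < J N%:R^-1 by near: N; exact: J1'.
have j2 : 0 < J (b / N%:R) by near: N; exact: J2'.
have [low0 upp0] := bnd d N d0 N1.
have low := low0 (fun n => hN0 N n NN0).
have upp := upp0 N0 NN0b hN0.
have l1 : k - d <= L N%:R^-1 / J N%:R^-1.
  by near: N; exact: L1'.
have l2 : Y N <= y + d.
  by near: N; exact: Y'.
set x := ratio N in low upp *.
have low' : k - d <= (1 + d) * x.
  by apply: (le_trans l1); rewrite ler_pdivrMr.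
have upp' : x <= (1 + d) * (y + d).
  rewrite -(ler_pM2r j2); apply: (le_trans upp).
  rewrite (_ : _ * L _ = (1 + d) * Y N * J (b / N%:R)); last first.
    rewrite /Y; move: (S (b / N%:R) / S N%:R^-1) (L (b / N%:R)) (J (b / N%:R)) j2 => u1 u2 u3 u30.
    by field; rewrite gt_eqF.
  by rewrite ler_pM2r// ler_pM2l//; lra.
apply/andP; split; last by nra.
rewrite -(ler_pM2l (_ : 0 < 1 + d)); last lra.
apply: le_trans low'; nra.
Unshelve. all: by end_near.
Qed.

(** The sum [S (A t)] at [t = 1 / N] is split at [N] and [N K]. The first range is at most
    [2 A S t], the last at most [2 S (t / K)], and the middle one at most [4 K N a N] by
    quasi-monotonicity. The constants make the outer ranges too small to account for the limit
    [A ^ gm]. *)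
Lemma tauberian_lower : exists2 c, 0 < c & \forall N \near \oo, c <= ratio N.
Proof.
have [A [K [A0 K0 A2 Kg]]] := tauberian_constants gm01.
have KR : (0 : R) < K%:R by rewrite ltr0n.
have Ap : 0 < A `^ gm by exact: powR_gt0.
exists (A `^ gm / (16 * K%:R)); first by rewrite divr_gt0// mulr_gt0.
have h1 : S (A * N%:R^-1) / S N%:R^-1 @[N --> \oo] --> A `^ gm.
  have := inv_nat_cvg ltr01; under eq_fun do rewrite mul1r.
  by move=> h; exact: (@cvg_comp _ _ _ (fun N : nat => N%:R^-1) (fun t => S (A * t) / S t) _ _ _ h (regular A0)).
have h2 : S (K%:R^-1 * N%:R^-1) / S N%:R^-1 @[N --> \oo] --> K%:R^-1 `^ gm.
  have := inv_nat_cvg ltr01; under eq_fun do rewrite mul1r.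
  have Ki : (0 : R) < K%:R^-1 by rewrite invr_gt0.
  by move=> h; exact: (@cvg_comp _ _ _ (fun N : nat => N%:R^-1) (fun t => S (K%:R^-1 * t) / S t) _ _ _ h (regular Ki)).
have [N0 hN0] := quasi_monotone ltr01.
have g78 : A `^ gm * (7 / 8) < A `^ gm by move: (A `^ gm) Ap => z z0; lra.
have g32 : K%:R^-1 `^ gm < K%:R^-1 `^ gm + A `^ gm / 32 by rewrite ltrDl divr_gt0.
have h1' := @cvgr_ge _ _ _ _ _ _ h1 _ g78; have h2' := @cvgr_le _ _ _ _ _ _ h2 _ g32.
near=> N.
have N1 : (0 < N)%N by near: N; exists 1%N.
have NN0 : (N0 <= N)%N by near: N; exists N0.
have NR : (0 : R) < N%:R by rewrite ltr0n.
pose t : R := N%:R^-1; have t0 : 0 < t by rewrite invr_gt0.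
have At0 : 0 < A * t by rewrite mulr_gt0.
have Kt0 : 0 < K%:R^-1 * t by rewrite mulr_gt0 ?invr_gt0.
pose f n := (n <= N * K)%:R * (2 * a N).
have f0 n : ((N * K).+1 <= n)%N -> f n = 0 by move=> h; rewrite /f leqNgt h mul0r.
have [cf ef] := ssum_finite f0.
have [c1 e1] := ssumZ (2 * A) (cvgn_increment (ltW t0)).
have [c2 e2] := ssumZ 2 (cvgn_increment (ltW Kt0)).
have [c3 e3] := ssumD c1 c2; have [c4 e4] := ssumD c3 cf.
have key : S (A * t) <= 2 * A * S t + 2 * S (K%:R^-1 * t) + ssum f.
  rewrite /S -e1 -e2 -e3 -e4; apply: ssum_le => //; first exact: cvgn_increment (ltW At0).
  move=> n; rewrite -!q_mul.
  have T1 : 0 <= 2 * A * (a n * (1 - q (n%:R * t))).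
    rewrite !mulr_ge0 ?(ltW A0)// subr_ge0 q_mul; by case/andP: (qn01 n (ltW t0)).
  have T2 : 0 <= 2 * (a n * (1 - q (n%:R * (K%:R^-1 * t)))).
    rewrite !mulr_ge0// subr_ge0 q_mul; by case/andP: (qn01 n (ltW Kt0)).
  have T3 : 0 <= f n by rewrite /f !mulr_ge0.
  have T4 : a n * (1 - q (n%:R * (A * t))) <= a n.
    by rewrite q_mul ler_piMr// gerBl; case/andP: (qn01 n (ltW At0)).
  have [nN|Nn] := leqP n N.
    suff : a n * (1 - q (n%:R * (A * t))) <= 2 * A * (a n * (1 - q (n%:R * t))).
      by move=> H; apply: (le_trans H); rewrite -addrA lerDl addr_ge0.
    rewrite [leRHS]mulrCA; apply: ler_wpM2l => //.
    have y0 : 0 <= n%:R * t by rewrite mulr_ge0 ?(ltW t0).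
    have y1 : n%:R * t <= 1 by rewrite /t ler_pdivrMr// mul1r ler_nat.
    have z0 : 0 <= n%:R * (A * t) by rewrite mulr_ge0 ?(ltW At0).
    have /andP[_ u1] := oneB_expRN_bounds z0; have /andP[u2 _] := oneB_expRN_bounds y0.
    apply: (le_trans u1);
    have u3 : n%:R * t <= 2 * (1 - q (n%:R * t)).
      apply: le_trans ((frac_ge_half y0).1 y1) _; apply: ler_wpM2l => //.
    rewrite [leLHS]mulrCA [leRHS](_ : _ = A * (2 * (1 - q (n%:R * t)))); last by ring.
    by apply: ler_wpM2l => //; exact: ltW.
  have [nK|Kn] := leqP n (N * K)%N.
    have aN : a n <= 2 * a N.
      by have := hN0 N n NN0 (ltnW Nn); rewrite (_ : 1 + 1 = 2 :> R).
    have fE : f n = 2 * a N by rewrite /f nK mul1r.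
    by apply: (le_trans T4); apply: (le_trans aN); rewrite fE lerDr addr_ge0.
  suff : a n <= 2 * (a n * (1 - q (n%:R * (K%:R^-1 * t)))).
    by move=> H; apply: (le_trans T4); apply: (le_trans H); rewrite addrAC lerDr addr_ge0.
  have y1 : 1 <= n%:R * (K%:R^-1 * t).
    rewrite /t -invfM ler_pdivlMr ?mulr_gt0// mul1r mulrC -natrM ler_nat; exact: ltnW.
  have y0 : 0 <= n%:R * (K%:R^-1 * t) by apply: le_trans y1.
  have /andP[u2 _] := oneB_expRN_bounds y0.
  have u3 : 1 <= 2 * (1 - q (n%:R * (K%:R^-1 * t))).
    by apply: le_trans ((frac_ge_half y0).2 y1) _; apply: ler_wpM2l.
  by rewrite [leRHS]mulrCA -[leLHS]mulr1; apply: ler_wpM2l.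
have fS : ssum f <= 4 * (K%:R * (N%:R * a N)).
  rewrite ef /series /= big_nat (eq_bigr (fun=> 2 * a N)); last first.
    by move=> n /andP[_ nM]; rewrite /f -ltnS nM mul1r.
  rewrite -big_nat sumr_const_nat subn0 -[leLHS]mulr_natl.
  have -> : 4 * (K%:R * (N%:R * a N)) = (N * K + N * K)%:R * (2 * a N).
    by rewrite natrD !natrM; ring.
  apply: ler_wpM2r; first by rewrite mulr_ge0.
  rewrite ler_nat -addn1 leq_add2l muln_gt0 N1 /=.
  by move: KR; rewrite ltr0n.
have S0 : 0 < S t by exact: S_gt0.
have b1 : A `^ gm * (7 / 8) <= S (A * t) / S t.
  by rewrite /t; near: N; exact: h1'.
have b2 : S (K%:R^-1 * t) / S t <= (K%:R^-1) `^ gm + A `^ gm / 32.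
  by rewrite /t; near: N; exact: h2'.
have b3 : S (A * t) / S t <= 2 * A + 2 * (S (K%:R^-1 * t) / S t) +
    4 * (K%:R * (N%:R * a N / S t)).
  rewrite ler_pdivrMr//; apply: (le_trans key); apply: (le_trans (lerD (lexx _) fS)).
  rewrite le_eqVlt; apply/orP; left; apply/eqP.
  by move: (S (K%:R^-1 * t)) (S t) S0 => y1 y2 y20; field; rewrite gt_eqF.
rewrite ler_pdivrMr ?mulr_gt0// -/t.
have -> : N%:R * a N / S t * (16 * K%:R) = 16 * (K%:R * (N%:R * a N / S t)) by ring.
move: b1 b2 b3 A2 Kg Ap; move: (S (A * t) / S t) (S (K%:R^-1 * t) / S t) (A `^ gm) (K%:R^-1 `^ gm)
  (K%:R * (N%:R * a N / S t)) => x1 x2 x3 x4 x.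
lra.
Unshelve. all: by end_near.
Qed.

(** The sandwich with [b = 2] bounds the ratio; with [b] close to [1] it then confines the ratio to
    a short interval, hence the Cauchy property. The lower bound makes the limit positive. *)
Theorem tauberian : exists2 C : R, 0 < C & (fun N => ratio N) @ \oo --> C.
Proof.
have [c c0 hc] := tauberian_lower.
have [k2 k20 hk2] := @tauberian_sandwich 2 (ltr1n R 2).
suff cv : cvgn (fun N => ratio N).
  have [C hC] := (cvg_ex _).1 cv; exists C => //.
  by apply: lt_le_trans c0 _; exact: (cvgr_to_ge hC).
apply: cauchy_cvg; apply: cauchy_exP => e e0.
pose B := 2 ^+ 2 * k2 + 1.
have B0 : 0 < B by rewrite ltr_wpDl// mulr_ge0// exprn_ge0.
pose d := Num.min 1 (e / (8 * (B + e + 1))).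
have p0 : 0 < 8 * (B + e + 1) by lra.
have d0 : 0 < d by rewrite lt_min ltr01 divr_gt0.
have d1 : d <= 1 by rewrite ge_min lexx.
have de : d * (8 * (B + e + 1)) <= e by rewrite -ler_pdivlMr// ge_min lexx orbT.
have b1 : 1 < 1 + d by rewrite ltrDl.
have [k k0 hk] := tauberian_sandwich b1.
exists k; rewrite /ball /=; near=> N.
have /andP[x1 x2] : k - e / 4 <= ratio N <= (1 + d) ^+ 2 * k + e / 4.
  by near: N; apply: hk; rewrite divr_gt0.
have /andP[_ x3] : k2 - 1 <= ratio N <= 2 ^+ 2 * k2 + 1.
  by near: N; exact: hk2.
rewrite /preimage /=; rewrite -/B in x3; move: (ratio N) x1 x2 x3 => x x1 x2 x3.
have kB : k <= B + e by lra.
have : (1 + d) ^+ 2 * k <= k + e / 2.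
  have : d * k <= d * (B + e) by rewrite ler_pM2l.
  have : d ^+ 2 * k <= d * k by rewrite ler_wpM2r// expr2 ler_piMl// ltW.
  have -> : (1 + d) ^+ 2 * k = k + 2 * (d * k) + d ^+ 2 * k by ring.
  have : d * (8 * (B + e + 1)) = 8 * (d * (B + e)) + 8 * d by ring.
  move: (d ^+ 2 * k) (d * k) (d * (B + e)) => y1 y2 y3; lra.
rewrite ltr_norml; move: ((1 + d) ^+ 2 * k) x2 => y x2 hy.
by apply/andP; split; lra.
Unshelve. all: by end_near.
Qed.

End Tauberian.

(** * Reference series *)

Section Excess.
Variable R : realType.
Local Notation phi n s := (n%:R * (1 - s) - 1 + s ^+ n).

Lemma phi_double n (s : R) : phi n s = (1 - s) ^+ 2 * \sum_(i < n) \sum_(j < i) s ^+ j.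
Proof.
elim: n => [|n IH]; first by rewrite big_ord0 mul0r expr0 mulr0 sub0r addNr.
have -> : \sum_(i < n.+1) \sum_(j < i) s ^+ j =
    \sum_(i < n) \sum_(j < i) s ^+ j + \sum_(j < n) s ^+ j by rewrite big_ord_recr.
rewrite (mulrDr ((1 - s) ^+ 2)) -IH; have -> : (1 - s) ^+ 2 * \sum_(j < n) s ^+ j = (1 - s) * ((1 - s) * \sum_(j < n) s ^+ j).
  by rewrite expr2 mulrA.
have -> : (1 - s) * \sum_(j < n) s ^+ j = 1 - s ^+ n.
  by apply: oppr_inj; rewrite opprB -mulNr opprB -subrX1.
by rewrite exprS -natr1; ring.
Qed.

Lemma sum_nat_ord n : \sum_(i < n) (i%:R : R) = n%:R * (n%:R - 1) / 2.
Proof.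
elim: n => [|n IH]; first by rewrite big_ord0 !mul0r.
by rewrite big_ord_recr /= IH -natr1; field.
Qed.

Lemma phi_bounds n (s : R) N : 0 <= s <= 1 -> (n <= N)%N ->
  (1 - s) ^+ 2 * (n%:R * (n%:R - 1) / 2) * s ^+ N <= phi n s <=
  (1 - s) ^+ 2 * (n%:R * (n%:R - 1) / 2).
Proof.
move=> /andP[s0 s1] nN; rewrite phi_double -sum_nat_ord -mulrA.
have d0 : 0 <= (1 - s) ^+ 2 by exact: sqr_ge0.
apply/andP; split; apply: ler_wpM2l => //; first rewrite mulr_suml;
  apply: ler_sum => -[i /= i_n] _.
- have -> : i%:R * s ^+ N = \sum_(j < i) s ^+ N by rewrite sumr_const card_ord mulr_natl.
  apply: ler_sum => -[j /= ji] _; apply: ler_wiXn2l => //.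
  by apply: leq_trans nN; apply: ltnW; exact: ltn_trans i_n.
- have -> : i%:R = \sum_(j < i) (1 : R) by rewrite sumr_const card_ord.
  by apply: ler_sum => -[j /= ji] _; exact: exprn_ile1.
Qed.

Section OneSequence.
Variable r : R^nat.
Hypotheses (r_ge0 : forall n, 0 <= r n) (cm : cvgn (series (fun n => n%:R * r n))).

Lemma excess_cvg s : 0 <= s <= 1 -> cvgn (series (fun n => r n * phi n s)).
Proof.
move=> s01; have [c _] := ssumZ (1 - s) cm.
apply: (series_le_cvg _ _ _ c) => n; have /andP[h1 h2] := excess_term n s01.
- by rewrite mulr_ge0.
- by have /andP[_ s1] := s01; rewrite mulr_ge0 ?subr_ge0 ?mulr_ge0.
- rewrite [leRHS](_ : _ = r n * (n%:R * (1 - s))); last by ring.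
  exact: ler_wpM2l.
Qed.

(** For [n <= N] the remainder is at least [s ^ N (1 - s)^2 n (n - 1) / 2], so partial sums of the
    divergent second moment appear as factors of [(1 - s)^2]. *)
Lemma excess_super (K : R) : ~ cvgn (series (fun n => n%:R ^+ 2 * r n)) ->
  \forall s \near (1 : R)^'-, K * (1 - s) ^+ 2 <= excess r s.
Proof.
move=> nc; have t0 n : 0 <= n%:R * (n%:R - 1) / 2 * r n.
  apply: mulr_ge0 => //; apply: divr_ge0 => //.
  by case: n => [|n]; rewrite ?mul0r// mulr_ge0// -natr1 addrK.
have [N hN] : exists N, 2 * `|K| <= series (fun n => n%:R * (n%:R - 1) / 2 * r n) N.
  apply: contrapT => /forallNP h; apply: nc.
  have c : cvgn (series (fun n => n%:R * (n%:R - 1) / 2 * r n)).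
    apply: (@series_cvg_bounded _ _ (2 * `|K|) t0 _).1 => N.
    by apply: ltW; rewrite ltNge; apply/negP; exact: h.
  have [c2 _] := ssumZ 2 c; have [c3 _] := ssumD c2 cm.
  rewrite (_ : (fun n => _) = (fun n => 2 * (n%:R * (n%:R - 1) / 2 * r n) + n%:R * r n))//.
  by apply/funext => n; field.
have half : (0 : R) < 1 / 2 by lra.
have [s0 /andP[s00 s01] sN] := exprn_near1 N half.
near=> s.
have /andP[sp s1] : 0 < s < 1 by near: s; exact: near_left1.
have hs : s0 <= s <= 1.
  by rewrite (ltW s1) andbT; apply: ltW; near: s; exact: nbhs_left_gt.
have s01' : 0 <= s <= 1 by rewrite !ltW.
have nn n : 0 <= r n * phi n s by have /andP[h1 _] := excess_term n s01'; rewrite mulr_ge0.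
apply: le_trans (series_le_ssum N nn (excess_cvg s01')).
have h2 := sN s hs; have d0 : 0 <= (1 - s) ^+ 2 by exact: sqr_ge0.
have : (1 - s) ^+ 2 * (1 / 2) * series (fun n => n%:R * (n%:R - 1) / 2 * r n) N <=
    series (fun n => r n * phi n s) N.
  rewrite /series /= mulr_sumr; apply: ler_sum_nat => n /andP[_ nN].
  have /andP[h3 _] := phi_bounds s01' (ltnW nN).
  apply: le_trans (ler_wpM2l (r_ge0 n) h3).
  rewrite [leRHS](_ : _ = (1 - s) ^+ 2 * (n%:R * (n%:R - 1) / 2 * r n) * s ^+ N); last by ring.
  rewrite [leLHS](_ : _ = (1 - s) ^+ 2 * (n%:R * (n%:R - 1) / 2 * r n) * (1 / 2)); last by ring.
  apply: ler_wpM2l; [exact: mulr_ge0 | lra].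
apply: le_trans; rewrite [K * _]mulrC -mulrA; apply: ler_wpM2l => //.
have := ler_norm K; lra.
Unshelve. all: by end_near.
Qed.

End OneSequence.

(** Only finitely many terms violate the coefficient comparison; they contribute [O((1 - s)^2)],
    which is negligible by [excess_super]. *)
Lemma excess_equiv (p r : R^nat) (c : R) :
  (forall n, 0 <= p n) -> (forall n, 0 <= r n) ->
  cvgn (series (fun n => n%:R * p n)) -> cvgn (series (fun n => n%:R * r n)) ->
  ~ cvgn (series (fun n => n%:R ^+ 2 * r n)) ->
  (forall e, 0 < e -> exists N, forall n, (N <= n)%N -> `|p n - c * r n| <= e * r n) ->
  excess p s / excess r s @[s --> (1 : R)^'-] --> c.
Proof.
move=> p0 r0 cp cr nr pr; apply/cvgrPdist_le => e e0.
have e2 : 0 < e / 2 by rewrite divr_gt0.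
have [N hN] := pr _ e2.
pose B := \sum_(0 <= n < N) `|p n - c * r n| * (n%:R * (n%:R - 1) / 2).
have hs := excess_super r0 cr (2 * (`|B| + 1) / e) nr.
near=> s.
have /andP[sp s1] : 0 < s < 1 by near: s; exact: near_left1.
have s01 : 0 <= s <= 1 by rewrite !ltW.
have E1 : 2 * (`|B| + 1) / e * (1 - s) ^+ 2 <= excess r s by near: s; exact: hs.
have d0 : 0 < (1 - s) ^+ 2 by rewrite exprn_gt0// subr_gt0.
have B1 : 0 < `|B| + 1 by rewrite ltr_wpDl.
have E0 : 0 < excess r s.
  by apply: lt_le_trans E1; rewrite mulr_gt0// divr_gt0// mulr_gt0.
have c1 := excess_cvg p0 cp s01; have c2 := excess_cvg r0 cr s01.
have [c3 e3] := ssumZ c c2; have [c4 e4] := ssumB c1 c3; have [c5 e5] := ssumZ (e / 2) c2.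
have P n : 0 <= phi n s by have /andP[] := excess_term n s01.
pose f n := (n < N)%:R * (`|p n - c * r n| * phi n s).
have f0 n : (N <= n)%N -> f n = 0 by move=> h; rewrite /f ltnNge h mul0r.
have [c6 e6] := ssum_finite f0; have [c7 e7] := ssumD c5 c6.
have fB : ssum f <= B * (1 - s) ^+ 2.
  rewrite e6 /series /= /B mulr_suml; apply: ler_sum_nat => n /andP[_ nN].
  rewrite /f nN mul1r -mulrA; apply: ler_wpM2l => //.
  by have /andP[_ h] := phi_bounds s01 (leqnn n); rewrite [leRHS]mulrC.
have bound : `|excess p s - c * excess r s| <= e / 2 * excess r s + ssum f.
  rewrite /excess -e3 -e4 -e5 -e7.
  have h n : `|p n * phi n s - c * (r n * phi n s)| <= e / 2 * (r n * phi n s) + f n.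
    rewrite (_ : _ - _ = (p n - c * r n) * phi n s); last by ring.
    rewrite normrM [`|phi n s|]ger0_norm// /f; have [nN|Nn] := ltnP n N.
      by rewrite mul1r lerDr !mulr_ge0 ?(ltW e0)// divr_ge0// ltW.
    by rewrite mul0r addr0 mulrA; apply: ler_wpM2r => //; exact: hN.
  by have := ssum_tail 0 h c7; rewrite /series /= !big_geq// !subr0.
rewrite distrC (_ : _ - c = (excess p s - c * excess r s) / excess r s); last first.
  by field; rewrite gt_eqF.
rewrite normrM normfV (gtr0_norm E0) ler_pdivrMr//.
apply: (le_trans bound); have E2 : B * (1 - s) ^+ 2 <= e / 2 * excess r s.
  have : e / 2 * (2 * (`|B| + 1) / e * (1 - s) ^+ 2) <= e / 2 * excess r s.
    by apply: ler_wpM2l => //; exact: ltW.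
  have -> : e / 2 * (2 * (`|B| + 1) / e * (1 - s) ^+ 2) = (`|B| + 1) * (1 - s) ^+ 2.
    by field; rewrite gt_eqF.
  apply: le_trans; apply: ler_wpM2r; first exact: ltW.
  by have := ler_norm B; lra.
apply: (@le_trans _ _ (e / 2 * excess r s + e / 2 * excess r s)).
  by rewrite lerD2l (le_trans fB).
by rewrite -mulrDl -splitr.
Unshelve. all: by end_near.
Qed.

End Excess.

Section PowerSums.
Variable R : realType.

Lemma ln_succ_bounds (N : nat) : (0 < N)%N ->
  (N.+1%:R^-1 : R) <= ln (N.+1%:R : R) - ln (N%:R : R) <= (N%:R^-1 : R).
Proof.
move=> N0; have p1 : (0 : R) < N%:R by rewrite ltr0n.
have p2 : (0 : R) < N.+1%:R by rewrite ltr0n.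
have i1 : (0 : R) < N%:R^-1 by rewrite invr_gt0.
have i2 : (0 : R) < N.+1%:R^-1 by rewrite invr_gt0.
apply/andP; split.
- have e : ln N%:R - ln N.+1%:R = ln (1 + (- N.+1%:R^-1)) :> R.
    rewrite -ln_div ?posrE//; congr ln.
    by rewrite -[X in X / _](addrK 1) natr1 mulrBl divff ?gt_eqF// mul1r.
  have : ln (1 + (- N.+1%:R^-1)) <= - N.+1%:R^-1 :> R.
    by apply: le_ln1Dx; rewrite ltrN2 invf_lt1// ltr1n ltnS.
  by rewrite -e; move: (ln _) (ln _) (_^-1) => x1 x2 x3; lra.
- have e : ln N.+1%:R - ln N%:R = ln (1 + N%:R^-1) :> R.
    by rewrite -ln_div ?posrE//; congr ln; rewrite -natr1 mulrDl divff ?gt_eqF// mul1r.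
  by rewrite e; apply: le_ln1Dx; lra.
Qed.

Lemma harmonic_bounds N : (0 < N)%N ->
  (ln N%:R : R) <= series (fun n => n%:R^-1) N /\
  series (fun n => n%:R^-1) N.+1 <= 1 + ln N%:R :> R.
Proof.
elim: N => // -[|N] IH _.
  by rewrite /series /= big_nat1 big_nat_recr//= big_nat1 invr0 invr1 ln1 add0r addr0 !lexx.
have [IH1 IH2] := IH isT; have /andP[h1 h2] := @ln_succ_bounds N.+1 isT.
rewrite (seriesSr _ N.+1) (seriesSr _ N.+2) /=; move: h1 h2 IH1 IH2.
move: (ln N.+1%:R) (ln N.+2%:R) (series _ N.+1) (series _ N.+2).
by move: (N.+1%:R^-1) (N.+2%:R^-1) => u v a b x y *; split; lra.
Qed.

Lemma inv_sqr_tail K M : (0 < K)%N ->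
  \sum_(K.+1 <= n < K.+1 + M) ((n%:R ^+ 2)^-1 : R) <= K%:R^-1 - (K + M)%:R^-1.
Proof.
move=> K0; elim: M => [|M IH]; first by rewrite big_geq ?addn0 ?subrr.
rewrite addnS big_nat_recr/=; last by rewrite leq_addr.
have p : (0 : R) < (K + M)%:R by rewrite ltr0n addn_gt0 K0.
have p' : (0 : R) < (K + M)%:R + 1 by lra.
have : ((K.+1 + M)%:R ^+ 2)^-1 <= (K + M)%:R^-1 - (K + M.+1)%:R^-1 :> R.
  rewrite addSn addnS -natr1; move: ((K + M)%:R : R) p p' => x p p'.
  have -> : x^-1 - (x + 1)^-1 = (x * (x + 1))^-1 by field; rewrite !gt_eqF.
  by rewrite lef_pV2 ?posrE ?exprn_gt0 ?mulr_gt0// expr2 ler_pM2r// lerDl.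
move: IH; move: (\sum_(_ <= _ < _) _) => y; lra.
Qed.

Lemma inv_sqr_sum_le N : series (fun n => (n%:R ^+ 2)^-1) N <= 2 :> R.
Proof.
apply: (@le_trans _ _ (series (fun n => (n%:R ^+ 2)^-1) (2 + N))).
  apply: nondecreasing_series => [n _|]; last by rewrite leq_addl.
  by rewrite invr_ge0 exprn_ge0.
have e2 : \sum_(0 <= n < 2) ((n%:R ^+ 2)^-1 : R) = 1.
  by rewrite big_nat_recr//= big_nat1 expr0n invr0 expr1n invr1 add0r.
rewrite /series /= (big_cat_nat (n := 2))//= e2.
have := @inv_sqr_tail 1 N isT; have : (0 : R) <= (1 + N)%:R^-1 by rewrite invr_ge0.
rewrite invr1; move: (\sum_(_ <= _ < _) _) => y; lra.
Qed.

Lemma sqrt_telescope (t : R) n : 0 < t -> (0 < n)%N ->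
  t / (2 * Num.sqrt (n%:R * t) * (1 + Num.sqrt (n%:R * t)) ^+ 2) <=
    Num.sqrt (n%:R * t) / (1 + Num.sqrt (n%:R * t)) -
    Num.sqrt (n.-1%:R * t) / (1 + Num.sqrt (n.-1%:R * t)).
Proof.
move=> t0 n0; set a := Num.sqrt (n%:R * t); set b := Num.sqrt (n.-1%:R * t).
have nR : (0 : R) < n%:R by rewrite ltr0n.
have a0 : 0 < a by rewrite sqrtr_gt0 mulr_gt0.
have b0 : 0 <= b by exact: sqrtr_ge0.
have ba : b <= a.
  by apply: ler_wsqrtr; rewrite ler_pM2r// ler_nat leq_pred.
have e : a ^+ 2 - b ^+ 2 = t.
  rewrite !sqr_sqrtr ?mulr_ge0 ?(ltW t0)// -mulrBl -natrB ?leq_pred//.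
  by rewrite -subn1 subKn// mul1r.
move: (a) (b) a0 b0 ba e; clear a b => a b a0 b0 ba e.
have -> : a / (1 + a) - b / (1 + b) = (a - b) / ((1 + a) * (1 + b)).
  by field; rewrite !gt_eqF//; lra.
have ab0 : 0 <= a - b by rewrite subr_ge0.
have pa : 0 < 1 + a by lra.
have pb : 0 < 1 + b by lra.
have -> : t = (a - b) * (a + b) by rewrite -e subr_sqr.
rewrite -[leLHS]mulrA; apply: (ler_wpM2l ab0).
rewrite ler_pdivrMr ?mulr_gt0 ?exprn_gt0// mulrC ler_pdivlMr ?mulr_gt0//.
have h1 : a + b <= 2 * a by lra.
have h2 : (1 + a) * (1 + b) <= (1 + a) ^+ 2 by rewrite expr2 ler_pM2l// lerD2l.
by apply: ler_pM => //; [lra | rewrite mulr_ge0 ?(ltW pa) ?(ltW pb)].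
Qed.

(* A term bounded by an increment of the bounded function [sqrt y / (1 + sqrt y)]. *)
Lemma sqrt_telescope_series (t C : R) (u : R^nat) : 0 < t -> 0 <= C ->
  (forall n, 0 <= u n) -> u 0%N = 0 ->
  (forall n, (0 < n)%N -> u n <=
     C * (t / (2 * Num.sqrt (n%:R * t) * (1 + Num.sqrt (n%:R * t)) ^+ 2))) ->
  cvgn (series u) /\ ssum u <= C.
Proof.
move=> t0 C0 u0 u00 ub; apply: series_cvg_bounded => // N.
suff : series u N.+1 <= C * (Num.sqrt (N%:R * t) / (1 + Num.sqrt (N%:R * t))).
  rewrite seriesSr => h; apply: (@le_trans _ _ (series u N + u N)); first by rewrite lerDl.
  apply: (le_trans h); rewrite ler_piMr//.
  have s0 : 0 <= Num.sqrt (N%:R * t) by exact: sqrtr_ge0.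
  by rewrite ler_pdivrMr ?mul1r; lra.
elim: N => [|N IH].
  by rewrite /series /= big_nat1 u00 mul0r sqrtr0 mul0r mulr0.
rewrite seriesSr; have h1 := ub N.+1 isT; have h2 := sqrt_telescope t0 (ltn0Sn N).
have h3 := le_trans h1 (ler_wpM2l C0 h2); rewrite /= mulrBr in h3.
move: IH h3; move: (C * _) (C * _) (series u _) (u _) => x1 x2 x3 x4; lra.
Qed.

Lemma cvgn_inv_sqrt3 : cvgn (series (fun n => (Num.sqrt n%:R ^+ 3)^-1 : R)).
Proof.
have [] // := @sqrt_telescope_series 1 8 (fun n => (Num.sqrt n%:R ^+ 3)^-1).
- by rewrite sqrtr0 expr0n invr0.
move=> n n0; rewrite mulr1; set a := Num.sqrt n%:R.
have a1 : 1 <= a by rewrite -sqrtr1 ler_sqrt// ler1n.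
have a0 : 0 < a by exact: lt_le_trans a1.
have a2 : 0 < 1 + a by lra.
rewrite mul1r ler_pdivlMr ?mulr_gt0 ?exprn_gt0//.
rewrite mulrC ler_pdivrMr ?exprn_gt0//.
have : (1 + a) ^+ 2 <= (2 * a) ^+ 2 by apply: lerXn2r; rewrite ?nnegrE; lra.
move=> h; have := ler_wpM2l (_ : 0 <= 2 * a) h.
rewrite (_ : 2 * a * (2 * a) ^+ 2 = 8 * a ^+ 3); last by ring.
by apply; lra.
Qed.

Lemma harmonic_diverges (u : R^nat) (c : R) N0 : 0 < c -> (forall n, 0 <= u n) ->
  (forall n, (N0 <= n)%N -> c * n%:R^-1 <= u n) -> ~ cvgn (series u).
Proof.
move=> c0 u0 cu cv; pose B := ssum u + c * series (fun n => n%:R^-1) N0.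
have h N : c * series (fun n => n%:R^-1) N <= B.
  have s0 M : 0 <= series (fun n => n%:R^-1 : R) M by rewrite /series /=; apply: sumr_ge0.
  have U0 : 0 <= ssum u by exact: ssum_ge0.
  have [NN|NN] := leqP N N0.
    rewrite /B -[leLHS]add0r; apply: lerD => //; rewrite ler_pM2l//.
    by apply: nondecreasing_series => // n _.
  rewrite /B addrC {1}/series /= (big_cat_nat (n := N0) (m := 0%N))//= ?(ltnW NN)// mulrDr lerD2l.
  apply: le_trans (series_le_ssum N u0 cv); rewrite /series /= (big_cat_nat (n := N0) (m := 0%N))//= ?(ltnW NN)//.
  rewrite -[leLHS]add0r; apply: lerD; first exact: sumr_ge0.
  by rewrite mulr_sumr; apply: ler_sum_nat => n /andP[n1 _]; exact: cu.
pose N := (Num.bound (expR (B / c + 1))).+1.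
have hN : expR (B / c + 1) <= N%:R.
  apply: ltW; apply: lt_le_trans (archi_boundP _) _; first exact: expR_ge0.
  by rewrite ler_nat.
have [h1 _] := @harmonic_bounds N isT.
have h2 : B / c + 1 <= ln N%:R by rewrite -ler_expR lnK// posrE ltr0n.
have := h N; rewrite mulrC -ler_pdivlMr//; lra.
Qed.

End PowerSums.

(** * The reference series of exponent 5/2 *)

Section Psi.
Variable R : realType.
(** Taylor remainder of the exponential. For [s = e^-t] it linearizes the terms of the excess: [n (1
    - s) - 1 + s^n = psi_exp (n t) - n psi_exp t]. *)
Definition psi_exp (y : R) : R := y - 1 + expR (- y).
Local Notation psi := psi_exp.

Lemma psi_exp_ge0 y : 0 <= psi y.
Proof. by have := expR_ge1Dx (- y); rewrite /psi; lra. Qed.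

Lemma psi_exp_le y : 0 <= y -> psi y <= y /\ psi y <= y ^+ 2 / 2.
Proof.
move=> y0; split; first by have : expR (- y) <= 1; [rewrite expR_le1 oppr_le0 | rewrite /psi; lra].
rewrite -subr_ge0; apply: (@ge0_of_derive R (fun y => y ^+ 2 / 2 - psi y) (fun y => y - (1 - expR (- y)))) => //.
- move=> x; rewrite /psi; apply: is_derive_eq; rewrite /GRing.scale /=; lra.
- by rewrite /psi expr0n mul0r oppr0 expR0; lra.
- by move=> x x0; have := psi_exp_ge0 x; rewrite /psi; lra.
Qed.

(** The comparison is differentiated twice; it says that [psi_exp y / y^2] is nonincreasing. *)
Lemma psi_exp_scale (l y : R) : 1 <= l -> 0 <= y -> psi (l * y) <= l ^+ 2 * psi y.
Proof.
move=> l1 y0; rewrite -subr_ge0; move: y y0.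
apply: (@ge0_of_derive R (fun y => l ^+ 2 * psi y - psi (l * y))
  (fun y => l * (l * (1 - expR (- y)) - (1 - expR (- (l * y)))))).
- move=> x; rewrite /psi; apply: is_derive_eq; rewrite /GRing.scale /=; ring.
- by rewrite /psi mulr0 oppr0 expR0; ring.
- move=> x x0; apply: mulr_ge0; first lra.
  apply: (@ge0_of_derive R (fun y => l * (1 - expR (- y)) - (1 - expR (- (l * y))))
    (fun y => l * (expR (- y) - expR (- (l * y))))) x0.
  + move=> z; apply: is_derive_eq; rewrite /GRing.scale /=; ring.
  + by rewrite mulr0 oppr0 expR0; ring.
  + move=> z z0; apply: mulr_ge0; first lra.
    by rewrite subr_ge0 ler_expR lerN2 ler_peMl.
Qed.

End Psi.

Section RefFive.
Variable R : realType.
Local Notation psi := (@psi_exp R).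
Local Notation root n := (Num.sqrt (n%:R : R)).
Let r5 n := (root n ^+ 5)^-1.
Let A t := ssum (fun n => r5 n * psi (n%:R * t)).

(** Using [psi_exp y <= y^2 / 2] for [y <= 1] and [psi_exp y <= y] beyond, the term fits under a
    telescoping increment, which yields the order [t^(3/2)]. *)
Lemma psi5_term t n : 0 < t -> (0 < n)%N -> r5 n * psi (n%:R * t) <=
  8 * Num.sqrt t ^+ 3 * (t / (2 * Num.sqrt (n%:R * t) * (1 + Num.sqrt (n%:R * t)) ^+ 2)).
Proof.
move=> t0 n0; have nR : (0 : R) < n%:R by rewrite ltr0n.
have a0 : 0 < root n by rewrite sqrtr_gt0.
have b0 : 0 < Num.sqrt t by rewrite sqrtr_gt0.
have [p1 p2] := psi_exp_le (ltW (mulr_gt0 nR t0)).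
rewrite /r5 [Num.sqrt (_ * _)]sqrtrM ?ler0n//.
have e1 : root n ^+ 2 = n%:R by rewrite sqr_sqrtr ?ler0n.
have e2 : Num.sqrt t ^+ 2 = t by rewrite sqr_sqrtr// ltW.
move: p1 p2; move: (psi _) => y.
move: (root n) e1 a0 (Num.sqrt t) e2 b0 => a e1 a0 b e2 b0.
rewrite -e1 -e2 -exprMn => p1 p2.
have c0 : 0 < a * b by exact: mulr_gt0.
have key : y * (1 + a * b) ^+ 2 <= 4 * (a * b) ^+ 4.
  move: (a * b) c0 p1 p2 => c c0 p1 p2; have c1 : 0 <= (1 + c) ^+ 2 by exact: sqr_ge0.
  have [h|h] := leP c 1.
    apply: (le_trans (ler_wpM2r c1 p2)).
    rewrite (_ : 4 * c ^+ 4 = c ^+ 2 ^+ 2 / 2 * 8); last by field.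
    apply: ler_wpM2l; first by rewrite divr_ge0 ?sqr_ge0.
    by apply: (@le_trans _ _ (2 ^+ 2)); [apply: lerXn2r; rewrite ?nnegrE|]; lra.
  apply: (le_trans (ler_wpM2r c1 p1)).
  rewrite (_ : 4 * c ^+ 4 = c ^+ 2 * (2 * c) ^+ 2); last by ring.
  apply: ler_wpM2l; first exact: sqr_ge0.
  by apply: lerXn2r; rewrite ?nnegrE; lra.
rewrite (_ : 8 * b ^+ 3 * _ = (a ^+ 5)^-1 * (4 * (a * b) ^+ 4 / (1 + a * b) ^+ 2)); last first.
  field; rewrite !gt_eqF//; lra.
apply: ler_wpM2l; first by rewrite invr_ge0 exprn_ge0// ltW.
have d0 : 0 < 1 + a * b by lra.
by rewrite ler_pdivlMr// exprn_gt0.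
Qed.

Lemma r5_ge0 n : 0 <= r5 n.
Proof. by rewrite invr_ge0 exprn_ge0// sqrtr_ge0. Qed.

Lemma psi5_ge0 t n : 0 <= r5 n * psi (n%:R * t).
Proof. by rewrite mulr_ge0 ?r5_ge0 ?psi_exp_ge0. Qed.

Lemma psi5_cvg t : 0 < t ->
  cvgn (series (fun n => r5 n * psi (n%:R * t))) /\ A t <= 8 * Num.sqrt t ^+ 3.
Proof.
move=> t0; have h8 : 0 <= 8 * Num.sqrt t ^+ 3 by rewrite mulr_ge0// exprn_ge0// sqrtr_ge0.
apply: (@sqrt_telescope_series _ t) => //.
- by move=> n; exact: psi5_ge0.
- by rewrite /r5 sqrtr0 expr0n invr0 mul0r.
- by move=> n; exact: psi5_term.
Qed.

Lemma psi5_scale t l : 0 < t -> 1 <= l -> A (l * t) <= l ^+ 2 * A t.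
Proof.
move=> t0 l1; have l0 : 0 < l by exact: lt_le_trans l1.
have [c1 _] := psi5_cvg t0; have [c2 _] := psi5_cvg (mulr_gt0 l0 t0).
have [c3 <-] := ssumZ (l ^+ 2) c1; apply: ssum_le => // n.
rewrite [leRHS]mulrCA; apply: ler_wpM2l; first exact: r5_ge0.
by rewrite mulrCA; apply: psi_exp_scale => //; rewrite mulr_ge0// ltW.
Qed.

(* [psi y / y ^ (5 / 2)] is decreasing, so each term of [A t] is dominated by
   the [m] corresponding terms of [A (t / m)]. *)
Lemma psi5_block t (m n k : nat) : 0 < t -> (0 < k)%N -> (k <= m * n)%N ->
  r5 n * psi (n%:R * t) / (root m) ^+ 5 <= r5 k * psi (k%:R * (t / m%:R)).
Proof.
move=> t0 k0 kmn; have mn0 : (0 < m * n)%N by exact: leq_trans kmn.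
have /andP[m0 n0] : (0 < m)%N && (0 < n)%N by rewrite -muln_gt0.
have mR : (0 : R) < m%:R by rewrite ltr0n.
have nR : (0 : R) < n%:R by rewrite ltr0n.
have kR : (0 : R) < k%:R by rewrite ltr0n.
have l1 : 1 <= (m * n)%:R / k%:R :> R by rewrite ler_pdivlMr// mul1r ler_nat.
have y0 : 0 <= k%:R * (t / m%:R) by rewrite mulr_ge0// divr_ge0// ltW.
have h := psi_exp_scale l1 y0.
have e : (m * n)%:R / k%:R * (k%:R * (t / m%:R)) = n%:R * t.
  by rewrite natrM; field; rewrite !gt_eqF.
rewrite e in h.
have -> : r5 n * psi (n%:R * t) / root m ^+ 5 = (root (n * m) ^+ 5)^-1 * psi (n%:R * t).
  rewrite /r5 (natrM _ n m) sqrtrM ?ler0n//; move: (psi _) (root n) (root m) => x a b.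
  have -> : (a * b) ^+ 5 = a ^+ 5 * b ^+ 5 by exact: exprMn.
  by move: (a ^+ 5) (b ^+ 5) => u v; rewrite invfM mulrAC.
apply: (@le_trans _ _ ((root (n * m) ^+ 5)^-1 * (((m * n)%:R / k%:R) ^+ 2 * psi (k%:R * (t / m%:R))))).
  by apply: ler_wpM2l => //; rewrite invr_ge0 exprn_ge0// sqrtr_ge0.
rewrite [leLHS]mulrA; apply: ler_wpM2r; first exact: psi_exp_ge0.
rewrite /r5 mulnC; have e1 : root (m * n) ^+ 2 = (m * n)%:R by rewrite sqr_sqrtr ?ler0n.
have e2 : root k ^+ 2 = k%:R by rewrite sqr_sqrtr ?ler0n.
have kb : root k <= root (m * n) by apply: ler_wsqrtr; rewrite ler_nat.
have a0 : 0 < root k by rewrite sqrtr_gt0.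
have b0 : 0 < root (m * n) by rewrite sqrtr_gt0 ltr0n.
move: (root k) e2 a0 (root (m * n)) e1 b0 kb => a e2 a0 b e1 b0 ab; rewrite -e1 -e2.
have -> : (b ^+ 5)^-1 * (b ^+ 2 / a ^+ 2) ^+ 2 = (b * a ^+ 4)^-1.
  by field; rewrite !gt_eqF.
rewrite lef_pV2 ?posrE ?exprn_gt0 ?mulr_gt0 ?exprn_gt0// exprS.
by apply: ler_wpM2r => //; rewrite exprn_ge0// ltW.
Qed.

Lemma psi5_divide t (m : nat) : 0 < t -> (0 < m)%N ->
  A t / root m ^+ 3 <= A (t / m%:R).
Proof.
move=> t0 m0; have mR : (0 : R) < m%:R by rewrite ltr0n.
have tm : 0 < t / m%:R by rewrite divr_gt0.
have [c1 _] := psi5_cvg t0; have [c2 _] := psi5_cvg tm.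
have q0 : 0 < root m by rewrite sqrtr_gt0.
rewrite mulrC; have [c3 <-] := ssumZ (root m ^+ 3)^-1 c1.
apply: (series_cvg_bounded _ _).2 => [n|n].
  by rewrite mulr_ge0 ?psi5_ge0// invr_ge0 exprn_ge0// ltW.
apply: (@le_trans _ _ (series (fun n => (root m ^+ 3)^-1 * (r5 n * psi (n%:R * t))) n.+1)).
  rewrite [leRHS]seriesSr lerDl mulr_ge0 ?psi5_ge0// invr_ge0 exprn_ge0// ltW.
apply: le_trans (series_le_ssum (m * n).+1 (psi5_ge0 _) c2).
elim: n => [|n IH].
  by rewrite muln0 /series /= !big_nat1 /r5 sqrtr0 expr0n invr0 !mul0r mulr0.
rewrite [leLHS]seriesSr {2}/series /= (big_cat_nat (n := (m * n).+1) (m := 0%N))//=; last first.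
  by rewrite ltnS leq_mul.
apply: lerD => //.
(* The block of indices from [m n + 1] to [m (n + 1)] has [m] terms, and
   [m * m^(-5/2) = m^(-3/2)]. *)
apply: (@le_trans _ _ (\sum_((m * n).+1 <= k < (m * n.+1).+1)
   (r5 n.+1 * psi (n.+1%:R * t) / (root m) ^+ 5))).
  rewrite sumr_const_nat subSS -mulnBr subSn// subnn muln1.
  have : root m ^+ 2 = m%:R by rewrite sqr_sqrtr ?ler0n.
  rewrite -[X in _ <= X]mulr_natr; move: (r5 _ * _) => z.
  move: (m%:R : R) (root m) q0 => M q q0 <-.
  by rewrite le_eqVlt; apply/orP; left; apply/eqP; field; rewrite gt_eqF.
by apply: ler_sum_nat => k /andP[k1 k2]; apply: psi5_block => //; exact: leq_ltn_trans k1.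
Qed.

(** The quotient [Q] is bounded by [8] and almost decreasing, [Q t >= (1 - t / t0) Q t0] for
    [t <= t0]; hence it tends to its supremum at [0]. *)
Lemma psi5_limit : exists2 L : R, 0 < L & A t / Num.sqrt t ^+ 3 @[t --> 0^'+] --> L.
Proof.
pose Q t := A t / Num.sqrt t ^+ 3.
have Q8 t : 0 < t -> Q t <= 8.
  by move=> t0; rewrite ler_pdivrMr ?exprn_gt0 ?sqrtr_gt0//; exact: (psi5_cvg t0).2.
have Qm t t0 : 0 < t -> t <= t0 -> (1 - t / t0) * Q t0 <= Q t.
  move=> tp tt; have t0p : 0 < t0 by exact: lt_le_trans tt.
  (* Division by the integer [m] is exact up to a factor between [1] and [(m + 1) / m], which
     [psi5_scale] absorbs. *)
  pose m := Num.truncn (t0 / t).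
  have t1 : 1 <= t0 / t by rewrite ler_pdivlMr// mul1r.
  have /andP[m1 m2] : m%:R <= t0 / t < m.+1%:R by apply: truncn_itv; exact: le_trans t1.
  have m0 : (0 < m)%N by rewrite truncn_gt0.
  have mR : (0 : R) < m%:R by rewrite ltr0n.
  have h1 := psi5_divide t0p m0.
  have l1 : 1 <= t0 / m%:R / t.
    by rewrite -mulrA -invfM ler_pdivlMr ?mulr_gt0// mul1r -ler_pdivlMr.
  have h2 := psi5_scale tp l1; rewrite divfK ?gt_eqF// in h2.
  have b0 : 0 < Num.sqrt (t0 / m%:R) by rewrite sqrtr_gt0 divr_gt0.
  have a0 : 0 < Num.sqrt t by rewrite sqrtr_gt0.
  have ab : Num.sqrt t <= Num.sqrt (t0 / m%:R).
    by apply: ler_wsqrtr; rewrite ler_pdivlMr// mulrC -ler_pdivlMr.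
  have eb : Num.sqrt (t0 / m%:R) ^+ 2 = t0 / m%:R by rewrite sqr_sqrtr// divr_ge0 ?ltW.
  have ea : Num.sqrt t ^+ 2 = t by rewrite sqr_sqrtr// ltW.
  have q0 : 0 < root m by rewrite sqrtr_gt0.
  have A0 : 0 <= A t0 by apply: ssum_ge0; [exact: psi5_ge0 | exact: (psi5_cvg t0p).1].
  have eb3 : Num.sqrt t0 = Num.sqrt (t0 / m%:R) * root m.
    by rewrite -sqrtrM ?divfK ?gt_eqF// divr_ge0 ?ltW.
  have hm : 1 - t / t0 <= t / (t0 / m%:R).
    rewrite invf_div mulrA ler_pdivlMr// mulrBl mul1r divfK ?gt_eqF//.
    apply: ltW; move: m2; rewrite ltr_pdivrMr// -natr1 mulrDl mul1r ltrBlDr [t * _]mulrC; done.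
  have Q0 : 0 <= Q t0 by rewrite divr_ge0// exprn_ge0// sqrtr_ge0.
  apply: (le_trans (ler_wpM2r Q0 hm)).
  have A1 : 0 <= A t by apply: ssum_ge0; [exact: psi5_ge0 | exact: (psi5_cvg tp).1].
  have := le_trans h1 h2; rewrite /Q eb3; move: (root m) q0 => q q0.
  move: (A t0) A0 (A t) A1 => x x0 y y0.
  move: (Num.sqrt t) ea a0 (Num.sqrt (t0 / m%:R)) eb b0 ab => a <- a0 b <- b0 ab h.
  rewrite ler_pdivlMr ?exprn_gt0//.
  have a2 : 0 <= a ^+ 2 / b ^+ 2 / b ^+ 3 * a ^+ 3.
    by rewrite mulr_ge0 ?divr_ge0 ?exprn_ge0 ?(ltW a0) ?(ltW b0).
  have := ler_wpM2l a2 h.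
  have -> : a ^+ 2 / b ^+ 2 / b ^+ 3 * a ^+ 3 * (x / q ^+ 3) =
      a ^+ 2 / b ^+ 2 * (x / (b * q) ^+ 3) * a ^+ 3 by field; rewrite !gt_eqF.
  move=> h3; apply: (le_trans h3).
  have -> : a ^+ 2 / b ^+ 2 / b ^+ 3 * a ^+ 3 * ((b ^+ 2 / a ^+ 2) ^+ 2 * y) = a / b * y.
    by field; rewrite !gt_eqF.
  by rewrite ler_piMl// ler_pdivrMr// mul1r.
pose D := [set Q t | t in [set t : R | 0 < t]].
have D0 : D (Q 1) by exists 1 => //=.
have supD : has_sup D.
  by split; [exists (Q 1) | exists 8 => _ [t /= t0 <-]; exact: Q8].
have Q1 : 0 < Q 1.
  rewrite /Q sqrtr1 expr1n divr1; have [c _] := @psi5_cvg 1 ltr01.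
  apply: lt_le_trans (term_le_ssum 1 (psi5_ge0 _) c).
  rewrite -[1%:R]/(1 : R) mulr1 /psi_exp subrr add0r.
  rewrite /r5 sqrtr1 expr1n invr1 mul1r; exact: expR_gt0.
have L0 : 0 < sup D by apply: (lt_le_trans Q1); exact: sup_upper_bound.
exists (sup D) => //; apply/cvgrPdist_le => e e0.
have e2 : 0 < e / 2 by rewrite divr_gt0.
have [_ [t0 /= t0p <-] hQ] := sup_adherent e2 supD.
have d0 : 0 < Num.min t0 (t0 * (e / 2) / sup D).
  by rewrite lt_min t0p divr_gt0// mulr_gt0.
near=> t.
have tp : 0 < t by near: t; exact: nbhs_right_gt.
have : t < Num.min t0 (t0 * (e / 2) / sup D) by near: t; exact: nbhs_right_lt.
rewrite lt_min => /andP[tt0 tD].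
have Qt : Q t <= sup D by apply: sup_upper_bound => //; exists t.
have Qt0 : Q t0 <= sup D by apply: sup_upper_bound => //; exists t0.
have h := Qm t t0 tp (ltW tt0).
have h2 : t / t0 * Q t0 <= e / 2.
  apply: (@le_trans _ _ (t / t0 * sup D)).
    by apply: ler_wpM2l => //; rewrite divr_ge0// ltW.
  by rewrite mulrAC ler_pdivrMr// [_ * t0]mulrC -ler_pdivlMr// ltW.
have gen (x y z u : R) : x - u <= y -> z - e / 2 < x -> u <= e / 2 -> z - y <= e by lra.
rewrite ger0_norm ?subr_ge0//; apply: gen hQ h2.
by move: h; rewrite mulrBl mul1r.
Unshelve. all: by end_near.
Qed.

End RefFive.

(** * Taylor remainders of power-decay sequences *)

Section PowerDecay.
Variables (R : realType) (p : R^nat) (c : R).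
Hypotheses (p_ge0 : forall n, 0 <= p n) (c_gt0 : 0 < c).

Local Notation ref d n := ((Num.sqrt (n%:R : R) ^+ d)^-1).

Lemma ref_ge0 d n : 0 <= ref d n.
Proof. by rewrite invr_ge0 exprn_ge0// sqrtr_ge0. Qed.

Lemma sqrt_nat_ge1 n : (0 < n)%N -> 1 <= Num.sqrt (n%:R : R).
Proof. by move=> n0; rewrite -{1}sqrtr1; apply: ler_wsqrtr; rewrite ler1n. Qed.

Lemma ref_le d e n : (0 < d)%N -> (d <= e)%N -> ref e n <= ref d n.
Proof.
(* At [n = 0] both sides are inverses of [0], hence [0], as the exponents are positive. *)
move=> d0 de; case: n => [|n].
  by rewrite sqrtr0 !expr0n !gtn_eqF// (leq_trans d0).
have h := sqrt_nat_ge1 (ltn0Sn n); have h0 : 0 < Num.sqrt n.+1%:R :> R by exact: lt_le_trans h.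
by rewrite lef_pV2 ?posrE ?exprn_gt0// ler_weXn2l.
Qed.

Lemma ref_mul d n : (0 < d)%N -> n%:R * ref d.+2 n = ref d n.
Proof.
move=> d0; case: n => [|n]; first by rewrite mul0r sqrtr0 !expr0n gtn_eqF// invr0.
have h0 : 0 < Num.sqrt n.+1%:R :> R by apply: lt_le_trans (sqrt_nat_ge1 (ltn0Sn n)).
have e : Num.sqrt n.+1%:R ^+ 2 = n.+1%:R :> R by rewrite sqr_sqrtr ?ler0n.
rewrite -{1}e; move: (Num.sqrt _) h0 => q q0.
rewrite -[d.+2]addn2 exprD invfM mulrA mulrC mulrA mulVf ?mul1r// expf_neq0// gt_eqF//.
Qed.

Variable d : nat.
Hypothesis asym : Num.sqrt n%:R ^+ d * p n @[n --> \oo] --> c.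

Lemma ref_approx e : 0 < e -> exists N, forall n, (N <= n)%N -> `|p n - c * ref d n| <= e * ref d n.
Proof.
move=> e0; have [N _ hN] := (@cvgrPdist_le _ _ _ _ _ _ _).1 asym e e0.
exists N.+1 => n Nn; have := hN n (ltnW Nn).
have h0 : 0 < Num.sqrt n%:R :> R by apply: lt_le_trans (sqrt_nat_ge1 (leq_ltn_trans (leq0n _) Nn)).
have q0 : 0 < Num.sqrt n%:R ^+ d :> R by exact: exprn_gt0.
rewrite /=; move: (Num.sqrt _ ^+ d) q0 (p n) => q q0 x h.
rewrite (_ : x - c / q = - (c - q * x) / q); last by field; rewrite gt_eqF.
by rewrite normrM normrN normfV (gtr0_norm q0) ler_wpM2r// invr_ge0 ltW.
Qed.

Lemma ref_le_bound : exists N, forall n, (N <= n)%N ->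
  c / 2 * ref d n <= p n <= 2 * c * ref d n.
Proof.
have e0 : 0 < c / 2 by rewrite divr_gt0.
have [N hN] := ref_approx e0; exists N => n Nn; have := hN n Nn; rewrite ler_norml.
have := ref_ge0 d n; move: (ref d n) (p n) c_gt0 => x y c0 x0 /andP[h1 h2].
have : 0 <= c * x by rewrite mulr_ge0// ltW.
move=> cx;
apply/andP; split; lra.
Qed.

(** The term is of order [n^(k - d/2)], here at most [n^(-3/2)]. The complementary case, where it is
    at least of order [1 / n], is the next lemma. *)
Lemma ref_cvg k : (2 * k + 3 <= d)%N -> cvgn (series (fun n => n%:R ^+ k * p n)).
Proof.
move=> kd; have [N hN] := ref_le_bound.
have [c3 _] := ssumZ (2 * c) (@cvgn_inv_sqrt3 R).
pose f n := (n < N)%N%:R * (n%:R ^+ k * p n).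
have f0 n : (N <= n)%N -> f n = 0 by move=> h; rewrite /f ltnNge h mul0r.
have [c6 _] := ssum_finite f0; have [c7 _] := ssumD c6 c3.
apply: (series_le_cvg _ _ _ c7) => n.
- by rewrite mulr_ge0// exprn_ge0.
- rewrite addr_ge0//; first by rewrite !mulr_ge0// exprn_ge0.
  by rewrite mulr_ge0 ?(ref_ge0 3)// mulr_ge0// ltW.
have h k' e n' : (0 < e)%N -> n'%:R ^+ k' * ref (2 * k' + e) n' = ref e n'.
  move=> e0; elim: k' => [|k' IH]; first by rewrite mul1r.
  rewrite exprSr -mulrA mulnS !addSn ref_mul ?addn_gt0 ?e0 ?orbT//.
rewrite /f; have [nN|Nn] := ltnP n N.
  by rewrite mul1r lerDl mulr_ge0 ?(ref_ge0 3)// mulr_ge0// ltW.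
rewrite mul0r add0r; have /andP[_ h2] := hN n Nn.
apply: (le_trans (ler_wpM2l (exprn_ge0 k (ler0n R n)) h2)).
rewrite mulrCA; apply: ler_wpM2l; first by rewrite mulr_ge0// ltW.
have <- := h k 3%N n isT; apply: ler_wpM2l; first exact: exprn_ge0.
by apply: ref_le; rewrite ?addn_gt0 ?orbT.
Qed.

Lemma ref_ncvg k : (0 < k)%N -> (2 < d)%N -> (d <= 2 * k + 2)%N ->
  ~ cvgn (series (fun n => n%:R ^+ k * p n)).
Proof.
move=> k0 d2 kd; have [N hN] := ref_le_bound.
apply: (@harmonic_diverges _ _ (c / 2) N.+1); first by rewrite divr_gt0.
  by move=> n; rewrite mulr_ge0// exprn_ge0.
move=> n Nn; have n0 : (0 < n)%N by exact: leq_ltn_trans Nn.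
have /andP[h1 _] := hN n (ltnW Nn).
apply: le_trans (ler_wpM2l (exprn_ge0 k (ler0n R n)) h1).
rewrite mulrCA; apply: ler_wpM2l; first by rewrite divr_ge0// ltW.
apply: (@le_trans _ _ (n%:R ^+ k * ref (2 * k + 2) n)).
  have h0 : 0 < Num.sqrt n%:R :> R by apply: lt_le_trans (sqrt_nat_ge1 n0).
  have e : Num.sqrt n%:R ^+ 2 = n%:R :> R by rewrite sqr_sqrtr ?ler0n.
  move: (n%:R : R) (Num.sqrt _) h0 e => x q q0 <-.
  rewrite exprD exprM; have : q ^+ 2 ^+ k != 0 by rewrite !expf_neq0// gt_eqF.
  by move: (q ^+ 2 ^+ k) (q ^+ 2) => y z y0; rewrite invfM mulrA divff// mul1r.
apply: ler_wpM2l; first exact: exprn_ge0.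
by apply: ref_le => //; exact: ltn_trans d2.
Qed.

End PowerDecay.

Section RightFilter.
Variable R : realType.

Lemma cvg_to_right T (F : set_system T) (FF : Filter F) (g : T -> R) (a : R) :
  g @ F --> a -> (\forall x \near F, a < g x) -> g @ F --> a^'+.
Proof.
move=> ga ag P /= /ga aP.
have aP' : \forall x \near F, a < g x -> P (g x) by exact: aP.
have : \forall x \near F, P (g x); last exact.
near=> x; have h1 : a < g x by near: x.
suff : a < g x -> P (g x) by apply.
by near: x.
Unshelve. all: by end_near.
Qed.

Lemma cvg_to_left T (F : set_system T) (FF : Filter F) (g : T -> R) (a : R) :
  g @ F --> a -> (\forall x \near F, g x < a) -> g @ F --> a^'-.
Proof.
move=> ga ag P /= /ga aP.
have aP' : \forall x \near F, g x < a -> P (g x) by exact: aP.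
have : \forall x \near F, P (g x); last exact.
near=> x; have h1 : g x < a by near: x.
suff : g x < a -> P (g x) by apply.
by near: x.
Unshelve. all: by end_near.
Qed.

Lemma near_left1P (P : R -> Prop) : (forall s, 0 < s < 1 -> P s) -> \forall s \near (1 : R)^'-, P s.
Proof. by move=> h; near=> s; apply: h; near: s; exact: near_left1. Unshelve. all: by end_near. Qed.

Lemma cvg_eq_left1 (f g : R -> R) (l : R) : (forall s, 0 < s < 1 -> f s = g s) ->
  f s @[s --> (1 : R)^'-] --> l -> g s @[s --> (1 : R)^'-] --> l.
Proof.
move=> h fl; apply: cvg_trans fl; apply: near_eq_cvg.
by apply: near_left1P => s s01; rewrite h.
Qed.

Lemma id_left1 : s @[s --> (1 : R)^'-] --> (1 : R).
Proof. exact: cvg_at_left_filter. Qed.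

Lemma neg_ln_bounds (s : R) : 0 < s < 1 -> 1 - s <= - ln s <= (1 - s) / s.
Proof.
move=> /andP[s0 s1]; apply/andP; split.
  have : ln (1 + (s - 1)) <= s - 1 by apply: le_ln1Dx; lra.
  by rewrite addrC subrK; move: (ln s) => x; lra.
rewrite -lnV ?posrE// (_ : (1 - s) / s = s^-1 - 1); last by field; rewrite gt_eqF.
have i0 : 0 < s^-1 by rewrite invr_gt0.
have : ln (1 + (s^-1 - 1)) <= s^-1 - 1 by apply: le_ln1Dx; lra.
by rewrite addrC subrK.
Qed.

Lemma neg_ln_ratio_cvg : - ln s / (1 - s) @[s --> (1 : R)^'-] --> (1 : R).
Proof.
apply: (@squeeze_cvgr _ _ _ _ (fun=> 1) (fun s => s^-1)); last 2 first.
- exact: cvg_cst.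
- by rewrite -[X in _ --> X](@invr1 R); apply: cvgV; [exact: oner_neq0 | exact: id_left1].
apply: near_left1P => s s01; have /andP[s0 s1] := s01.
have /andP[h1 h2] := neg_ln_bounds s01; have d0 : 0 < 1 - s by rewrite subr_gt0.
by rewrite ler_pdivlMr// mul1r h1 ler_pdivrMr// mulrC.
Qed.

Lemma neg_ln_right : - ln s @[s --> (1 : R)^'-] --> (0 : R)^'+.
Proof.
apply: cvg_to_right; last first.
  by apply: near_left1P => s s01; rewrite oppr_gt0 ln_lt0.
have h : 1 - s @[s --> (1 : R)^'-] --> (0 : R).
  by rewrite -(subrr (1 : R)); apply: cvgB; [exact: cvg_cst | exact: id_left1].
have h2 : - ln s / (1 - s) * (1 - s) @[s --> (1 : R)^'-] --> (1 * 0 : R).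
  by apply: cvgM h; exact: neg_ln_ratio_cvg.
rewrite mulr0 in h2; apply: cvg_eq_left1 h2 => s /andP[_ s1].
by rewrite divfK// subr_eq0 gt_eqF.
Qed.

End RightFilter.

(** * Remainders at [s = 1] for the exponents 5/2 and 3 *)

Section ExcessAsymptotics.
Variables (R : realType) (p : R^nat) (c : R).
Hypotheses (p_ge0 : forall n, 0 <= p n) (c_gt0 : 0 < c).
Local Notation ref d n := ((Num.sqrt (n%:R : R) ^+ d)^-1).

Lemma ref_asym d : Num.sqrt n%:R ^+ d * ref d n @[n --> \oo] --> (1 : R).
Proof.
apply: cvg_near_cst; near=> n; have n0 : (0 < n)%N by near: n; exact: nbhs_infty_gt.
by rewrite divff// expf_neq0// gt_eqF// (lt_le_trans ltr01 (sqrt_nat_ge1 _ n0)).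
Unshelve. all: by end_near.
Qed.

Lemma excess_ref_equiv d : (4 < d <= 6)%N ->
  Num.sqrt n%:R ^+ d * p n @[n --> \oo] --> c ->
  excess p s / excess (fun n => ref d n) s @[s --> (1 : R)^'-] --> c.
Proof.
move=> /andP[d4 d6] asym; have r0 n : 0 <= ref d n by exact: ref_ge0.
have h1 : (2 * 1 + 3 <= d)%N by [].
have h2 : (d <= 2 * 2 + 2)%N by [].
have d2 : (2 < d)%N by exact: ltn_trans d4.
have c1 := @ref_cvg R p c p_ge0 c_gt0 d asym 1 h1.
have c2 := @ref_cvg R (fun n => ref d n) 1 r0 ltr01 d (ref_asym d) 1 h1.
have c3 := @ref_ncvg R (fun n => ref d n) 1 r0 ltr01 d (ref_asym d) 2 isT d2 h2.
apply: excess_equiv => //.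
exact: (@ref_approx R p c d asym).
Qed.

Let r5 n := ref 5 n.
Let r6 n := ref 6 n.

(** With [t = - ln s] the excess is the series of [psi5_limit] minus [M psi_exp t]. The correction
    is at most [M (1 - s)^2] near [1], negligible against [(1 - s)^(3/2)]. *)
Lemma excess_r5 : exists2 K : R, 0 < K &
  excess r5 s / Num.sqrt (1 - s) ^+ 3 @[s --> (1 : R)^'-] --> K.
Proof.
have [L L0 hL] := @psi5_limit R; exists L => //.
have c2 := @ref_cvg R r5 1 (ref_ge0 R 5) ltr01 5 (ref_asym 5) 1 isT.
pose M := ssum (fun n => n%:R ^+ 1 * r5 n).
pose t s : R := - ln s.
have h1 := cvg_comp _ _ (@neg_ln_right R) hL.
have tq : Num.sqrt (t s / (1 - s)) ^+ 3 @[s --> (1 : R)^'-] --> (1 : R).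
  have h : Num.sqrt (t s / (1 - s)) @[s --> (1 : R)^'-] --> (1 : R).
    have h0 : Num.sqrt (t s / (1 - s)) @[s --> (1 : R)^'-] --> Num.sqrt (1 : R).
      by apply: (cvg_comp _ _ (@neg_ln_ratio_cvg R)); exact: sqrt_continuous.
    by rewrite sqrtr1 in h0.
  have h' : Num.sqrt (t s / (1 - s)) * (Num.sqrt (t s / (1 - s)) * Num.sqrt (t s / (1 - s)))
      @[s --> (1 : R)^'-] --> (1 * (1 * 1) : R) by apply: cvgM => //; apply: cvgM.
  by rewrite !mulr1 in h'; exact: h'.
have rest : M * Num.sqrt (1 - s) @[s --> (1 : R)^'-] --> (0 : R).
  rewrite -(mulr0 M); apply: cvgMl_tmp; rewrite -[X in _ --> X](@sqrtr0 R).
  apply: (@cvg_comp _ _ _ (fun s : R => 1 - s) (@Num.sqrt R) _ (nbhs (0 : R))); last exact: sqrt_continuous.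
  by rewrite -(subrr (1 : R)); apply: cvgB; [exact: cvg_cst | exact: id_left1].
have up : ssum (fun n => r5 n * psi_exp (n%:R * t s)) / Num.sqrt (t s) ^+ 3 *
    Num.sqrt (t s / (1 - s)) ^+ 3 @[s --> (1 : R)^'-] --> L * 1.
  by apply: cvgM tq; exact: h1.
have lo : ssum (fun n => r5 n * psi_exp (n%:R * t s)) / Num.sqrt (t s) ^+ 3 *
    Num.sqrt (t s / (1 - s)) ^+ 3 - M * Num.sqrt (1 - s) @[s --> (1 : R)^'-] --> L * 1 - 0.
  by apply: cvgB rest.
rewrite subr0 mulr1 in lo; rewrite mulr1 in up.
apply: squeeze_cvgr lo up; near=> s.
have s01 : 0 < s < 1 by near: s; exact: near_left1.
have s34 : 3 / 4 < s by near: s; apply: nbhs_left_gt; lra.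
have /andP[s0 s1] := s01; have /andP[t1 t2] := neg_ln_bounds s01.
have e0 : 0 < 1 - s by rewrite subr_gt0.
have t0 : 0 < - ln s by exact: lt_le_trans t1.
have es : s = expR (- - ln s) by rewrite opprK lnK.
have [c3 _] := psi5_cvg t0.
have M0 : 0 <= M by apply: ssum_ge0 c2 => n; rewrite mulr_ge0// ref_ge0.
have exE : excess r5 s = ssum (fun n => r5 n * psi_exp (n%:R * t s)) - psi_exp (t s) * M.
  have [c4 e4] := ssumZ (psi_exp (t s)) c2; have [_ e5] := ssumB c3 c4.
  rewrite -e4 -e5 /excess; apply: ssum_eq => n; rewrite /psi_exp {1 2}es.
  by rewrite /r5 /t -expRM_natl mulrN; ring.
have pt : psi_exp (t s) <= (1 - s) ^+ 2.
  apply: (le_trans (psi_exp_le (ltW t0)).2).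
  have : t s <= (1 - s) * (4 / 3).
    apply: (le_trans t2); apply: ler_wpM2l; first exact: ltW.
    by rewrite -[4 / 3]invrK lef_pV2 ?posrE ?invr_gt0 ?divr_gt0// invf_div ltW.
  rewrite -/(t s) => h; have : (t s) ^+ 2 <= ((1 - s) * (4 / 3)) ^+ 2.
    by apply: lerXn2r => //; rewrite nnegrE; [exact: ltW | rewrite mulr_ge0 ?divr_ge0// ltW].
  rewrite exprMn; have := sqr_ge0 (1 - s); move: (_ ^+ 2) (_ ^+ 2) => x y; lra.
have q0 : 0 < Num.sqrt (1 - s) by rewrite sqrtr_gt0.
have eA : ssum (fun n => r5 n * psi_exp (n%:R * t s)) / Num.sqrt (t s) ^+ 3 *
    Num.sqrt (t s / (1 - s)) ^+ 3 = ssum (fun n => r5 n * psi_exp (n%:R * t s)) / Num.sqrt (1 - s) ^+ 3.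
  have -> : Num.sqrt (t s / (1 - s)) = Num.sqrt (t s) / Num.sqrt (1 - s).
    by rewrite sqrtrM ?sqrtrV// ltW.
  have : 0 < Num.sqrt (t s) by rewrite sqrtr_gt0.
  by move: (Num.sqrt _) (Num.sqrt _) q0 => a b b0 a0; field; rewrite !gt_eqF.
rewrite eA exE mulrBl; apply/andP; split; last first.
  by rewrite gerBl divr_ge0 ?exprn_ge0 ?sqrtr_ge0// mulr_ge0// psi_exp_ge0.
rewrite lerD2l lerN2 ler_pdivrMr ?exprn_gt0// mulrAC -mulrA [psi_exp _ * M]mulrC.
apply: ler_wpM2l => //; apply: (le_trans pt).
have {1}-> : 1 - s = Num.sqrt (1 - s) ^+ 2 by rewrite sqr_sqrtr// ltW.
by rewrite le_eqVlt; apply/orP; left; apply/eqP; ring.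
Unshelve. all: by end_near.
Qed.

Lemma r6E n : r6 n = (n%:R ^+ 3)^-1.
Proof. by rewrite /r6 -[6%N]/(2 * 3)%N exprM sqr_sqrtr ?ler0n. Qed.

Lemma r6_cvg : cvgn (series (fun n => n%:R * r6 n)).
Proof. exact: (@ref_cvg R r6 1 (ref_ge0 R 6) ltr01 6 (ref_asym 6) 1 isT). Qed.

(** Cut at [N], the integer part of [1 / (1 - s)]. Below it the quadratic bound leaves a harmonic
    sum, at most [1 + ln N]; above it the linear bound leaves a tail of at most [2 (1 - s)^2].
    Together they give the constant [5]. *)
Lemma excess_r6_upper s : 0 < s < 1 ->
  excess r6 s <= (1 - s) ^+ 2 / 2 * (ln (1 - s)^-1 + 5).
Proof.
move=> s01; have /andP[s0 s1] := s01; have s01' : 0 <= s <= 1 by rewrite !ltW.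
have e0 : 0 < 1 - s by rewrite subr_gt0.
have e1 : 1 <= (1 - s)^-1 by rewrite invf_ge1//; lra.
pose N := Num.truncn (1 - s)^-1.
have /andP[m1 m2] : N%:R <= (1 - s)^-1 < N.+1%:R by apply: truncn_itv; exact: le_trans e1.
have N0 : (0 < N)%N by rewrite truncn_gt0.
have NR : (0 : R) < N%:R by rewrite ltr0n.
have d0 : 0 <= (1 - s) ^+ 2 / 2 by rewrite divr_ge0 ?sqr_ge0.
have nn n : 0 <= r6 n * (n%:R * (1 - s) - 1 + s ^+ n).
  by have /andP[h1 _] := excess_term n s01'; rewrite mulr_ge0// (ref_ge0 R 6).
apply: (series_cvg_bounded nn _).2 => M.
apply: (@le_trans _ _ (series (fun n => r6 n * (n%:R * (1 - s) - 1 + s ^+ n)) (N.+1 + M))).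
  by apply: nondecreasing_series => [n _ _|]; [exact: nn | rewrite leq_addl].
rewrite /series /= (big_cat_nat (n := N.+1) (m := 0%N))//= ?leq_addr//.
have b1 : \sum_(0 <= n < N.+1) r6 n * (n%:R * (1 - s) - 1 + s ^+ n) <=
    (1 - s) ^+ 2 / 2 * (1 + ln N%:R).
  have [_ hb] := @harmonic_bounds R N N0.
  apply: le_trans (ler_wpM2l d0 hb); rewrite /series /= mulr_sumr.
  apply: ler_sum_nat => n _; case: n => [|n].
    by rewrite r6E expr0n invr0 mul0r mulr0.
  have /andP[_ h] := phi_bounds s01' (leqnn n.+1).
  have n0 : (0 : R) < n.+1%:R by [].
  apply: (le_trans (ler_wpM2l (ref_ge0 R 6 n.+1) h)); rewrite -/(r6 n.+1) r6E.
  have -> : (n.+1%:R ^+ 3)^-1 * ((1 - s) ^+ 2 * (n.+1%:R * (n.+1%:R - 1) / 2)) =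
     (1 - s) ^+ 2 / 2 * ((n.+1%:R - 1) / n.+1%:R ^+ 2).
    by move: (n.+1%:R : R) n0 => x x0; field; rewrite gt_eqF.
  apply: ler_wpM2l => //; rewrite ler_pdivrMr ?exprn_gt0// expr2 mulrA mulVf ?gt_eqF// mul1r.
  by rewrite gerBl.
have b2 : \sum_(N.+1 <= n < N.+1 + M) r6 n * (n%:R * (1 - s) - 1 + s ^+ n) <=
    (1 - s) * N%:R^-1.
  have h : \sum_(N.+1 <= n < N.+1 + M) ((n%:R ^+ 2)^-1 : R) <= N%:R^-1.
    by apply: (le_trans (@inv_sqr_tail R N M N0)); rewrite gerBl invr_ge0.
  apply: le_trans (ler_wpM2l (ltW e0) h); rewrite mulr_sumr.
  apply: ler_sum_nat => -[//|n] _.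
  have n0 : (0 : R) < n.+1%:R by [].
  have /andP[_ h2] := excess_term n.+1 s01'.
  apply: (le_trans (ler_wpM2l (ref_ge0 R 6 n.+1) h2)); rewrite -/(r6 n.+1) r6E.
  by move: (n.+1%:R : R) n0 => x x0; rewrite le_eqVlt; apply/orP; left; apply/eqP; field; rewrite gt_eqF.
have b3 : N%:R^-1 <= 2 * (1 - s).
  rewrite -[2 * (1 - s)]invrK lef_pV2 ?posrE ?invr_gt0 ?mulr_gt0//.
  rewrite invfM ler_pdivrMl//; apply: (le_trans (ltW m2)).
  by rewrite -natrM ler_nat mul2n -addnn -addn1 leq_add2l.
have b4 : ln N%:R <= ln (1 - s)^-1 by rewrite ler_ln ?posrE ?invr_gt0.
apply: (le_trans (lerD b1 b2)).
have := ler_wpM2l d0 b4; have := ler_wpM2l (ltW e0) b3.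
by move: (ln N%:R) (ln (1 - s)^-1) (N%:R^-1) (1 - s) => x y z d; lra.
Qed.

(** Cut at [eta / (1 - s)], so that [s ^ N >= 1 - eta] on the retained terms; what is left is the
    sum of [1 / n - 1 / n^2], and the squares sum to at most [2]. *)
Lemma excess_r6_lower s eta : 0 < s < 1 -> 0 < eta < 1 -> 1 - s <= eta ->
  (1 - eta) * ((1 - s) ^+ 2 / 2) * (ln (1 - s)^-1 + ln eta - 2) <= excess r6 s.
Proof.
move=> s01 /andP[h0 h1] se; have /andP[s0 s1] := s01; have s01' : 0 <= s <= 1 by rewrite !ltW.
have e0 : 0 < 1 - s by rewrite subr_gt0.
have e1 : 1 <= eta / (1 - s) by rewrite ler_pdivlMr// mul1r.
pose N := Num.truncn (eta / (1 - s)).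
have /andP[m1 m2] : N%:R <= eta / (1 - s) < N.+1%:R by apply: truncn_itv; exact: le_trans e1.
have d0 : 0 <= (1 - eta) * ((1 - s) ^+ 2 / 2).
  by rewrite mulr_ge0 ?divr_ge0 ?sqr_ge0// subr_ge0 ltW.
have nn n : 0 <= r6 n * (n%:R * (1 - s) - 1 + s ^+ n).
  by have /andP[? _] := excess_term n s01'; rewrite mulr_ge0// (ref_ge0 R 6).
apply: le_trans (series_le_ssum N.+1 nn (excess_cvg (ref_ge0 R 6) r6_cvg s01')).
have [hb _] := @harmonic_bounds R N.+1 isT.
have sq := @inv_sqr_sum_le R N.+1.
have l1 : ln (1 - s)^-1 + ln eta <= ln N.+1%:R.
  by rewrite -lnM ?posrE ?invr_gt0// mulrC ler_ln ?posrE ?divr_gt0// ltW.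
apply: (@le_trans _ _ ((1 - eta) * ((1 - s) ^+ 2 / 2) *
   (series (fun n => n%:R^-1) N.+1 - series (fun n => (n%:R ^+ 2)^-1) N.+1))).
  by apply: ler_wpM2l => //; move: (series _ _) (series _ _) (ln _) (ln _) (ln _) hb sq l1 => *; lra.
rewrite /series /= -sumrB mulr_sumr; apply: ler_sum_nat => n /andP[_ nN].
case: n nN => [|n] nN; first by rewrite r6E !expr0n !invr0 subrr mulr0 mul0r.
have /andP[h _] := phi_bounds s01' (nN : (n.+1 <= N)%N).
have n0 : (0 : R) < n.+1%:R by [].
apply: le_trans (ler_wpM2l (ref_ge0 R 6 n.+1) h); rewrite -/(r6 n.+1) r6E.
have sN : 1 - eta <= s ^+ N.
  have e01 : 0 <= 1 - s <= 1 by apply/andP; split; lra.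
  have := bernoulli_ge N e01; rewrite subKr; apply: le_trans.
  by rewrite lerD2l lerN2 -ler_pdivlMr.
have -> : (n.+1%:R ^+ 3)^-1 * ((1 - s) ^+ 2 * (n.+1%:R * (n.+1%:R - 1) / 2) * s ^+ N) =
     s ^+ N * ((1 - s) ^+ 2 / 2 * (n.+1%:R^-1 - (n.+1%:R ^+ 2)^-1)).
  by move: (n.+1%:R : R) (s ^+ N) n0 => x y x0; field; rewrite gt_eqF.
rewrite -mulrA; apply: ler_wpM2r => //.
rewrite mulr_ge0 ?divr_ge0 ?sqr_ge0// subr_ge0 lef_pV2 ?posrE ?exprn_gt0// expr2 ler_pMl//.
by rewrite ler1n.
Qed.

Lemma excess_r6 : excess r6 s / ((1 - s) ^+ 2 * ln (1 - s)^-1) @[s --> (1 : R)^'-] --> (1 / 2 : R).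
Proof.
apply/cvgrPdist_le => e e0.
have [eta /andP[h0 h1] he] : exists2 eta : R, 0 < eta < 1 & eta <= e / 2.
  exists (Num.min (1 / 2) (e / 2)); last by rewrite ge_min lexx orbT.
  by rewrite lt_min divr_gt0// divr_gt0//= gt_min; apply/orP; left; lra.
(* Once [ln (1 / (1 - s))] exceeds [B], all additive constants of both bounds are at most [e] times
   the logarithm. *)
pose B := (5 + `|ln eta| + 2) / e + 1.
have B0 : 0 < B by rewrite ltr_wpDl// divr_ge0 ?(ltW e0)// !addr_ge0.
have d0 : 0 < Num.min eta (expR (- B)) by rewrite lt_min h0 expR_gt0.
near=> s.
have s01 : 0 < s < 1 by near: s; exact: near_left1.
have sd : 1 - s < Num.min eta (expR (- B)).
  have : 1 - Num.min eta (expR (- B)) < s by near: s; apply: nbhs_left_gt; rewrite ltrBlDr ltrDl.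
  by rewrite ltrBlDr addrC -ltrBlDr.
have /andP[s0 s1] := s01; have e1 : 0 < 1 - s by rewrite subr_gt0.
move: sd; rewrite lt_min => /andP[sd1 sd2].
have LB : B < ln (1 - s)^-1.
  by rewrite lnV ?posrE// ltrNr -ltr_expR lnK.
have up := excess_r6_upper s01.
have lo := excess_r6_lower s01 (_ : 0 < eta < 1) (ltW sd1).
have {}lo := lo (introT andP (conj h0 h1)).
have L0 : 0 < ln (1 - s)^-1 by exact: lt_trans LB.
have q0 : 0 < (1 - s) ^+ 2 by exact: exprn_gt0.
have eB : 5 + `|ln eta| + 2 <= e * ln (1 - s)^-1.
  by rewrite -ler_pdivrMl// mulrC; apply: ltW; apply: lt_trans LB; rewrite /B ltrDl.
move: up lo L0 q0 eB; move: (ln (1 - s)^-1) ((1 - s) ^+ 2) (excess r6 s) => L q E up lo L0 q0 eB.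
have Lq : 0 < q * L by exact: mulr_gt0.
have n1 := ler_norm (- ln eta); rewrite normrN in n1.
have n0 := normr_ge0 (ln eta).
have U : E <= (1 / 2 + e) * (q * L).
  apply: (le_trans up).
  have : 5 * q <= e * L * q by apply: ler_wpM2r; [exact: ltW | lra].
  have := mulr_gt0 e0 Lq.
  rewrite (_ : (1 / 2 + e) * (q * L) = 1 / 2 * (q * L) + e * (q * L)); last by ring.
  rewrite (_ : q / 2 * (L + 5) = 1 / 2 * (q * L) + 5 * q / 2); last by field.
  rewrite (_ : e * L * q = e * (q * L)); last by ring.
  by move: (q * L) (5 * q) (e * _) => x y z; lra.
have D : (1 / 2 - e) * (q * L) <= E.
  apply: le_trans lo.
  have q2 : 0 <= q / 2 by rewrite divr_ge0// ltW.
  have k1 : 0 <= eta * (e * L) by rewrite !mulr_ge0// ltW.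
  have k2 : eta * L <= e / 2 * L by apply: ler_wpM2r => //; exact: ltW.
  have k3 : (1 - eta) * (L - e * L) <= (1 - eta) * (L + ln eta - 2).
    by apply: ler_wpM2l; lra.
  have k4 : (1 - 2 * e) * L <= (1 - eta) * (L + ln eta - 2).
    apply: le_trans k3; have := mulr_gt0 e0 L0.
    rewrite (_ : (1 - eta) * (L - e * L) = L - e * L - eta * L + eta * (e * L)); last by ring.
    rewrite (_ : (1 - 2 * e) * L = L - 2 * (e * L)); last by ring.
    rewrite (_ : e / 2 * L = e * L / 2) in k2; last by field.
    by move: k1 k2; move: (e * L) (eta * L) (eta * _) => x y z; lra.
  rewrite (_ : (1 / 2 - e) * (q * L) = q / 2 * ((1 - 2 * e) * L)); last by field.
  rewrite (_ : (1 - eta) * (q / 2) * (L + ln eta - 2) = q / 2 * ((1 - eta) * (L + ln eta - 2))); last by ring.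
  exact: ler_wpM2l.
move: U D; rewrite -(ler_pdivrMr _ _ Lq) -(ler_pdivlMr _ _ Lq).
move: (E / (q * L)) => x U D; rewrite ler_norml; apply/andP; split; lra.
Unshelve. all: by end_near.
Qed.

Lemma excess5 : Num.sqrt n%:R ^+ 5 * p n @[n --> \oo] --> c ->
  exists2 K : R, 0 < K &
  excess p s / Num.sqrt (1 - s) ^+ 3 @[s --> (1 : R)^'-] --> K.
Proof.
move=> asym; have h := @excess_ref_equiv 5 isT asym.
have [K K0 hK] := excess_r5; exists (c * K); first exact: mulr_gt0.
have h2 : excess p s / excess r5 s * (excess r5 s / Num.sqrt (1 - s) ^+ 3) @[s --> (1 : R)^'-] --> c * K.
  exact: cvgM h hK.
have hp := @cvgr_gt _ _ _ _ _ _ hK _ K0.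
apply: cvg_trans h2; apply: near_eq_cvg; near=> s.
have : 0 < excess r5 s / Num.sqrt (1 - s) ^+ 3 by near: s; exact: hp.
move=> h0; rewrite mulrA divfK//; apply: contraTneq h0 => ->; rewrite mul0r ltxx.
Unshelve. all: by end_near.
Qed.

Lemma excess6 : Num.sqrt n%:R ^+ 6 * p n @[n --> \oo] --> c ->
  excess p s / ((1 - s) ^+ 2 * ln (1 - s)^-1) @[s --> (1 : R)^'-] --> c / 2.
Proof.
move=> asym; have h := @excess_ref_equiv 6 isT asym; have hK := excess_r6.
have h2 : excess p s / excess r6 s * (excess r6 s / ((1 - s) ^+ 2 * ln (1 - s)^-1))
    @[s --> (1 : R)^'-] --> c * (1 / 2) by exact: cvgM h hK.
rewrite mul1r in h2; have hp := @cvgr_gt _ _ _ _ _ _ hK _ (_ : 0 < 1 / 2).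
apply: cvg_trans h2; apply: near_eq_cvg; near=> s.
have : 0 < excess r6 s / ((1 - s) ^+ 2 * ln (1 - s)^-1) by near: s; apply: hp; lra.
move=> h0; rewrite mulrA divfK//; apply: contraTneq h0 => ->; rewrite mul0r ltxx.
Unshelve. all: by end_near.
Qed.

End ExcessAsymptotics.

(** * The critical point *)

Section LipschitzSlope.
Variables (R : realType) (p u : R^nat).
Hypothesis tr : transient_renewal p u.

Lemma slope_lipschitz (t : R) : 0 < t < 1 -> exists2 K, 0 <= K &
  forall s, 0 <= s <= t -> slope u t - slope u s <= K * (t - s).
Proof.
move=> /andP[t0 t1]; have u0 := tr_u tr.
have uB n : 0 <= u n <= 1.
  by rewrite u0 (le_trans (renewal_le tr n))//; have /andP[] := tr_p tr n.+1.
have t01 : 0 <= t < 1 by rewrite ltW.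
have c1 := @cvgn_series_power R u 1 t 1 uB t01.
have c2 := @cvgn_series_power R u 1 t 2 uB t01.
have [c3 _] := ssumD c1 c2.
pose f n := n%:R ^+ 1 * u n * t ^+ n + n%:R ^+ 2 * u n * t ^+ n.
have f0 n : 0 <= f n by rewrite addr_ge0// !mulr_ge0// exprn_ge0// ltW.
exists (ssum f) => [|s /andP[s0 st]]; first exact: ssum_ge0.
have cs := slope_cvg tr (_ : 0 <= s < 1); rewrite s0 (le_lt_trans st t1) in cs.
have {}cs := cs isT; have ct := slope_cvg tr t01.
rewrite /slope opprD addrACA subrr add0r.
have [c4 <-] := ssumB ct cs; rewrite [leRHS]mulrC.
have [c5 <-] := ssumZ (t - s) c3; apply: ssum_le => // n.
have [h _] := expr_diff_bounds n.+1 s0 st; rewrite -mulrBr.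
apply: (le_trans (ler_wpM2l (mulr_ge0 (ler0n R n) (u0 n)) h)) => /=.
rewrite le_eqVlt; apply/orP; left; apply/eqP; rewrite /f -natr1; ring.
Qed.

End LipschitzSlope.

Section Critical.
Variables (R : realType) (p1 u1 p2 u2 : R^nat) (a b : R) (p : R^nat).
Hypotheses (tr1 : transient_renewal p1 u1) (tr2 : transient_renewal p2 u2).
Hypotheses (a0 : 0 < a) (b0 : 0 < b) (p_ge0 : forall n, 0 <= p n).

Local Notation zz := (zz u1 u2 a b).
Local Notation psi := (psi u1 u2 a b).
Local Notation chord := (chord u1 u2 a b).
Local Notation admissible_arg := (admissible_arg u1 u2 a b).
Local Notation finite_slopes := (finite_slopes u1 u2 a b).
Local Notation W1 := (slope u1).
Local Notation W2 := (slope u2).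

Hypothesis green : green_on_curve u1 u2 a b p.
Hypotheses (cm2 : cvgn (series (fun n => n%:R * p2 n)))
  (nc2 : ~ cvgn (series (fun n => n%:R ^+ 2 * p2 n))).

Variable X0 : R.
Hypotheses (aX0 : admissible_arg X0) (fX0 : finite_slopes X0).
Hypotheses (s20 : arg2 u2 b X0 = 1) (s10 : arg1 u1 a X0 < 1).

Local Notation s1 X := (arg1 u1 a X).
Local Notation s2 X := (arg2 u2 b X).
Local Notation eps X := (1 - s2 X).
Local Notation E X := (excess p2 (s2 X)).
Local Notation sec1 X := (secant u1 (s1 X) (s1 X0)).
Local Notation sec2 X := (secant u2 (s2 X) 1).
Local Notation G s := (gen_p p2 s).

Let p2_ge0 n : 0 <= p2 n. Proof. by have /andP[] := tr_p tr2 n. Qed.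
Let X0_gt0 : 0 < X0. Proof. exact: (arg_pos tr1 tr2 a0 b0 aX0). Qed.
Let z0_gt0 : 0 < zz X0. Proof. exact: (zz_gt0 tr1 tr2 a0 b0 aX0). Qed.

Lemma near_rightP (P : R -> Prop) : (forall X, X0 < X -> P X) -> \forall X \near X0^'+, P X.
Proof. by move=> h; near=> X; apply: h; near: X; exact: nbhs_right_gt. Unshelve. all: by end_near. Qed.

Lemma cvg_eq_right (f g : R -> R) (l : R) : (forall X, X0 < X -> f X = g X) ->
  f X @[X --> X0^'+] --> l -> g X @[X --> X0^'+] --> l.
Proof.
move=> h fl; apply: cvg_trans fl; apply: near_eq_cvg.
by apply: near_rightP => s s01; rewrite h.
Qed.

Lemma s2_bounds X : X0 < X -> 0 < s2 X < 1.
Proof.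
move=> hX; have aX := admissible_arg_le aX0 (ltW hX).
have [_ /andP[p20 _] _ _] := argP tr1 tr2 a0 b0 aX.
by have [_ l2] := arg_decr tr1 tr2 a0 b0 aX0 hX; rewrite p20 -s20.
Qed.

Lemma s2_left : s2 X @[X --> X0^'+] --> (1 : R)^'-.
Proof.
apply: cvg_to_left; last by apply: near_rightP => X /s2_bounds /andP[].
have [_ c2] := arg_continuous tr1 tr2 a0 b0 aX0.
rewrite -[X in _ --> X]s20.
apply: (right_cvg _ c2) => X h; by rewrite max_r.
Qed.

Lemma eps_cvg0 : eps X @[X --> X0^'+] --> (0 : R).
Proof.
have h : s2 X @[X --> X0^'+] --> (1 : R).
  by apply: cvg_trans s2_left _; exact: cvg_within.
by rewrite -(subrr (1 : R)); apply: cvgB => //; exact: cvg_cst.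
Qed.

Lemma sec2_cvg : sec2 X @[X --> X0^'+] --> W2 1.
Proof.
have h : W2 1 - (excess p2 s / (1 - s) - mean p2 * (G 1 - G s) / G 1) / (G s * G 1)
   @[s --> (1 : R)^'-] --> W2 1 - (0 - mean p2 * (G 1 - G 1) / G 1) / (G 1 * G 1).
  have gc := gen_p_cvg1 tr2 cm2.
  have g1 : G 1 != 0 by rewrite gt_eqF// (gen_p_gt0 tr2)// ler01 lexx.
  apply: cvgB; first exact: cvg_cst.
  apply: cvgM.
    apply: cvgB; first exact: (excess_div_cvg0 tr2 cm2).
    apply: cvgM; last exact: cvg_cst.
    apply: cvgM; first exact: cvg_cst.
    by apply: cvgB; [exact: cvg_cst | exact: gc].
  by apply: cvgV; [rewrite mulf_neq0 | apply: cvgM; [exact: gc | exact: cvg_cst]].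
rewrite subrr mulr0 mul0r subrr mul0r subr0 in h.
have h2 := cvg_comp _ _ s2_left h.
apply: cvg_eq_right h2 => X /s2_bounds s01 /=.
by rewrite -(slope1_secant tr2 cm2 s01) subKr.
Qed.

(** [X - X0] is [b] times the increment of [V2], that is [b (1 / s2 - 1)] times the secant of the
    second factor. *)
Lemma delta_eps : (X - X0) / eps X @[X --> X0^'+] --> b * W2 1.
Proof.
have s2c : s2 X @[X --> X0^'+] --> (1 : R) by apply: cvg_trans s2_left _; exact: cvg_within.
have h : b * (sec2 X / s2 X) @[X --> X0^'+] --> b * (W2 1 / 1).
  apply: cvgM; first exact: cvg_cst.
  by apply: cvgM; [exact: sec2_cvg | apply: cvgV => //; exact: oner_neq0].
rewrite divr1 in h; apply: cvg_eq_right h => X hX.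
have /andP[p0 p1'] := s2_bounds hX.
have [_ _ _ e2] := argP tr1 tr2 a0 b0 (admissible_arg_le aX0 (ltW hX)).
have [_ _ _ f2] := argP tr1 tr2 a0 b0 aX0.
have c := slope_cvg1 tr2 cm2; rewrite s20 in f2.
have d2 := gap_secant tr2 p0 p1' (lexx 1) c.
have -> : X - X0 = b * (gap u2 (s2 X) - gap u2 1) by rewrite mulrBr e2 f2.
have e0 : 0 < 1 - s2 X by rewrite subr_gt0.
by rewrite d2 invr1; field; rewrite !gt_eqF.
Qed.

Lemma excess_right_gt0 : \forall X \near X0^'+, 0 < E X.
Proof.
have h := excess_super p2_ge0 cm2 1 nc2.
have h2 := cvg_comp _ _ s2_left (cvg_id (F := (1 : R)^'-)).
near=> X; have hX : X0 < X by near: X; exact: nbhs_right_gt.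
have /andP[p0 p1'] := s2_bounds hX.
apply: (@lt_le_trans _ _ (1 * (1 - s2 X) ^+ 2)).
  by rewrite mul1r exprn_gt0// subr_gt0.
by near: X; exact: (s2_left h).
Unshelve. all: by end_near.
Qed.

Lemma eps_sqr_excess : eps X ^+ 2 / E X @[X --> X0^'+] --> (0 : R).
Proof.
apply/cvgrPdist_le => e e0; have h := excess_super p2_ge0 cm2 e^-1 nc2.
near=> X; have hX : X0 < X by near: X; exact: nbhs_right_gt.
have /andP[p0 p1'] := s2_bounds hX.
have E0 : 0 < E X by near: X; exact: excess_right_gt0.
have k : e^-1 * (1 - s2 X) ^+ 2 <= E X by near: X; exact: (s2_left h).
rewrite sub0r normrN ger0_norm; last by rewrite divr_ge0 ?sqr_ge0// ltW.
by rewrite ler_pdivrMr// -ler_pdivrMl.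
Unshelve. all: by end_near.
Qed.

(** By [slope1_secant], [W2 1 - sec2] is [E / eps] plus a term [O(eps)], up to a factor tending to
    [1 / G(1)^2]; relative to [E / eps] that term is [O(eps^2 / E)] and vanishes because the second
    moment is infinite. *)
Lemma inv_sec2 : ((sec2 X)^-1 - (W2 1)^-1) / (E X / eps X) @[X --> X0^'+] -->
  ((G 1 * W2 1) ^+ 2)^-1.
Proof.
have c := slope_cvg1 tr2 cm2; have W0 := slope_ge1 tr2 ler01 c.
have W2p : 0 < W2 1 by exact: lt_le_trans W0.
have g1 : 0 < G 1 by rewrite (gen_p_gt0 tr2)// ler01 lexx.
have gc : G (s2 X) @[X --> X0^'+] --> G 1.
  exact: (cvg_comp _ _ s2_left (gen_p_cvg1 tr2 cm2)).
have h : (1 - mean p2 * (mean p2 * (eps X ^+ 2 / E X) - eps X) / G 1) / (G (s2 X) * G 1) /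
    (sec2 X * W2 1) @[X --> X0^'+] -->
    (1 - mean p2 * (mean p2 * 0 - 0) / G 1) / (G 1 * G 1) / (W2 1 * W2 1).
  apply: cvgM; last first.
    apply: cvgV; first by rewrite mulf_neq0// gt_eqF.
    by apply: cvgM; [exact: sec2_cvg | exact: cvg_cst].
  apply: cvgM; last first.
    by apply: cvgV; [rewrite mulf_neq0// gt_eqF | apply: cvgM; [exact: gc | exact: cvg_cst]].
  apply: cvgB; first exact: cvg_cst.
  apply: cvgM; last exact: cvg_cst.
  apply: cvgM; first exact: cvg_cst.
  apply: cvgB; last exact: eps_cvg0.
  by apply: cvgM; [exact: cvg_cst | exact: eps_sqr_excess].
rewrite (_ : (1 - _) / _ / _ = ((G 1 * W2 1) ^+ 2)^-1) in h; last first.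
  by field; rewrite !gt_eqF.
apply: cvg_trans h; apply: near_eq_cvg; near=> X.
have hX : X0 < X by near: X; exact: nbhs_right_gt.
have s01 := s2_bounds hX; have /andP[p0 p1'] := s01.
have E0 : 0 < E X by near: X; exact: excess_right_gt0.
have gX : 0 < G (s2 X) by rewrite (gen_p_gt0 tr2)// !ltW.
have e0 : 0 < eps X by rewrite subr_gt0.
have w1 := secant_ge1 tr2 p0 p1' c; have w0 : 0 < sec2 X by exact: lt_le_trans w1.
have eq1 := slope1_secant tr2 cm2 s01.
have s01' : 0 <= s2 X <= 1 by rewrite !ltW.
rewrite (gen_p_excess tr2 cm2 s01') in eq1.
have -> : (sec2 X)^-1 - (W2 1)^-1 = (W2 1 - sec2 X) / (sec2 X * W2 1).
  by field; rewrite !gt_eqF.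
rewrite eq1; move: (sec2 X) w0 (W2 1) W2p (G (s2 X)) gX (G 1) g1 (eps X) e0 (E X) E0.
move=> w w0 W W1 g g0 G1 G10 e e0' x x0; field.
by rewrite !gt_eqF.
Unshelve. all: by end_near.
Qed.

(** The argument of the first factor stays below [1], where its slope is Lipschitz. Its variation is
    [O(X - X0)], hence [O(eps)], negligible against [E / eps]. *)
Lemma inv_sec1 : ((sec1 X)^-1 - (W1 (s1 X0))^-1) / (E X / eps X) @[X --> X0^'+] --> (0 : R).
Proof.
have [/andP[q10 _] _ e1 _] := argP tr1 tr2 a0 b0 aX0; have [f1 _] := fX0.
have q1 : 0 < s1 X0 < 1 by rewrite q10.
have [K K0 hK] := slope_lipschitz tr1 q1.
have h : K / a * ((X - X0) / eps X * (eps X ^+ 2 / E X)) @[X --> X0^'+] -->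
    K / a * (b * W2 1 * 0).
  apply: cvgM; first exact: cvg_cst.
  by apply: cvgM; [exact: delta_eps | exact: eps_sqr_excess].
rewrite !mulr0 in h; apply: squeeze_cvgr (cvg_cst (0 : R)) h.
near=> X; have hX : X0 < X by near: X; exact: nbhs_right_gt.
have /andP[p20 p21] := s2_bounds hX.
have E0 : 0 < E X by near: X; exact: excess_right_gt0.
have e0 : 0 < eps X by rewrite subr_gt0.
have aX := admissible_arg_le aX0 (ltW hX).
have [/andP[p10 _] _ d1 _] := argP tr1 tr2 a0 b0 aX.
have [l1 _] := arg_decr tr1 tr2 a0 b0 aX0 hX.
have /andP[b1 b1'] := secant_bounds tr1 p10 l1 (ltW s10) f1.
have w1 := secant_ge1 tr1 p10 l1 f1; have w0 : 0 < sec1 X by exact: lt_le_trans w1.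
have v1 := slope_ge1 tr1 (ltW q10) f1; have v0 : 0 < W1 (s1 X0) by exact: lt_le_trans v1.
have lo : 0 <= (sec1 X)^-1 - (W1 (s1 X0))^-1.
  by rewrite subr_ge0 lef_pV2 ?posrE// ltW.
have r0 : 0 < E X / eps X by exact: divr_gt0.
rewrite divr_ge0 ?(ltW r0)//= ler_pdivrMr//.
have -> : K / a * ((X - X0) / eps X * (eps X ^+ 2 / E X)) * (E X / eps X) = K * ((X - X0) / a).
  by field; rewrite !gt_eqF.
have t1 : (sec1 X)^-1 - (W1 (s1 X0))^-1 <= W1 (s1 X0) - sec1 X.
  have -> : (sec1 X)^-1 - (W1 (s1 X0))^-1 = (W1 (s1 X0) - sec1 X) / (sec1 X * W1 (s1 X0)).
    by field; rewrite !gt_eqF.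
  rewrite ler_pdivrMr ?mulr_gt0// ler_peMr ?subr_ge0 ?(ltW b1')//.
  by rewrite -[leLHS]mulr1; apply: ler_pM.
have t2 : W1 (s1 X0) - W1 (s1 X) <= K * (s1 X0 - s1 X) by apply: hK; rewrite !ltW.
have t3 : s1 X0 - s1 X <= (X - X0) / a.
  have -> : (X - X0) / a = gap u1 (s1 X) - gap u1 (s1 X0).
    have e : X - X0 = a * (gap u1 (s1 X) - gap u1 (s1 X0)) by rewrite mulrBr d1 e1.
    by rewrite e mulrAC divff ?gt_eqF// mul1r.
  rewrite (gap_secant tr1 p10 l1 (ltW s10) f1).
  have -> : (s1 X)^-1 - (s1 X0)^-1 = (s1 X0 - s1 X) / (s1 X * s1 X0).
    by field; rewrite !gt_eqF.
  rewrite -mulrA ler_peMr ?subr_ge0 ?(ltW l1)// -[leLHS]mulr1; apply: ler_pM => //.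
  rewrite invf_ge1 ?mulr_gt0// mulr_ile1 ?(ltW p10) ?(ltW q10) ?(ltW s10)//.
  by rewrite (le_trans (ltW l1))// ltW.
have t4 := ler_wpM2l K0 t3.
move: t1 t2 t4 b1; move: (W1 _) (W1 _) (sec1 X) (_ / a) => *; lra.
Unshelve. all: by end_near.
Qed.

(** The chord exceeds [psi X0] by a quantity of exact order [E / eps], which dominates [eps] and
    hence [X - X0]. *)
Lemma chord_not_lipschitz (K : R) : ~ (forall X, X0 < X -> chord X0 X - psi X0 <= K * (X - X0)).
Proof.
move=> hK.
have h : K * ((X - X0) / eps X * (eps X ^+ 2 / E X)) @[X --> X0^'+] --> K * (b * W2 1 * 0).
  apply: cvgM; first exact: cvg_cst.
  by apply: cvgM; [exact: delta_eps | exact: eps_sqr_excess].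
have h2 : ((sec1 X)^-1 - (W1 (s1 X0))^-1) / (E X / eps X) +
    ((sec2 X)^-1 - (W2 1)^-1) / (E X / eps X) @[X --> X0^'+] --> 0 + ((G 1 * W2 1) ^+ 2)^-1.
  by apply: cvgD; [exact: inv_sec1 | exact: inv_sec2].
have g1 : 0 < G 1 by rewrite (gen_p_gt0 tr2)// ler01 lexx.
have w0 : 0 < W2 1 by apply: lt_le_trans (slope_ge1 tr2 ler01 (slope_cvg1 tr2 cm2)).
have : 0 + ((G 1 * W2 1) ^+ 2)^-1 <= K * (b * W2 1 * 0).
  apply: ler_cvg_to h2 h _; near=> X.
  have hX : X0 < X by near: X; exact: nbhs_right_gt.
  have /andP[p20 p21] := s2_bounds hX.
  have E0 : 0 < E X by near: X; exact: excess_right_gt0.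
  have e0 : 0 < eps X by rewrite subr_gt0.
  have r0 : 0 < E X / eps X by exact: divr_gt0.
  rewrite -mulrDl ler_pdivrMr//.
  have -> : K * ((X - X0) / eps X * (eps X ^+ 2 / E X)) * (E X / eps X) = K * (X - X0).
    by field; rewrite !gt_eqF.
  apply: le_trans (hK X hX); rewrite /psi /chord s20.
  by move: (W1 _)^-1 (W2 _)^-1 (sec1 X)^-1 (sec2 X)^-1 => x y z t; lra.
by rewrite !mulr0 add0r leNgt invr_gt0 exprn_gt0// mulr_gt0.
Unshelve. all: by end_near.
Qed.

Hypothesis psi0 : psi X0 = 0.

Local Notation kappa := ((G 1 * W2 1) ^+ 2)^-1.

Lemma chord_excess : chord X0 X / (E X / eps X) @[X --> X0^'+] --> kappa.
Proof.
have h : ((sec1 X)^-1 - (W1 (s1 X0))^-1) / (E X / eps X) +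
    ((sec2 X)^-1 - (W2 1)^-1) / (E X / eps X) @[X --> X0^'+] --> 0 + kappa.
  by apply: cvgD; [exact: inv_sec1 | exact: inv_sec2].
rewrite add0r in h; apply: cvg_eq_right h => X hX /=.
rewrite -mulrDl; congr (_ / _); move: psi0; rewrite /psi /chord s20.
move: (W1 _)^-1 (W2 _)^-1 (sec1 X)^-1 (sec2 X)^-1 => x y z t; lra.
Qed.

Let psi0_ge0 : 0 <= psi X0. Proof. by rewrite psi0. Qed.

Lemma W2_gt0 : 0 < W2 1.
Proof. by apply: lt_le_trans (slope_ge1 tr2 ler01 (slope_cvg1 tr2 cm2)). Qed.

Lemma zz_excess : (zz X / zz X0 - 1) / E X @[X --> X0^'+] --> b * W2 1 * kappa / zz X0.
Proof.
have h : (X - X0) / eps X * (chord X0 X / (E X / eps X)) / zz X0 @[X --> X0^'+] -->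
    b * W2 1 * kappa / zz X0.
  apply: cvgM; last exact: cvg_cst.
  by apply: cvgM; [exact: delta_eps | exact: chord_excess].
apply: cvg_trans h; apply: near_eq_cvg; near=> X.
have hX : X0 < X by near: X; exact: nbhs_right_gt.
have /andP[p20 p21] := s2_bounds hX.
have E0 : 0 < E X by near: X; exact: excess_right_gt0.
have e0 : 0 < eps X by rewrite subr_gt0.
have -> : zz X / zz X0 - 1 = (zz X - zz X0) / zz X0 by field; rewrite gt_eqF.
rewrite (zz_chord tr1 tr2 a0 b0 aX0 fX0 hX).
move: (E X) E0 (eps X) e0 (chord X0 X) (zz X0) z0_gt0 => x x0 e e0 c z z0.
by field; rewrite !gt_eqF.
Unshelve. all: by end_near.
Qed.

Local Notation tau X := (ln (zz X / zz X0)).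

Lemma ratio_cvg1 : zz X / zz X0 @[X --> X0^'+] --> (1 : R).
Proof.
have h : zz X / zz X0 @[X --> X0^'+] --> zz X0 / zz X0.
  by apply: cvgM; [exact: (zz_right_cvg tr1 tr2 a0 b0 aX0) | exact: cvg_cst].
by rewrite divff ?gt_eqF in h.
Qed.

Lemma ratio_gt1 X : X0 < X -> 1 < zz X / zz X0.
Proof.
by move=> hX; rewrite ltr_pdivlMr// mul1r; exact: (zz_incr tr1 tr2 a0 b0 aX0 fX0 psi0_ge0 hX).
Qed.

Lemma tau_excess : tau X / E X @[X --> X0^'+] --> b * W2 1 * kappa / zz X0.
Proof.
have up := zz_excess.
have lo : (zz X / zz X0 - 1) / E X / (zz X / zz X0) @[X --> X0^'+] --> b * W2 1 * kappa / zz X0 / 1.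
  by apply: cvgM => //; apply: cvgV; [exact: oner_neq0 | exact: ratio_cvg1].
rewrite divr1 in lo; apply: squeeze_cvgr lo up; near=> X.
have hX : X0 < X by near: X; exact: nbhs_right_gt.
have E0 : 0 < E X by near: X; exact: excess_right_gt0.
have := ratio_gt1 hX; move: (zz X / zz X0) => y y1.
have y0 : 0 < y by exact: lt_trans y1.
have i0 : 0 < y^-1 by rewrite invr_gt0.
have i1 : y^-1 < 1 by rewrite invf_lt1.
rewrite mulrAC; apply/andP; split; apply: ler_wpM2r; rewrite ?invr_ge0 ?(ltW E0)//.
- have : ln (1 + (y^-1 - 1)) <= y^-1 - 1 by apply: le_ln1Dx; lra.
  rewrite addrC subrK lnV ?posrE// => h; rewrite mulrBl divff ?gt_eqF// mul1r; lra.
- have : ln (1 + (y - 1)) <= y - 1 by apply: le_ln1Dx; lra.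
  by rewrite addrC subrK.
Unshelve. all: by end_near.
Qed.

(** [zz X / X] varies mainly through the denominator: [zz] itself varies only by [(X - X0)] times a
    chord that tends to [0]. The drop is thus linear in [eps]. *)
Lemma drop_eps : (zz X0 / X0 - zz X / X) / eps X @[X --> X0^'+] --> b * W2 1 * zz X0 / X0 ^+ 2.
Proof.
have cX := chord_right_cvg tr1 tr2 a0 b0 aX0 fX0; rewrite psi0 in cX.
have h : (X - X0) / eps X * ((zz X0 - X0 * chord X0 X) / (X * X0)) @[X --> X0^'+] -->
    b * W2 1 * ((zz X0 - X0 * 0) / (X0 * X0)).
  apply: cvgM; first exact: delta_eps.
  apply: cvgM.
    by apply: cvgB; [exact: cvg_cst | apply: cvgM => //; exact: cvg_cst].
  apply: cvgV; first by rewrite mulf_neq0// gt_eqF.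
  by apply: cvgM; [exact: cvg_at_right_filter | exact: cvg_cst].
rewrite mulr0 subr0 mulrA -expr2 in h; apply: cvg_eq_right h => X hX.
have /andP[p20 p21] := s2_bounds hX; have e0 : 0 < eps X by rewrite subr_gt0.
have Xp : 0 < X by exact: lt_trans hX.
have -> : zz X = zz X0 + (X - X0) * chord X0 X.
  by rewrite -(zz_chord tr1 tr2 a0 b0 aX0 fX0 hX) addrC subrK.
move: (chord X0 X) (zz X0) (eps X) e0 => c z e e0; field.
by rewrite !gt_eqF.
Qed.

Local Notation a_ n := (p n * (zz X0)^-1 ^+ n).

(** [tau] is the logarithmic distance of the radii, [1 / zz X = e^(- tau) / zz X0], so the increment
    at [tau] is the difference of two Green functions known on the curve. *)
Lemma increment_tau X : X0 < X -> increment (fun n => a_ n) (tau X) = zz X0 / X0 - zz X / X.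
Proof.
move=> hX; have r1 := ratio_gt1 hX; have r0 : 0 < zz X / zz X0 by exact: lt_trans r1.
have zX : 0 < zz X by rewrite -(pmulr_lgt0 _ (_ : 0 < (zz X0)^-1)) ?invr_gt0.
have [c1 <-] := gsum_base tr1 tr2 a0 b0 p_ge0 green aX0 fX0 psi0_ge0.
have [c2 <-] := gsum_right tr1 tr2 a0 b0 green aX0 fX0 psi0_ge0 hX.
have [_ <-] := ssumB c1 c2; rewrite /increment; apply: ssum_eq => n.
rewrite expRN lnK ?posrE// mulrBr mulr1; congr (_ - _).
by rewrite -mulrA -exprMn invf_div mulrA mulVf ?mul1r// gt_eqF.
Qed.

(* [tau] maps right neighbourhoods of [X0] onto right neighbourhoods of [0]. *)
Lemma tau_transfer (f : R -> R) (l : R) : f (tau X) @[X --> X0^'+] --> l ->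
  f t @[t --> 0^'+] --> l.
Proof.
move=> h; apply/cvgrPdist_le => e e0.
have /cvgrPdist_le /(_ e e0) hn := h.
have [X1 hX1 hX] : exists2 X1, X0 < X1 & forall X, X0 < X <= X1 -> `|l - f (tau X)| <= e.
  have /nbhs_ballP [d /= d0 hd] : nbhs X0 (fun t => X0 < t -> `|l - f (tau t)| <= e) := hn.
  exists (X0 + d / 2) => [|X /andP[h1 h2]]; first by rewrite ltrDl divr_gt0.
  apply: (hd X _ h1); rewrite -ball_normE /= ltr0_norm; last by rewrite subr_lt0.
  by move: d0 => /= d0; lra.
have cz := zz_clamped_continuous tr1 tr2 a0 b0 aX0.
have t1 : 0 < tau X1 by rewrite ln_gt0// ratio_gt1.
near=> t.
have tp : 0 < t by near: t; exact: nbhs_right_gt.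
have tl : t < tau X1 by near: t; exact: nbhs_right_lt.
pose v := zz X0 * expR t.
have vb : zz X0 <= v <= zz X1.
  apply/andP; split; first by rewrite ler_peMr// ltW// expR_gt1.
  have r0 : 0 < zz X1 / zz X0 by exact: lt_trans (ratio_gt1 hX1).
  rewrite /v [_ * expR t]mulrC -ler_pdivlMr// -[zz X1 / zz X0]lnK ?posrE//.
  by rewrite ler_expR ltW.
have [X /andP[l1 l2] e1] : exists2 X, X0 <= X <= X1 & zz (Num.max X0 X) = v.
  have mX1 : Num.max X0 X1 = X1 by rewrite max_r// ltW.
  have := @IVT R (fun X => zz (Num.max X0 X)) X0 X1 v (ltW hX1) (continuous_subspaceT cz).
  rewrite /= maxxx mX1 ge_min le_max; have /andP[-> ->] := vb; rewrite orbT => /(_ isT).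
  by case=> X; rewrite in_itv /= => hX' <-; exists X.
rewrite max_r// in e1.
have hX0 : X0 < X.
  rewrite lt_neqAle l1 andbT; apply/eqP => e2; rewrite -e2 in e1.
  have : zz X0 < v by rewrite /v ltr_pMr// expR_gt1.
  by rewrite -e1 ltxx.
have -> : t = tau X by rewrite e1 /v mulrAC divff ?mul1r ?expRK// gt_eqF.
by apply: hX; rewrite hX0.
Unshelve. all: by end_near.
Qed.

Lemma tau_excess_limit_gt0 : 0 < b * W2 1 * kappa / zz X0.
Proof.
have g1 : 0 < G 1 by rewrite (gen_p_gt0 tr2)// ler01 lexx.
have w0 := W2_gt0.
by rewrite divr_gt0// mulr_gt0 ?invr_gt0 ?exprn_gt0 ?mulr_gt0.
Qed.

Lemma drop_eps_limit_gt0 : 0 < b * W2 1 * zz X0 / X0 ^+ 2.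
Proof. by rewrite divr_gt0 ?exprn_gt0// !mulr_gt0// W2_gt0. Qed.

Lemma increment_eps : increment (fun n => a_ n) (tau X) / eps X @[X --> X0^'+] -->
  b * W2 1 * zz X0 / X0 ^+ 2.
Proof. by apply: cvg_eq_right drop_eps => X hX; rewrite increment_tau. Qed.

Lemma eps_gt0 X : X0 < X -> 0 < eps X.
Proof. by move=> /s2_bounds /andP[_ h]; rewrite subr_gt0. Qed.

Lemma tau_scaled (f : R -> R) (K : R) : 0 < K ->
  excess p2 s / f (1 - s) @[s --> (1 : R)^'-] --> K ->
  exists2 c : R, 0 < c & tau X / f (eps X) @[X --> X0^'+] --> c.
Proof.
move=> K0 hK; exists (b * W2 1 * kappa / zz X0 * K).
  by rewrite mulr_gt0// tau_excess_limit_gt0.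
have h2 : tau X / E X * (E X / f (eps X)) @[X --> X0^'+] --> b * W2 1 * kappa / zz X0 * K.
  by apply: cvgM; [exact: tau_excess | exact: (cvg_comp _ _ s2_left hK)].
apply: cvg_trans h2; apply: near_eq_cvg; near=> X.
have E0 : 0 < E X by near: X; exact: excess_right_gt0.
by rewrite mulrA divfK// gt_eqF.
Unshelve. all: by end_near.
Qed.

End Critical.

(** * Regular variation *)

Section RegularVariation.
Variable R : realType.
Local Notation near0 := ((0 : R)^'+).

Lemma powR_cvg T (F : set_system T) (FF : Filter F) (g : T -> R) (l r : R) :
  0 < l -> g x @[x --> F] --> l -> g x `^ r @[x --> F] --> l `^ r.
Proof.
move=> l0 gl; have h : expR (r * ln (g x)) @[x --> F] --> expR (r * ln l).
  apply: continuous_cvg; first exact: continuous_expR.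
  apply: cvgM; first exact: cvg_cst.
  by apply: continuous_cvg gl; exact: continuous_ln.
rewrite {2}/powR gt_eqF//; apply: cvg_trans h; apply: near_eq_cvg.
have h0 := @cvgr_gt _ _ _ _ _ _ gl _ l0.
near=> x; have gx : 0 < g x by near: x; exact: h0.
by rewrite /powR gt_eqF.
Unshelve. all: by end_near.
Qed.

Lemma regular_of_equiv (S F : R -> R) (gm K : R) : 0 < K ->
  (forall t, 0 < t -> 0 < S t) -> S t / F t @[t --> near0] --> K ->
  (forall l, 0 < l -> F (l * t) / F t @[t --> near0] --> l `^ gm) ->
  forall l, 0 < l -> S (l * t) / S t @[t --> near0] --> l `^ gm.
Proof.
move=> K0 S0 SF Freg l l0.
have lc : l * t @[t --> near0] --> near0.
  apply: cvg_to_right.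
    have : l * t @[t --> near0] --> l * 0.
      by apply: cvgM; [exact: cvg_cst | exact: cvg_at_right_filter].
    by rewrite mulr0.
  by near=> t; rewrite mulr_gt0//; near: t; exact: nbhs_right_gt.
have h1 := cvg_comp _ _ lc SF.
have h : S (l * t) / F (l * t) * (F (l * t) / F t) / (S t / F t) @[t --> near0] -->
    K * l `^ gm / K.
  apply: cvgM; first by apply: cvgM; [exact: h1 | exact: Freg].
  by apply: cvgV => //; rewrite gt_eqF.
rewrite mulrAC divff ?gt_eqF// mul1r in h.
apply: cvg_trans h; apply: near_eq_cvg.
have p1 := @cvgr_gt _ _ _ _ _ _ SF _ K0.
have p2 := @cvgr_gt _ _ _ _ _ _ h1 _ K0.
near=> t.
have tp : 0 < t by near: t; exact: nbhs_right_gt.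
have q1 : 0 < S t / F t by near: t; exact: p1.
have q2 : 0 < S (l * t) / F (l * t) by near: t; exact: p2.
have F1 : F t != 0 by apply: contraTneq q1 => ->; rewrite invr0 mulr0 ltxx.
have F2 : F (l * t) != 0 by apply: contraTneq q2 => ->; rewrite invr0 mulr0 ltxx.
have St := S0 t tp; field; rewrite F1 F2 gt_eqF//.
Unshelve. all: by end_near.
Qed.

Lemma regular_power (gm l : R) : 0 < l ->
  (l * t) `^ gm / t `^ gm @[t --> near0] --> l `^ gm.
Proof.
move=> l0; apply: cvg_near_cst; near=> t.
have tp : 0 < t by near: t; exact: nbhs_right_gt.
by rewrite powRM ?ltW// mulfK// gt_eqF// powR_gt0.
Unshelve. all: by end_near.
Qed.

Lemma inv_ln_inv_cvg0 : (ln t^-1)^-1 @[t --> near0] --> (0 : R).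
Proof.
apply/cvgrPdist_le => e e0; near=> t.
have tp : 0 < t by near: t; exact: nbhs_right_gt.
have th : t < expR (- e^-1) by near: t; apply: nbhs_right_lt; exact: expR_gt0.
have L : e^-1 < ln t^-1 by rewrite lnV ?posrE// ltrNr -ltr_expR lnK.
have L0 : 0 < ln t^-1 by apply: lt_trans L; rewrite invr_gt0.
rewrite sub0r normrN gtr0_norm ?invr_gt0// -[leRHS]invrK.
by rewrite lef_pV2 ?posrE ?invr_gt0// ltW.
Unshelve. all: by end_near.
Qed.

Lemma regular_sqrt_log (l : R) : 0 < l ->
  Num.sqrt (l * t / ln (l * t)^-1) / Num.sqrt (t / ln t^-1) @[t --> near0] --> l `^ (1 / 2).
Proof.
move=> l0.
have h : Num.sqrt (l / (1 - ln l * (ln t^-1)^-1)) @[t --> near0] --> Num.sqrt (l / (1 - ln l * 0)).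
  apply: continuous_cvg; first exact: sqrt_continuous.
  apply: cvgM; first exact: cvg_cst.
  apply: cvgV; first by rewrite mulr0 subr0 oner_neq0.
  apply: cvgB; first exact: cvg_cst.
  by apply: cvgM; [exact: cvg_cst | exact: inv_ln_inv_cvg0].
rewrite mulr0 subr0 divr1 -powR12_sqrt ?(ltW l0)// -[2^-1]div1r in h.
apply: cvg_trans h; apply: near_eq_cvg.
have d0 : 0 < Num.min 1 l^-1 by rewrite lt_min ltr01 invr_gt0.
near=> t.
have tp : 0 < t by near: t; exact: nbhs_right_gt.
have : t < Num.min 1 l^-1 by near: t; exact: nbhs_right_lt.
rewrite lt_min => /andP[t1 tl].
have L0 : 0 < ln t^-1 by rewrite ln_gt0// invf_gt1.
have lt1 : l * t < 1 by rewrite -ltr_pdivlMl// mulr1.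
have lt0 : 0 < l * t by exact: mulr_gt0.
have L1 : 0 < ln (l * t)^-1 by rewrite ln_gt0// invf_gt1.
have e : ln (l * t)^-1 = ln t^-1 - ln l.
  by rewrite !lnV ?posrE// lnM ?posrE// opprD addrC.
rewrite -sqrtrV; last by rewrite divr_ge0// ltW.
rewrite -sqrtrM; last by rewrite divr_ge0// ltW.
congr Num.sqrt; move: L1; rewrite e; move: (ln t^-1) L0 (ln l) => x x0 y xy.
by field; rewrite !gt_eqF.
Unshelve. all: by end_near.
Qed.

Section Scaled.
Variables (T : Type) (F : set_system T) (FF : ProperFilter F) (tau eps S : T -> R) (c k : R).
Hypotheses (c0 : 0 < c) (Seps : S x / eps x @[x --> F] --> k) (eps0 : eps @ F --> near0).

Let eps_near (P : R -> Prop) : (\forall t \near near0, P t) -> \forall x \near F, P (eps x).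
Proof. by move=> h; exact: (eps0 h). Qed.

Let eps_gt0 : \forall x \near F, 0 < eps x.
Proof. by apply: (@eps_near (fun t => 0 < t)); exact: nbhs_right_gt. Qed.

(** Inversion of [tau ~ c eps^(3/2)] into [eps ~ (tau / c)^(2/3)], while [S] is of order [eps]. *)
Lemma scaled_power : tau x / Num.sqrt (eps x) ^+ 3 @[x --> F] --> c ->
  S x / tau x `^ (2 / 3) @[x --> F] --> k / c `^ (2 / 3).
Proof.
move=> tc; have cp : 0 < c `^ (2 / 3) by exact: powR_gt0.
have h : S x / eps x / (tau x / Num.sqrt (eps x) ^+ 3) `^ (2 / 3) @[x --> F] --> k / c `^ (2 / 3).
  by apply: cvgM => //; apply: cvgV; [rewrite gt_eqF | exact: powR_cvg].
apply: cvg_trans h; apply: near_eq_cvg.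
have h0 := @cvgr_gt _ _ _ _ _ _ tc _ c0.
near=> x; have e0 : 0 < eps x by near: x; exact: eps_gt0.
have : 0 < tau x / Num.sqrt (eps x) ^+ 3 by near: x; exact: h0.
have q0 : 0 < Num.sqrt (eps x) by rewrite sqrtr_gt0.
have q3 : 0 < Num.sqrt (eps x) ^+ 3 by exact: exprn_gt0.
rewrite pmulr_lgt0 ?invr_gt0// => t0.
have e : eps x = (Num.sqrt (eps x) ^+ 3) `^ (2 / 3).
  rewrite -powR_mulrn ?(ltW q0)// -powRrM (_ : 3 * (2 / 3) = 2%:R); last by field.
  by rewrite powR_mulrn ?(ltW q0)// sqr_sqrtr// ltW.
have -> : tau x `^ (2 / 3) = (tau x / Num.sqrt (eps x) ^+ 3) `^ (2 / 3) * eps x.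
  have d0 : 0 < tau x / Num.sqrt (eps x) ^+ 3 by rewrite divr_gt0.
  by rewrite [X in _ = _ * X]e -powRM ?(ltW d0) ?(ltW q3)// divfK// gt_eqF.
have : 0 < (tau x / Num.sqrt (eps x) ^+ 3) `^ (2 / 3) by rewrite powR_gt0// divr_gt0.
by move: (_ `^ _) => y y0; field; rewrite !gt_eqF.
Unshelve. all: by end_near.
Qed.

(** The logarithms of [c] and of [ln (1 / eps)] are negligible against [ln (1 / eps)], so only the
    exponent [2] of [eps] survives. This allows [ln (1 / eps)] to be replaced by half of
    [ln (1 / tau)] when inverting. *)
Lemma ln_scaled : tau x / (eps x ^+ 2 * ln (eps x)^-1) @[x --> F] --> c ->
  ln (tau x)^-1 / ln (eps x)^-1 @[x --> F] --> (2 : R).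
Proof.
move=> tc; have L1 : (ln (eps x)^-1)^-1 @[x --> F] --> (0 : R).
  exact: (cvg_comp _ _ eps0 inv_ln_inv_cvg0).
(* From [ln y <= y] at [y = sqrt L], that is [ln L <= 2 sqrt L]. *)
have lnL : ln (ln (eps x)^-1) / ln (eps x)^-1 @[x --> F] --> (0 : R).
  have up : 2 * Num.sqrt (ln (eps x)^-1)^-1 @[x --> F] --> 2 * Num.sqrt (0 : R).
    by apply: cvgM; [exact: cvg_cst | apply: continuous_cvg L1; exact: sqrt_continuous].
  rewrite sqrtr0 mulr0 in up; apply: squeeze_cvgr (cvg_cst (0 : R)) up.
  have es : \forall x \near F, eps x < expR (- 1) by apply: (@eps_near (fun t => t < expR (- 1))); apply: nbhs_right_lt; exact: expR_gt0.
  near=> x; have e0 : 0 < eps x by near: x; exact: eps_gt0.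
  have e1 : eps x < expR (- 1) by near: x; exact: es.
  have : 1 < ln (eps x)^-1 by rewrite lnV ?posrE// ltrNr -ltr_expR lnK.
  move: (ln (eps x)^-1) => L L1'; have L0 : 0 < L by exact: lt_trans L1'.
  have q0 : 0 < Num.sqrt L by rewrite sqrtr_gt0.
  rewrite divr_ge0 ?ln_ge0 ?(ltW L1') ?(ltW L0)//= sqrtrV ?(ltW L0)//.
  have {2}-> : L = Num.sqrt L ^+ 2 by rewrite sqr_sqrtr// ltW.
  have {1}-> : L = Num.sqrt L ^+ 2 by rewrite sqr_sqrtr// ltW.
  have : ln (Num.sqrt L) <= Num.sqrt L.
    have : ln (1 + (Num.sqrt L - 1)) <= Num.sqrt L - 1 by apply: le_ln1Dx; lra.
    by rewrite addrC subrK; lra.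
  move: (Num.sqrt L) q0 => q q0 h; rewrite lnXn// ler_pdivrMr ?exprn_gt0//.
  rewrite (_ : 2 / q * q ^+ 2 = 2 * q); last by field; rewrite gt_eqF.
  by rewrite mulr2n; lra.
have lnc : ln (tau x / (eps x ^+ 2 * ln (eps x)^-1)) * (ln (eps x)^-1)^-1 @[x --> F] --> ln c * 0.
  by apply: cvgM => //; apply: continuous_cvg tc; exact: continuous_ln.
rewrite mulr0 in lnc.
have h : 2 - ln (ln (eps x)^-1) / ln (eps x)^-1 -
   ln (tau x / (eps x ^+ 2 * ln (eps x)^-1)) * (ln (eps x)^-1)^-1 @[x --> F] --> (2 - 0 - 0 : R).
  by apply: cvgB => //; apply: cvgB => //; exact: cvg_cst.
rewrite !subr0 in h; apply: cvg_trans h; apply: near_eq_cvg.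
have h0 := @cvgr_gt _ _ _ _ _ _ tc _ c0.
have es : \forall x \near F, eps x < 1 by apply: (@eps_near (fun t => t < 1)); exact: nbhs_right_lt.
near=> x; have e0 : 0 < eps x by near: x; exact: eps_gt0.
have e1 : eps x < 1 by near: x; exact: es.
have : 0 < tau x / (eps x ^+ 2 * ln (eps x)^-1) by near: x; exact: h0.
have L0 : 0 < ln (eps x)^-1 by rewrite ln_gt0// invf_gt1.
rewrite pmulr_lgt0 ?invr_gt0 ?mulr_gt0 ?exprn_gt0// => t0.
have -> : ln (tau x / (eps x ^+ 2 * ln (eps x)^-1)) =
    ln (tau x) + 2 * ln (eps x)^-1 - ln (ln (eps x)^-1).
  rewrite ln_div ?posrE ?mulr_gt0 ?exprn_gt0// lnM ?posrE ?exprn_gt0//.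
  by rewrite lnXn// lnV ?posrE// mulr2n; ring.
rewrite [ln (tau x)^-1]lnV ?posrE//.
move: (ln (tau x)) (ln (ln (eps x)^-1)) (ln (eps x)^-1) L0 => u v L L0.
by field; rewrite gt_eqF.
Unshelve. all: by end_near.
Qed.

Lemma scaled_log : tau x / (eps x ^+ 2 * ln (eps x)^-1) @[x --> F] --> c ->
  S x / Num.sqrt (tau x / ln (tau x)^-1) @[x --> F] --> k / Num.sqrt (c / 2).
Proof.
move=> tc; have h2 := ln_scaled tc.
have c2 : 0 < c / 2 by rewrite divr_gt0.
have h : S x / eps x / Num.sqrt (tau x / (eps x ^+ 2 * ln (eps x)^-1) /
    (ln (tau x)^-1 / ln (eps x)^-1)) @[x --> F] --> k / Num.sqrt (c / 2).
  apply: cvgM => //; apply: cvgV; first by rewrite gt_eqF// sqrtr_gt0.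
  apply: continuous_cvg; first exact: sqrt_continuous.
  by apply: cvgM => //; apply: cvgV.
apply: cvg_trans h; apply: near_eq_cvg.
have h0 := @cvgr_gt _ _ _ _ _ _ tc _ c0.
have h20 := @cvgr_gt _ _ _ _ _ _ h2 _ (ltr0n R 2).
have es : \forall x \near F, eps x < 1 by apply: (@eps_near (fun t => t < 1)); exact: nbhs_right_lt.
near=> x; have e0 : 0 < eps x by near: x; exact: eps_gt0.
have e1 : eps x < 1 by near: x; exact: es.
have : 0 < tau x / (eps x ^+ 2 * ln (eps x)^-1) by near: x; exact: h0.
have L0 : 0 < ln (eps x)^-1 by rewrite ln_gt0// invf_gt1.
rewrite pmulr_lgt0 ?invr_gt0 ?mulr_gt0 ?exprn_gt0// => t0.
have : 0 < ln (tau x)^-1 / ln (eps x)^-1 by near: x; exact: h20.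
rewrite pmulr_lgt0 ?invr_gt0// => M0.
have -> : tau x / (eps x ^+ 2 * ln (eps x)^-1) / (ln (tau x)^-1 / ln (eps x)^-1) =
    tau x / ln (tau x)^-1 / eps x ^+ 2.
  move: (ln (eps x)^-1) L0 (ln (tau x)^-1) M0 => L L0 M M0.
  by field; rewrite !gt_eqF.
rewrite [Num.sqrt (_ / eps x ^+ 2)]sqrtrM; last by rewrite divr_ge0// ltW.
rewrite sqrtrV ?exprn_ge0 ?(ltW e0)// sqrtr_sqr gtr0_norm//.
have : 0 < Num.sqrt (tau x / ln (tau x)^-1) by rewrite sqrtr_gt0 divr_gt0.
by move: (Num.sqrt _) => y y0; field; rewrite !gt_eqF.
Unshelve. all: by end_near.
Qed.

End Scaled.

End RegularVariation.

Section CriticalIncrement.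
Variables (R : realType) (p1 u1 p2 u2 : R^nat) (a b : R) (p : R^nat).
Hypotheses (tr1 : transient_renewal p1 u1) (tr2 : transient_renewal p2 u2).
Hypotheses (a0 : 0 < a) (b0 : 0 < b) (p_ge0 : forall n, 0 <= p n).
Hypothesis green : green_on_curve u1 u2 a b p.
Hypotheses (cm2 : cvgn (series (fun n => n%:R * p2 n)))
  (nc2 : ~ cvgn (series (fun n => n%:R ^+ 2 * p2 n))).
Variable X0 : R.
Hypotheses (aX0 : admissible_arg u1 u2 a b X0) (fX0 : finite_slopes u1 u2 a b X0).
Hypotheses (s20 : arg2 u2 b X0 = 1) (s10 : arg1 u1 a X0 < 1) (psi0 : psi u1 u2 a b X0 = 0).

Local Notation S := (increment (fun n => p n * (zz u1 u2 a b X0)^-1 ^+ n)).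

Let eps_right : 1 - arg2 u2 b X @[X --> X0^'+] --> (0 : R)^'+.
Proof.
apply: cvg_to_right; first exact: (eps_cvg0 tr1 tr2 a0 b0 aX0 s20).
by near=> X; apply: (eps_gt0 tr1 tr2 a0 b0 aX0 s20); near: X; exact: nbhs_right_gt.
Unshelve. all: by end_near.
Qed.

Lemma increment5 (K : R) : 0 < K ->
  excess p2 s / Num.sqrt (1 - s) ^+ 3 @[s --> (1 : R)^'-] --> K ->
  exists2 C : R, 0 < C & S t / t `^ (2 / 3) @[t --> (0 : R)^'+] --> C.
Proof.
move=> K0 hK.
have [c c0 hc] := tau_scaled tr1 tr2 a0 b0 cm2 nc2 aX0 fX0 s20 s10 psi0 (f := fun e => Num.sqrt e ^+ 3) K0 hK.
have hS := increment_eps tr1 tr2 a0 b0 p_ge0 green cm2 aX0 fX0 s20 psi0.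
have h := scaled_power _ c0 hS eps_right hc.
have k0 := drop_eps_limit_gt0 tr1 tr2 a0 b0 cm2 aX0.
have h' := tau_transfer tr1 tr2 a0 b0 aX0 fX0 psi0 (f := fun t => S t / t `^ (2 / 3)) (h _).
exists (b * slope u2 1 * zz u1 u2 a b X0 / X0 ^+ 2 / c `^ (2 / 3)); last exact: h'.
by rewrite divr_gt0// powR_gt0.
Qed.

Lemma increment6 (K : R) : 0 < K ->
  excess p2 s / ((1 - s) ^+ 2 * ln (1 - s)^-1) @[s --> (1 : R)^'-] --> K ->
  exists2 C : R, 0 < C & S t / Num.sqrt (t / ln t^-1) @[t --> (0 : R)^'+] --> C.
Proof.
move=> K0 hK.
have [c c0 hc] := tau_scaled tr1 tr2 a0 b0 cm2 nc2 aX0 fX0 s20 s10 psi0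
  (f := fun e => e ^+ 2 * ln e^-1) K0 hK.
have hS := increment_eps tr1 tr2 a0 b0 p_ge0 green cm2 aX0 fX0 s20 psi0.
have h := scaled_log _ c0 hS eps_right hc.
have k0 := drop_eps_limit_gt0 tr1 tr2 a0 b0 cm2 aX0.
have h' := tau_transfer tr1 tr2 a0 b0 aX0 fX0 psi0
  (f := fun t => S t / Num.sqrt (t / ln t^-1)) (h _).
exists (b * slope u2 1 * zz u1 u2 a b X0 / X0 ^+ 2 / Num.sqrt (c / 2)); last exact: h'.
by rewrite divr_gt0// sqrtr_gt0 divr_gt0.
Qed.

End CriticalIncrement.

(** * Almost monotone coefficients *)

Section LogConvex.
Variables (R : realType) (e : R^nat) (B : R).
Hypotheses (e_gt0 : forall n, 0 < e n) (eB : forall n, e n <= B)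
  (convex : forall n, e n.+1 ^+ 2 <= e n * e n.+2).

Let ratio n := e n.+1 / e n.

Let ratio_incr n : ratio n <= ratio n.+1.
Proof.
rewrite /ratio ler_pdivrMr// mulrAC ler_pdivlMr// -expr2 mulrC.
exact: convex.
Qed.

Let ratio_mono m n : (m <= n)%N -> ratio m <= ratio n.
Proof. by move=> mn; apply: (homo_leq (f := ratio) lexx le_trans) => // i; exact: ratio_incr. Qed.

Let ratio_gt0 n : 0 < ratio n. Proof. exact: divr_gt0. Qed.

Let ratio_ge n (q : R) : 0 <= q -> q <= ratio n -> forall m, q ^+ m * e n <= e (n + m)%N.
Proof.
move=> q0 qn; elim=> [|m IH]; first by rewrite addn0 mul1r.
rewrite addnS exprS -mulrA; apply: (le_trans (ler_wpM2l q0 IH)).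
rewrite mulrC -ler_pdivlMl// mulrC; apply: (le_trans qn).
by apply: ratio_mono; rewrite leq_addr.
Qed.

Lemma log_convex_decr n : e n.+1 <= e n.
Proof.
rewrite leNgt; apply/negP => h; pose q := ratio n.
have q1 : 1 < q by rewrite /q /ratio ltr_pdivlMr// mul1r.
have q0 : 0 <= q by rewrite ltW// (lt_trans ltr01).
have [m hm] : exists m, B / e n < q ^+ m.
  have d0 : 0 < q - 1 by rewrite subr_gt0.
  pose m := Num.bound (`|B / e n| / (q - 1)).
  have hm : `|B / e n| / (q - 1) < m%:R by rewrite archi_boundP// divr_ge0// ltW.
  exists m; have := bernoulli_gep m (ltW d0); rewrite [1 + (q - 1)]addrC subrK.
  apply: lt_le_trans; rewrite ltr_pdivrMr// in hm.
  by have := ler_norm (B / e n); lra.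
have := ratio_ge q0 (lexx q) m; rewrite ltr_pdivrMr// in hm.
by have := eB (n + m)%N; lra.
Qed.

(** As the ratios increase, either they eventually reach [c] or they all stay below it, and then the
    sequence decays geometrically. *)
Lemma log_convex_ratio (c : R) : c < 1 ->
  (forall d, 0 < d < 1 -> exists n, e 0%N * d ^+ n < e n) ->
  exists n0, forall n, (n0 <= n)%N -> c * e n <= e n.+1.
Proof.
move=> c1 nc; apply: contrapT => /forallNP h.
have rc n : ratio n < c.
  rewrite ltNge; apply/negP => hn; apply: (h n) => m nm.
  by rewrite -ler_pdivlMr//; apply: (le_trans hn); exact: ratio_mono.
have c0 : 0 < c by exact: lt_trans (rc 0%N).
have [|n] := nc c; first by rewrite c0.
apply/negP; rewrite -leNgt.
elim: n => [|n IH]; first by rewrite mulr1.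
rewrite exprSr mulrA; have := ltW (rc n); rewrite ler_pdivrMr// => h1.
by apply: (le_trans h1); rewrite mulrC ler_wpM2r// ltW.
Qed.

End LogConvex.

Lemma leq_half_bounds n : (n./2 + n./2 <= n <= (n./2 + n./2).+1)%N.
Proof. by have := odd_double_half n; rewrite -addnn; case: (odd n) => /=; lia. Qed.

Lemma leq_double_sub n m h : (m <= h)%N -> (n <= (h + h).+1)%N ->
  (n <= 2 * (h - m) + (m + m).+1)%N.
Proof. by move=> *; lia. Qed.

Lemma addnAC_shift j k y : (j + (k + y) + (j + (k + y)) = j + (k + (k + y)) + (j + y))%N.
Proof. by lia. Qed.

(** Index bookkeeping for the odd case: [2 i + 1 = k + 2 m], and [2 m] is written as [j + k (n + 1)]
    by Euclidean division. Then [j + k (n + 2)] is the odd index [2 i + 1], and [j + k n] is the odd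
    index [2 i' + 1]. *)
Lemma odd_index_split k l n0 n1 M i : k = (l + l).+1 ->
  (n0 + n1 + k * M.+2 + k + k <= i)%N -> exists m i' j n,
  [/\ (m + l = i)%N, (i' + l.+1 = m)%N & [/\ (M <= n)%N, (n0 <= i')%N & (n1 <= i')%N]] /\
  [/\ (m + m = j + k * n.+1)%N, (j + k * n.+2 = i + i.+1)%N & (j + k * n = i' + i'.+1)%N].
Proof.
move=> kE hi; have kp : (0 < k)%N by rewrite kE.
have [i' iE] : exists i', (i' + l.+1 + l = i)%N by exists (i - l.+1 - l)%N; lia.
have hi' : (n0 + n1 + k * M.+1 <= i')%N by move: hi; rewrite [(k * M.+2)%N]mulnS; lia.
pose N := (i' + l.+1 + (i' + l.+1))%N.
have NM : (k * M.+1 <= N)%N by rewrite /N; lia.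
have nM : (M.+1 <= N %/ k)%N by rewrite leq_divRL// mulnC.
have NE : N = (N %% k + k * (N %/ k).-1.+1)%N.
  by rewrite prednK ?(leq_trans _ nM)// addnC mulnC -divn_eq.
exists (i' + l.+1)%N, i', (N %% k)%N, (N %/ k).-1; split; split=> //.
- by split; move: nM hi'; lia.
- by rewrite mulnS addnCA -NE kE /N -iE; lia.
- by move: NE; rewrite mulnS {2}kE /N; lia.
Qed.

Lemma quasi_monotone_index n0 n1 m n : (n0 + n0 + n1 + n1 + 2 <= m)%N -> (m < n)%N ->
  [/\ (n0 <= m./2)%N, (n1 <= m./2)%N & (n1 <= n./2)%N] /\
  (if odd m then m = (m./2 + (m./2).+1)%N /\ ((m./2).+1 <= n./2)%N
   else m = (m./2 + m./2)%N /\ (m./2 <= n./2)%N).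
Proof.
move=> hm mn; have /andP[a1 a2] := leq_half_bounds m; have /andP[b1 b2] := leq_half_bounds n.
have := odd_double_half m; rewrite -addnn; case: (odd m) => /= E.
  by split; [split; lia | split; lia].
by split; [split; lia | split; lia].
Qed.

(* By [p_sqr] the subsequence of even indices is log-convex, hence decreasing
   with ratios tending to [1]; [p_ratio] with [k] odd compares it with the odd
   indices. *)
Section QuasiMonotone.
Variables (R : realType) (p : R^nat) (r B : R) (n1 k : nat).
Hypotheses (p_ge0 : forall n, 0 <= p n) (p_gt0 : forall n, (n1 <= n)%N -> 0 < p n).
Hypothesis p_sqr : forall m n, p (m + n)%N ^+ 2 <= p (m + m)%N * p (n + n)%N.
Hypothesis p_ratio : forall j n, n.+2%:R * p (j + k * n.+1)%N ^+ 2 <=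
  p (j + k * n.+2)%N * (n.+1%:R * p (j + k * n)%N + p (j + k * n.+1)%N / p k).
Hypotheses (k_odd : odd k) (pk_gt0 : 0 < p k) (r_gt0 : 0 < r).

Local Notation a n := (p n * r ^+ n).

Hypotheses (aB : forall n, a n <= B) (nc : ~ cvgn (series (fun n => n%:R * a n))).

Let a_ge0 n : 0 <= a n. Proof. by rewrite mulr_ge0// exprn_ge0// ltW. Qed.

Let a_sqr m n : a (m + n)%N ^+ 2 <= a (m + m)%N * a (n + n)%N.
Proof.
rewrite exprMn -exprM mulnC mulSn mul1n.
have -> : a (m + m)%N * a (n + n)%N = p (m + m)%N * p (n + n)%N * r ^+ (m + n + (m + n)).
  by rewrite addnACA [r ^+ (m + m + _)]exprD; ring.
by apply: ler_wpM2r => //; rewrite exprn_ge0// ltW.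
Qed.

(** Even-indexed coefficients, started late enough to be positive. *)
Let e j := a (j + n1 + (j + n1))%N.

Let e_gt0 j : 0 < e j.
Proof. by rewrite mulr_gt0 ?exprn_gt0// p_gt0// -addnA (leq_trans _ (leq_addl _ _))// leq_addr. Qed.

Let e_convex j : e j.+1 ^+ 2 <= e j * e j.+2.
Proof.
have := a_sqr (j + n1) (j.+2 + n1).
by rewrite (_ : (j + n1 + (j.+2 + n1) = j.+1 + n1 + (j.+1 + n1))%N)//; lia.
Qed.

Let eB j : e j <= B. Proof. exact: aB. Qed.

Lemma even_decr i j : (n1 <= i)%N -> (i <= j)%N -> a (j + j)%N <= a (i + i)%N.
Proof.
move=> ni ij.
have h : forall m n, (m <= n)%N -> e n <= e m.
  move=> m n mn; apply: (@homo_leq _ e (fun x y => y <= x)) => // [y x z h1 h2|i'].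
    exact: le_trans h2 h1.
  exact: log_convex_decr e_gt0 eB e_convex i'.
have := h (i - n1)%N (j - n1)%N (leq_sub2r _ ij).
by rewrite /e !subnK// (leq_trans ni).
Qed.

Lemma odd_le_even i : (n1 <= i)%N -> a (i + i.+1)%N <= a (i + i)%N.
Proof.
move=> ni; have h := a_sqr i i.+1.
have h2 : a (i.+1 + i.+1)%N <= a (i + i)%N by exact: even_decr.
have := le_trans h (ler_wpM2l (a_ge0 (i + i)) h2); rewrite -expr2.
by rewrite ler_pXn2r// nnegrE.
Qed.

Lemma le_half n : (n1 <= n./2)%N -> a n <= a (n./2 + n./2)%N.
Proof.
move=> h; have := odd_double_half n; rewrite -addnn; case: (odd n) => /= E.
  have -> : a n = a (n./2 + (n./2).+1)%N by rewrite addnS -add1n E.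
  exact: odd_le_even.
by have -> : a n = a (n./2 + n./2)%N by rewrite -[(n./2 + n./2)%N]add0n E.
Qed.

(** Ratios bounded away from [1] would make [a] decay geometrically along even indices, hence along
    all, and the series of [n * a n] would converge. *)
Lemma even_ratio (c : R) : c < 1 -> exists n0, forall i, (n0 <= i)%N ->
  c * a (i + i)%N <= a (i.+1 + i.+1)%N.
Proof.
move=> c1; have [|n0 hn] := @log_convex_ratio _ e e_gt0 e_convex c c1.
  move=> d /andP[d0 d1]; apply: contrapT => /forallNP h; apply: nc.
  (* One step of [e] is two steps of [a], hence the square root. *)
  pose q := Num.sqrt d; have q0 : 0 < q by rewrite sqrtr_gt0.
  have q1 : q < 1 by rewrite -sqrtr1 ltr_sqrt.
  have q2 : q ^+ 2 = d by rewrite sqr_sqrtr// ltW.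
  pose C := (B + e 0%N) / q ^+ (n1 + n1).+1.
  have B0 : 0 <= B by apply: le_trans (aB 0%N).
  have aC n : a n <= C * q ^+ n.
    have qe m : 0 <= q ^+ m by rewrite exprn_ge0// ltW.
    rewrite /C mulrAC ler_pdivlMr ?exprn_gt0//.
    have [hn|hn] := ltnP n./2 n1.
      have n2 : (n <= (n1 + n1).+1)%N.
        have /andP[_ h2] := leq_half_bounds n; apply: (leq_trans h2).
        by rewrite ltnS leq_add// ltnW.
      apply: ler_pM => //; first by apply: (le_trans (aB n)); rewrite lerDl ltW.
      by apply: ler_wiXn2l => //; exact: ltW.
    have h1 := le_half hn; apply: (le_trans (ler_wpM2r (qe _) h1)).
    have := h (n./2 - n1)%N => /negP; rewrite -leNgt /e subnK// => h2.
    apply: (le_trans (ler_wpM2r (qe _) h2)).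
    have -> : d ^+ (n./2 - n1) = q ^+ (2 * (n./2 - n1)) by rewrite exprM q2.
    have qd x : x * q ^+ (2 * (n./2 - n1)) * q ^+ (n1 + n1).+1 =
        x * q ^+ (2 * (n./2 - n1) + (n1 + n1).+1) by rewrite exprD mulrA.
    rewrite qd; apply: ler_pM; rewrite ?qe ?a_ge0//; first by rewrite lerDr.
    apply: ler_wiXn2l; rewrite ?ltW//.
    by apply: leq_double_sub => //; have /andP[] := leq_half_bounds n.
  have q01 : 0 <= q < 1 by rewrite ltW.
  have [cv _] := ssumZ C (@cvgn_nat_geometric R 1 q q01).
  apply: (series_le_cvg _ _ _ cv) => n.
  - by rewrite mulr_ge0.
  - have C0 : 0 <= C by rewrite divr_ge0 ?exprn_ge0 ?(ltW q0)// addr_ge0// ltW.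
    apply: (mulr_ge0 C0); apply: mulr_ge0; first exact: exprn_ge0.
    by apply: exprn_ge0; exact: ltW.
  - by rewrite expr1 [leRHS]mulrCA; apply: ler_wpM2l.
exists (n0 + n1)%N => i hi; have i1 : (n1 <= i)%N by exact: leq_trans (leq_addl _ _) hi.
have E : (i - n1 + n1 = i)%N by rewrite subnK.
have E' : ((i - n1).+1 + n1 = i.+1)%N by rewrite addSn E.
have := hn (i - n1)%N; rewrite /e E E'; apply.
by rewrite leq_subRL// addnC.
Qed.

(** [p_ratio] is used at the even middle index [N = 2 m]: it bounds [a (2 i + 1)] from below by
    [a N] once the other neighbour [a (2 i' + 1)] is at most [a N / c2]. That holds because it is
    below [a (2 i')] and even ratios are close to [1]. *)
Lemma odd_ge_even (c : R) : 0 < c < 1 -> exists n0, forall i, (n0 <= i)%N ->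
  c * a (i.+1 + i.+1)%N <= a (i + i.+1)%N.
Proof.
move=> /andP[c0 c1]; pose l := k./2.
have kE : k = (l + l).+1 by have := odd_double_half k; rewrite k_odd -addnn -/l add1n.
(* [l + 1] even steps lead from [2 i'] to [N], and [(1 - x) ^ (l + 1) >= (1 + c) / 2] by
   Bernoulli. *)
pose x := (1 - c) / (2 * l.+1%:R).
have x0 : 0 < x by rewrite divr_gt0 ?subr_gt0// mulr_gt0.
have x1 : x <= 1.
  rewrite ler_pdivrMr ?mulr_gt0// mul1r; apply: (@le_trans _ _ 1); first lra.
  by rewrite -natrM ler1n.
have x1' : 1 - x < 1 by rewrite gtrBl.
have [n0 hn] := even_ratio x1'.
pose c2 := (1 - x) ^+ l.+1.
have c2g : (1 + c) / 2 <= c2.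
  have x01 : 0 <= x <= 1 by rewrite ltW.
  apply: le_trans (bernoulli_ge l.+1 x01).
  have -> : l.+1%:R * x = (1 - c) / 2 
    by rewrite /x; have := ltr0Sn R l; move: (l.+1%:R : R) => y y0; field; rewrite gt_eqF.
  lra.
have c20 : 0 < c2 by apply: lt_le_trans c2g; rewrite divr_gt0// addr_gt0.
have iter i m : (n0 <= i)%N -> (1 - x) ^+ m * a (i + i)%N <= a ((i + m) + (i + m))%N.
  move=> hi; elim: m => [|m IH]; first by rewrite mul1r !addn0.
  rewrite exprS -mulrA addnS; apply: le_trans (hn (i + m)%N _); last by rewrite (leq_trans hi)// leq_addr.
  by apply: ler_wpM2l => //; rewrite subr_ge0.
pose rho := (a k)^-1.
have rho0 : 0 <= rho by rewrite invr_ge0.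
(* [th < 1] bounds [c / c2]; for [n >= M] the slack [(1 - th) n] absorbs the error term
   [c * rho]. *)
pose th := 2 * c / (1 + c).
have th1 : th < 1 by rewrite ltr_pdivrMr; lra.
pose M := Num.bound (c * rho / (1 - th)).
have hM : c * rho / (1 - th) < M%:R.
  by rewrite archi_boundP// divr_ge0 ?mulr_ge0 ?(ltW c0)// subr_ge0 ltW.
exists (n0 + n1 + k * M.+2 + k + k)%N => i hi.
have [m [i' [j [n [[mi i'E [nM i'n0 i'n1]] [NE E2 E0]]]]]] := odd_index_split kE hi.
pose N := (m + m)%N; rewrite -/N in NE.
have mn1 : (n1 <= m)%N by rewrite -i'E (leq_trans i'n1)// leq_addr.
have E3 : (N + N = i + i.+1 + (j + k * n))%N 
  by rewrite -E2 NE !mulnS addnAC_shift.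
have E4 : (i + i.+1 = k + N)%N by rewrite -E2 NE mulnS addnCA.
have A0 : a (j + k * n)%N <= a N / c2.
  rewrite E0 ler_pdivlMr//; apply: (le_trans (ler_wpM2r (ltW c20) (odd_le_even i'n1))).
  by rewrite mulrC /N -i'E; exact: iter.
have A1 : 0 < a N by rewrite mulr_gt0 ?exprn_gt0// p_gt0// (leq_trans mn1)// leq_addr.
have main : n.+2%:R * a N ^+ 2 <= a (i + i.+1)%N * (n.+1%:R * a (j + k * n)%N + a N * rho).
  have := ler_wpM2r (exprn_ge0 (N + N) (ltW r_gt0)) (p_ratio j n).
  rewrite -NE E2; move=> h.
  have -> : n.+2%:R * a N ^+ 2 = n.+2%:R * p N ^+ 2 * r ^+ (N + N).
    by rewrite exprMn -exprM muln2 -addnn mulrA.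
  apply: (le_trans h); rewrite le_eqVlt; apply/orP; left; apply/eqP.
  have e1 : r ^+ (N + N) = r ^+ (i + i.+1) * r ^+ (j + k * n).
    by rewrite -exprD E3.
  have e2 : r ^+ (N + N) = r ^+ (i + i.+1) * r ^+ N / r ^+ k.
    by rewrite E4 !exprD; field; rewrite expf_neq0// gt_eqF.
  rewrite mulrDr mulrDl.
  have -> : p (i + i.+1)%N * (n.+1%:R * p (j + k * n)%N) * r ^+ (N + N) =
     a (i + i.+1)%N * (n.+1%:R * a (j + k * n)%N) by rewrite e1; ring.
  have -> : p (i + i.+1)%N * (p N / p k) * r ^+ (N + N) = a (i + i.+1)%N * (a N * rho).
    by rewrite e2 /rho; field; rewrite expf_neq0 ?gt_eqF.
  by rewrite -mulrDr.
have main2 : n.+2%:R * a N <= a (i + i.+1)%N * (n.+1%:R / c2 + rho).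
  have gen (y z w : R) : 0 <= z -> 0 < y -> w <= y / c2 ->
      n.+2%:R * y ^+ 2 <= z * (n.+1%:R * w + y * rho) -> n.+2%:R * y <= z * (n.+1%:R / c2 + rho).
    move=> z0 y0 wy h; rewrite -(ler_pM2r y0).
    rewrite (_ : n.+2%:R * y * y = n.+2%:R * y ^+ 2); last by rewrite expr2 mulrA.
    apply: (le_trans h).
    rewrite (_ : z * (n.+1%:R / c2 + rho) * y = z * (n.+1%:R * (y / c2) + y * rho)); last by ring.
    by apply: ler_wpM2l => //; rewrite lerD2r; apply: ler_wpM2l.
  exact: gen (a_ge0 _) A1 A0 main.
have dec : a (i.+1 + i.+1)%N <= a N by apply: even_decr => //; rewrite -mi leqW// leq_addr.
apply: (le_trans (ler_wpM2l (ltW c0) dec)).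
have D0 : 0 < n.+1%:R / c2 + rho by rewrite ltr_pwDl// divr_gt0.
rewrite -(ler_pM2r D0); apply: le_trans main2.
rewrite mulrAC; apply: ler_wpM2r; first exact: ltW.
have t1 : c / c2 <= th.
  rewrite /th ler_pdivrMr// mulrAC ler_pdivlMr; last lra.
  have := ler_wpM2l (ltW c0) c2g; lra.
have t2 : c * rho <= (1 - th) * n%:R.
  rewrite ltr_pdivrMr ?subr_gt0// in hM; apply: (le_trans (ltW hM)).
  by rewrite mulrC ler_pM2l ?subr_gt0// ler_nat.
rewrite mulrDr mulrCA; have := ler_wpM2l (ler0n R n.+1) t1.
have : th * 1 <= 1 by lra.
rewrite -[n.+2%:R]natr1 -natr1; move: (n%:R : R) t2 => y; lra.
Qed.

(** [a n] is at most the even-indexed term just below it, even-indexed terms decrease, and an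
    odd-indexed [a m] is almost as large as the even-indexed term that follows it. *)
Lemma quasi_monotone eta : 0 < eta -> exists N0, forall m n, (N0 <= m)%N -> (m <= n)%N ->
  a n <= (1 + eta) * a m.
Proof.
move=> eta0; have c01 : 0 < (1 + eta)^-1 < 1.
  by rewrite invr_gt0 addr_gt0//= invf_lt1 ?ltrDl// addr_gt0.
have [n0 hn] := odd_ge_even c01.
exists (n0 + n0 + n1 + n1 + 2)%N => m n hm mn.
have E1 : 1 <= 1 + eta by rewrite lerDl ltW.
have [->|mn'] := eqVneq m n; first by rewrite ler_peMl.
have {mn mn'} mn : (m < n)%N by rewrite ltn_neqAle mn' mn.
have [[m0 m1 nn1]] := quasi_monotone_index hm mn.
move=> idx; apply: (le_trans (le_half nn1)); move: idx; case: (odd m) => -[mE mn2].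
  have h := hn m./2 m0; rewrite ler_pdivrMl ?addr_gt0// in h.
  by rewrite mE; apply: le_trans h; apply: even_decr => //; rewrite leqW.
apply: (le_trans (even_decr m1 mn2)).
by rewrite -mE ler_peMl.
Qed.

End QuasiMonotone.

(** * Triangle sums *)

Section PairSums.
Variables (R : realType) (H : choiceType).
Implicit Types (f : H * H -> \bar R) (g : H * H -> R).

Lemma ler_sum_subset (T : choiceType) (X Y : seq T) (h : T -> R) : uniq X -> uniq Y ->
  {subset X <= Y} -> (forall x, 0 <= h x) -> \sum_(x <- X) h x <= \sum_(x <- Y) h x.
Proof.
move=> uX uY XY h0.
have -> : \sum_(x <- X) h x = \sum_(x <- Y | x \in X) h x.
  rewrite -[RHS]big_filter; apply: perm_big; apply: uniq_perm; rewrite ?filter_uniq// => x.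
  by rewrite mem_filter; case: (boolP (x \in X)) => // /XY.
by rewrite big_mkcond /=; apply: ler_sum => x _; case: ifP.
Qed.

Lemma esum_pair_le f g (B : R) : (forall x, 0 <= g x) ->
  (forall x, (f x <= (g x)%:E)%E) ->
  (forall A A' : seq H, uniq A -> uniq A' -> \sum_(x <- A) \sum_(y <- A') g (x, y) <= B) ->
  (\esum_(x in [set: H * H]) f x <= B%:E)%E.
Proof.
move=> g0 fg gB; rewrite /esum; apply: ge_ereal_sup => _ [X [finX _] <-].
have [r Xr] := (finite_seqP X).1 finX.
have XE : X = [set` undup r].
  by rewrite Xr; apply/seteqP; split=> x /=; rewrite mem_undup.
rewrite XE -fsbig_seq ?undup_uniq//.
apply: (@le_trans _ _ (\sum_(x <- undup r) (g x)%:E)%E); first exact: lee_sum.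
rewrite sumEFin lee_fin.
pose A := undup (map fst (undup r)); pose A' := undup (map snd (undup r)).
apply: le_trans (gB A A' (undup_uniq _) (undup_uniq _)).
rewrite -big_allpairs; apply: ler_sum_subset => //; first exact: undup_uniq.
- by apply: allpairs_uniq; rewrite ?undup_uniq// => -[? ?] [? ?] _ _ [-> ->].
- move=> [x y] xX; apply/allpairsP; exists (x, y); rewrite /= !mem_undup; split=> //.
  + by apply/mapP; exists (x, y).
  + by apply/mapP; exists (x, y).
Qed.

Lemma esum_pair_ge f g (A A' : seq H) : uniq A -> uniq A' ->
  (forall x, ((g x)%:E <= f x)%E) ->
  ((\sum_(x <- A) \sum_(y <- A') g (x, y))%:E <= \esum_(x in [set: H * H]) f x)%E.
Proof.
move=> uA uA' fg; apply: esum_ge.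
exists [set` [seq (x, y) | x <- A, y <- A']]; first by split => //; exact: finite_seq.
rewrite -fsbig_seq; last by apply: allpairs_uniq => // -[? ?] [? ?] _ _ [-> ->].
apply: (@le_trans _ _ (\sum_(x <- [seq (x, y) | x <- A, y <- A']) (g x)%:E)%E); last exact: lee_sum.
by rewrite sumEFin big_allpairs.
Qed.

End PairSums.

Section GreenBounds.
Variables (R : realType) (G : groupType) (mu : G -> R).
Local Notation p := (convolution_pow mu).
Hypothesis p_ge0 : forall n x, 0 <= p n x.

Lemma green_ler (x y : G) (r C : R) : 0 <= r ->
  (forall n, series (fun k => p k (x^-1 * y)%g * r ^+ k) n <= C) ->
  (green mu x y r <= C%:E)%E.
Proof.
move=> r0 h; apply: lime_le.
  by apply: is_cvg_nneseries => n _ _; rewrite lee_fin mulr_ge0// exprn_ge0.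
by apply: nearW => n; rewrite sumEFin lee_fin; exact: h.
Qed.

Lemma green_ger (x y : G) (r : R) N : 0 <= r ->
  ((series (fun k => p k (x^-1 * y)%g * r ^+ k) N)%:E <= green mu x y r)%E.
Proof.
move=> r0; rewrite /series /= -sumEFin; apply: nneseries_lim_ge => n _ _.
by rewrite lee_fin mulr_ge0// exprn_ge0.
Qed.

Lemma green_ge0 (x y : G) (r : R) : 0 <= r -> (0 <= green mu x y r)%E.
Proof. by move=> r0; have := green_ger x y 0 r0; rewrite /series /= big_geq. Qed.

End GreenBounds.

Section Triangle.
Variable R : realType.

Lemma triangle_sum (g f : R^nat) N : (forall n, 0 <= g n) -> (forall n, 0 <= f n) ->
  \sum_(0 <= n < N) (\sum_(0 <= m < n.+1) g m) * f n <=
  \sum_(0 <= m < N) \sum_(0 <= k < N) g m * f (k + m)%N.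
Proof.
move=> g0 f0.
have -> : \sum_(0 <= n < N) (\sum_(0 <= m < n.+1) g m) * f n =
    \sum_(0 <= n < N) \sum_(0 <= m < N | (m <= n)%N) g m * f n.
  apply: eq_big_nat => n /andP[_ nN]; rewrite mulr_suml.
  by rewrite (big_nat_widen _ _ N)//=; apply: eq_bigl => m; rewrite ltnS.
rewrite (exchange_big_dep_nat xpredT)//=; apply: ler_sum_nat => m /andP[_ mN].
rewrite -!mulr_sumr; apply: ler_wpM2l => //.
have -> : \sum_(0 <= n < N | (m <= n)%N) f n = \sum_(0 <= k < N - m) f (k + m)%N.
  transitivity (\sum_(m <= n < N) f n); first by rewrite [RHS](big_nat_widenl _ 0).
  by rewrite -{1}[m]add0n big_addn.
by apply: (@nondecreasing_series R (fun k => f (k + m)%N) xpredT 0) => // *; rewrite ?leq_subr.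
Qed.

(** There are [(n + 1) (n + 2) / 2 >= n^2 / 2] triples of sum [n], all of them in the cube of side
    [N] when [n < N]. *)
Lemma triple_sum (f : R^nat) N : (forall n, 0 <= f n) ->
  \sum_(0 <= n < N) n%:R ^+ 2 / 2 * f n <=
  \sum_(0 <= i < N) \sum_(0 <= j < N) \sum_(0 <= k < N) f (i + j + k)%N.
Proof.
move=> f0; have g0 n : (0 : R) <= n.+1%:R by [].
apply: le_trans (_ : \sum_(0 <= m < N) \sum_(0 <= k < N) m.+1%:R * f (k + m)%N <= _).
  apply: le_trans (triangle_sum N g0 f0); apply: ler_sum_nat => n _; apply: ler_wpM2r => //.
  elim: n => [|n IH]; first by rewrite expr0n mul0r big_nat1.
  rewrite big_nat_recr//=; apply: le_trans (lerD IH (lexx _)).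
  by rewrite -[n.+2%:R]natr1 -natr1; move: (n%:R : R) (ler0n R n) => x x0; lra.
rewrite exchange_big /= [leRHS]exchange_big /= [leRHS](eq_bigr (fun j => \sum_(0 <= i < N)
   \sum_(0 <= k < N) f (i + j + k)%N))//.
have step k : \sum_(0 <= m < N) m.+1%:R * f (k + m)%N <=
    \sum_(0 <= i < N) \sum_(0 <= j < N) f (k + (i + j))%N.
  have f0' n : 0 <= f (k + n)%N by [].
  have := @triangle_sum (fun=> 1) (fun n => f (k + n)%N) N (fun=> ler01) f0'.
  under eq_bigr => n _ do rewrite sumr_const_nat subn0.
  move=> h; apply: (le_trans h); rewrite le_eqVlt; apply/orP; left; apply/eqP.
  by apply: eq_bigr => i _; apply: eq_bigr => j _; rewrite mul1r [(j + i)%N]addnC.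
apply: ler_sum => k _; apply: (le_trans (step k)).
rewrite le_eqVlt; apply/orP; left; apply/eqP; apply: eq_bigr => i _; apply: eq_bigr => j _.
by congr f; lia.
Qed.

End Triangle.

Section WalkTriple.
Variables (R : realType) (H : groupType) (mu : H -> R) (S : seq H).
Hypotheses (mu_ge0 : forall x, 0 <= mu x) (uS : uniq S).
Hypothesis suppS : forall x, mu x != 0 -> x \in S.
Local Notation p := (convolution_pow mu).
Local Notation P N x := (series (fun k => p k x) N).

Let p_ge0 n x : 0 <= p n x. Proof. exact: (convpow_ge0 mu_ge0 uS suppS). Qed.

Definition walk_ball N : seq H := undup (flatten [seq walk_support S n | n <- iota 0 N]).

Lemma walk_ballP n N : (n < N)%N -> {subset walk_support S n <= walk_ball N}.
Proof.
move=> nN x xn; rewrite mem_undup; apply/flattenP; exists (walk_support S n) => //.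
by apply/mapP; exists n; rewrite // mem_iota.
Qed.

Lemma sum_ball_ge m n N x : (m < N)%N ->
  p (m + n) x <= \sum_(y <- walk_ball N) p m y * p n (y^-1 * x)%g.
Proof.
move=> mN; rewrite (chapman_kolmogorov mu_ge0 uS suppS).
apply: (@ler_sum_subset R H _ _ (fun y => p m y * p n (y^-1 * x)%g)) => [|||y].
- exact: uniq_walk_support.
- exact: undup_uniq.
- exact: walk_ballP.
- by rewrite mulr_ge0.
Qed.

(** Chapman-Kolmogorov twice: a loop of length [i + j + k] is cut at times [i] and [i + j].
    Truncated triangle sums of the factor thus dominate the second moment of its return times; the
    middle point may need the ball of radius [2 N]. *)
Lemma walk_triple N : \sum_(0 <= n < N) n%:R ^+ 2 / 2 * p n 1%g <=
  \sum_(x <- walk_ball N) \sum_(y <- walk_ball (N + N)) P N x * P N (x^-1 * y)%g * P N y^-1%g.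
Proof.
apply: (le_trans (triple_sum N (fun n => p_ge0 n 1%g))).
apply: (@le_trans _ _ (\sum_(y <- walk_ball (N + N)) (\sum_(0 <= i < N) \sum_(0 <= j < N) p (i + j) y) * P N y^-1%g)).
  rewrite [leRHS](_ : _ = \sum_(0 <= i < N) \sum_(0 <= j < N) \sum_(0 <= k < N)
    \sum_(y <- walk_ball (N + N)) p (i + j) y * p k (y^-1 * 1)%g); last first.
    under eq_bigr => y _ do rewrite mulr_suml.
    rewrite exchange_big /=; apply: eq_bigr => i _.
    under eq_bigr => y _ do rewrite mulr_suml.
    rewrite exchange_big /=; apply: eq_bigr => j _.
    under eq_bigr => y _ do rewrite /series /= mulr_sumr.
    rewrite exchange_big /=; apply: eq_bigr => k _.
    by apply: eq_bigr => y _; rewrite mulg1.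
  apply: ler_sum_nat => i /andP[_ iN]; apply: ler_sum_nat => j /andP[_ jN].
  by apply: ler_sum => k _; apply: sum_ball_ge; lia.
rewrite [leRHS]exchange_big /=; apply: ler_sum => y _; rewrite -mulr_suml; apply: ler_wpM2r.
  by rewrite /series /=; apply: sumr_ge0.
rewrite [leRHS](_ : _ = \sum_(0 <= i < N) \sum_(0 <= j < N)
    \sum_(x <- walk_ball N) p i x * p j (x^-1 * y)%g); last first.
  under eq_bigr => x _ do rewrite /series /= mulr_suml.
  rewrite exchange_big /=; apply: eq_bigr => i _.
  under eq_bigr => x _ do rewrite mulr_sumr.
  by rewrite exchange_big.
by apply: ler_sum_nat => i /andP[_ iN]; apply: ler_sum => j _; apply: sum_ball_ge.
Qed.

End WalkTriple.

Section TriangleSums.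
Variables (R : realType) (G1 G2 : groupType) (mu1 : G1 -> R) (mu2 : G2 -> R).
Variables (S1 : seq G1) (S2 : seq G2) (a : R).
Hypotheses (mu1_ge0 : forall x, 0 <= mu1 x) (mu2_ge0 : forall x, 0 <= mu2 x).
Hypotheses (uS1 : uniq S1) (uS2 : uniq S2).
Hypothesis suppS1 : forall x, mu1 x != 0 -> x \in S1.
Hypothesis suppS2 : forall x, mu2 x != 0 -> x \in S2.
Hypothesis a01 : 0 < a < 1.

Local Notation Gamma := (free_product G1 G2).
Local Notation mu := (mixture mu1 mu2 a).
Local Notation b := (1 - a).
Local Notation p := (convolution_pow mu).
Local Notation q1 := (fun n => convolution_pow mu1 n 1%g).
Local Notation q2 := (fun n => convolution_pow mu2 n 1%g).
Local Notation u1 := (fun n => taboo mu1 S1 n 1%g).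
Local Notation u2 := (fun n => taboo mu2 S2 n 1%g).

Let a0 : 0 < a. Proof. by case/andP: a01. Qed.
Let b0 : 0 < b. Proof. by rewrite subr_gt0; case/andP: a01. Qed.

Hypotheses (adm1 : admissible mu1) (adm2 : admissible mu2).
Hypotheses (tr1 : transient_renewal q1 u1) (tr2 : transient_renewal q2 u2).

Local Notation arg1 := (arg1 u1 a).
Local Notation arg2 := (arg2 u2 b).
Local Notation zz := (zz u1 u2 a b).
Local Notation admissible_arg := (admissible_arg u1 u2 a b).

Lemma mixture_convpow_ge0 n w : 0 <= p n w.
Proof.
exact: (convpow_ge0 (mixture_ge0 mu1_ge0 mu2_ge0 uS1 uS2 suppS1 suppS2 a01)
  (uniq_mixture_support _ _) (mixture_supportP mu1_ge0 mu2_ge0 uS1 uS2 suppS1 suppS2)).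
Qed.

Lemma word_weight_inl X x : word_weight mu1 mu2 S1 S2 (arg1 X) (arg2 X) (fp_word (fp_inl G2 x)) =
  hit mu1 S1 (arg1 X) x.
Proof.
rewrite /= /push /=; case: ifPn => [/eqP ->|_]; first by rewrite word_weight_nil hit1.
by rewrite word_weight_cons word_weight_nil mulr1.
Qed.

Lemma word_weight_inr X y : word_weight mu1 mu2 S1 S2 (arg1 X) (arg2 X) (fp_word (fp_inr G1 y)) =
  hit mu2 S2 (arg2 X) y.
Proof.
rewrite /= /push /=; case: ifPn => [/eqP ->|_]; first by rewrite word_weight_nil hit1.
by rewrite word_weight_cons word_weight_nil mulr1.
Qed.

(* The Green function on a factor is dominated by a function with finite sum,
   uniformly in the position, so that the double sum converges. *)
Lemma green_triangle_lt_oo (H : groupType) (i : H -> Gamma) (h : H -> R) (r C M : R) :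
  0 <= r -> 0 <= C -> (forall x, i x^-1%g = (i x)^-1%g) -> (forall x y, i (x * y)%g = (i x * i y)%g) ->
  i 1%g = 1%g ->
  (forall x, 0 <= h x) -> (forall A, uniq A -> \sum_(x <- A) h x <= M) ->
  (forall n x, series (fun k => p k (i x) * r ^+ k) n <= C * h x) ->
  (green_triangle i mu r < +oo)%E.
Proof.
move=> r0 C0 iV iM i1 h0 hM hC.
have hM1 x : h x <= M by have := hM [:: x] isT; rewrite big_seq1.
have M0 : 0 <= M by apply: le_trans (h0 1%g) (hM1 _).
pose g (z : H * H) := C * h z.1 * (C * h (z.1^-1 * z.2)%g) * (C * h z.2^-1%g).
have gr x y : (green mu (i x) (i y) r <= (C * h (x^-1 * y)%g)%:E)%E.
  by apply: (green_ler mixture_convpow_ge0) => // n; rewrite -iV// -iM.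
apply: le_lt_trans (ltry (C * C * C * (M * M * M))); apply: (@esum_pair_le _ _ _ g).
- by move=> z; rewrite !mulr_ge0.
- move=> [x y] /=; rewrite !EFinM.
  have g0 u v : (0 <= green mu u v r)%E by exact: (green_ge0 mixture_convpow_ge0).
  apply: lee_pmul; rewrite ?mule_ge0//.
    apply: lee_pmul => //.
    by have := gr 1%g x; rewrite invg1 mul1g i1.
  by have := gr y 1%g; rewrite mulg1 i1.
- move=> A A' uA uA'; rewrite /g /=.
  apply: (@le_trans _ _ (\sum_(x <- A) \sum_(y <- A') C * C * C * M * (h x * h (x^-1 * y)%g))).
    apply: ler_sum => x _; apply: ler_sum => y _.
    rewrite (_ : _ * _ = C * C * C * (h x * h (x^-1 * y)%g) * h y^-1%g); last by ring.
    rewrite (_ : C * C * C * M * _ = C * C * C * (h x * h (x^-1 * y)%g) * M); last by ring.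
    by apply: ler_wpM2l => //; rewrite !mulr_ge0.
  under eq_bigr do rewrite -mulr_sumr -mulr_sumr; rewrite -mulr_sumr.
  rewrite -[leRHS]mulrA [leRHS](_ : _ = C * C * C * M * (M * M)); last by ring.
  apply: ler_wpM2l; first by rewrite !mulr_ge0.
  apply: (@le_trans _ _ (\sum_(x <- A) h x * M)).
    apply: ler_sum => x _; apply: ler_wpM2l => //.
    rewrite -(big_map (fun y => (x^-1 * y)%g) xpredT h); apply: hM.
    by rewrite map_inj_uniq//; exact: mulgI.
  by rewrite -mulr_suml; apply: ler_wpM2r => //; exact: hM.
Qed.

Section Critical.
Variable X0 : R.
Hypotheses (aX0 : admissible_arg X0) (s20 : arg2 X0 = 1).
Hypotheses (fX0 : finite_slopes u1 u2 a b X0) (psi0 : 0 <= psi u1 u2 a b X0).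

Let X0_gt0 : 0 < X0. Proof. exact: (arg_pos tr1 tr2 a0 b0 aX0). Qed.
Let z0_gt0 : 0 < zz X0. Proof. exact: (zz_gt0 tr1 tr2 a0 b0 aX0). Qed.

(** At radius [1 / zz X0] the Green function dominates its value on the curve at any [X > X0], which
    is [zz X / X] times [hit]. There [hit] times [gen_p] exceeds the partial sum, and [X] decreasing
    to [X0] sends the argument to [1]. *)
Lemma green_inr_ge y (v w : Gamma) N : (v^-1 * w)%g = fp_inr G1 y ->
  ((zz X0 / X0 / gen_p q2 1 * series (fun k => convolution_pow mu2 k y) N)%:E <=
   green mu v w (zz X0)^-1)%E.
Proof.
move=> vw; have r0 : 0 <= (zz X0)^-1 by rewrite invr_ge0 ltW.
have lo n := @green_ger R _ mu mixture_convpow_ge0 v w (zz X0)^-1 n r0.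
have g0 := @green_ge0 R _ mu mixture_convpow_ge0 v w (zz X0)^-1 r0.
rewrite vw in lo; case: (green mu v w (zz X0)^-1) lo g0 => [B lo _|_ _|//]; last exact: leey.
rewrite lee_fin.
have G2_gt0 : 0 < gen_p q2 1 by rewrite (gen_p_gt0 tr2)// ler01 lexx.
have Fc : zz X / X / gen_p q2 1 * series (fun k => convolution_pow mu2 k y * arg2 X ^+ k) N
    @[X --> X0^'+] --> zz X0 / X0 / gen_p q2 1 * series (fun k => convolution_pow mu2 k y * 1 ^+ k) N.
  apply: cvgM.
    apply: cvgM; last exact: cvg_cst.
    apply: cvgM; first exact: (zz_right_cvg tr1 tr2 a0 b0 aX0).
    by apply: cvgV; [rewrite gt_eqF | exact: cvg_at_right_filter].
  have hs : arg2 X @[X --> X0^'+] --> (1 : R).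
    have [_ c2] := arg_continuous tr1 tr2 a0 b0 aX0.
    rewrite -[X in _ --> X]s20.
    by apply: (right_cvg _ c2) => X h; rewrite max_r.
  elim: N => [|N IH].
    rewrite /series /= big_geq//; under eq_fun do rewrite big_geq//; exact: cvg_cst.
  rewrite seriesSr; under eq_fun do rewrite seriesSr.
  apply: cvgD => //; apply: cvgM; first exact: cvg_cst.
  exact: (cvg_comp _ _ hs (@exprn_continuous R N _)).
have -> : series (fun k => convolution_pow mu2 k y) N =
    series (fun k => convolution_pow mu2 k y * 1 ^+ k) N.
  by rewrite /series /=; apply: eq_bigr => k _; rewrite expr1n mulr1.
apply: (cvgr_to_le Fc); near=> X.
have hX : X0 < X by near: X; exact: nbhs_right_gt.
have zX := zz_incr tr1 tr2 a0 b0 aX0 fX0 psi0 hX.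
have zXp : 0 < zz X by exact: lt_trans zX.
have Xp : 0 < X by exact: lt_trans hX.
have h := green_eq (w := fp_inr G1 y) mu1_ge0 mu2_ge0 uS1 uS2 suppS1 suppS2 a01 adm1 adm2
  tr1 tr2 aX0 hX zX.
rewrite word_weight_inr in h.
have hB : zz X / X * hit mu2 S2 (arg2 X) y <= B.
  apply: (cvgr_to_le h); apply: nearW => n; rewrite -lee_fin.
  apply: le_trans (lo n); rewrite lee_fin /series /=; apply: ler_sum => k _.
  apply: ler_wpM2l; first exact: mixture_convpow_ge0.
  by apply: lerXn2r; rewrite ?nnegrE ?invr_ge0 ?(ltW zXp) ?(ltW z0_gt0)// lef_pV2 ?posrE// ltW.
apply: le_trans hB; rewrite -!mulrA; apply: ler_wpM2l; first exact: ltW.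
apply: ler_wpM2l; first by rewrite invr_ge0 ltW.
have [_ /andP[p20 p21] _ _] := argP tr1 tr2 a0 b0 (admissible_arg_le aX0 (ltW hX)).
have s01 : 0 <= arg2 X <= 1 by rewrite ltW.
rewrite mulrC ler_pdivrMr//.
apply: (le_trans (hit_ge mu2_ge0 uS2 suppS2 adm2 tr2 y N s01)).
apply: ler_wpM2l; first exact: (hit_ge0 mu2_ge0 uS2 suppS2 adm2 tr2).
have one : 0 <= (1 : R) <= 1 by rewrite ler01 lexx.
rewrite /gen_p; apply: ssum_le => [||n].
- exact: (cvgn_gen_p tr2).
- exact: (cvgn_gen_p tr2).
- apply: ler_wpM2l; first by have /andP[] := tr_p tr2 n.
  by apply: lerXn2r; rewrite ?nnegrE// ltW.
Unshelve. all: by end_near.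
Qed.

(** Each of the three Green functions carries a factor [c]; the triangle sum is then at least [c^3]
    times the partial sums of a divergent second moment. *)
Lemma green_triangle_oo : ~ cvgn (series (fun n => n%:R ^+ 2 * q2 n)) ->
  green_triangle (@fp_inr G1 G2) mu (zz X0)^-1 = +oo%E.
Proof.
move=> nc; have [f1 fM] := fp_inr_morphism G1 G2.
pose c := zz X0 / X0 / gen_p q2 1.
have G2_gt0 : 0 < gen_p q2 1 by rewrite (gen_p_gt0 tr2)// ler01 lexx.
have c0 : 0 < c by rewrite !divr_gt0.
have q0 n x : 0 <= convolution_pow mu2 n x by exact: (convpow_ge0 mu2_ge0 uS2 suppS2).
have bound N : ((c ^+ 3 * \sum_(0 <= n < N) n%:R ^+ 2 / 2 * q2 n)%:E <=
    green_triangle (@fp_inr G1 G2) mu (zz X0)^-1)%E.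
  pose P x := series (fun k => convolution_pow mu2 k x) N.
  have P0 x : 0 <= P x by rewrite /P /series /=; apply: sumr_ge0.
  pose g (z : G2 * G2) := c * P z.1 * (c * P (z.1^-1 * z.2)%g) * (c * P z.2^-1%g).
  apply: le_trans (@esum_pair_ge _ _ _ g (walk_ball S2 N) (walk_ball S2 (N + N)) _ _ _);
    rewrite ?undup_uniq//.
  - rewrite lee_fin.
    apply: (le_trans (ler_wpM2l (exprn_ge0 3 (ltW c0)) (walk_triple mu2_ge0 uS2 suppS2 N))).
    rewrite le_eqVlt; apply/orP; left; apply/eqP; rewrite mulr_sumr; apply: eq_bigr => x _.
    by rewrite mulr_sumr; apply: eq_bigr => y _; rewrite /g /= /P; ring.
  - move=> [x y]; rewrite /g /=.
    have h1 : ((c * P x)%:E <= green mu 1%g (fp_inr G1 x) (zz X0)^-1)%E.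
      by apply: green_inr_ge; rewrite invg1 mul1g.
    have h2 : ((c * P (x^-1 * y)%g)%:E <= green mu (fp_inr G1 x) (fp_inr G1 y) (zz X0)^-1)%E.
      by apply: green_inr_ge; rewrite fp_inrV -fM.
    have h3 : ((c * P y^-1%g)%:E <= green mu (fp_inr G1 y) 1%g (zz X0)^-1)%E.
      by apply: green_inr_ge; rewrite mulg1 fp_inrV.
    have cP z : 0 <= c * P z by rewrite mulr_ge0// ltW.
    move: (c * P x) (c * P (x^-1 * y)%g) (c * P y^-1%g) (cP x) (cP (x^-1 * y)%g) (cP y^-1%g) h1 h2 h3.
    move=> z1 z2 z3 z10 z20 z30 h1 h2 h3; rewrite !EFinM.
    apply: lee_pmul => //; first by rewrite mule_ge0.
    by apply: lee_pmul.
case: (green_triangle _ _ _) bound => [B|//|] bound; last first.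
  by have := bound 0%N; rewrite leeNy_eq.
exfalso; apply: nc.
have t0 n : 0 <= n%:R ^+ 2 * q2 n by rewrite mulr_ge0 ?exprn_ge0.
apply: (@series_cvg_bounded _ _ (2 * (B / c ^+ 3)) t0 _).1 => N.
have := bound N; rewrite lee_fin mulrC -ler_pdivlMr ?exprn_gt0// => h.
rewrite -ler_pdivrMl//; apply: le_trans h; rewrite /series /= mulr_sumr.
by apply: ler_sum => n _; rewrite le_eqVlt; apply/orP; left; apply/eqP; field.
Qed.

End Critical.
End TriangleSums.

(** * Dichotomy along the curve *)

Section Dichotomy.
Variables (R : realType) (G1 G2 : groupType) (mu1 : G1 -> R) (mu2 : G2 -> R).
Variables (S1 : seq G1) (S2 : seq G2) (a : R).
Hypotheses (mu1_ge0 : forall x, 0 <= mu1 x) (mu2_ge0 : forall x, 0 <= mu2 x).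
Hypotheses (uS1 : uniq S1) (uS2 : uniq S2).
Hypothesis suppS1 : forall x, mu1 x != 0 -> x \in S1.
Hypothesis suppS2 : forall x, mu2 x != 0 -> x \in S2.
Hypotheses (mu1_1 : \sum_(s <- S1) mu1 s = 1) (mu2_1 : \sum_(s <- S2) mu2 s = 1).
Hypothesis a01 : 0 < a < 1.

Local Notation mu := (mixture mu1 mu2 a).
Local Notation b := (1 - a).
Local Notation p := (fun n => convolution_pow mu n 1%g).
Local Notation q1 := (fun n => convolution_pow mu1 n 1%g).
Local Notation q2 := (fun n => convolution_pow mu2 n 1%g).
Local Notation u1 := (fun n => taboo mu1 S1 n 1%g).
Local Notation u2 := (fun n => taboo mu2 S2 n 1%g).

Let a0 : 0 < a. Proof. by case/andP: a01. Qed.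
Let b0 : 0 < b. Proof. by rewrite subr_gt0; case/andP: a01. Qed.

Hypotheses (adm1 : admissible mu1) (adm2 : admissible mu2).
Hypotheses (tr1 : transient_renewal q1 u1) (tr2 : transient_renewal q2 u2).

Local Notation arg1 := (arg1 u1 a).
Local Notation arg2 := (arg2 u2 b).
Local Notation zz := (zz u1 u2 a b).
Local Notation psi := (psi u1 u2 a b).
Local Notation admissible_arg := (admissible_arg u1 u2 a b).
Local Notation finite_slopes := (finite_slopes u1 u2 a b).

Lemma mixture_return_bounds n : 0 <= p n <= 1.
Proof.
apply/andP; split; first exact: (mixture_convpow_ge0 mu1_ge0 mu2_ge0 uS1 uS2 suppS1 suppS2 a01).
apply: (@convpow_le1 _ _ mu (mixture_support S1 S2)).
- exact: (mixture_ge0 mu1_ge0 mu2_ge0 uS1 uS2 suppS1 suppS2 a01).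
- exact: uniq_mixture_support.
- exact: (mixture_supportP mu1_ge0 mu2_ge0 uS1 uS2 suppS1 suppS2).
- exact: sum_mixture.
Qed.

Let p01 := mixture_return_bounds.
Let p_ge0 n : 0 <= p n. Proof. by have /andP[] := p01 n. Qed.

Lemma mixture_green_on_curve : green_on_curve u1 u2 a b p.
Proof.
split=> [X n aX|X Y aX XY zXY].
- have := green_le mu1_ge0 mu2_ge0 uS1 uS2 suppS1 suppS2 a01 adm1 adm2 tr1 tr2 aX n 1%g.
  by rewrite word_weight_nil mulr1.
- have := green_eq (w := 1%g) mu1_ge0 mu2_ge0 uS1 uS2 suppS1 suppS2 a01 adm1 adm2 tr1 tr2 aX XY zXY.
  by rewrite word_weight_nil mulr1.
Qed.

Let green := mixture_green_on_curve.

Lemma return_bounded X n : admissible_arg X -> p n * (zz X)^-1 ^+ n <= zz X / X.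
Proof.
move=> aX; have := green.1 X n.+1 aX; rewrite seriesSr; apply: le_trans; rewrite lerDr.
rewrite /series /=; apply: sumr_ge0 => k _; rewrite mulr_ge0 ?exprn_ge0// invr_ge0 ltW//.
exact: (zz_gt0 tr1 tr2 a0 b0 aX).
Qed.

(** At a zero of [psi] the differentiated series diverges by [psi0_gt0], while the terms of the
    series are bounded; both the radius and the divergence follow. *)
Lemma critical_radius X : admissible_arg X -> finite_slopes X -> psi X = 0 ->
  inv_spectral_radius mu = (zz X)^-1 /\ divergent mu.
Proof.
move=> aX fX psiX; have z0 := zz_gt0 tr1 tr2 a0 b0 aX.
have r0 : 0 < (zz X)^-1 by rewrite invr_gt0.
have nc : ~ cvgn (series (fun n => n%:R * p n * (zz X)^-1 ^+ n)).
  move=> cd0; have cd := (@cvgn_derivative R _ mu _ (lt0r_neq0 r0)).2 cd0.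
  have := psi0_gt0 tr1 tr2 a0 b0 p_ge0 green aX fX (_ : 0 <= psi X) cd.
  by rewrite psiX lexx ltxx => /(_ isT).
have e : inv_spectral_radius mu = (zz X)^-1.
  exact: (inv_spectral_radius_eq p01 r0 (fun n => return_bounded n aX) nc).
split=> //; rewrite /divergent e.
apply/(green_derivative_cvg p01 (ltW r0)) => cd; apply: nc.
exact: (@cvgn_derivative R _ mu _ (lt0r_neq0 r0)).1 cd.
Qed.

Lemma finite_slopes_lt1 X : admissible_arg X -> arg1 X < 1 -> arg2 X < 1 -> finite_slopes X.
Proof.
move=> aX h1 h2; have [/andP[p10 _] /andP[p20 _] _ _] := argP tr1 tr2 a0 b0 aX.
by split; [apply: (slope_cvg tr1) | apply: (slope_cvg tr2)]; rewrite ltW.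
Qed.

(** When both arguments are below [1] the hitting functions have finite total mass on their factors,
    and so do the triangle sums. *)
Lemma interior_spr X : admissible_arg X -> arg1 X < 1 -> arg2 X < 1 -> psi X = 0 ->
  spectrally_positive_recurrent mu.
Proof.
move=> aX h1 h2 psiX; have [e dv] := critical_radius aX (finite_slopes_lt1 aX h1 h2) psiX.
split=> //; rewrite e /J2.
have [/andP[p10 _] /andP[p20 _] _ _] := argP tr1 tr2 a0 b0 aX.
have z0 := zz_gt0 tr1 tr2 a0 b0 aX; have X0 := arg_pos tr1 tr2 a0 b0 aX.
have r0 : 0 <= (zz X)^-1 by rewrite invr_ge0 ltW.
have C0 : 0 <= zz X / X by rewrite divr_ge0 ?ltW.
have s1 : 0 <= arg1 X <= 1 by rewrite !ltW.
have s2 : 0 <= arg2 X <= 1 by rewrite !ltW.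
have s1' : 0 <= arg1 X < 1 by rewrite ltW.
have s2' : 0 <= arg2 X < 1 by rewrite ltW.
have [f1 fM] := fp_inl_morphism G1 G2; have [f1' fM'] := fp_inr_morphism G1 G2.
apply: lte_add_pinfty.
- apply: (@green_triangle_lt_oo _ _ _ _ _ S1 S2 _ mu1_ge0 mu2_ge0 uS1 uS2 suppS1 suppS2 a01 _ _
    (hit mu1 S1 (arg1 X)) _ (zz X / X) (1 - arg1 X)^-1) => //.
  + by move=> x; rewrite fp_inlV.
  + by move=> x; exact: (hit_ge0 mu1_ge0 uS1 suppS1 adm1 tr1).
  + by move=> A uA; exact: (sum_hit_le mu1_ge0 uS1 suppS1 mu1_1 adm1 tr1).
  + move=> n x; rewrite -(word_weight_inl (G2 := G2) mu1 mu2 S1 S2 a X x).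
    exact: (green_le mu1_ge0 mu2_ge0 uS1 uS2 suppS1 suppS2 a01 adm1 adm2 tr1 tr2 aX).
- apply: (@green_triangle_lt_oo _ _ _ _ _ S1 S2 _ mu1_ge0 mu2_ge0 uS1 uS2 suppS1 suppS2 a01 _ _
    (hit mu2 S2 (arg2 X)) _ (zz X / X) (1 - arg2 X)^-1) => //.
  + by move=> x; rewrite fp_inrV.
  + by move=> x; exact: (hit_ge0 mu2_ge0 uS2 suppS2 adm2 tr2).
  + by move=> A uA; exact: (sum_hit_le mu2_ge0 uS2 suppS2 mu2_1 adm2 tr2).
  + move=> n x; rewrite -(word_weight_inr (G1 := G1) mu1 mu2 S1 S2 a X x).
    exact: (green_le mu1_ge0 mu2_ge0 uS1 uS2 suppS1 suppS2 a01 adm1 adm2 tr1 tr2 aX).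
Qed.

Lemma negative_spr X : admissible_arg X -> finite_slopes X -> psi X < 0 ->
  spectrally_positive_recurrent mu.
Proof.
move=> aX fX psiX; have [Y XY psiY] := psi_zero tr1 tr2 a0 b0 aX fX psiX.
have [l1 l2] := arg_decr tr1 tr2 a0 b0 aX XY.
have [/andP[_ p11] /andP[_ p21] _ _] := argP tr1 tr2 a0 b0 aX.
apply: interior_spr psiY; first exact: admissible_arg_le (ltW XY).
- exact: lt_le_trans l1 p11.
- exact: lt_le_trans l2 p21.
Qed.

Hypotheses (cm2 : cvgn (series (fun n => n%:R * q2 n)))
  (nc2 : ~ cvgn (series (fun n => n%:R ^+ 2 * q2 n)))
  (nc1 : ~ cvgn (series (fun n => n%:R * q1 n))).
Hypothesis p_pos : forall N, exists2 n, (N <= n)%N & 0 < p n.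

Lemma inv_spectral_radius_ge0 : 0 <= inv_spectral_radius mu.
Proof.
rewrite invr_ge0 leNgt; apply/negP => h.
have [N hN] := spectral_radius_lt p01 (lexx 0) h.
have [n] := p_pos N.+1; case: n => // n nN pn.
by have := hN n.+1 (ltnW nN); rewrite expr0n leNgt pn.
Qed.

(** The derivative is finite at [1 / zz X0], which settles the case of a radius [R] at most that
    large. If [R] were larger, the second derivative would be finite as well and the chord
    Lipschitz, contradicting [chord_not_lipschitz]. *)
Lemma positive_not_divergent X0 : admissible_arg X0 -> arg2 X0 = 1 -> arg1 X0 < 1 ->
  0 < psi X0 -> ~ divergent mu.
Proof.
move=> aX0 s20 s10 psi0.
have [/andP[p10 _] _ _ _] := argP tr1 tr2 a0 b0 aX0.
have fX0 : finite_slopes X0.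
  split; first by apply: (slope_cvg tr1); rewrite ltW.
  by rewrite s20; exact: (slope_cvg1 tr2 cm2).
have z0 := zz_gt0 tr1 tr2 a0 b0 aX0; have R0 := inv_spectral_radius_ge0.
have r0 : 0 < (zz X0)^-1 by rewrite invr_gt0.
have cd := derivative_cvg tr1 tr2 a0 b0 p_ge0 green aX0 fX0 (ltW psi0) psi0.
move=> /(green_derivative_cvg p01 R0); apply.
have [RX|RX] := leP (inv_spectral_radius mu) (zz X0)^-1.
  apply: (series_le_cvg _ _ _ cd) => n.
  - by rewrite !mulr_ge0 ?exprn_ge0.
  - by rewrite !mulr_ge0 ?exprn_ge0// ltW.
  - apply: ler_wpM2l; first by rewrite mulr_ge0.
    by apply: lerXn2r => //; rewrite nnegrE ltW.
exfalso.
have sr : spectral_radius mu < (zz X0)^-1^-1.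
  rewrite -[spectral_radius mu]invrK ltf_pV2 ?posrE//.
  exact: lt_trans r0 RX.
have c2 := spectral_radius_series p01 (k := 2%N) r0 sr.
have cd2 : cvgn (series (fun n => n%:R ^+ 2 * p n * (zz X0)^-1 ^+ n.-1)).
  have [c3 _] := ssumZ (zz X0) c2.
  apply: (series_le_cvg _ _ _ c3) => n.
  - by rewrite !mulr_ge0 ?exprn_ge0// ltW.
  - by rewrite !mulr_ge0 ?exprn_ge0// ltW.
  - case: n => [|n]; first by rewrite expr0n !mul0r mulr0.
    rewrite le_eqVlt; apply/orP; left; apply/eqP; rewrite -pred_Sn.
    move: (n.+1%:R ^+ 2 * _) => P; rewrite exprS mulrCA [X in _ = _ * X]mulrA.
    by rewrite divff ?mul1r// gt_eqF.
have [K hK] := chord_lipschitz tr1 tr2 a0 b0 p_ge0 green aX0 fX0 (ltW psi0) cd cd2.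
exact: (chord_not_lipschitz tr1 tr2 a0 b0 cm2 nc2 aX0 fX0 s20 s10 hK).
Qed.

(* Below its convergence boundary the curve always contains a point with
   negative slope when the first factor, whose slope is unbounded, stops it. *)
Lemma first_factor_spr : b * gap u2 1 <= a * gap u1 1 -> spectrally_positive_recurrent mu.
Proof.
move=> h; pose X1 := a * gap u1 1.
have aX1 : admissible_arg X1 by split.
(* A reference point on the curve at which the second slope [w] exceeds [1] strictly; to its left
   that slope is at least [w]. *)
pose X2 := X1 + 1; have X12 : X1 < X2 by rewrite ltrDl.
have aX2 := admissible_arg_le aX1 (ltW X12).
have [/andP[p10 p11] /andP[p20 p21] e1 e2] := argP tr1 tr2 a0 b0 aX2.
have s11 : arg1 X1 = 1 by apply: (arg1K tr1 a0); rewrite ltr01 lexx.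
have [l1 l2] := arg_decr tr1 tr2 a0 b0 aX1 X12.
have [_ /andP[_ p21'] _ _] := argP tr1 tr2 a0 b0 aX1.
have t1 : arg2 X2 < 1 by exact: lt_le_trans l2 p21'.
have t01 : 0 <= arg2 X2 < 1 by rewrite ltW.
have w2 := slope_gt1 tr2 p20 (slope_cvg tr2 t01).
set w := slope u2 (arg2 X2) in w2.
have iw : 0 < 1 - w^-1 by rewrite subr_gt0 invf_lt1// (lt_trans ltr01).
(* The middle term makes [1 / W1(s) <= (1 - 1 / w) / 2], hence [psi] negative; the first term, with
   the [1], forces [s] beyond the argument at [X2], so that the new point lies between [X1] and
   [X2]. *)
pose K := slope u1 (arg1 X2) + 2 / (1 - w^-1) + 1.
have [s /andP[s0 s1] Ks] := @slope_unbounded _ _ _ tr1 K nc1.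
have s01 : 0 <= s < 1 by rewrite ltW.
have cs := slope_cvg tr1 s01.
have p11' : 0 <= arg1 X2 < 1 by rewrite ltW// -s11.
have W1 : 1 <= slope u1 (arg1 X2) by exact: (slope_ge1 tr1 (ltW p10) (slope_cvg tr1 p11')).
have d0 : 0 < 2 / (1 - w^-1) by rewrite divr_gt0.
have sX : arg1 X2 < s.
  rewrite ltNge; apply/negP => hs.
  have h' : 0 <= s <= arg1 X2 by rewrite ltW.
  by have [_] := slope_le tr1 h' (slope_cvg tr1 p11'); move: Ks; rewrite /K; lra.
pose X := a * gap u1 s.
have gs : gap u1 1 < gap u1 s.
  have := gap_decr tr1 s0 s1 (lexx 1); rewrite invr1.
  by have i1 : 1 < s^-1 by [rewrite invf_gt1]; lra.
have X1X : X1 < X by rewrite ltr_pM2l.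
have aX := admissible_arg_le aX1 (ltW X1X).
have XX2 : X < X2.
  rewrite -e1 ltr_pM2l//.
  have := gap_decr tr1 p10 sX (ltW s1).
  by have i1 : s^-1 < (arg1 X2)^-1 by [rewrite ltf_pV2 ?posrE]; lra.
have aXs : arg1 X = s by apply: (arg1K tr1 a0); rewrite s0 ltW.
have [m1 m2] := arg_decr tr1 tr2 a0 b0 aX XX2.
have [k1 k2] := arg_decr tr1 tr2 a0 b0 aX1 X1X.
have t2 : arg2 X < 1 by exact: lt_le_trans k2 p21'.
have fX : finite_slopes X by apply: finite_slopes_lt1 => //; rewrite aXs.
apply: (negative_spr aX fX); rewrite psi_slopes aXs.
have m2' : 0 <= arg2 X2 <= arg2 X by rewrite !ltW.
have [_ ww] := slope_le tr2 m2' fX.2; rewrite -/w in ww.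
have w0 : 0 < w by exact: lt_trans w2.
have i2 : (slope u2 (arg2 X))^-1 <= w^-1 by rewrite lef_pV2 ?posrE// (lt_le_trans w0).
have i1 : (slope u1 s)^-1 <= (1 - w^-1) / 2.
  rewrite -[leRHS]invrK invf_div lef_pV2 ?posrE//.
    by apply: le_trans Ks; rewrite /K; lra.
  by apply: lt_le_trans Ks; rewrite /K; lra.
move: i1 i2 iw; move: (slope u1 s)^-1 (slope u2 (arg2 X))^-1 w^-1 => x y z; lra.
Qed.

Theorem critical_base : divergent mu -> ~ spectrally_positive_recurrent mu ->
  exists X0, [/\ admissible_arg X0, finite_slopes X0, arg2 X0 = 1, arg1 X0 < 1 & psi X0 = 0].
Proof.
move=> dv nspr; have [h|h] := leP (b * gap u2 1) (a * gap u1 1).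
  by case: nspr; exact: first_factor_spr.
pose X0 := b * gap u2 1; have aX0 : admissible_arg X0 by split => //; exact: ltW.
have s20 : arg2 X0 = 1 by apply: (arg2K tr2 b0); rewrite ltr01 lexx.
have [/andP[p10 p11] _ e1 _] := argP tr1 tr2 a0 b0 aX0.
have s10 : arg1 X0 < 1.
  rewrite lt_neqAle p11 andbT; apply/eqP => e; rewrite e in e1.
  by move: h; rewrite e1 ltxx.
have fX0 : finite_slopes X0.
  split; first by apply: (slope_cvg tr1); rewrite ltW.
  by rewrite s20; exact: (slope_cvg1 tr2 cm2).
exists X0; split=> //; have [psi0|psi0|//] := ltrgtP (psi X0) 0.
- by case: nspr; exact: negative_spr psi0.
- by case: (positive_not_divergent aX0 s20 s10 psi0).
Qed.

Lemma critical_not_spr X0 : admissible_arg X0 -> finite_slopes X0 -> arg2 X0 = 1 ->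
  psi X0 = 0 -> ~ spectrally_positive_recurrent mu.
Proof.
move=> aX0 fX0 s20 psi0 [_]; have [-> _] := critical_radius aX0 fX0 psi0.
have z0 := zz_gt0 tr1 tr2 a0 b0 aX0.
have psi0' : 0 <= psi X0 by rewrite psi0.
rewrite /J2 (green_triangle_oo mu1_ge0 mu2_ge0 uS1 uS2 suppS1 suppS2 a01 adm1 adm2 tr1 tr2
  aX0 s20 fX0 psi0' nc2) addey//.
rewrite gt_eqF// (lt_le_trans (ltNyr 0))//; apply: esum_ge0 => x _.
by rewrite !mule_ge0// green_ge0// ?invr_ge0 ?ltW//;
  exact: (mixture_convpow_ge0 mu1_ge0 mu2_ge0 uS1 uS2 suppS1 suppS2 a01).
Qed.

(** Restriction to the paths that only use steps of the first factor; it transfers aperiodicity to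
    the product walk. *)
Lemma mixture_convpow_ge n x :
  a ^+ n * convolution_pow mu1 n x <= convolution_pow mu n (fp_inl G2 x).
Proof.
have mu_ge0 := mixture_ge0 mu1_ge0 mu2_ge0 uS1 uS2 suppS1 suppS2 a01.
have suppS := mixture_supportP mu1_ge0 mu2_ge0 uS1 uS2 suppS1 suppS2 (a := a).
have [f1 fM] := fp_inl_morphism G1 G2.
elim: n x => [|n IH] x.
  by rewrite mul1r /= /unit_mass -f1 (inj_eq (@fp_inl_inj G1 G2)).
rewrite (convpowSl mu1_ge0 uS1 suppS1) (convpowSl mu_ge0 (uniq_mixture_support _ _) suppS).
rewrite (step_mixture a mu1_ge0 mu2_ge0 uS1 uS2 suppS1 suppS2).
rewrite -[leLHS]addr0; apply: lerD; last first.
  apply: mulr_ge0; first exact: ltW.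
  by apply: sumr_ge0 => y _; rewrite mulr_ge0//;
    exact: (mixture_convpow_ge0 mu1_ge0 mu2_ge0 uS1 uS2 suppS1 suppS2 a01).
rewrite exprS -mulrA; apply: ler_wpM2l; first exact: ltW.
rewrite /step mulr_sumr; apply: ler_sum => y _.
by rewrite mulrCA; apply: ler_wpM2l => //; rewrite -fM; exact: IH.
Qed.

End Dichotomy.

(** The equation [psi = 0] with [s2 = 1] only involves the slopes, so it can be solved for [s1]
    before the weight is chosen; the weight then places both arguments on one curve. *)
Lemma critical_parameter (R : realType) (p1 u1 p2 u2 : R^nat) :
  transient_renewal p1 u1 -> transient_renewal p2 u2 ->
  ~ cvgn (series (fun n => n%:R * p1 n)) -> cvgn (series (fun n => n%:R * p2 n)) ->
  exists a X0, [/\ 0 < a < 1, admissible_arg u1 u2 a (1 - a) X0 & finite_slopes u1 u2 a (1 - a) X0] /\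
    [/\ arg2 u2 (1 - a) X0 = 1, arg1 u1 a X0 < 1 & psi u1 u2 a (1 - a) X0 = 0].
Proof.
move=> tr1 tr2 nc1 cm2; have c2 := slope_cvg1 tr2 cm2.
have w2 := slope_gt1 tr2 ltr01 c2; set w := slope u2 1 in w2.
have w1 : 0 < w - 1 by rewrite subr_gt0.
have w0 : 0 < w by exact: lt_trans w2.
(* The solution of [1 / K + 1 / w = 1]; the continuous slope [W1] takes this value because it starts
   at [1] and is unbounded. *)
pose K := w / (w - 1).
have K1 : 1 < K by rewrite ltr_pdivlMr// mul1r ltrBlDr ltrDl.
have [t /andP[t0 t1] Kt] := @slope_unbounded _ _ _ tr1 K nc1.
have t01 : 0 <= t < 1 by rewrite ltW.
have ct := slope_cvg tr1 t01.
have s0 : slope u1 0 = 1.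
  rewrite /slope (_ : (fun n => _) = fun=> 0); last first.
    by apply/funext => n; rewrite expr0n; case: n => [|n]; rewrite ?mulr0 ?mul0r.
  by rewrite (ssum_zero _).2 addr0.
have [s /andP[sa sb] sK] : exists2 s, 0 <= s <= t & slope_clamped u1 t s = K.
  apply: ivt_pointwise; first exact: ltW.
  - by move=> x _; apply: (slope_clamped_continuous tr1 (ltW t0) ct).
  - by left; rewrite !slope_clampedE ?lexx ?(ltW t0)// s0 (ltW K1).
rewrite slope_clampedE ?sa// in sK.
have sp : 0 < s.
  rewrite lt_neqAle sa andbT; apply/eqP => e; move: sK; rewrite -e s0 => e'.
  by rewrite -e' ltxx in K1.
have s1 : s < 1 by exact: le_lt_trans sb t1.
have s01 : 0 < s <= 1 by rewrite sp ltW.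
have one : 0 < (1 : R) <= 1 by rewrite ltr01 lexx.
have V1 := gap_gt0 tr1 s01; have V2 := gap_gt0 tr2 one.
(* Solves [a V1(s) = (1 - a) V2(1)]. *)
pose a := gap u2 1 / (gap u1 s + gap u2 1).
have D0 : 0 < gap u1 s + gap u2 1 by exact: addr_gt0.
have a0 : 0 < a by exact: divr_gt0.
have a1 : a < 1 by rewrite ltr_pdivrMr// mul1r ltrDr.
have b0 : 0 < 1 - a by rewrite subr_gt0.
have e : (1 - a) * gap u2 1 = a * gap u1 s by rewrite /a; field; rewrite gt_eqF.
exists a, (a * gap u1 s).
have A1 : arg1 u1 a (a * gap u1 s) = s by exact: (arg1K tr1 a0).
have A2 : arg2 u2 (1 - a) (a * gap u1 s) = 1 by rewrite -e; exact: (arg2K tr2 b0).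
split; split; rewrite ?A1 ?A2//.
- by rewrite a0 a1.
- split; last by rewrite e.
  rewrite ler_pM2l//; have := gap_decr tr1 sp s1 (lexx 1); rewrite invr1.
  by have i1 : 1 < s^-1 by [rewrite invf_gt1]; lra.
- split; rewrite ?A1 ?A2//.
  by have [] := slope_le tr1 (_ : 0 <= s <= t) ct; rewrite // sa.
- rewrite psi_slopes A1 A2 sK -/w /K invf_div.
  by field; rewrite gt_eqF.
Qed.

(** * Asymptotics at the critical point *)

Local Notation near0 := ((0 : _)^'+).

Section CriticalAsymptotics.
Variables (R : realType) (G1 G2 : groupType) (mu1 : G1 -> R) (mu2 : G2 -> R).
Variables (S1 : seq G1) (S2 : seq G2) (a : R).
Hypotheses (mu1_ge0 : forall x, 0 <= mu1 x) (mu2_ge0 : forall x, 0 <= mu2 x).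
Hypotheses (uS1 : uniq S1) (uS2 : uniq S2).
Hypothesis suppS1 : forall x, mu1 x != 0 -> x \in S1.
Hypothesis suppS2 : forall x, mu2 x != 0 -> x \in S2.
Hypotheses (mu1_1 : \sum_(s <- S1) mu1 s = 1) (mu2_1 : \sum_(s <- S2) mu2 s = 1).
Hypothesis a01 : 0 < a < 1.

Local Notation mu := (mixture mu1 mu2 a).
Local Notation b := (1 - a).
Local Notation p := (fun n => convolution_pow mu n 1%g).
Local Notation q1 := (fun n => convolution_pow mu1 n 1%g).
Local Notation q2 := (fun n => convolution_pow mu2 n 1%g).
Local Notation u1 := (fun n => taboo mu1 S1 n 1%g).
Local Notation u2 := (fun n => taboo mu2 S2 n 1%g).

Let a0 : 0 < a. Proof. by case/andP: a01. Qed.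
Let b0 : 0 < b. Proof. by rewrite subr_gt0; case/andP: a01. Qed.

Hypotheses (adm1 : admissible mu1) (adm2 : admissible mu2).
Hypotheses (tr1 : transient_renewal q1 u1) (tr2 : transient_renewal q2 u2).

Local Notation zz := (zz u1 u2 a b).
Local Notation psi := (psi u1 u2 a b).
Local Notation admissible_arg := (admissible_arg u1 u2 a b).
Local Notation finite_slopes := (finite_slopes u1 u2 a b).

Hypotheses (sym1 : symmetric_measure mu1) (sym2 : symmetric_measure mu2) (aper1 : aperiodic mu1).
Variable X0 : R.
Hypotheses (aX0 : admissible_arg X0) (fX0 : finite_slopes X0) (psi0 : psi X0 = 0).

Local Notation r := (zz X0)^-1.
Local Notation c n := (p n * r ^+ n).
Local Notation S := (increment (fun n => c n)).

Let mu_ge0 := mixture_ge0 mu1_ge0 mu2_ge0 uS1 uS2 suppS1 suppS2 a01.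
Let suppS := mixture_supportP mu1_ge0 mu2_ge0 uS1 uS2 suppS1 suppS2 (a := a).
Let uS : uniq (mixture_support S1 S2) := uniq_mixture_support _ _.
Let p_ge0 n : 0 <= p n. Proof. exact: (convpow_ge0 mu_ge0 uS suppS). Qed.
Let r_gt0 : 0 < r. Proof. by rewrite invr_gt0 (zz_gt0 tr1 tr2 a0 b0 aX0). Qed.
Let c_ge0 n : 0 <= c n. Proof. by rewrite mulr_ge0// exprn_ge0// ltW. Qed.

Lemma mixture_aperiodic : aperiodic mu.
Proof.
have [n0 h] := aper1; exists n0 => n hn.
have [f1 _] := fp_inl_morphism G1 G2.
have := mixture_convpow_ge mu1_ge0 mu2_ge0 uS1 uS2 suppS1 suppS2 a01 n 1%g.
rewrite f1; apply: lt_le_trans; rewrite mulr_gt0 ?exprn_gt0//; exact: h.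
Qed.

Lemma critical_quasi_monotone e : 0 < e ->
  exists N0, forall m n, (N0 <= m)%N -> (m <= n)%N -> c n <= (1 + e) * c m.
Proof.
have [n1 hn1] := mixture_aperiodic.
have msym : symmetric_measure mu.
  exact: (mixture_symmetric a mu1_ge0 mu2_ge0 uS1 uS2 suppS1 suppS2 sym1 sym2).
have k0 : (n1 <= n1.*2.+1)%N by rewrite -addnn -addnS leq_addr.
have kodd : odd n1.*2.+1 by rewrite /= odd_double.
have nc : ~ cvgn (series (fun n => n%:R * c n)).
  move=> h; have h' : cvgn (series (fun n => n%:R * p n * r ^+ n)).
    by under eq_fun do rewrite -mulrA.
  have cd := (@cvgn_derivative R _ mu _ (lt0r_neq0 r_gt0)).2 h'.
  have gr := mixture_green_on_curve mu1_ge0 mu2_ge0 uS1 uS2 suppS1 suppS2 a01 adm1 adm2 tr1 tr2.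
  have := psi0_gt0 tr1 tr2 a0 b0 p_ge0 gr aX0 fX0 (_ : 0 <= psi X0) cd.
  by rewrite psi0 lexx ltxx => /(_ isT).
apply: (quasi_monotone (n1 := n1) (k := n1.*2.+1) (B := zz X0 / X0)) => //.
- by move=> m n; exact: (convpow_sqr_le mu_ge0 uS suppS msym).
- by move=> j n; apply: (convpow_ratio mu_ge0 uS suppS); apply: hn1.
- exact: hn1.
- move=> n; exact: (return_bounded mu1_ge0 mu2_ge0 uS1 uS2 suppS1 suppS2 mu1_1 mu2_1 a01 adm1 adm2
    tr1 tr2 n aX0).
Qed.

Lemma cvgn_critical : cvgn (series (fun n => c n)).
Proof.
have gr := mixture_green_on_curve mu1_ge0 mu2_ge0 uS1 uS2 suppS1 suppS2 a01 adm1 adm2 tr1 tr2.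
exact: (gsum_base tr1 tr2 a0 b0 p_ge0 gr aX0 fX0 (eq_ind_r (fun x => 0 <= x) (lexx 0) psi0)).1.
Qed.

Lemma critical_increment_gt0 t : 0 < t -> 0 < S t.
Proof.
move=> t0; have [n1 hn1] := mixture_aperiodic.
have ci := cvgn_increment c_ge0 cvgn_critical (ltW t0).
have q01 : 0 <= expR (- t) < 1 by rewrite expR_ge0 expR_lt1 oppr_lt0.
have d0 n : 0 <= 1 - expR (- t) ^+ n.
  by rewrite subr_ge0 exprn_ile1//; have /andP[_ /ltW] := q01.
apply: lt_le_trans (term_le_ssum n1.+1 (fun n => mulr_ge0 (c_ge0 n) (d0 n)) ci).
rewrite !mulr_gt0 ?exprn_gt0 ?hn1// subr_gt0 exprn_ilt1//; by have /andP[] := q01.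
Qed.

Lemma critical_tauberian (F : R -> R) (gm K : R) : 0 < gm < 1 -> 0 < K ->
  S t / F t @[t --> near0] --> K ->
  (forall l, 0 < l -> F (l * t) / F t @[t --> near0] --> l `^ gm) ->
  exists2 C : R, 0 < C & n%:R * c n / F n%:R^-1 @[n --> \oo] --> C.
Proof.
move=> gm01 K0 SF Freg.
have reg := regular_of_equiv K0 critical_increment_gt0 SF Freg.
have [C C0 hC] := tauberian c_ge0 cvgn_critical gm01 critical_increment_gt0 reg
  critical_quasi_monotone.
exists (C * K); first exact: mulr_gt0.
have hK : S n%:R^-1 / F n%:R^-1 @[n --> \oo] --> K.
  have := @inv_nat_cvg R 1 ltr01; under eq_fun do rewrite mul1r.
  by move=> h; exact: (@cvg_comp _ _ _ (fun n : nat => n%:R^-1) (fun t => S t / F t) _ _ _ h SF).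
have h : n%:R * c n / S n%:R^-1 * (S n%:R^-1 / F n%:R^-1) @[n --> \oo] --> C * K by exact: cvgM hC hK.
apply: cvg_trans h; apply: near_eq_cvg; near=> n.
have n0 : (0 < n)%N by near: n; exists 1%N.
have s0 : S n%:R^-1 != 0 by rewrite gt_eqF// critical_increment_gt0// invr_gt0 ltr0n.
by rewrite mulrA mulfVK.
Unshelve. all: by end_near.
Qed.

End CriticalAsymptotics.

Lemma sharp_power (R : realType) (p : R^nat) (r C : R) : 0 < r -> 0 < C ->
  n%:R * (p n * r ^+ n) / n%:R^-1 `^ (2 / 3) @[n --> \oo] --> C ->
  asymptotically_equal p (fun n => C * r ^- n * n%:R `^ (- (5 / 3))).
Proof.
move=> r0 C0 h.
have h' : C^-1 * (n%:R * (p n * r ^+ n) / n%:R^-1 `^ (2 / 3)) @[n --> \oo] --> C^-1 * C.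
  by apply: cvgM => //; exact: cvg_cst.
rewrite mulVf ?gt_eqF// in h'.
apply: cvg_trans h'; apply: near_eq_cvg; near=> n.
have n0 : (0 < n)%N by near: n; exists 1%N.
have x0 : (0 : R) < n%:R by rewrite ltr0n.
have -> : n%:R^-1 `^ (2 / 3) = n%:R `^ (- (2 / 3)) :> R.
  by rewrite -[n%:R^-1]powR_inv1 ?(ltW x0)// -powRrM mulN1r.
have e : n%:R `^ (- (5 / 3)) * n%:R = n%:R `^ (- (2 / 3)) :> R.
  rewrite -{2}[n%:R]powRr1 ?(ltW x0)// -powRD ?(gt_eqF x0) ?implybT//.
  by congr (_ `^ _); lra.
have w0 : 0 < n%:R `^ (- (5 / 3)) :> R by exact: powR_gt0.
have q0 : 0 < r ^+ n by exact: exprn_gt0.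
rewrite -e; move: (n%:R `^ (- (5 / 3)) : R) (n%:R : R) (r ^+ n) x0 w0 q0 => w x q x0 w0 q0.
by field; rewrite !gt_eqF.
Unshelve. all: by end_near.
Qed.

Lemma sharp_log (R : realType) (p : R^nat) (r C : R) : 0 < r -> 0 < C ->
  n%:R * (p n * r ^+ n) / Num.sqrt (n%:R^-1 / ln (n%:R^-1)^-1) @[n --> \oo] --> C ->
  asymptotically_equal p
    (fun n => C * r ^- n * n%:R `^ (- (3 / 2)) * ln n%:R `^ (- (1 / 2))).
Proof.
move=> r0 C0 h.
have h' : C^-1 * (n%:R * (p n * r ^+ n) / Num.sqrt (n%:R^-1 / ln (n%:R^-1)^-1))
    @[n --> \oo] --> C^-1 * C by apply: cvgM => //; exact: cvg_cst.
rewrite mulVf ?gt_eqF// in h'.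
apply: cvg_trans h'; apply: near_eq_cvg; near=> n.
have n1 : (1 < n)%N by near: n; exists 2%N.
have x0 : (0 : R) < n%:R by rewrite ltr0n ltnW.
have l0 : 0 < ln n%:R :> R by rewrite ln_gt0// ltr1n.
have -> : Num.sqrt (n%:R^-1 / ln (n%:R^-1)^-1) = n%:R `^ (- (1 / 2)) * ln n%:R `^ (- (1 / 2)) :> R.
  rewrite invrK -powR12_sqrt ?divr_ge0 ?invr_ge0 ?(ltW l0) ?(ltW x0)//.
  rewrite powRM ?invr_ge0 ?(ltW l0) ?(ltW x0)//.
  rewrite -[n%:R^-1]powR_inv1 ?(ltW x0)// -[(ln _)^-1]powR_inv1 ?(ltW l0)//.
  by rewrite -!powRrM !mulN1r div1r.
have e : n%:R `^ (- (3 / 2)) * n%:R = n%:R `^ (- (1 / 2)) :> R.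
  rewrite -{2}[n%:R]powRr1 ?(ltW x0)// -powRD ?(gt_eqF x0) ?implybT//.
  by congr (_ `^ _); lra.
have w0 : 0 < n%:R `^ (- (3 / 2)) :> R by exact: powR_gt0.
have v0 : 0 < ln n%:R `^ (- (1 / 2)) :> R by exact: powR_gt0.
have q0 : 0 < r ^+ n by exact: exprn_gt0.
rewrite -e; move: (n%:R `^ (- (3 / 2)) : R) (ln n%:R `^ (- (1 / 2)) : R) (n%:R : R) (r ^+ n) x0 w0 v0 q0 => w v x q x0 w0 v0 q0.
by field; rewrite !gt_eqF.
Unshelve. all: by end_near.
Qed.

Lemma finite_support (R : realType) (G : groupType) (mu : G -> R) :
  is_probability mu -> finitely_supported mu ->
  exists S : seq G, [/\ uniq S, forall x, mu x != 0 -> x \in S & \sum_(s <- S) mu s = 1].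
Proof.
move=> [mu0 mu1] /finite_seqP[S hS].
have supp x : mu x != 0 -> x \in undup S.
  by move=> h; rewrite mem_undup; have : [set` S] x by rewrite -hS.
exists (undup S); split=> //; first exact: undup_uniq.
by rewrite -(fine_esum_seq (undup_uniq S) mu0 supp) mu1.
Qed.

Lemma lattice_return (R : realType) (d : nat) (mu : Zpow d -> R) (S : seq (Zpow d)) :
  (forall x, 0 <= mu x) -> uniq S -> (forall x, mu x != 0 -> x \in S) ->
  \sum_(s <- S) mu s = 1 -> symmetric_measure mu -> admissible mu -> aperiodic mu ->
  exists2 c : R, 0 < c & Num.sqrt n%:R ^+ d * convolution_pow mu n 1%g @[n --> \oo] --> c.
Proof.
move=> mu0 uS supp mu1 sym adm aper.
have p0 (x : 'rV[int]_d) : convolution_pow mu 0 x = (x == 0)%:R by [].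
have pS n (x : 'rV[int]_d) : convolution_pow mu n.+1 x =
    \sum_(s <- S) mu s * convolution_pow mu n ((x : 'rV[int]_d) - s).
  rewrite (convpowSl mu0 uS supp) /step; apply: eq_bigr => s _.
  by congr (_ * convolution_pow mu n _); exact: addrC.
have symN (x : 'rV[int]_d) : mu (- x) = mu x by rewrite [RHS]sym.
exact: (@lattice_local_limit R d mu S mu0 uS supp mu1 symN (convolution_pow mu) p0 pS adm aper).
Qed.

Lemma return_ge0 (R : realType) (G : groupType) (mu : G -> R) (S : seq G) :
  (forall x, 0 <= mu x) -> uniq S -> (forall x, mu x != 0 -> x \in S) ->
  forall n, 0 <= convolution_pow mu n 1%g.
Proof. by move=> mu0 uS supp n; exact: (convpow_ge0 mu0 uS supp). Qed.

Lemma lattice_transient (R : realType) (d k : nat) (mu : Zpow d -> R) (S : seq (Zpow d)) (c : R) :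
  (2 < d)%N -> (0 < k)%N -> (d <= 2 * k + 2)%N ->
  (forall x, 0 <= mu x) -> uniq S -> (forall x, mu x != 0 -> x \in S) ->
  \sum_(s <- S) mu s = 1 ->
  0 < c -> Num.sqrt n%:R ^+ d * convolution_pow mu n 1%g @[n --> \oo] --> c ->
  transient_renewal (fun n => convolution_pow mu n 1%g) (fun n => taboo mu S n 1%g).
Proof.
move=> d2 k0 dk mu0 uS supp mu1 c0 hc; have q0 := return_ge0 mu0 uS supp.
apply: (walk_transient_renewal mu0 uS supp mu1 (k := k)).
  have := ref_cvg q0 c0 hc (k := 0) d2.
  by under eq_fun do rewrite expr0 mul1r.
exact: (ref_ncvg q0 c0 hc k0 d2 dk).
Qed.

Theorem theorem1p2 (R : realType) (d : nat)
    (mu1 : Zpow 3 -> R) (mu2 : Zpow d -> R) :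
  d = 5%N \/ d = 6%N ->
  is_probability mu1 -> finitely_supported mu1 -> admissible mu1 ->
  symmetric_measure mu1 -> aperiodic mu1 ->
  is_probability mu2 -> finitely_supported mu2 -> admissible mu2 ->
  symmetric_measure mu2 -> aperiodic mu2 ->
  (exists alpha : R,
     [/\ 0 < alpha < 1, divergent (mixture mu1 mu2 alpha)
       & ~ spectrally_positive_recurrent (mixture mu1 mu2 alpha)])
  /\
  (forall alpha : R,
     0 < alpha < 1 ->
     divergent (mixture mu1 mu2 alpha) ->
     ~ spectrally_positive_recurrent (mixture mu1 mu2 alpha) ->
     let mu := mixture mu1 mu2 alpha in
     let rho := inv_spectral_radius mu in
     exists C : R, 0 < C /\
       (d = 5%N ->
          asymptotically_equal (fun n => convolution_pow mu n 1%g)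
            (fun n => C * rho ^- n * n%:R `^ (- (5 / 3)))) /\
       (d = 6%N ->
          asymptotically_equal (fun n => convolution_pow mu n 1%g)
            (fun n => C * rho ^- n * n%:R `^ (- (3 / 2))
                      * ln n%:R `^ (- (1 / 2))))).
Proof.
move=> hd pr1 fin1 adm1 sym1 aper1 pr2 fin2 adm2 sym2 aper2.
have gm1 : 0 < (2 / 3 : R) < 1 by lra.
have gm2 : 0 < (1 / 2 : R) < 1 by lra.
have [S1 [uS1 supp1 sum1]] := finite_support pr1 fin1.
have [S2 [uS2 supp2 sum2]] := finite_support pr2 fin2.
have [mu1_ge0 _] := pr1; have [mu2_ge0 _] := pr2.
have [c1 c1_gt0 asym1] := lattice_return mu1_ge0 uS1 supp1 sum1 sym1 adm1 aper1.
have [c2 c2_gt0 asym2] := lattice_return mu2_ge0 uS2 supp2 sum2 sym2 adm2 aper2.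
have q1_ge0 := return_ge0 mu1_ge0 uS1 supp1; have q2_ge0 := return_ge0 mu2_ge0 uS2 supp2.
have d2 : (2 < d)%N by case: hd => ->.
have d4 : (2 * 1 + 3 <= d)%N by case: hd => ->.
have d6 : (d <= 2 * 2 + 2)%N by case: hd => ->.
have tr1 : transient_renewal (fun n => convolution_pow mu1 n 1%g) (fun n => taboo mu1 S1 n 1%g).
  exact: (lattice_transient (k := 1) _ _ _ mu1_ge0 uS1 supp1 sum1 c1_gt0 asym1).
have tr2 : transient_renewal (fun n => convolution_pow mu2 n 1%g) (fun n => taboo mu2 S2 n 1%g).
  exact: (lattice_transient (k := 2) d2 isT d6 mu2_ge0 uS2 supp2 sum2 c2_gt0 asym2).
(* In dimension 3 the terms are of order [n^(-1/2)]. For the second factor, the first moments are of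
   order [n^(1 - d/2)], summable, and the second moments of order [n^(-1/2)] or [n^(-1)], not
   summable: this is the role of [d] in [{5, 6}]. *)
have nc1 : ~ cvgn (series (fun n => n%:R * convolution_pow mu1 n 1%g)).
  exact: (ref_ncvg q1_ge0 c1_gt0 asym1 (k := 1) isT isT isT).
have nc2 : ~ cvgn (series (fun n => n%:R ^+ 2 * convolution_pow mu2 n 1%g)).
  exact: (ref_ncvg q2_ge0 c2_gt0 asym2 (k := 2) isT d2 d6).
have cm2 : cvgn (series (fun n => n%:R * convolution_pow mu2 n 1%g)).
  exact: (ref_cvg q2_ge0 c2_gt0 asym2 (k := 1) d4).
split.
  have [a [X0 [[a01 aX0 fX0] [s20 s10 psi0]]]] := critical_parameter tr1 tr2 nc1 cm2.
  have [_ dv] := critical_radius mu1_ge0 mu2_ge0 uS1 uS2 supp1 supp2 sum1 sum2 a01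
    adm1 adm2 tr1 tr2 aX0 fX0 psi0.
  exists a; split => //.
  exact: (critical_not_spr mu1_ge0 mu2_ge0 uS1 uS2 supp1 supp2 sum1 sum2 a01
    adm1 adm2 tr1 tr2 nc2 aX0 fX0 s20 psi0).
move=> a a01 dv nspr mu rho.
have p_pos N : exists2 n, (N <= n)%N & 0 < convolution_pow mu n 1%g.
  have [n0 h] := mixture_aperiodic mu1_ge0 mu2_ge0 uS1 uS2 supp1 supp2 a01 aper1.
  by exists (maxn N n0); rewrite ?leq_maxl// h// leq_maxr.
have [X0 [aX0 fX0 s20 s10 psi0]] := critical_base mu1_ge0 mu2_ge0 uS1 uS2 supp1 supp2 sum1 sum2
  a01 adm1 adm2 tr1 tr2 cm2 nc2 nc1 p_pos dv nspr.
have [rE _] := critical_radius mu1_ge0 mu2_ge0 uS1 uS2 supp1 supp2 sum1 sum2 a01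
  adm1 adm2 tr1 tr2 aX0 fX0 psi0.
have [a0 a1] := andP a01; have b0 : 0 < 1 - a by rewrite subr_gt0.
have r0 : 0 < rho.
  by rewrite /rho rE invr_gt0; exact: (zz_gt0 tr1 tr2 a0 b0 aX0).
have mu_ge0 := mixture_ge0 mu1_ge0 mu2_ge0 uS1 uS2 supp1 supp2 a01.
have p_ge0 : forall n, 0 <= convolution_pow mu n 1%g.
  exact: (return_ge0 mu_ge0 (uniq_mixture_support _ _)
    (mixture_supportP mu1_ge0 mu2_ge0 uS1 uS2 supp1 supp2 (a := a))).
have green := mixture_green_on_curve mu1_ge0 mu2_ge0 uS1 uS2 supp1 supp2 a01 adm1 adm2 tr1 tr2.
have tb := critical_tauberian mu1_ge0 mu2_ge0 uS1 uS2 supp1 supp2 sum1 sum2 a01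
  adm1 adm2 tr1 tr2 sym1 sym2 aper1 aX0 fX0 psi0.
case: hd => hd.
- subst d; have [K K0 hK] := excess5 q2_ge0 c2_gt0 asym2.
  have [K' K'0 hK'] := increment5 tr1 tr2 a0 b0 p_ge0 green cm2 nc2 aX0 fX0 s20 s10 psi0 K0 hK.
  have [C C0 hC] := tb _ _ _ gm1 K'0 hK' (@regular_power R _).
  exists C; split=> //; split=> // _; apply: (sharp_power r0 C0).
  by rewrite /rho rE.
- subst d; have hK := excess6 q2_ge0 c2_gt0 asym2.
  have K0 : 0 < c2 / 2 by rewrite divr_gt0.
  have [K' K'0 hK'] := increment6 tr1 tr2 a0 b0 p_ge0 green cm2 nc2 aX0 fX0 s20 s10 psi0 K0 hK.
  have [C C0 hC] := tb _ _ _ gm2 K'0 hK' (@regular_sqrt_log R).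
  exists C; split=> //; split=> // _; apply: (sharp_log r0 C0).
  by rewrite /rho rE.
Qed.
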